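(* Let $(\mathsf A_\pm,\mathsf T_\pm)$ be abstract spaces with skeletons $\Gamma_\pm$, where $\mathsf A_+=\{0\}\cup\mathsf A_+'$ with $\alpha:=\min\mathsf A_+'>0$, $\mathsf T_0=\mathbb R$, and $\max\mathsf A_-<0$. Let $V_{u_+}\in\mathcal D^{\overline\alpha_+}(\mathsf T_+;\Gamma_+)$ with $\overline\alpha_+>0$, $V_{u_-}\in\mathcal D^{\overline\alpha_-}(\mathsf T_-;\Gamma_-)$ with $\overline\alpha_-<0$, $N_*>0$, and assume that $\kappa:=(\overline\alpha_++\min\mathsf A_-)\wedge(\alpha+\overline\alpha_-)$ satisfies $\kappa-\alpha\notin\mathsf A$, $\kappa-\alpha>\max\mathsf A_-$ and $\kappa>0$. Suppose there exists $v_+\diamond v_-\in\mathcal S'(\mathbb R^2;\mathsf T_{<\kappa})$ such that for each $\beta\in\mathsf A$ with $\beta<\kappa$, each $x\in\mathbb R^2$ and $T\le1$ $$\|\Gamma_\beta(x)(v_+\diamond v_-)_T(x)\|_{\mathsf T_\beta}\le(T^{\frac14})^\beta.$$ Denote $v_-:=((v_+\diamond v_-)_{0,\beta_-})_{\beta_-\in\mathsf A_-}\in\mathcal S'(\mathbb R^2;\mathsf T_-)$, and suppose there is $u_-\in\mathcal S'(\mathbb R^2)$ such that for all $x\in\mathbb R^2$, $T\le1$ $$\|(u_-)_T(x)-V_{u_-}(x).(v_-)_T(x)\|_{\overline{\mathsf T}_{\kappa-\alpha}}\le(T^{\frac14})^{\kappa-\alpha}.$$ Then there exists a unique distribution $u_+\diamond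 u_-\in\mathcal S'(\mathbb R^2)$ such that for all $T\le1$ $$\Big\|(u_+\diamond u_-)_T-C_\kappa V_{u_+\diamond u_-}.\begin{pmatrix}(u_-)_T\\(v_+\diamond v_-)_T\end{pmatrix}\Big\|\lesssim M_\kappa\,(T^{\frac14})^\kappa,$$ where $$M_\kappa:=(1+\|\overline\Gamma\|_{sk})^{|\mathsf A|-1}\big(N_*[u_+]_\alpha+M^c+N^{\min_{\beta\in\mathsf A,\beta\ge\kappa}\langle\beta\rangle}\|\overline\Gamma\|_{sk}M^b\big).$$ Moreover, for each $\eta<\kappa$ the following suboptimal bound holds for $T\le1$: $$\Big\|(u_+\diamond u_-)_T-u_+(u_-)_T-C_\eta(\overline V_{u_+}\otimes V_{u_-}).(v_+\diamond v_-)_T\Big\|\lesssim M_\eta\,(T^{\frac14})^\eta,$$ where $M_\eta:=M_\kappa+N^{\min_{\beta\in\mathsf A,\beta\ge\eta}\langle\beta\rangle}\|\overline V_{u_+}\|_{\mathsf T_+;\Gamma_+}\|V_{u_-}\|_{\mathsf T_-;\Gamma_-}$. Here $M^b,M^c$, the function $u_+$, and the forms $\overline V_{u_+}$, $V_{u_+\diamond u_-}$ are defined in the context, $\|\cdot\|$ is the supremum norm on $\mathbb R^2$, and $\lesssim$ means up to a constant depending only on the sets of homogeneities and exponents involved.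
   Context: $d(x,y)=|x_1-y_1|+\sqrt{|x_2-y_2|}$ on $\mathbb R^2$; $[u]_\alpha=\sup_{x\ne y}d^{-\alpha}(y,x)|u(y)-u(x)|$. For $T>0$, $\psi_T$ is the Schwartz function with Fourier transform $\exp(-T(k_1^4+k_2^2))$ and $g_T(x)=\langle g,\psi_T(x-\cdot)\rangle$ for (Banach-valued) tempered distributions $g$. Abstract space: a pair $(\mathsf A,\mathsf T)$ with $\mathsf A\subset\mathbb R$ finite and $\mathsf T=\bigoplus_{\beta\in\mathsf A}\mathsf T_\beta$ a direct sum of real Banach spaces, elements $\mathsf v=(\mathsf v_\beta)_\beta$; $|\mathsf A|$ is the number of elements, $\mathsf T_{<\kappa}=\bigoplus_{\beta<\kappa}\mathsf T_\beta$. Skeleton: $\Gamma\in C^0(\mathbb R^2;\mathcal L(\mathsf T,\mathsf T))$ with components $\Gamma_\beta(x)\mathsf v:=(\Gamma(x)\mathsf v)_\beta$ such that $\Gamma_\beta(x)\mathsf v=\mathsf v_\beta+\sum_{\gamma<\beta}\Gamma^\gamma_\beta(x)\mathsf v_\gamma$ and, for some $C$, $\|(\Gamma_\beta(y)-\Gamma_\beta(x))\mathsf v\|_{\mathsf T_\beta}\le C\sum_{\gamma<\beta}d^{\beta-\gamma}(y,x)\|\Gamma_\gamma(x)\mathsf v\|_{\mathsf T_\gamma}$ for all $\beta,\mathsf v$, $d(y,x)\le1$; the minimal $C$ is $\|\Gamma\|_{sk}$. Modelled distribution: $V\in C^0(\mathbb R^2;\mathsf T^* )$ is in $\mathcal D^{\overline\alpha}(\mathsf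 T;\Gamma)$ if, with finite constants, $|(V(y)-V(x)).\mathsf v|\le[V]_{\mathcal D^{\overline\alpha}(\mathsf T;\Gamma)}\sum_\beta d^{(\overline\alpha-\beta)\vee0}(y,x)\|\Gamma_\beta(x)\mathsf v\|_{\mathsf T_\beta}$ for $d(y,x)\le1$ and $|V(x).\mathsf v|\le\|V\|_{\mathsf T;\Gamma}\sum_\beta N^{\langle\beta\rangle}\|\Gamma_\beta(x)\mathsf v\|_{\mathsf T_\beta}$ (smallest constants); $N\in(0,1]$ is a fixed parameter and $\langle\cdot\rangle$ assigns nonnegative exponents to homogeneities, denoted $\langle\cdot\rangle_\pm$ on $\mathsf A_\pm$ and $\langle\cdot\rangle$ on $\mathsf A$, with $\langle\beta_+\rangle_++\langle\beta_-\rangle_-\ge\langle\beta_++\beta_-\rangle$. Reduction: every $V$ can be written uniquely as $V.\mathsf v=\sum_\beta\tilde V_\beta.\Gamma_\beta\mathsf v$ with $\tilde V_\beta(x)\in\mathsf T_\beta^*$; $C_\eta V.\mathsf v:=\sum_{\beta<\eta}\tilde V_\beta.\Gamma_\beta\mathsf v$, defined for $\min\mathsf A<\eta\le\max\mathsf A$ (all levels $\eta,\kappa$ at which reductions are taken are understood to lie in this range); $C_\eta V$ only depends on the components of homogeneity $<\eta$. $C_\alpha V_{u_+}$ is identified with the function $u_+\in C^0(\mathbb R^2)$ via $C_\alpha V_{u_+}.\mathsf v_+=u_+(\mathsf v_+)_0$; $\overline V_{u_+}:=V_{u_+}-C_\alpha V_{u_+}$. Product: $\mathsf A=\mathsf A_++\mathsf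 A_-$; $\mathsf T=\mathsf T_+\otimes\mathsf T_-$ (completed in a crossnorm) $=\bigoplus_{\beta\in\mathsf A}\mathsf T_\beta$, $\mathsf T_\beta=\bigoplus_{\beta_++\beta_-=\beta}\mathsf T_{\beta_+}\otimes\mathsf T_{\beta_-}$ with the sum of the norms; elements have components $\mathsf v_{\beta_+,\beta_-}$; $\Gamma(x)=\Gamma_+(x)\otimes\Gamma_-(x)$. The crossnorm is assumed uniform: for bounded operators $A_\pm,B_\pm$ defined on (finite direct sums, with sum norms, of) the graded pieces of $\mathsf T_\pm$ with values in such spaces or in finite-dimensional spaces, $A_+\otimes A_-$ (determined by $(A_+\otimes A_-)(\mathsf v_+\otimes\mathsf v_-)=A_+\mathsf v_+\otimes A_-\mathsf v_-$) is bounded, depends boundedly and bilinearly on $(A_+,A_-)$, and if $\|A_\pm\mathsf v_\pm\|\le\|B_\pm\mathsf v_\pm\|$ for all $\mathsf v_\pm$, then $\|(A_+\otimes A_-)\mathsf v\|\le\|(B_+\otimes B_-)\mathsf v\|$ for all $\mathsf v$. Extension: $\overline{\mathsf A}=\{\kappa-\alpha\}\cup\mathsf A$, $\overline{\mathsf T}=\overline{\mathsf T}_{\kappa-\alpha}\oplus\mathsf T\ni(\mathsf u_-,\mathsf v)$ with $\overline{\mathsf T}_{\kappa-\alpha}=\mathbb R$ normed by $\frac1{N_*}|\cdot|$; $\overline\Gamma_\beta(\mathsf u_-,\mathsf v)=\Gamma_\beta\mathsf v$ for $\beta\ne\kappa-\alpha$, $\overline\Gamma_{\kappa-\alpha}(\mathsf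 u_-,\mathsf v)=\mathsf u_--V_{u_-}.\mathsf v_-$ with $\mathsf v_-:=(\mathsf v_{0,\beta_-})_{\beta_-\in\mathsf A_-}$. The product form on $\overline{\mathsf T}$ is $V_{u_+\diamond u_-}.(\mathsf u_-,\mathsf v):=u_+\mathsf u_-+(\overline V_{u_+}\otimes V_{u_-}).\mathsf v$; $C_\kappa V_{u_+\diamond u_-}$ is its reduction with respect to $\overline\Gamma$, and $C_\eta(\overline V_{u_+}\otimes V_{u_-})$ is the reduction with respect to $\Gamma$. Constants: $M^b:=\|V_{u_+}\|_{\mathsf T_+;\Gamma_+}\|V_{u_-}\|_{\mathsf T_-;\Gamma_-}$ and $$M^c:=\big(N^{\min_{\mathsf A_+'}\langle\beta\rangle_+}\|\overline V_{u_+}\|_{\mathsf T_+;\Gamma_+}+[u_+]_\alpha+[V_{u_+}]_{\mathcal D^{\overline\alpha_+}(\mathsf T_+;\Gamma_+)}\big)[V_{u_-}]_{\mathcal D^{\overline\alpha_-}(\mathsf T_-;\Gamma_-)}+N^{\min_{\mathsf A_-}\langle\beta\rangle_-}[V_{u_+}]_{\mathcal D^{\overline\alpha_+}(\mathsf T_+;\Gamma_+)}\|V_{u_-}\|_{\mathsf T_-;\Gamma_-}.$$ *)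

(* Defs.v *)
(* The plane is [R * R].  Elements of a finite direct sum of Banach spaces
   [E k] are dependent functions [forall k, E k] with pointwise operations;
   the direct sum carries the sum norm [snorm]. *)
From HB Require Import structures.
From mathcomp Require Import all_boot all_order all_algebra finmap.
From mathcomp Require Import all_classical all_reals all_analysis.
Set Implicit Arguments.
Unset Strict Implicit.
Unset Printing Implicit Defensive.
Import Order.TTheory GRing.Theory Num.Theory.
Import numFieldNormedType.Exports.
Local Open Scope classical_set_scope.
Local Open Scope ring_scope.

(* Definite description: [t0] is a junk value, used only when no [t]
   satisfies [P]. *)
Definition the (T : Type) (t0 : T) (P : T -> Prop) : T :=
  if pselect (exists t, P t) is left h then projT1 (cid h) else t0.

(* The smallest nonnegative admissible constant. *)
Definition least_const (R : realType) (P : R -> Prop) : R :=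
  inf [set C : R | 0 <= C /\ P C].

(* Minimum of a nonempty finite list. *)
Definition minl (R : realType) (s : seq R) : R :=
  \big[Num.min/head 0 s]_(b <- s) b.

Definition sumset (R : realType) (A B : {fset R}) : {fset R} :=
  [fset (a + b)%R | a in A, b in B]%fset.

Section Plane.
Context (R : realType).

Definition pdist (x y : R * R) : R :=
  `|x.1 - y.1| + Num.sqrt `|x.2 - y.2|.

(* A real supremum: junk value 0 when the set is unbounded. *)
Definition holder_seminorm (a : R) (u : R * R -> R) : R :=
  sup [set c | exists x y : R * R,
         x <> y /\ c = (pdist y x) `^ (- a) * `|u y - u x|].

Definition basis_dir (b : bool) : R * R := if b then (0, 1) else (1, 0).

(* Iterated partial derivative along a word of coordinate directions. *)
Definition pderiv (w : seq bool) (phi : R * R -> R) : R * R -> R :=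
  foldr (fun b (f : R * R -> R) x => 'D_(basis_dir b) f x) phi w.

Definition schwartz_weight (n : nat) (x : R * R) : R :=
  (1 + `|x.1| + `|x.2|) ^+ n.

Definition schwartz (phi : R * R -> R) : Prop :=
  forall w : seq bool,
    (forall x, differentiable (pderiv w phi) x) /\
    forall n : nat, exists C : R, forall x,
      schwartz_weight n x * `|pderiv w phi x| <= C.

(* A tempered distribution is a function on all test functions of which only
   the values on Schwartz functions matter: there it is linear and bounded by
   finitely many Schwartz seminorms. *)
Definition tempered (X : completeNormedModType R)
    (g : (R * R -> R) -> X) : Prop :=
  (forall (a : R) phi chi, schwartz phi -> schwartz chi ->
     g (fun x => a * phi x + chi x) = a *: g phi + g chi) /\
  exists (n : nat) (C : R), forall phi (M : R), schwartz phi ->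
    (forall w : seq bool, (size w <= n)%N ->
       forall x, schwartz_weight n x * `|pderiv w phi x| <= M) ->
    `|g phi| <= C * M.

Definition mollify (X : completeNormedModType R)
    (rho : R * R -> R) (g : (R * R -> R) -> X) (x : R * R) : X :=
  g (fun y => rho (x - y)).

Definition leb2 :
    {measure set (measurableTypeR R * measurableTypeR R) -> \bar R} :=
  (lebesgue_measure \x lebesgue_measure)%E.

(* [psi T] is the Schwartz function with Fourier transform
   [k |-> exp (- T (k_1^4 + k_2^2))]; the transform is
   [\int psi(x) exp(- i k . x) dx], written out in real and imaginary parts
   ([psi T] is real since its transform is real and even). *)
Definition is_kernel_family (psi : R -> R * R -> R) : Prop :=
  forall T : R, 0 < T -> schwartz (psi T) /\
    forall k : R * R,
      (\int[leb2]_x (psi T x * cos (k.1 * x.1 + k.2 * x.2)))%R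
        = expR (- (T * (k.1 ^+ 4 + k.2 ^+ 2))) /\
      (\int[leb2]_x (psi T x * sin (k.1 * x.1 + k.2 * x.2)))%R = 0.

End Plane.

(* The real line with the norm [`|x| / c]. *)
Definition rescaled (R : realType) (c : {posnum R}) : Type := R^o.

Section Rescaled.
Context (R : realType) (c : {posnum R}).

HB.instance Definition _ := GRing.Lmodule.on (rescaled c).
HB.instance Definition _ := Pointed.on (rescaled c).

Let nrm (x : rescaled c) : R := `|x : R| / c%:num.

Let nrmD (x y : rescaled c) : nrm (x + y) <= nrm x + nrm y.
Proof. by rewrite /nrm -mulrDl ler_wpM2r// ler_normD. Qed.

Let nrmZ (l : R) (x : rescaled c) : nrm (l *: x) = `|l| * nrm x.
Proof. by rewrite /nrm normrM mulrA. Qed.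

Let nrm0 (x : rescaled c) : nrm x = 0 -> x = 0.
Proof.
move=> /eqP; rewrite mulf_eq0 invr_eq0 [c%:num == 0]gt_eqF// orbF normr_eq0.
by move/eqP.
Qed.

HB.instance Definition _ :=
  Lmodule_isNormed.Build R (rescaled c) nrmD nrmZ nrm0.

Lemma rescaled_normE (x : rescaled c) : `|x| = `|x : R| / c%:num.
Proof. by []. Qed.

Let ball_rescaledE (x : rescaled c) (e : R) :
  ball x e = ball (x : R^o) (e * c%:num) :> set R.
Proof.
rewrite -!ball_normE; apply/seteqP; split => y /=;
  by rewrite rescaled_normE ltr_pdivrMr.
Qed.

Let rescaled_complete (F : set_system (rescaled c)) :
  ProperFilter F -> cauchy F -> cvg F.
Proof.
move=> FF /cauchy_ballP Fc.
have FcR : cauchy (F : set_system R^o).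
  apply/cauchy_ballP => e e0; have e0' : 0 < e / c%:num by exact: divr_gt0.
  have := Fc _ e0'; apply: filterS => -[x y] /=.
  by rewrite ball_rescaledE divfK.
have FFR : ProperFilter (F : set_system R^o) by [].
have /cvg_ex[l Fl] : cvg (F : set_system R^o) by exact: cauchy_cvg.
apply/cvg_ex; exists (l : rescaled c); apply/cvg_ballP => e e0.
have /cvg_ballP := (Fl : (F : set_system R^o) --> (l : R^o)).
move=> /(_ (e * c%:num) (mulr_gt0 e0 (gt0 c))); apply: filterS => x.
by rewrite ball_rescaledE.
Qed.

HB.instance Definition _ :=
  Uniform_isComplete.Build (rescaled c) rescaled_complete.

End Rescaled.

Section DirectSums.
Context (R : realType).
Implicit Types (K L : finType).

Definition snorm K (E : K -> completeNormedModType R)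
    (v : forall k, E k) : R := \sum_k `|v k|.

Definition bounded_by K L (E : K -> completeNormedModType R)
    (F : L -> completeNormedModType R)
    (A : (forall k, E k) -> forall l, F l) (a : R) : Prop :=
  forall v, snorm (A v) <= a * snorm v.

Definition is_op K L (E : K -> completeNormedModType R)
    (F : L -> completeNormedModType R)
    (A : (forall k, E k) -> forall l, F l) : Prop :=
  (forall (a : R) v w l, A (fun k => a *: v k + w k) l = a *: A v l + A w l) /\
  exists a : R, bounded_by A a.

Definition is_form K (E : K -> completeNormedModType R)
    (f : (forall k, E k) -> R) : Prop :=
  (forall (a : R) v w, f (fun k => a *: v k + w k) = a * f v + f w) /\
  exists a : R, forall v, `|f v| <= a * snorm v.

End DirectSums.

Section TensorProducts.
Context (R : realType) (I J : finType).
Context (E : I -> completeNormedModType R) (F : J -> completeNormedModType R).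

(* [tspace i j] is the completed tensor product of [E i] and [F j]. *)
Record tensor_data := TensorData {
  tspace : I -> J -> completeNormedModType R;
  tens : forall i j, E i -> F j -> tspace i j }.

Variable X : tensor_data.

(* Target spaces of operators: [None] stands for the real line, so that
   families of [None]s are the finite-dimensional spaces R^n; tensoring with
   the real line is trivial. *)
Definition tgtl (a : option I) : completeNormedModType R :=
  if a is Some i then E i else R^o.

Definition tgtr (b : option J) : completeNormedModType R :=
  if b is Some j then F j else R^o.

Definition tgtt (a : option I) (b : option J) : completeNormedModType R :=
  match a, b with
  | Some i, Some j => tspace X i j
  | Some i, None => E i
  | None, Some j => F j
  | None, None => R^o
  end.

Definition tgt_tens (a : option I) (b : option J) :
    tgtl a -> tgtr b -> tgtt a b :=
  match a, b return tgtl a -> tgtr b -> tgtt a b with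
  | Some i, Some j => fun v w => @tens X i j v w
  | Some i, None => fun v w => (w : R) *: v
  | None, Some j => fun v w => (v : R) *: w
  | None, None => fun v w => (v : R) * (w : R)
  end.

(* [O] is the tensor product of [A], acting on the direct sum of the
   [E (s k)], and [B], acting on the direct sum of the [F (r l)]. *)
Definition is_tensor_op (K L K' L' : finType) (s : K -> I) (r : L -> J)
    (s' : K' -> option I) (r' : L' -> option J)
    (A : (forall k, E (s k)) -> forall k', tgtl (s' k'))
    (B : (forall l, F (r l)) -> forall l', tgtr (r' l'))
    (O : (forall p : K * L, tspace X (s p.1) (r p.2)) ->
         forall p : K' * L', tgtt (s' p.1) (r' p.2)) : Prop :=
  is_op O /\
  forall v w p, O (fun q => tens X (v q.1) (w q.2)) p
                = tgt_tens (A v p.1) (B w p.2).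

(* A family of targets consisting either of spaces [E i] only or of copies
   of the real line only. *)
Definition pure_target (K U : Type) (s : K -> option U) : Prop :=
  (forall k, isSome (s k)) \/ (forall k, ~~ isSome (s k)).

(* Every [tspace i j] is the completion of the algebraic tensor product in a
   crossnorm, and the crossnorm is uniform.  That the algebraic tensor product
   embeds follows from the clause [ucn_op] for functionals; that the tensor
   product of operators is unique and bilinear follows from [ucn_dense]. *)
Record uniform_crossnorm : Prop := {
  ucn_linl : forall i j (a : R) (v v' : E i) (w : F j),
    tens X (a *: v + v') w = a *: tens X v w + tens X v' w;
  ucn_linr : forall i j (a : R) (v : E i) (w w' : F j),
    tens X v (a *: w + w') = a *: tens X v w + tens X v w';
  ucn_cross : forall i j (v : E i) (w : F j),
    `|tens X v w| = `|v| * `|w|;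
  ucn_dense : forall i j (z : tspace X i j) (e : R), 0 < e ->
    exists s : seq (E i * F j), `|z - \sum_(q <- s) tens X q.1 q.2| < e;
  ucn_op : forall (K L K' L' : finType) (s : K -> I) (r : L -> J)
      (s' : K' -> option I) (r' : L' -> option J),
    pure_target s' -> pure_target r' ->
    exists c : R, forall
      (A : (forall k, E (s k)) -> forall k', tgtl (s' k'))
      (B : (forall l, F (r l)) -> forall l', tgtr (r' l')) (a b : R),
      is_op A -> is_op B -> 0 <= a -> 0 <= b ->
      bounded_by A a -> bounded_by B b ->
      exists O, is_tensor_op A B O /\ bounded_by O (c * a * b);
  ucn_mono : forall (K L K1 L1 K2 L2 : finType) (s : K -> I) (r : L -> J)
      (s1 : K1 -> option I) (r1 : L1 -> option J)
      (s2 : K2 -> option I) (r2 : L2 -> option J)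
      (Al : (forall k, E (s k)) -> forall k', tgtl (s1 k'))
      (Ar : (forall l, F (r l)) -> forall l', tgtr (r1 l'))
      (Bl : (forall k, E (s k)) -> forall k', tgtl (s2 k'))
      (Br : (forall l, F (r l)) -> forall l', tgtr (r2 l')) OA OB,
    pure_target s1 -> pure_target r1 -> pure_target s2 -> pure_target r2 ->
    is_op Al -> is_op Ar -> is_op Bl -> is_op Br ->
    is_tensor_op Al Ar OA -> is_tensor_op Bl Br OB ->
    (forall v, snorm (Al v) <= snorm (Bl v)) ->
    (forall w, snorm (Ar w) <= snorm (Br w)) ->
    forall z, snorm (OA z) <= snorm (OB z) }.

Definition tensor_op (A : (forall i, E i) -> forall i, E i)
    (B : (forall j, F j) -> forall j, F j) :
    (forall p : I * J, tspace X p.1 p.2) ->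
    forall p : I * J, tspace X p.1 p.2 :=
  the (fun _ _ => 0)
    (@is_tensor_op I J I J id id Some Some A B).

Definition tensor_form (f : (forall i, E i) -> R) (g : (forall j, F j) -> R) :
    (forall p : I * J, tspace X p.1 p.2) -> R :=
  the (fun _ => 0) (fun h => is_form h /\
    forall v w, h (fun p => tens X (v p.1) (w p.2)) = f v * g w).

End TensorProducts.

Arguments tensor_op {R I J E F} X A B.
Arguments tensor_form {R I J E F} X f g.

(* An abstract space: a finite direct sum of Banach spaces indexed by [gidx],
   the summand [gpiece i] having homogeneity [ghom i].  The graded piece of
   homogeneity [b] is the direct sum, with the sum norm, of the summands [i]
   with [ghom i = b]; several summands may share a homogeneity, as happens
   for tensor products. *)
Record gspace (R : realType) := GSpace {
  gidx : finType;
  ghom : gidx -> R;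
  gpiece : gidx -> completeNormedModType R }.

Section GradedSpaces.
Context (R : realType).

(* One summand for each element of the set of homogeneities [A]. *)
Definition gspace_of (A : {fset R}) (T : A -> completeNormedModType R) :
  gspace R := GSpace val T.

Definition adjoin (b : R) (Y : completeNormedModType R) (S : gspace R) :
  gspace R :=
  GSpace (fun o : option (gidx S) => if o is Some i then ghom i else b)
         (fun o => if o is Some i then gpiece i else Y).

Definition gtensor (Sp Sm : gspace R)
    (X : tensor_data (@gpiece R Sp) (@gpiece R Sm)) : gspace R :=
  GSpace (fun p : gidx Sp * gidx Sm => ghom p.1 + ghom p.2)
         (fun p => tspace X p.1 p.2).

Definition gvec (S : gspace R) : Type := forall i : gidx S, gpiece i.
Definition gop (S : gspace R) : Type := R * R -> gvec S -> gvec S.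
Definition gform (S : gspace R) : Type := R * R -> gvec S -> R.

Variable S : gspace R.

Definition homs : {fset R} := [fset ghom i | i in gidx S]%fset.

(* The norm of the component of homogeneity [b]. *)
Definition graded_norm (b : R) (v : gvec S) : R :=
  \sum_(i | ghom i == b) `|v i|.

Definition trunc (eta : R) (v : gvec S) : gvec S :=
  fun i => if ghom i < eta then v i else 0.

Definition skeleton_bound (G : gop S) (C : R) : Prop :=
  forall b, b \in homs -> forall (v : gvec S) (x y : R * R), pdist y x <= 1 ->
    graded_norm b (fun i => G y v i - G x v i)
    <= C * \sum_(c <- homs | c < b)
             (pdist y x) `^ (b - c) * graded_norm c (G x v).

Record is_skeleton (G : gop S) : Prop := {
  sk_op : forall x, is_op (G x);
  sk_cont : forall x (e : R), 0 < e -> \forall y \near x,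
    forall v : gvec S, snorm (fun i => G y v i - G x v i) <= e * snorm v;
  sk_tri : exists c : R * R -> forall i j : gidx S, gpiece i -> gpiece j,
    (forall x i j, linear (c x i j)) /\
    forall x (v : gvec S) j,
      G x v j = v j + \sum_(i | ghom i < ghom j) c x i j (v i);
  sk_bound : exists C : R, skeleton_bound G C }.

Definition sk_norm (G : gop S) : R := least_const (skeleton_bound G).

Definition mod_bound (G : gop S) (a : R) (V : gform S) (C : R) : Prop :=
  forall (v : gvec S) (x y : R * R), pdist y x <= 1 ->
    `|V y v - V x v|
    <= C * \sum_(b <- homs)
             (pdist y x) `^ (Num.max (a - b) 0) * graded_norm b (G x v).

Definition size_bound (G : gop S) (N : R) (ang : R -> R) (V : gform S)
    (C : R) : Prop :=
  forall (v : gvec S) (x : R * R),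
    `|V x v| <= C * \sum_(b <- homs) N `^ (ang b) * graded_norm b (G x v).

Record is_modelled (G : gop S) (N : R) (ang : R -> R) (a : R)
    (V : gform S) : Prop := {
  md_form : forall x, is_form (V x);
  md_cont : forall x (e : R), 0 < e -> \forall y \near x,
    forall v : gvec S, `|V y v - V x v| <= e * snorm v;
  md_mod : exists C : R, mod_bound G a V C;
  md_size : exists C : R, size_bound G N ang V C }.

Definition mod_norm (G : gop S) (a : R) (V : gform S) : R :=
  least_const (mod_bound G a V).

Definition size_norm (G : gop S) (N : R) (ang : R -> R) (V : gform S) : R :=
  least_const (size_bound G N ang V).

(* The unique form [W] with [V x v = W (G x v)]: its restrictions to the graded
   pieces are the coefficients of the expansion of [V] in the components of
   [G], and [reduce] keeps those of homogeneity below [eta]. *)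
Definition coefficients (G : gop S) (V : gform S) (x : R * R) : gvec S -> R :=
  the (fun _ => 0) (fun W => is_form W /\ forall v, V x v = W (G x v)).

Definition reduce (G : gop S) (eta : R) (V : gform S) : gform S :=
  fun x v => coefficients G V x (trunc eta (G x v)).

(* A tempered distribution with values in the pieces of homogeneity below
   [kappa]. *)
Definition tempered_below (kappa : R)
    (g : forall i : gidx S, (R * R -> R) -> gpiece i) : Prop :=
  forall i, tempered (g i) /\
    (kappa <= ghom i -> forall phi, schwartz phi -> g i phi = 0).

End GradedSpaces.

Section Product.
Context (R : realType).

(* {0} together with the homogeneities of [S], the piece of homogeneity 0
   being the real line. *)
Definition with_unit (S : gspace R) : gspace R :=
  adjoin 0 (R^o : completeNormedModType R) S.

Definition unit0 (S : gspace R) : gvec (with_unit S) :=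
  fun o => match o return @gpiece R (with_unit S) o with
           | None => (1 : R)
           | Some _ => 0
           end.

Variables (Sp' Sm : gspace R).
Let Sp := with_unit Sp'.
Variables (X : tensor_data (@gpiece R Sp) (@gpiece R Sm)).
Let S := gtensor X.

Definition tensor_skeleton (Gp : gop Sp) (Gm : gop Sm) : gop S :=
  fun x => tensor_op X (Gp x) (Gm x).

Definition product_form (Vp : gform Sp) (Vm : gform Sm) : gform S :=
  fun x => tensor_form X (Vp x) (Vm x).

(* The function [u] with [reduce Gp alpha Vp x v = u x * v None]. *)
Definition scalar_part (Gp : gop Sp) (alpha : R) (Vp : gform Sp) : R * R -> R :=
  fun x => reduce Gp alpha Vp x (@unit0 Sp').

Definition higher_part (Gp : gop Sp) (alpha : R) (Vp : gform Sp) : gform Sp :=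
  fun x v => Vp x v - reduce Gp alpha Vp x v.

(* The component in [R (x) gpiece j], identified with [gpiece j] through
   [w |-> 1 (x) w]. *)
Definition minus_part (v : gvec S) : gvec Sm :=
  fun j => the 0 (fun w => v (None, j) = tens X (i := None) (1 : R^o) w).

Variables (level : R) (Nst : {posnum R}).

Definition extension : gspace R :=
  adjoin level (rescaled Nst : completeNormedModType R) S.

Definition ext_vec (u : R) (v : gvec S) : gvec extension :=
  fun o => match o return @gpiece R extension o with
           | None => (u : rescaled Nst)
           | Some i => v i
           end.

Definition ext_fst (w : gvec extension) : R := w None.
Definition ext_snd (w : gvec extension) : gvec S := fun i => w (Some i).

Definition ext_skeleton (G : gop S) (Vm : gform Sm) : gop extension :=
  fun x w => ext_vec (ext_fst w - Vm x (minus_part (ext_snd w)))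
                     (G x (ext_snd w)).

Definition diamond_form (u : R * R -> R) (Vbar : gform Sp) (Vm : gform Sm) :
    gform extension :=
  fun x w => u x * ext_fst w + product_form Vbar Vm x (ext_snd w).

End Product.

Arguments tensor_skeleton {R Sp' Sm} X Gp Gm.
Arguments product_form {R Sp' Sm} X Vp Vm.
Arguments minus_part {R Sp' Sm} X v.
Arguments ext_vec {R Sp' Sm} X level Nst u v.
Arguments ext_skeleton {R Sp' Sm} X level Nst G Vm.
Arguments diamond_form {R Sp' Sm} X level Nst u Vbar Vm.

(* Main.v *)
(** For fixed [x] let [H x] be the real tempered distribution obtained by
    applying the form [reduce Gext kappa Vdiam x] to [(u_-, v_+ <> v_-)], and let
    [diag t x := (H x)_t (x)].

    The distributions [H x] are coherent: with [rho = t^(1/4)] and [d] the distance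
    of [x] and [y], [|(H y)_t (y) - (H x)_t (y)|] is at most a multiple of
    [M_kappa \sum_(b < kappa) rho^b (d^(kappa - b) + d^Q)].  For [d <= 1] this is the
    Leibniz rule [V(y) (x) W(y) - V(x) (x) W(x) = V(y) (x) (W(y) - W(x)) +
    (V(y) - V(x)) (x) W(x)], combined with the skeleton bound for the components of
    homogeneity at least [kappa] removed by the reduction.  For [d > 1] one joins
    [y] to [x] by about [d^2] points at mutual distance at most 1; each level of
    homogeneity then costs one factor [1 + sk_norm Gext], hence the power [|A| - 1].

    Since [psi_s * psi_t = psi_(s+t)], coherence gives
    [|psi_s * diag t - diag (s + t)| <= C M t^(kappa/4)] for [s <= 3 t].  As
    [kappa > 0], the functions [diag (2^-n)] converge as distributions, and
    telescoping over [n] gives the bound on [u_T - diag T].  A distribution [g] with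
    [g_t = O(t^(kappa/4))] vanishes, because [g(phi)] is the limit of
    [\int g_t phi]; this is uniqueness.  The suboptimal bound only adds the terms of
    homogeneity in [[eta, kappa)]. *)

(* The kernels are known only through their transforms, so the semigroup law and the scaling of
   [psi t] come from injectivity of the Fourier transform, and bounds on [psi t] reduce to moments
   of [psi 1]. [diag t] may blow up like a negative power of [t], so its pairing with a test
   function has no evident limit; the power is lowered unit by unit, trading derivatives of the test
   function for factors [t^(1/4)]. These crude bounds only serve convergence; the constant of the
   final estimate comes from coherence alone. A form on the completed tensor product cannot be
   estimated by decomposing a vector into pure tensors. Bounds there compare operators on the two
   factors separately and invoke monotonicity of the crossnorm. The extended set of homogeneities
   has |A| + 1 elements, at least one of them not below [kappa]; hence a homogeneity below [kappa]
   has at most |A| - 1 others below it, which is the power in [M_kappa]. All constants are fixed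
   before the Banach spaces appear. *)
Require Import Defs.
From HB Require Import structures.
From mathcomp Require Import all_boot all_order all_algebra finmap.
From mathcomp Require Import all_classical all_reals all_analysis.
From mathcomp Require Import measurable_realfun ring lra.
Set Implicit Arguments.
Unset Strict Implicit.
Unset Printing Implicit Defensive.
Import Order.TTheory GRing.Theory Num.Theory.
Import numFieldNormedType.Exports.

Local Open Scope classical_set_scope.
Local Open Scope ring_scope.

(** * Integration over the plane *)

Section Leb2Affine.
Context (R : realType).
Local Notation mR := (measurableTypeR R).
Local Notation leb := (@lebesgue_measure R).

Definition affine1 (a b : R) (x : R) : R := a * x + b.

Lemma measurable_affine1 (a b : R) :
  measurable_fun [set: mR] (affine1 a b : mR -> mR).
Proof. by apply: measurable_funD => //; apply: measurable_funM. Qed.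

(** Both sides are measures of [A], so by uniqueness they need only agree on the intervals []u, v]].
    A negative [a] moves the closed end to the other side, which does not change the length. *)
Lemma lebesgue_measure_affine (a b : R) (A : set R) : a != 0 ->
  measurable (A : set mR) ->
  (`|a|%:E * leb (affine1 a b @^-1` A))%E = leb A.
Proof.
move=> a0 mA; apply/esym.
have na : 0 <= `|a| by [].
pose mu' : {measure set mR -> \bar R} :=
  mscale (NngNum na) (pushforward leb (affine1 a b : mR -> mR)).
pose mu := mu' (@measurable_affine1 a b).
suff h : forall X : set mR, measurable X -> leb X = mu X.
  by rewrite (h _ mA).
move=> X mX; apply: lebesgue_measure_unique => // _ [[u v]] _ <-.
transitivity (`|a|%:E * leb (affine1 a b @^-1` `]u, v]))%E; last by [].
have [agt|alt|/eqP] := ltgtP 0 a; last by rewrite eq_sym (negbTE a0).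
- rewrite (_ : affine1 a b @^-1` `]u, v] = `](u - b) / a, (v - b) / a]%classic); last first.
    apply/seteqP; split => x /=; rewrite /affine1 !in_itv/=;
    by rewrite ltr_pdivrMr// ler_pdivlMr// ltrBlDr lerBrDr (mulrC x).
  rewrite !lebesgue_measure_itv/= !lte_fin ltr_pM2r ?invr_gt0// ltrD2r.
  case: ifPn => uv; last by rewrite mule0.
  by rewrite -EFinB -EFinM gtr0_norm//; congr EFin; field; rewrite gt_eqF.
- rewrite (_ : affine1 a b @^-1` `]u, v] = `[(v - b) / a, (u - b) / a[%classic); last first.
    apply/seteqP; split => x /=; rewrite /affine1 !in_itv/= => /andP[];
    rewrite ?ltr_ndivrMr ?ler_ndivlMr ?ltr_ndivlMr ?ler_ndivrMr// => h1 h2;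
    apply/andP; split; lra.
  rewrite !lebesgue_measure_itv/= !lte_fin ltr_nM2r ?invr_lt0// ltrD2r.
  case: ifPn => uv; last by rewrite mule0.
  by rewrite -EFinB -EFinM ltr0_norm//; congr EFin; field; rewrite lt_eqF.
Qed.

Definition affine2 (a b x : R * R) : R * R :=
  (affine1 a.1 b.1 x.1, affine1 a.2 b.2 x.2).

Lemma measurable_affine2 (a b : R * R) :
  measurable_fun [set: mR * mR] (affine2 a b : mR * mR -> mR * mR).
Proof.
apply: measurable_fun_pair;
 exact: (measurableT_comp (@measurable_affine1 _ _)).
Qed.

Lemma leb2X (A B : set R) : measurable (A : set mR) ->
  measurable (B : set mR) -> (@leb2 R (A `*` B) = leb A * leb B)%E.
Proof. by move=> mA mB; exact: (product_measure1E _ _ mA mB). Qed.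

(** Uniqueness of the product measure reduces this to rectangles, whose preimages are rectangles. *)
Lemma leb2_affine (a b : R * R) (A : set (R * R)) : a.1 != 0 -> a.2 != 0 ->
  measurable (A : set (mR * mR)) ->
  ((`|a.1| * `|a.2|)%:E * @leb2 R (affine2 a b @^-1` A))%E = @leb2 R A.
Proof.
move=> a1 a2 mA; apply/esym.
have na : 0 <= `|a.1| * `|a.2| by exact: mulr_ge0.
pose mu' : {measure set (mR * mR) -> \bar R} :=
  mscale (NngNum na) (pushforward (@leb2 R) (affine2 a b : mR * mR -> mR * mR)).
pose mu := mu' (@measurable_affine2 a b).
suff h : forall X : set (mR * mR), measurable X -> @leb2 R X = mu X.
  by rewrite (h _ mA).
apply: product_measure_unique => X Y mX mY.
transitivity ((`|a.1| * `|a.2|)%:E * @leb2 R (affine2 a b @^-1` (X `*` Y)))%E; first by [].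
have -> : affine2 a b @^-1` (X `*` Y) =
   (affine1 a.1 b.1 @^-1` X) `*` (affine1 a.2 b.2 @^-1` Y) by [].
rewrite leb2X; last 2 first.
  by rewrite -[X in measurable X]setTI; apply: measurable_affine1.
  by rewrite -[X in measurable X]setTI; apply: measurable_affine1.
rewrite EFinM muleACA; congr (_ * _)%E; exact: lebesgue_measure_affine.
Qed.

Lemma ge0_int_affine (a b : R * R) (f : R * R -> \bar R) :
  a.1 != 0 -> a.2 != 0 ->
  measurable_fun [set: mR * mR] (f : mR * mR -> \bar R) ->
  (forall x, 0 <= f x)%E ->
  ((`|a.1| * `|a.2|)%:E * \int[@leb2 R]_x f (affine2 a b x) =
   \int[@leb2 R]_x f x)%E.
Proof.
move=> a1 a2 mf f0.
have na : 0 <= `|a.1| * `|a.2| by exact: mulr_ge0.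
pose mu' : {measure set (mR * mR) -> \bar R} :=
  pushforward (@leb2 R) (affine2 a b : mR * mR -> mR * mR).
pose mu0 := mu' (@measurable_affine2 a b).
pose mu : {measure set (mR * mR) -> \bar R} := mscale (NngNum na) mu0.
transitivity (\int[mu]_x f x)%E; last first.
  by apply: eq_measure_integral => A mA _; apply: (leb2_affine b a1 a2 mA).
transitivity ((`|a.1| * `|a.2|)%:E * \int[mu0]_x f x)%E; last first.
  exact/esym/(ge0_integral_mscale mu0 measurableT (NngNum na) mf).
have := @ge0_integral_pushforward _ _ _ _ _ _ (@measurable_affine2 a b)
  (@leb2 R) setT f measurableT mf.
rewrite preimage_setT => h.
by apply: (congr1 (fun z => _ * z)%E); rewrite -h.
Qed.

End Leb2Affine.

Section Integrals.
Context (R : realType).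
Local Notation mR := (measurableTypeR R).
Local Notation leb := (@lebesgue_measure R).

Definition meas2 (f : R * R -> R) : Prop :=
  measurable_fun [set: mR * mR] (f : mR * mR -> R).

Definition L1 (f : R * R -> R) : Prop :=
  (@leb2 R).-integrable [set: mR * mR] (EFin \o f : mR * mR -> \bar R).

Definition int2 (f : R * R -> R) : R := (\int[@leb2 R]_x f x)%R.

Lemma L1_meas f : L1 f -> meas2 f.
Proof. by move=> /integrableP[/measurable_EFinP]. Qed.

Lemma meas2_affine a b f : meas2 f -> meas2 (fun x => f (affine2 a b x)).
Proof. by move=> mf; apply: (measurableT_comp mf); exact: measurable_affine2. Qed.

Lemma meas2M f g : meas2 f -> meas2 g -> meas2 (fun x => f x * g x).
Proof. by move=> mf mg; exact: measurable_funM. Qed.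

Lemma L1_affine a b f : a.1 != 0 -> a.2 != 0 -> L1 f ->
  L1 (fun x => f (affine2 a b x)).
Proof.
move=> a1 a2 fi; have mf := L1_meas fi; apply/integrableP; split.
  by apply/measurable_EFinP; exact: (meas2_affine a b mf).
move/integrableP : fi => [_].
have c0 : 0 < `|a.1| * `|a.2| by rewrite mulr_gt0 ?normr_gt0.
rewrite -(ge0_int_affine b a1 a2)//; last first.
  by apply: measurableT_comp => //; exact/measurable_EFinP.
move=> h; rewrite ltey; apply/eqP => h'; move: h; rewrite /= h'.
by rewrite gt0_muley ?lte_fin// ltxx.
Qed.

(** Positive and negative parts are transformed separately; both integrals must be finite to be
    subtracted in the extended reals. *)
Lemma int2_affine a b f : a.1 != 0 -> a.2 != 0 -> L1 f ->
  `|a.1| * `|a.2| * int2 (fun x => f (affine2 a b x)) = int2 f.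
Proof.
move=> a1 a2 fi; have mf := L1_meas fi; have fi' := L1_affine b a1 a2 fi.
have mE : measurable_fun [set: mR * mR] (EFin \o f : mR * mR -> \bar R).
  exact/measurable_EFinP.
have hp := ge0_int_affine b a1 a2 (measurable_funepos mE) (fun x => funepos_ge0 _ x).
have hn := ge0_int_affine b a1 a2 (measurable_funeneg mE) (fun x => funeneg_ge0 _ x).
have fp := integrable_fin_num measurableT (integrable_funepos measurableT fi').
have fn := integrable_fin_num measurableT (integrable_funeneg measurableT fi').
set F := (EFin \o f : R * R -> \bar R) in hp hn.
pose A := (\int[@leb2 R]_x (F^\+ (affine2 a b x)))%E.
pose B := (\int[@leb2 R]_x (F^\- (affine2 a b x)))%E.
have eA : (\int[@leb2 R]_x ((F \o affine2 a b)^\+ x) = A)%E.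
  by rewrite funepos_comp.
have eB : (\int[@leb2 R]_x ((F \o affine2 a b)^\- x) = B)%E.
  by rewrite funeneg_comp.
have hA : A \is a fin_num by rewrite -eA; exact: fp.
have hB : B \is a fin_num by rewrite -eB; exact: fn.
have -> : int2 f = fine ((`|a.1| * `|a.2|)%:E * A - (`|a.1| * `|a.2|)%:E * B)%E.
  by rewrite /A /B hp hn /int2 /Rintegral integralE.
have -> : int2 (fun x => f (affine2 a b x)) = fine (A - B)%E.
  by rewrite -eA -eB /int2 /Rintegral integralE.
by rewrite -(fineK hA) -(fineK hB) -!EFinM -!EFinB /= mulrBr.
Qed.

Lemma int2_shift b f : L1 f -> int2 (fun x => f (x + b)) = int2 f.
Proof.
move=> fi; rewrite -[RHS](@int2_affine (1, 1) b)//= ?oner_eq0//.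
rewrite normr1 !mul1r; congr int2; apply/funext => x; congr f.
by case: x b => ? ? [? ?]; rewrite /affine2 /affine1/= !mul1r.
Qed.

Lemma L1_shift b f : L1 f -> L1 (fun x => f (x + b)).
Proof.
move=> fi; have := @L1_affine (1, 1) b f; rewrite /= oner_eq0 => /(_ erefl erefl fi).
congr L1; apply/funext => x; congr f.
by case: x b => ? ? [? ?]; rewrite /affine2 /affine1/= !mul1r.
Qed.

Lemma int2_reflect b f : L1 f -> int2 (fun x => f (b - x)) = int2 f.
Proof.
move=> fi; rewrite -[RHS](@int2_affine (- 1, - 1) b)//= ?oppr_eq0 ?oner_eq0//.
rewrite normrN normr1 !mul1r; congr int2; apply/funext => x; congr f.
by case: x b => ? ? [? ?]; rewrite /affine2 /affine1/= !mulN1r; congr pair; rewrite addrC.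
Qed.

Lemma L1_reflect b f : L1 f -> L1 (fun x => f (b - x)).
Proof.
move=> fi; have := @L1_affine (- 1, - 1) b f; rewrite /= oppr_eq0 oner_eq0 => /(_ erefl erefl fi).
congr L1; apply/funext => x; congr f.
by case: x b => ? ? [? ?]; rewrite /affine2 /affine1/= !mulN1r; congr pair; rewrite addrC.
Qed.

Lemma L1_le f g : meas2 f -> L1 g -> (forall x, `|f x| <= g x) -> L1 f.
Proof.
move=> mf gi fg; apply: (le_integrable _ _ _ gi) => //.
  exact/measurable_EFinP.
by move=> x _; rewrite lee_fin/= (le_trans (fg x))// ler_norm.
Qed.

Lemma L1D f g : L1 f -> L1 g -> L1 (fun x => f x + g x).
Proof. by move=> fi gi; exact: (integrableD measurableT fi gi). Qed.

Lemma L1Z c f : L1 f -> L1 (fun x => c * f x).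
Proof. by move=> fi; exact: (integrableZl measurableT c fi). Qed.

Lemma L1B f g : L1 f -> L1 g -> L1 (fun x => f x - g x).
Proof. by move=> fi gi; exact: (integrableB measurableT fi gi). Qed.

Lemma L1_norm f : L1 f -> L1 (fun x => `|f x|).
Proof. by move=> fi; exact: (integrable_norm fi). Qed.

Lemma int2D f g : L1 f -> L1 g -> int2 (fun x => f x + g x) = int2 f + int2 g.
Proof. by move=> fi gi; exact: (RintegralD measurableT fi gi). Qed.

Lemma int2B f g : L1 f -> L1 g -> int2 (fun x => f x - g x) = int2 f - int2 g.
Proof. by move=> fi gi; exact: (RintegralB measurableT fi gi). Qed.

Lemma int2Z c f : L1 f -> int2 (fun x => c * f x) = c * int2 f.
Proof. by move=> fi; exact: (RintegralZl c measurableT fi). Qed.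

Lemma int2_le f g : L1 f -> L1 g -> (forall x, f x <= g x) -> int2 f <= int2 g.
Proof. by move=> fi gi fg; apply: (le_Rintegral measurableT fi gi) => x _; exact: fg. Qed.

Lemma int2_norm f : L1 f -> `|int2 f| <= int2 (fun x => `|f x|).
Proof. by move=> fi; exact: (le_normr_Rintegral measurableT fi). Qed.

Lemma int2_ge0 f : (forall x, 0 <= f x) -> 0 <= int2 f.
Proof. by move=> f0; apply: Rintegral_ge0 => x _; exact: f0. Qed.

Lemma int2_norm_le f g : L1 f -> L1 g -> (forall x, `|f x| <= g x) ->
  `|int2 f| <= int2 g.
Proof.
move=> fi gi fg; apply: (le_trans (int2_norm fi)).
by apply: int2_le => //; exact: L1_norm.
Qed.

Lemma int2_dct (f_ : nat -> R * R -> R) f g :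
  (forall n, meas2 (f_ n)) -> L1 g -> (forall n x, `|f_ n x| <= g x) ->
  (forall x, f_ n x @[n --> \oo] --> f x) ->
  L1 f /\ int2 (f_ n) @[n --> \oo] --> int2 f.
Proof.
move=> mf gi fg ff.
have mf' : meas2 f by apply: (measurable_fun_cvg mf) => x _; exact: ff.
have [|||||h1 h2 h3] := @dominated_convergence _ _ _ (@leb2 R) setT measurableT
  (fun n x => (f_ n x)%:E) (EFin \o f) (EFin \o g).
- by move=> n; apply/measurable_EFinP; exact: mf.
- exact/measurable_EFinP.
- by apply: aeW => x _; apply: cvg_EFin; [exact: nearW|exact: ff].
- exact: gi.
- by apply: aeW => x n _; rewrite lee_fin.
split; first exact: h1.
apply: (@fine_cvg _ _ _ _ (fun n => (\int[@leb2 R]_x (f_ n x)%:E)%E)).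
by rewrite /int2 /Rintegral fineK//; exact: (integrable_fin_num measurableT h1).
Qed.

(** The sigma-algebra on the plane is the product one, so one has to know that an open set is a
    countable union of boxes: here boxes with rational centre and radius [1 / (n + 1)]. *)
Lemma continuous_meas2 (f : R * R -> R) : continuous f -> meas2 f.
Proof.
move=> cf; apply: (measurability _ (RGenOInfty.measurableE R)).
move=> _ [_ [r ->] <-]; rewrite setTI.
set U := f @^-1` _.
have Uo : open U.
  by apply: open_comp => [x _|]; [exact: cf|rewrite set_itvE; exact: open_gt].
pose box (q : nat * (rat * rat)) : set (R * R) :=
  ball (ratr q.2.1 : R) (q.1.+1%:R^-1) `*` ball (ratr q.2.2 : R) (q.1.+1%:R^-1).
have -> : U = \bigcup_(q in [set q | box q `<=` U]) box q.
  apply/seteqP; split=> [x Ux|x [q /= qU]]; last exact: qU.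
  have /nbhs_ballP[e /= e0 eU] : nbhs x U by apply: open_nbhs_nbhs.
  have e20 : 0 < e / 2 by exact: divr_gt0.
  have [n _ /(_ n (leqnn n)) /= ne] := near_infty_natSinv_lt (PosNum e20).
  have n0 : 0 < n.+1%:R^-1 :> R by rewrite invr_gt0.
  pose m : R := n.+1%:R^-1; rewrite -/m in n0 ne.
  have [q1 hq1] : exists q, ratr q \in `]x.1 - m, x.1 + m[.
    by apply: rat_in_itvoo; lra.
  have [q2 hq2] : exists q, ratr q \in `]x.2 - m, x.2 + m[.
    by apply: rat_in_itvoo; lra.
  move: hq1 hq2; rewrite !in_itv/= => /andP[a1 a2] /andP[b1 b2].
  exists (n, (q1, q2)) => [/=|].
    move=> y [/=]; rewrite -!ball_normE/= -/m => + + ; rewrite !ltr_norml => /andP[c1 c2] /andP[d1 d2].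
    by apply: eU; split; rewrite /= -ball_normE/= ltr_norml; apply/andP; split; lra.
  by split; rewrite /= -ball_normE/= -/m ltr_norml; apply/andP; split; lra.
rewrite bigcup_mkcond; apply: countable_bigcupT_measurable => // q.
case: ifP => _; last exact: measurable0.
by apply: measurableX; apply: measurable_ball.
Qed.

End Integrals.

(** * Fubini's theorem on the plane *)

Section FubiniPlane.
Context (R : realType).
Local Notation mR := (measurableTypeR R).
Local Notation leb := (@lebesgue_measure R).

Lemma int2E (f : R * R -> R) : L1 f ->
  (\int[@leb2 R]_x (f x)%:E)%E = (int2 f)%:E.
Proof.
by move=> fi; rewrite /int2 /Rintegral fineK//; exact: (integrable_fin_num measurableT fi).
Qed.

(* A fresh constant for [leb2], so that the sigma-finite structure needed by
   Fubini's theorem can be attached to it. *)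
Definition leb2_fun : set (mR * mR) -> \bar R :=
  (@lebesgue_measure R \x @lebesgue_measure R)%E.

HB.instance Definition _ := Measure.on leb2_fun.

Lemma leb2_fun_sigma_finite : sigma_finite setT leb2_fun.
Proof.
have /sigma_finiteP[F [TF ndF Foo]] := sigma_finiteT leb.
exists (fun n => F n `*` F n).
  rewrite -setXTT {1 2}TF predeqE => -[x y]; split.
    move=> [/= [n _ Fnx] [k _ Fky]]; exists (maxn n k) => //; split.
    - by move: x Fnx; exact/subsetPset/ndF/leq_maxl.
    - by move: y Fky; exact/subsetPset/ndF/leq_maxr.
  by move=> [n _ []/= ? ?]; split; exists n.
move=> k; have [mF Fk] := Foo k; split; first exact: measurableX.
have -> : leb2_fun (F k `*` F k) = (leb (F k) * leb (F k))%E by exact: leb2X.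
by rewrite lte_mul_pinfty// ge0_fin_numE.
Qed.

HB.instance Definition _ :=
  Measure_isSigmaFinite.Build _ _ _ leb2_fun leb2_fun_sigma_finite.

Let leb2s : {sigma_finite_measure set (mR * mR)%type -> \bar R} := leb2_fun.

(** Domination of the inner integrals by an integrable [g] is Tonelli's criterion for integrability
    on the product. *)
Lemma int2_fubini (h : R * R -> R * R -> R) (g : R * R -> R) :
  measurable_fun [set: (mR * mR) * (mR * mR)]
    ((fun z => h z.1 z.2) : (mR * mR) * (mR * mR) -> R) ->
  (forall x, L1 (h x)) -> (forall y, L1 (h ^~ y)) ->
  L1 g -> (forall x, int2 (fun y => `|h x y|) <= g x) ->
  [/\ L1 (fun x => int2 (h x)), L1 (fun y => int2 (h ^~ y)) &
   int2 (fun x => int2 (h x)) = int2 (fun y => int2 (h ^~ y))].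
Proof.
move=> mh h1 h2 gi hg.
pose H (z : (mR * mR) * (mR * mR)) : \bar R := (h z.1 z.2)%:E.
have mH : measurable_fun setT H by exact/measurable_EFinP.
have Hi : (leb2s \x leb2s)%E.-integrable setT H.
  apply/(integrable12ltyP leb2s leb2s mH).
  apply: (@le_lt_trans _ _ (\int[leb2s]_x (g x)%:E)%E); last first.
    by rewrite (int2E gi) ltry.
  have abs x : (\int[leb2s]_y `|H (x, y)|)%E = (int2 (fun y => `|h x y|))%:E.
    by rewrite -(int2E (L1_norm (h1 x))).
  apply: ge0_le_integral => //.
  - by move=> x _; exact: integral_ge0.
  - have := @measurable_fun_fubini_tonelli_F _ _ _ _ _ leb2s (fun z => `|H z|%E).
    by apply => //; exact: measurableT_comp.
  - by apply/measurable_EFinP; exact: (L1_meas gi).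
  - by move=> x _; rewrite abs lee_fin; exact: hg.
have e1 x : fubini_F leb2s H x = (int2 (h x))%:E by rewrite -(int2E (h1 x)).
have e2 y : fubini_G leb2s H y = (int2 (h ^~ y))%:E by rewrite -(int2E (h2 y)).
have i1 : L1 (fun x => int2 (h x)).
  have := integrable_fubini_F Hi; congr (_.-integrable _ _).
  by apply/funext => x; rewrite e1.
(* This is the first marginal of the function with exchanged arguments. *)
have i2 : L1 (fun y => int2 (h ^~ y)).
  pose Hs (z : (mR * mR) * (mR * mR)) : \bar R := H (z.2, z.1).
  have mHs : measurable_fun setT Hs.
    by apply: (measurableT_comp mH); apply: measurable_fun_pair.
  have Hsi : (leb2s \x leb2s)%E.-integrable setT Hs.
    apply/(integrable12ltyP leb2s leb2s mHs).
    by move/(integrable21ltyP leb2s leb2s mH) : Hi.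
  have := integrable_fubini_F Hsi; congr (_.-integrable _ _).
  by apply/funext => x; rewrite -[LHS]/(fubini_G leb2s H x) e2.
split; [exact: i1|exact: i2|].
have := Fubini Hi.
rewrite (_ : (fun x => \int[leb2s]_y H (x, y))%E = (fun x => (int2 (h x))%:E)); last first.
  by apply/funext => x; rewrite -e1.
rewrite (_ : (fun y => \int[leb2s]_x H (x, y))%E = (fun y => (int2 (h ^~ y))%:E)); last first.
  by apply/funext => x; rewrite -e2.
rewrite -[X in X = _]/(\int[@leb2 R]_x (int2 (h x))%:E)%E.
rewrite -[X in _ = X]/(\int[@leb2 R]_x (int2 (h ^~ x))%:E)%E.
by move=> e; apply: EFin_inj; rewrite -(int2E i1) -(int2E i2).
Qed.

Lemma meas2_sub (k : R * R -> R) : meas2 k ->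
  measurable_fun [set: (mR * mR) * (mR * mR)]
    ((fun z => k (z.1 - z.2)) : (mR * mR) * (mR * mR) -> R).
Proof.
move=> mk; pose sb (z : (mR * mR) * (mR * mR)) : mR * mR :=
  (z.1.1 - z.2.1, z.1.2 - z.2.2).
suff msb : measurable_fun setT sb by exact: (measurableT_comp mk msb).
have m1 : measurable_fun [set: (mR * mR) * (mR * mR)] (fun z : (mR * mR) * (mR * mR) => z.1.1).
  exact: (measurableT_comp measurable_fst measurable_fst).
have m2 : measurable_fun [set: (mR * mR) * (mR * mR)] (fun z : (mR * mR) * (mR * mR) => z.2.1).
  exact: (measurableT_comp measurable_fst measurable_snd).
have m3 : measurable_fun [set: (mR * mR) * (mR * mR)] (fun z : (mR * mR) * (mR * mR) => z.1.2).
  exact: (measurableT_comp measurable_snd measurable_fst).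
have m4 : measurable_fun [set: (mR * mR) * (mR * mR)] (fun z : (mR * mR) * (mR * mR) => z.2.2).
  exact: (measurableT_comp measurable_snd measurable_snd).
by apply: measurable_fun_pair; exact: measurable_funB.
Qed.

Lemma L1_bounded_mul (k F : R * R -> R) (c : R) : L1 k -> meas2 F ->
  (forall x, `|F x| <= c) -> L1 (fun x => k x * F x).
Proof.
move=> ki mF Fc; apply: (@L1_le _ _ (fun x => c * `|k x|)).
- by apply: meas2M => //; exact: L1_meas.
- exact/L1Z/L1_norm.
- by move=> x; rewrite normrM mulrC ler_wpM2r.
Qed.

(** For fixed [x] the slice of [k (x - y) F y f x] has L1 norm at most [c |f x|] times that of [k],
    by invariance under reflection and translation; this is the dominating function required by
    [int2_fubini]. *)
Lemma fubini_conv (k F f : R * R -> R) (c c' : R) :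
  L1 k -> meas2 F -> (forall x, `|F x| <= c) ->
  L1 f -> (forall x, `|f x| <= c') ->
  [/\ L1 (fun x => int2 (fun y => k (x - y) * F y) * f x),
     L1 (fun y => F y * int2 (fun x => k (x - y) * f x)) &
    int2 (fun x => int2 (fun y => k (x - y) * F y) * f x) =
    int2 (fun y => F y * int2 (fun x => k (x - y) * f x))].
Proof.
move=> ki mF Fc fi fc.
have c0 : 0 <= c by rewrite (le_trans _ (Fc 0)).
pose h x y := k (x - y) * F y * f x.
have k1 x : L1 (fun y => k (x - y) * F y).
  by apply: L1_bounded_mul Fc => //; exact: L1_reflect.
have k2 y : L1 (fun x => k (x - y) * f x).
  by apply: L1_bounded_mul fc; [exact: L1_shift|exact: L1_meas].
have E1 x : int2 (h x) = int2 (fun y => k (x - y) * F y) * f x.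
  rewrite mulrC -int2Z//; congr int2; apply/funext => y; rewrite /h; ring.
have E2 y : int2 (h ^~ y) = F y * int2 (fun x => k (x - y) * f x).
  rewrite -int2Z//; congr int2; apply/funext => x; rewrite /h; ring.
have h1 x : L1 (h x).
  have := L1Z (f x) (k1 x); congr L1; apply/funext => y; rewrite /h; ring.
have h2 y : L1 (h ^~ y).
  have := L1Z (F y) (k2 y); congr L1; apply/funext => x; rewrite /h; ring.
have [|||||i1 i2 e] := @int2_fubini h (fun x => (c * int2 (fun y => `|k y|)) * `|f x|).
- apply: measurable_funM; first apply: measurable_funM.
  + by apply: meas2_sub; exact: L1_meas.
  + exact: (measurableT_comp mF measurable_snd).
  + exact: (measurableT_comp (L1_meas fi) measurable_fst).
- exact: h1.
- exact: h2.
- exact/L1Z/L1_norm.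
- move=> x; rewrite -mulrA [X in _ * X]mulrC mulrA.
  rewrite -(int2_reflect x (L1_norm ki)) -int2Z; last exact: (L1_reflect x (L1_norm ki)).
  apply: int2_le; first exact: L1_norm.
    by apply: L1Z; exact: (L1_reflect x (L1_norm ki)).
  move=> y; rewrite /h !normrM.
  rewrite [leRHS](_ : _ = `|k (x - y)| * c * `|f x|); last by ring.
  by rewrite ler_wpM2r// ler_wpM2l.
split.
- by move: i1; congr L1; apply/funext => x; rewrite E1.
- by move: i2; congr L1; apply/funext => x; rewrite E2.
- have -> : (fun x => int2 (fun y => k (x - y) * F y) * f x) = (fun x => int2 (h x)).
    by apply/funext => x; rewrite E1.
  by rewrite e; congr int2; apply/funext => y; rewrite E2.
Qed.

End FubiniPlane.

(** * Rapidly decreasing functions *)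

Section Rapid.
Context (R : realType).
Local Notation mR := (measurableTypeR R).
Local Notation leb := (@lebesgue_measure R).

(** The integrand is even and its integral over the positive half-line is known. *)
Lemma integrable_oneDsqrV :
  (\int[leb]_x ((oneDsqr x)^-1)%:E < +oo :> \bar R)%E.
Proof.
have m : measurable_fun [set: R] (fun x : R => ((oneDsqr x)^-1)%:E).
  by apply/measurable_EFinP; apply: continuous_measurable_fun; exact: continuous_oneDsqrV.
have p x : (0 <= ((oneDsqr x)^-1)%:E :> \bar R)%E.
  by rewrite lee_fin invr_ge0 (le_trans _ (oneDsqr_ge1 x)).
have e := ge0_integration_by_substitution0 m p.
rewrite (_ : (fun r => ((oneDsqr (- r))^-1)%:E) = (fun r => ((oneDsqr r)^-1)%:E)) in e; last first.
  by apply/funext => x; rewrite /oneDsqr sqrrN.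
have -> : [set: R] = `]-oo, 0[%classic `|` `[0, +oo[%classic.
  apply/seteqP; split => x // _; have [x0|x0] := ltP x 0; [left|right];
    by rewrite /= in_itv/= ?x0.
rewrite ge0_integral_setU//=; last 2 first.
- exact: measurable_funTS.
- by apply/disj_setPS => x []/=; rewrite !in_itv/= andbT => /lt_le_trans h /h; rewrite ltxx.
rewrite lte_add_pinfty//; last by rewrite integral0y_oneDsqr ltry.
apply: (@le_lt_trans _ _ (\int[leb]_(x in `]-oo, 0%R]) ((oneDsqr x)^-1)%:E)%E).
  apply: ge0_subset_integral => //; first exact: measurable_funTS.
  by move=> x /=; rewrite !in_itv/= => /ltW.
by rewrite -e integral0y_oneDsqr ltry.
Qed.

(** A product of two Cauchy densities up to normalisation: the integrable majorant used to turn
    decay into integrability. *)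
Definition jap (x : R * R) : R := (oneDsqr x.1)^-1 * (oneDsqr x.2)^-1.

Lemma jap_ge0 x : 0 <= jap x.
Proof. by rewrite mulr_ge0// invr_ge0 (le_trans _ (oneDsqr_ge1 _)). Qed.

Lemma continuous_fst2 : continuous (fun x : R * R => x.1).
Proof. by move=> x; exact: cvg_fst. Qed.

Lemma continuous_snd2 : continuous (fun x : R * R => x.2).
Proof. by move=> x; exact: cvg_snd. Qed.

Lemma continuous_jap : continuous jap.
Proof.
move=> x; apply: cvgM.
  apply: (@continuous_comp _ _ _ (fun x : R * R => x.1) (fun u : R => (oneDsqr u)^-1)).
    exact: continuous_fst2.
  exact: continuous_oneDsqrV.
apply: (@continuous_comp _ _ _ (fun x : R * R => x.2) (fun u : R => (oneDsqr u)^-1)).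
  exact: continuous_snd2.
exact: continuous_oneDsqrV.
Qed.

Lemma L1_jap : L1 jap.
Proof.
have m : meas2 jap by apply: continuous_meas2; exact: continuous_jap.
have m1 : measurable_fun [set: R] (fun x : R => ((oneDsqr x)^-1)%:E).
  by apply/measurable_EFinP; apply: continuous_measurable_fun; exact: continuous_oneDsqrV.
have p x : (0 <= ((oneDsqr x)^-1)%:E :> \bar R)%E.
  by rewrite lee_fin invr_ge0 (le_trans _ (oneDsqr_ge1 x)).
have mH : measurable_fun [set: mR * mR] (EFin \o jap : mR * mR -> \bar R).
  exact/measurable_EFinP.
apply/(integrable12ltyP leb leb mH) => /=.
pose c := (\int[leb]_x ((oneDsqr x)^-1)%:E)%E.
have c0 : (0 <= c)%E by apply: integral_ge0.
have cE : (\int[leb]_x \int[leb]_y `|(jap (x, y))%:E| = c * c)%E.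
  have h x : (\int[leb]_y `|(jap (x, y))%:E| = ((oneDsqr x)^-1)%:E * c)%E.
    rewrite -ge0_integralZl//. 
    by apply: eq_integral => y _; rewrite gee0_abs// lee_fin jap_ge0.
  transitivity (\int[leb]_x (((oneDsqr x)^-1)%:E * c))%E.
    by apply: eq_integral => x _; rewrite h.
  by rewrite ge0_integralZr.
by rewrite cE lte_mul_pinfty// ?integrable_oneDsqrV// ge0_fin_numE// integrable_oneDsqrV.
Qed.

Local Notation w := (@schwartz_weight R).

Lemma weight_ge1 n x : 1 <= w n x.
Proof. by rewrite exprn_ege1// -addrA lerDl addr_ge0. Qed.

Lemma weight_gt0 n x : 0 < w n x.
Proof. exact: (lt_le_trans ltr01 (weight_ge1 n x)). Qed.

Lemma weight_ge0 n x : 0 <= w n x.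
Proof. exact/ltW/weight_gt0. Qed.

Lemma weight_add n x y : w n (x + y) <= w n x * w n y.
Proof.
rewrite -exprMn lerXn2r ?nnegrE ?addr_ge0 ?mulr_ge0 ?addr_ge0//=.
have := ler_normD x.1 y.1; have := ler_normD x.2 y.2.
set a := `|x.1 + y.1|; set b := `|x.2 + y.2|.
have := normr_ge0 x.1; have := normr_ge0 x.2; have := normr_ge0 y.1; have := normr_ge0 y.2.
set c := `|x.1|; set d := `|x.2|; set e := `|y.1|; set f := `|y.2|.
move=> *; nra.
Qed.

Lemma weight_opp n x : w n (- x) = w n x.
Proof. by rewrite /schwartz_weight/= !normrN. Qed.

Lemma weight_le n m x : (n <= m)%N -> w n x <= w m x.
Proof. by move=> nm; rewrite ler_weXn2l// -addrA lerDl addr_ge0. Qed.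

Lemma weight_exp n m x : w n x * w m x = w (n + m)%N x.
Proof. by rewrite -exprD. Qed.

Lemma norm1_le_weight n x : `|x.1| + `|x.2| <= w n.+1 x.
Proof.
apply: le_trans (weight_le x (isT : (1 <= n.+1)%N)).
by rewrite /schwartz_weight expr1 -addrA lerDr.
Qed.

Lemma continuous_weight n : continuous (w n).
Proof.
move=> x; apply: (@continuous_comp _ _ _ (fun x : R * R => 1 + `|x.1| + `|x.2|) (fun u : R => u ^+ n)).
  apply: cvgD; first apply: cvgD; first exact: cvg_cst.
    by apply: cvg_norm; exact: continuous_fst2.
  by apply: cvg_norm; exact: continuous_snd2.
exact: exprn_continuous.
Qed.

(** Two powers of [1 + |x_1| + |x_2|] dominate each factor [1 + x_i^2], so four extra powers of the
    weight buy integrability. *)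
Lemma weight4_jap x : 1 <= w 4 x * jap x.
Proof.
rewrite /jap /schwartz_weight -invfM ler_pdivlMr; last first.
  by rewrite mulr_gt0// (lt_le_trans ltr01 (oneDsqr_ge1 _)).
rewrite mul1r /oneDsqr -(real_normK (num_real x.1)) -(real_normK (num_real x.2)).
have := normr_ge0 x.1; have := normr_ge0 x.2.
set a := `|_|; set b := `|_| => a0 b0.
have -> : (1 + b + a) ^+ 4 = ((1 + b + a) ^+ 2) * ((1 + b + a) ^+ 2) by rewrite -exprD.
by apply: ler_pM; rewrite ?addr_ge0 ?sqr_ge0//; nra.
Qed.

(** Decay without smoothness: unlike the Schwartz functions, this class is stable under
    multiplication by indicators of cells, on which [exchange] rests. *)
Definition rapid (f : R * R -> R) : Prop :=
  meas2 f /\ forall n, exists C : R, forall x, w n x * `|f x| <= C.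

Lemma rapid_weight_L1 n f : rapid f -> L1 (fun x => w n x * `|f x|).
Proof.
move=> [mf fr]; have [C hC] := fr (n + 4)%N.
apply: (@L1_le _ _ (fun x => C * jap x)).
- apply: meas2M; first by apply: continuous_meas2; exact: continuous_weight.
  exact: measurableT_comp.
- exact/L1Z/L1_jap.
- move=> x; rewrite ger0_norm ?mulr_ge0 ?weight_ge0//.
  apply: le_trans (ler_wpM2r (jap_ge0 x) (hC x)).
  rewrite -weight_exp (_ : _ * _ * _ * _ = (w n x * `|f x|) * (w 4 x * jap x)); last by ring.
  by rewrite ler_peMr ?weight4_jap// mulr_ge0 ?weight_ge0.
Qed.

Lemma rapid_L1 f : rapid f -> L1 f.
Proof.
move=> fr; apply: (L1_le _ (rapid_weight_L1 0 fr)); first by case: fr.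
by move=> x; rewrite /schwartz_weight expr0 mul1r.
Qed.

Lemma rapid_bounded f : rapid f -> exists C, forall x, `|f x| <= C.
Proof.
move=> [_ /(_ 0)[C hC]]; exists C => x.
by have := hC x; rewrite /schwartz_weight expr0 mul1r.
Qed.

Lemma rapid_mul f g c : rapid f -> meas2 g -> (forall x, `|g x| <= c) ->
  rapid (fun x => g x * f x).
Proof.
move=> [mf fr] mg gc; split; first exact: meas2M.
move=> n; have [C hC] := fr n; exists (c * C) => x.
rewrite normrM mulrCA ler_pM//; first by rewrite mulr_ge0 ?weight_ge0.
Qed.

End Rapid.

(** * Injectivity of the Fourier transform *)

Section FourierInjectivity.
Context (R : realType).
Local Notation mR := (measurableTypeR R).
Local Notation leb := (@lebesgue_measure R).

Definition dot (k x : R * R) : R := k.1 * x.1 + k.2 * x.2.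

Lemma dotDl k l x : dot (k + l) x = dot k x + dot l x.
Proof. by rewrite /dot/=; ring. Qed.

Lemma dotBl k l x : dot (k - l) x = dot k x - dot l x.
Proof. by rewrite /dot/=; ring. Qed.

Lemma continuous_dot k : continuous (dot k).
Proof.
move=> x; apply: cvgD; apply: cvgM; try exact: cvg_cst.
  exact: continuous_fst2.
exact: continuous_snd2.
Qed.

Lemma meas2_cos k : meas2 (fun x => cos (dot k x)).
Proof.
apply: continuous_meas2 => x; apply: (@continuous_comp _ _ _ (dot k) cos).
  exact: continuous_dot.
exact: continuous_cos.
Qed.

Lemma meas2_sin k : meas2 (fun x => sin (dot k x)).
Proof.
apply: continuous_meas2 => x; apply: (@continuous_comp _ _ _ (dot k) sin).
  exact: continuous_dot.
exact: continuous_sin.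
Qed.

Lemma cvg_seq_le (u : nat -> R) l c : u n @[n --> \oo] --> l ->
  (forall n, u n <= c) -> l <= c.
Proof.
move=> ul uc; rewrite -(cvg_lim _ ul)//; apply: limr_le.
  exact: cvgP ul.
by apply: nearW.
Qed.

Section Annihilated.
Variable f : R * R -> R.
Hypothesis fi : L1 f.

(* [killed f h]: the product [f h] has a vanishing Fourier transform.  For [f]
   with vanishing transform the class of such [h] is stable under multiplication
   by cosines and bounded limits; it contains the functions [exp (- t sin (l . x)^2)],
   hence in the limit the Gaussians, which concentrate at the origin. *)
Record killed (h : R * R -> R) : Prop := Killed {
  killed_meas : meas2 h;
  killed_bnd : exists c, forall x, `|h x| <= c;
  killed_cos : forall k, int2 (fun x => f x * (h x * cos (dot k x))) = 0;
  killed_sin : forall k, int2 (fun x => f x * (h x * sin (dot k x))) = 0 }.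

Let fh_L1 h t c : meas2 h -> (forall x, `|h x| <= c) -> meas2 t ->
  (forall x, `|t x| <= 1) -> L1 (fun x => f x * (h x * t x)).
Proof.
move=> mh hc mt t1; apply: (L1_bounded_mul (c := c) fi).
  exact: meas2M.
by move=> x; rewrite normrM -[leRHS]mulr1 ler_pM.
Qed.

Lemma killedD a b h1 h2 : killed h1 -> killed h2 ->
  killed (fun x => a * h1 x + b * h2 x).
Proof.
move=> [m1 [c1 b1] k1 s1] [m2 [c2 b2] k2 s2]; split.
- by apply: measurable_funD; apply: measurable_funM.
- exists (`|a| * c1 + `|b| * c2) => x; rewrite (le_trans (ler_normD _ _))//.
  by rewrite !normrM lerD// ler_wpM2l.
- move=> k; have i1 := fh_L1 m1 b1 (meas2_cos k) (fun x => cos_max _).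
  have i2 := fh_L1 m2 b2 (meas2_cos k) (fun x => cos_max _).
  rewrite (_ : (fun x => _) = (fun x => a * (f x * (h1 x * cos (dot k x)))
    + b * (f x * (h2 x * cos (dot k x))))); last by apply/funext => x; ring.
  by rewrite int2D ?int2Z ?k1 ?k2 ?mulr0 ?addr0//; apply: L1Z.
- move=> k; have i1 := fh_L1 m1 b1 (meas2_sin k) (fun x => sin_max _).
  have i2 := fh_L1 m2 b2 (meas2_sin k) (fun x => sin_max _).
  rewrite (_ : (fun x => _) = (fun x => a * (f x * (h1 x * sin (dot k x)))
    + b * (f x * (h2 x * sin (dot k x))))); last by apply/funext => x; ring.
  by rewrite int2D ?int2Z ?s1 ?s2 ?mulr0 ?addr0//; apply: L1Z.
Qed.

(** By the product-to-sum formulas, multiplying by [cos (l . x)] replaces the frequency [k] by the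
    average of [k + l] and [k - l]. *)
Lemma killed_mul_cos l h : killed h -> killed (fun x => cos (dot l x) * h x).
Proof.
move=> [m1 [c1 b1] k1 s1]; split.
- by apply: meas2M => //; exact: meas2_cos.
- exists c1 => x; rewrite normrM -[leRHS]mul1r ler_pM// cos_max//.
- move=> k; have i1 l := fh_L1 m1 b1 (meas2_cos l) (fun x => cos_max _).
  rewrite (_ : (fun x => _) = (fun x => 2^-1 * (f x * (h x * cos (dot (k + l) x)))
    + 2^-1 * (f x * (h x * cos (dot (k - l) x))))); last first.
    by apply/funext => x; rewrite dotDl dotBl cosD cosB; field.
  by rewrite int2D ?int2Z ?k1 ?mulr0 ?addr0//; apply: L1Z.
- move=> k; have i1 l := fh_L1 m1 b1 (meas2_sin l) (fun x => sin_max _).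
  rewrite (_ : (fun x => _) = (fun x => 2^-1 * (f x * (h x * sin (dot (k + l) x)))
    + 2^-1 * (f x * (h x * sin (dot (k - l) x))))); last first.
    by apply/funext => x; rewrite dotDl dotBl sinD sinB; field.
  by rewrite int2D ?int2Z ?s1 ?mulr0 ?addr0//; apply: L1Z.
Qed.

Lemma killed_lim (h_ : nat -> R * R -> R) h c :
  (forall n, killed (h_ n)) -> (forall n x, `|h_ n x| <= c) ->
  (forall x, h_ n x @[n --> \oo] --> h x) -> killed h.
Proof.
move=> kh hc hl.
have mh : meas2 h.
  by apply: (measurable_fun_cvg (fun n => killed_meas (kh n))) => x _; exact: hl.
have lim0 t : meas2 t -> (forall x, `|t x| <= 1) ->
    (forall n, int2 (fun x => f x * (h_ n x * t x)) = 0) ->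
    int2 (fun x => f x * (h x * t x)) = 0.
  move=> mt t1 k0.
  have [||||_] := @int2_dct _ (fun n x => f x * (h_ n x * t x))
    (fun x => f x * (h x * t x)) (fun x => c * `|f x|).
  - by move=> n; apply: meas2M; [exact: L1_meas|apply: meas2M => //; case: (kh n)].
  - exact/L1Z/L1_norm.
  - move=> n x; rewrite normrM mulrC ler_wpM2r// normrM -[leRHS]mulr1 ler_pM//.
  - move=> x; apply: cvgM; first exact: cvg_cst.
    by apply: cvgM; [exact: hl|exact: cvg_cst].
  rewrite (_ : (fun n => _) = (fun=> 0)); last by apply/funext => n; rewrite k0.
  by move=> h0; apply/esym/(cvg_unique _ _ h0) => //; exact: cvg_cst.
split => //.
- exists c => x.
  rewrite ler_norml; apply/andP; split; last first.
    by apply: (cvg_seq_le (hl x)) => n; rewrite (le_trans (ler_norm _)).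
  rewrite lerNl; apply: (@cvg_seq_le (fun n => - h_ n x)); first exact: cvgN.
  by move=> n; rewrite (le_trans (ler_norm _))// normrN.
- by move=> k; apply: lim0 => [|x|n]; [exact: meas2_cos|exact: cos_max|case: (kh n)].
- by move=> k; apply: lim0 => [|x|n]; [exact: meas2_sin|exact: sin_max|case: (kh n)].
Qed.

(** The squared sine of half the angle, written with a cosine because [killed] is stable under
    cosines. *)
Definition halfcos l (x : R * R) : R := (1 - cos (dot l x)) / 2.

Lemma halfcos_bnd l x : 0 <= halfcos l x <= 1.
Proof.
have := cos_max (dot l x); rewrite /halfcos ler_norml => /andP[h1 h2].
by apply/andP; split; lra.
Qed.

(** The partial sums of the exponential series are polynomials in a cosine, and [exp t] bounds them
    all because [halfcos] lies between 0 and 1. *)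
Lemma killed_mul_exp l t h : 0 <= t -> killed h ->
  killed (fun x => expR (- t * halfcos l x) * h x).
Proof.
move=> t0 kh; have [mh [c hc] _ _] := kh.
have c0 : 0 <= c by rewrite (le_trans _ (hc 0)).
have kpow n : killed (fun x => exp_coeff (- t * halfcos l x) n * h x).
  elim: n => [|n IH].
    have := killedD 1 0 kh kh; congr killed; apply/funext => x.
    by rewrite /exp_coeff/= expr0 fact0 divr1 mul0r addr0.
  have := killedD (- t / 2 / n.+1%:R) (t / 2 / n.+1%:R) IH (killed_mul_cos l IH).
  congr killed; apply/funext => x; rewrite /exp_coeff/= exprS factS natrM /halfcos.
  have n0 : n.+1%:R != 0 :> R by rewrite pnatr_eq0.
  have f0 : n`!%:R != 0 :> R by rewrite pnatr_eq0 -lt0n fact_gt0.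
  move: n0 f0; move: (n.+1%:R : R) (n`!%:R : R) => a b a0 b0.
  by field; rewrite a0 b0.
apply: (@killed_lim (fun n x => series (exp_coeff (- t * halfcos l x)) n * h x)
   _ (expR t * c)).
- elim=> [|n IH].
    have := killedD 0 0 kh kh; congr killed; apply/funext => x.
    by rewrite /series/= big_geq// !mul0r addr0.
  have := killedD 1 1 IH (kpow n); congr killed; apply/funext => x.
  by rewrite /series/= big_nat_recr//= !mul1r mulrDl.
- move=> n x; rewrite normrM ler_pM//.
  apply: le_trans (_ : series (exp_coeff t) n <= _).
    rewrite (le_trans (ler_norm_sum _ _ _))// ler_sum// => i _.
    rewrite /exp_coeff/= normrM normrX normfV (ger0_norm (ler0n _ _)).
    rewrite ler_wpM2r ?invr_ge0// lerXn2r ?nnegrE//.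
    have /andP[q0 q1] := halfcos_bnd l x.
    by rewrite mulNr normrN normrM (ger0_norm t0) (ger0_norm q0) ler_piMr.
  apply: (nondecreasing_cvgn_le _ (is_cvg_series_exp_coeff t)).
  by apply: nondecreasing_series => k _ _; exact: exp_coeff_ge0.
- move=> x; apply: cvgM; last exact: cvg_cst.
  exact: is_cvg_series_exp_coeff.
Qed.

End Annihilated.

Definition gauss2 (s : R) (x : R * R) : R := expR (- s * (x.1 ^+ 2 + x.2 ^+ 2)).

(** The derivative of the sine at 0, taken along the null sequence [x / (n + 1)], which avoids 0
    unless [x = 0]. *)
Lemma cvg_mul_sin_div (x : R) : n.+1%:R * sin (x / n.+1%:R) @[n --> \oo] --> x.
Proof.
have [->|x0] := eqVneq x 0.
  rewrite (_ : (fun n => _) = (fun=> 0)); first exact: cvg_cst.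
  by apply/funext => n; rewrite mul0r sin0 mulr0.
pose u n : R := x / n.+1%:R.
have u0 : u n @[n --> \oo] --> 0.
  rewrite -[X in _ --> X](mulr0 x); apply: cvgM; first exact: cvg_cst.
  exact: cvg_harmonic.
have ud : u n @[n --> \oo] --> 0^'.
  move=> A /u0 [N _ h]; exists N => // n Nn; apply: (h n Nn).
  by apply: mulf_neq0 => //; rewrite invr_eq0 pnatr_eq0.
have [dsin sin'] := is_derive_sin (0 : R).
have h : h^-1 *: (sin (h *: 1 + 0) - sin 0) @[h --> 0^'] --> (1 : R).
  by move: dsin; rewrite /derivable -/(derive sin 0 1) sin' cos0.
have := cvg_comp _ _ ud h => {}h.
rewrite (_ : (fun n => _) = (fun n => x * ((u n)^-1 *: (sin (u n *: 1 + 0) - sin 0)))); last first.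
  apply/funext => n; rewrite addr0 sin0 subr0 /u /GRing.scale/= mulr1 mulrA.
  by rewrite invfM invrK mulrA divff// mul1r.
by rewrite -[X in _ --> X]mulr1; apply: cvgM; [exact: cvg_cst|exact: h].
Qed.

Lemma halfcosE l x : halfcos l x = sin (dot l x / 2) ^+ 2.
Proof.
rewrite /halfcos {1}(_ : dot l x = (dot l x / 2) *+ 2); last by field.
by rewrite cos_mulr2n cos2sin2; field.
Qed.

Lemma killed_gauss f s : L1 f -> killed f (fun=> 1) -> 0 <= s -> killed f (gauss2 s).
Proof.
move=> fi k1 s0.
have pn n : n.+1%:R != 0 :> R by rewrite pnatr_eq0.
(* With frequency [2 / (n + 1)] along an axis, [halfcos] is the square of [sin (x_i / (n + 1))]; the
   factor [s (n + 1)^2] makes the exponent tend to [- s x_i^2]. *)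
pose e n (l : R * R) x := expR (- (s * n.+1%:R ^+ 2) * halfcos l x).
pose l1 n : R * R := (2 / n.+1%:R, 0).
pose l2 n : R * R := (0, 2 / n.+1%:R).
have t0 n : 0 <= s * n.+1%:R ^+ 2 by rewrite mulr_ge0.
have e1 n l x : `|e n l x| <= 1.
  rewrite ger0_norm ?expR_ge0// -expR0 ler_expR mulNr oppr_le0 mulr_ge0//.
  by have /andP[] := halfcos_bnd l x.
apply: (@killed_lim _ fi (fun n x => e n (l1 n) x * (e n (l2 n) x * 1)) _ 1).
- by move=> n; do 2 apply: killed_mul_exp => //.
- by move=> n x; rewrite mulr1 normrM -[leRHS]mulr1 ler_pM.
- move=> x; rewrite /gauss2 mulrDr expRD.
  have lim i u : (forall n, dot (i n) x / 2 = u / n.+1%:R) ->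
      e n (i n) x @[n --> \oo] --> expR (- s * u ^+ 2).
    move=> iu; apply: (cvg_comp (fun n => - (s * n.+1%:R ^+ 2) * halfcos (i n) x) expR); last exact: continuous_expR.
    rewrite (_ : (fun n => _) = (fun n => - s * (n.+1%:R * sin (u / n.+1%:R)) ^+ 2)); last first.
      by apply/funext => n; rewrite halfcosE iu; ring.
    apply: cvgM; first exact: cvg_cst.
    rewrite expr2; under eq_fun do rewrite expr2.
    by apply: cvgM; exact: cvg_mul_sin_div.
  apply: cvgM; first by apply: lim => n; rewrite /dot/= mul0r addr0; move: (n.+1%:R : R) (pn n) => a a0; field.
  rewrite -[X in _ --> X]mulr1; apply: cvgM; last exact: cvg_cst.
  by apply: lim => n; rewrite /dot/= mul0r add0r; move: (n.+1%:R : R) (pn n) => a a0; field.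
Qed.

Lemma continuous_gauss2 s : continuous (gauss2 s).
Proof.
move=> x; apply: (@continuous_comp _ _ _ (fun x : R * R => - s * (x.1 ^+ 2 + x.2 ^+ 2)) expR);
  last exact: continuous_expR.
apply: cvgM; first exact: cvg_cst.
by apply: cvgD; rewrite expr2; under eq_fun do rewrite expr2; apply: cvgM;
  try exact: continuous_fst2; exact: continuous_snd2.
Qed.

Lemma gauss2_le_jap x : gauss2 1 x <= jap x.
Proof.
rewrite /gauss2 /jap mulN1r opprD expRD !expRN ler_pM ?invr_ge0 ?expR_ge0//.
- by rewrite lef_pV2 ?posrE ?expR_gt0 ?expR_ge1Dx// (lt_le_trans ltr01 (oneDsqr_ge1 _)).
- by rewrite lef_pV2 ?posrE ?expR_gt0 ?expR_ge1Dx// (lt_le_trans ltr01 (oneDsqr_ge1 _)).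
Qed.

Lemma L1_gauss2 : L1 (gauss2 1).
Proof.
apply: (L1_le _ (@L1_jap R)); first by apply: continuous_meas2; exact: continuous_gauss2.
by move=> x; rewrite ger0_norm ?expR_ge0// gauss2_le_jap.
Qed.

(** The Gaussian is at least [exp (-2)] on the unit square. *)
Lemma int2_gauss2_gt0 : 0 < int2 (gauss2 1).
Proof.
pose B : set (R * R) := `[0, 1] `*` `[0, 1].
have mB : measurable (B : set (mR * mR)) by apply: measurableX.
have mi : meas2 (\1_B : R * R -> R) by exact: measurable_indic.
have lB : @leb2 R B = 1%E.
  rewrite /B leb2X//; rewrite !lebesgue_measure_itv/= lte_fin ltr01.
  by rewrite oppr0 adde0 mule1.
have iB : int2 (\1_B : R * R -> R) = 1.
  by rewrite /int2 /Rintegral integral_indic// setIT lB.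
have Bi : L1 (\1_B : R * R -> R).
  apply/integrableP; split; first exact/measurable_EFinP.
  have -> : (\int[@leb2 R]_x `|(EFin \o (\1_B : R * R -> R)) x| =
      \int[@leb2 R]_x ((\1_B : R * R -> R) x)%:E)%E.
    by apply: eq_integral => x _ /=; rewrite ger0_norm.
  by rewrite integral_indic// setIT lB ltry.
apply: (@lt_le_trans _ _ (int2 (fun x => expR (-2) * (\1_B x : R)))).
  by rewrite int2Z// iB mulr1 expR_gt0.
apply: int2_le; [exact: L1Z|exact: L1_gauss2|move=> x].
rewrite indicE; have [|_] := boolP (x \in B); last by rewrite mulr0 expR_ge0.
rewrite inE /B /= !in_itv/= => -[/andP[a b] /andP[c d]].
by rewrite mulr1 ler_expR mulN1r lerN2 -[leRHS]/(1 + 1) lerD// expr_le1.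
Qed.

(** The integral of [f] against the Gaussian of parameter [(n + 1)^2] vanishes; rescaled, it is the
    integral of [f (x / (n + 1))] against a fixed Gaussian, which tends to [f 0] times a positive
    number. *)
Lemma fourier_inj_at0 (f : R * R -> R) C : continuous f ->
  L1 f -> (forall x, `|f x| <= C) ->
  (forall k, int2 (fun x => f x * cos (dot k x)) = 0) ->
  (forall k, int2 (fun x => f x * sin (dot k x)) = 0) -> f 0 = 0.
Proof.
move=> cf fi fC fc fs.
have mf : meas2 f by exact: continuous_meas2.
have k1 : killed f (fun=> 1).
  split; first exact: measurable_cst.
  - by exists 1 => x; rewrite normr1.
  - by move=> k; under [X in int2 X]eq_fun do rewrite mul1r.
  - by move=> k; under [X in int2 X]eq_fun do rewrite mul1r.
have pn n : n.+1%:R != 0 :> R by rewrite pnatr_eq0.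
have kg s : 0 <= s -> int2 (fun x => f x * gauss2 s x) = 0.
  move=> s0; have [_ _ /(_ 0) + _] := killed_gauss fi k1 s0.
  by congr (_ = _); congr int2; apply/funext => x; rewrite /dot !mul0r addr0 cos0 mulr1.
pose h n x := f (affine2 (n.+1%:R^-1, n.+1%:R^-1) 0 x) * gauss2 1 x.
have fg_L1 s : 0 <= s -> L1 (fun x => f x * gauss2 s x).
  move=> s0; apply: (@L1_bounded_mul _ _ _ 1) => //.
    by apply: continuous_meas2; exact: continuous_gauss2.
  by move=> x; rewrite ger0_norm ?expR_ge0// -expR0 ler_expR mulNr oppr_le0 mulr_ge0// addr_ge0 ?sqr_ge0.
have h0 n : int2 (h n) = 0.
  have n0 : n.+1%:R^-1 != 0 :> R by rewrite invr_eq0 pnatr_eq0.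
  have := @int2_affine _ (n.+1%:R^-1, n.+1%:R^-1) 0 _ n0 n0 (fg_L1 (n.+1%:R ^+ 2) (sqr_ge0 _)).
  rewrite kg ?sqr_ge0// => /eqP; rewrite mulf_eq0 mulf_eq0 !normr_eq0 (negbTE n0)/= => /eqP <-.
  congr int2; apply/funext => x; rewrite /h /gauss2; congr (_ * expR _).
  by rewrite /affine2 /affine1/= !addr0; move: (n.+1%:R : R) (pn n) => a a0; field.
have [||||_] := @int2_dct _ h (fun x => f 0 * gauss2 1 x) (fun x => C * gauss2 1 x).
- move=> n; apply: meas2M; first exact: meas2_affine.
  by apply: continuous_meas2; exact: continuous_gauss2.
- exact/L1Z/L1_gauss2.
- move=> n x; rewrite /h normrM (ger0_norm (expR_ge0 _)) ler_wpM2r ?expR_ge0//.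
- move=> x; apply: cvgM; last exact: cvg_cst.
  apply: (cvg_comp (fun n => affine2 (n.+1%:R^-1, n.+1%:R^-1) 0 x) f); last exact: cf.
  have c0 u : n.+1%:R^-1 * u + 0 @[n --> \oo] --> (0 : R).
    rewrite -[X in _ --> X]addr0 -[X in X + _](mul0r u).
    by apply: cvgD; [apply: cvgM; [exact: cvg_harmonic|exact: cvg_cst]|exact: cvg_cst].
  exact: (cvg_pair (c0 x.1) (c0 x.2)).
rewrite (_ : (fun n => _) = (fun=> 0)); last by apply/funext => n; rewrite h0.
move=> hl; have : int2 (fun x => f 0 * gauss2 1 x) = 0.
  by apply: (cvg_unique _ hl) => //; exact: cvg_cst.
rewrite int2Z => [/eqP|]; last exact: L1_gauss2.
by rewrite mulf_eq0 (gt_eqF int2_gauss2_gt0) orbF => /eqP.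
Qed.

(** A translate of [f] again has vanishing transform, by the addition formulas, so the value at 0
    suffices. *)
Lemma fourier_inj (f : R * R -> R) C : continuous f ->
  L1 f -> (forall x, `|f x| <= C) ->
  (forall k, int2 (fun x => f x * cos (dot k x)) = 0) ->
  (forall k, int2 (fun x => f x * sin (dot k x)) = 0) -> forall x, f x = 0.
Proof.
move=> cf fi fC fc fs a.
have fci k : L1 (fun x => f x * cos (dot k x)).
  by apply: (L1_bounded_mul (c := 1)) => // [|x]; [exact: meas2_cos|exact: cos_max].
have fsi k : L1 (fun x => f x * sin (dot k x)).
  by apply: (L1_bounded_mul (c := 1)) => // [|x]; [exact: meas2_sin|exact: sin_max].
rewrite -[a]add0r; apply: (@fourier_inj_at0 (fun x => f (x + a)) C).
- move=> x; apply: (cvg_comp (fun x : R * R => x + a) f); last exact: cf.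
  by apply: cvgD; [exact: cvg_id|exact: cvg_cst].
- exact: L1_shift.
- by move=> x; exact: fC.
- move=> k; rewrite (_ : (fun x => _) = (fun x => cos (dot k a) * (f (x + a) * cos (dot k (x + a)))
    + sin (dot k a) * (f (x + a) * sin (dot k (x + a))))); last first.
    apply/funext => x; have -> : dot k x = dot k (x + a) - dot k a by rewrite /dot/=; ring.
    by rewrite cosB; ring.
  rewrite int2D; [|exact/L1Z/(L1_shift a (fci k))|exact/L1Z/(L1_shift a (fsi k))].
  rewrite !int2Z; [|exact/(L1_shift a (fsi k))|exact/(L1_shift a (fci k))].
  by rewrite (int2_shift a (fci k)) (int2_shift a (fsi k)) fc fs !mulr0 addr0.
- move=> k; rewrite (_ : (fun x => _) = (fun x => cos (dot k a) * (f (x + a) * sin (dot k (x + a)))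
    - sin (dot k a) * (f (x + a) * cos (dot k (x + a))))); last first.
    apply/funext => x; have -> : dot k x = dot k (x + a) - dot k a by rewrite /dot/=; ring.
    by rewrite sinB; ring.
  rewrite int2B; [|exact/L1Z/(L1_shift a (fsi k))|exact/L1Z/(L1_shift a (fci k))].
  rewrite !int2Z; [|exact/(L1_shift a (fci k))|exact/(L1_shift a (fsi k))].
  by rewrite (int2_shift a (fci k)) (int2_shift a (fsi k)) fc fs !mulr0 subr0.
Qed.

End FourierInjectivity.

(** * Schwartz functions *)

Section Schwartz.
Context (R : realType).
Local Notation w := (@schwartz_weight R).
Implicit Types (f g phi chi : R * R -> R).

Definition norm1 (v : R * R) : R := `|v.1| + `|v.2|.

(** The bound in terms of which [tempered] is formulated; naming it lets the loss of derivatives be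
    tracked by the index [n] alone. *)
Definition sbound (n : nat) phi (M : R) : Prop :=
  forall s : seq bool, (size s <= n)%N -> forall x, w n x * `|pderiv s phi x| <= M.

Lemma pderiv_cat s t phi : pderiv (s ++ t) phi = pderiv s (pderiv t phi).
Proof. by rewrite /pderiv foldr_cat. Qed.

Lemma schwartz_pderiv s phi : schwartz phi -> schwartz (pderiv s phi).
Proof. by move=> sf t; rewrite -pderiv_cat; exact: sf. Qed.

Lemma schwartz_differentiable phi x : schwartz phi -> differentiable phi x.
Proof. by move=> /(_ [::])[]. Qed.

Lemma schwartz_continuous phi : schwartz phi -> continuous phi.
Proof. by move=> sf x; apply: differentiable_continuous; exact: schwartz_differentiable. Qed.

Lemma schwartz_rapid phi : schwartz phi -> rapid phi.
Proof.
move=> sf; split; first by apply: continuous_meas2; exact: schwartz_continuous.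
by have [] := sf [::].
Qed.

Lemma seqs_finite n : exists ss : seq (seq bool), forall s, (size s <= n)%N -> s \in ss.
Proof.
elim: n => [|n [ss IH]]; first by exists [:: [::]] => s; rewrite leqn0 size_eq0 inE.
exists ([::] :: [seq b :: t | b <- [:: true; false], t <- ss]) => -[//|b s] sn.
rewrite inE; apply/orP; right; apply/allpairsP; exists (b, s) => /=.
by split; [case: (b)|exact: IH|].
Qed.

Lemma schwartz_sbound n phi : schwartz phi -> exists M, 0 <= M /\ sbound n phi M.
Proof.
move=> sf; have [ss hss] := seqs_finite n.
suff [M [M0 h]] : exists M, 0 <= M /\ forall s, s \in ss -> forall x, w n x * `|pderiv s phi x| <= M.
  by exists M; split => // s sn; apply: h; exact: hss.
elim: ss {hss} => [|s ss [M [M0 IH]]]; first by exists 0.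
have [_ /(_ n)[C hC]] := sf s.
exists (M + `|C|); split; first by rewrite addr_ge0.
move=> t; rewrite inE => /orP[/eqP ->|/IH h] x.
  by rewrite (le_trans (hC x))// (le_trans (ler_norm _))// lerDr.
by rewrite (le_trans (h x))// lerDl.
Qed.

Lemma sbound_le n m phi M : (n <= m)%N -> sbound m phi M -> sbound n phi M.
Proof.
move=> nm h s sn x; apply: le_trans (h s (leq_trans sn nm) x).
by rewrite ler_wpM2r// weight_le.
Qed.

Lemma sbound_leM n phi M M' : M <= M' -> sbound n phi M -> sbound n phi M'.
Proof. by move=> MM h s sn x; exact: le_trans (h s sn x) MM. Qed.

Lemma sbound_ge0 n phi M : sbound n phi M -> 0 <= M.
Proof.
by move=> /(_ [::] (leq0n _) 0); apply: le_trans; rewrite mulr_ge0 ?weight_ge0.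
Qed.

Lemma sbound_pt phi M n x : sbound n phi M -> w n x * `|phi x| <= M.
Proof. by move=> /(_ [::] (leq0n _) x). Qed.

Lemma derive_comb (a : R) f g x v : differentiable f x -> differentiable g x ->
  'D_v (fun y => a * f y + g y) x = a * 'D_v f x + 'D_v g x.
Proof.
move=> df dg.
have df' := diff_derivable df (v := v); have dg' := diff_derivable dg (v := v).
rewrite -[LHS]/('D_v ((a \*: f) + g) x).
by rewrite (deriveD (@derivableZ _ _ _ f a x v df') dg') (@deriveZ _ _ _ f a x v df').
Qed.

Lemma differentiable_comb (a : R) f g x : differentiable f x -> differentiable g x ->
  differentiable (fun y => a * f y + g y) x.
Proof.
by move=> df dg; apply: (differentiableD (f := a \*: f) _ dg); exact: differentiableZ.
Qed.

Lemma pderiv_comb (a : R) f g s : schwartz f -> schwartz g ->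
  pderiv s (fun y => a * f y + g y) = (fun y => a * pderiv s f y + pderiv s g y).
Proof.
move=> sf sg; elim: s => [//|b s IH] /=.
apply/funext => x; rewrite -[LHS]/('D_(basis_dir R b) (pderiv s (fun y => a * f y + g y)) x).
by rewrite IH derive_comb//; [case: (sf s)|case: (sg s)].
Qed.

Lemma schwartz_comb (a : R) f g : schwartz f -> schwartz g ->
  schwartz (fun y => a * f y + g y).
Proof.
move=> sf sg s; rewrite pderiv_comb//.
have [df bf] := sf s; have [dg bg] := sg s; split.
  by move=> x; exact: differentiable_comb.
move=> n; have [C1 h1] := bf n; have [C2 h2] := bg n.
exists (`|a| * C1 + C2) => x.
apply: (@le_trans _ _ (`|a| * (w n x * `|pderiv s f x|) + w n x * `|pderiv s g x|)).
  rewrite mulrCA -mulrDr ler_wpM2l ?weight_ge0//.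
  by rewrite (le_trans (ler_normD _ _))// normrM.
by rewrite lerD// ler_wpM2l.
Qed.

Lemma schwartzB f g : schwartz f -> schwartz g -> schwartz (fun y => f y - g y).
Proof.
move=> sf sg; have := schwartz_comb (-1) sg sf; congr schwartz.
by apply/funext => y; rewrite mulN1r addrC.
Qed.

Lemma derive_shift2 f b x v : 'D_v (fun y => f (y + b)) x = 'D_v f (x + b).
Proof. by rewrite /derive /=; under eq_fun do rewrite -addrA. Qed.

Lemma derive_opp2 f x v : 'D_v (fun y => f (- y)) x = 'D_(- v) f (- x).
Proof. by rewrite /derive /=; under eq_fun do rewrite opprD -scalerN. Qed.

Lemma differentiable_shift2 f b x : differentiable f (x + b) ->
  differentiable (fun y => f (y + b)) x.
Proof. by move=> df; apply: (@differentiable_comp _ _ _ _ (fun y => y + b) f). Qed.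

Lemma differentiable_opp2 f x : differentiable f (- x) ->
  differentiable (fun y => f (- y)) x.
Proof. by move=> df; apply: (@differentiable_comp _ _ _ _ (fun y => - y) f). Qed.

Lemma pderiv_shift s f b : pderiv s (fun y => f (y + b)) = (fun y => pderiv s f (y + b)).
Proof.
elim: s => [//|c s IH]; apply/funext => x.
rewrite -[LHS]/('D_(basis_dir R c) (pderiv s (fun y => f (y + b))) x) IH.
exact: derive_shift2.
Qed.

Lemma schwartz_shift f b : schwartz f -> schwartz (fun y => f (y + b)).
Proof.
move=> sf s; rewrite pderiv_shift; have [df bf] := sf s; split.
  by move=> x; exact: differentiable_shift2.
move=> n; have [C h] := bf n; exists (C * w n b) => x.
apply: (@le_trans _ _ ((w n (x + b) * w n b) * `|pderiv s f (x + b)|)).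
  rewrite ler_wpM2r//; have := weight_add n (x + b) (- b).
  by rewrite addrK weight_opp.
by rewrite mulrAC ler_wpM2r ?weight_ge0.
Qed.

Lemma sbound_shift n f b M : sbound n f M -> sbound n (fun y => f (y + b)) (M * w n b).
Proof.
move=> h s sn x; rewrite pderiv_shift.
apply: (@le_trans _ _ ((w n (x + b) * w n b) * `|pderiv s f (x + b)|)).
  rewrite ler_wpM2r//; have := weight_add n (x + b) (- b).
  by rewrite addrK weight_opp.
by rewrite mulrAC ler_wpM2r ?weight_ge0//; exact: h.
Qed.

Lemma deriveN2 f x v : differentiable f x -> 'D_(- v) f x = - 'D_v f x.
Proof. by move=> df; rewrite !deriveE// linearN. Qed.

Lemma pderiv_opp s f : schwartz f ->
  pderiv s (fun y => f (- y)) = (fun y => (-1) ^+ size s * pderiv s f (- y)).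
Proof.
move=> sf; elim: s => [|c s IH]; first by apply/funext => x; rewrite mul1r.
apply/funext => x.
rewrite -[LHS]/('D_(basis_dir R c) (pderiv s (fun y => f (- y))) x) IH.
have df : differentiable (pderiv s f) (- x) by case: (sf s).
have dg := differentiable_opp2 df.
have := @derive_comb ((-1) ^+ size s) (fun y => pderiv s f (- y)) (fun=> 0) x (basis_dir R c) dg (differentiable_cst _ _).
under eq_fun do rewrite addr0.
move=> ->; rewrite derive_cst addr0 derive_opp2 deriveN2//.
by rewrite exprS mulN1r mulrN mulNr.
Qed.

Lemma schwartz_opp f : schwartz f -> schwartz (fun y => f (- y)).
Proof.
move=> sf s; rewrite pderiv_opp//; have [df bf] := sf s; split.
  move=> x; have := @differentiable_comb ((-1) ^+ size s) (fun y => pderiv s f (- y)) (fun=> 0) x (differentiable_opp2 (df _)) (differentiable_cst _ _).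
  by under eq_fun do rewrite addr0.
move=> n; have [C h] := bf n; exists C => x.
by rewrite normrM normrX normrN1 expr1n mul1r -(weight_opp _ x).
Qed.

Lemma schwartz_reflect f b : schwartz f -> schwartz (fun y => f (b - y)).
Proof.
move=> sf; have := schwartz_shift (- b) (schwartz_opp sf); congr schwartz.
by apply/funext => y; rewrite opprD opprK addrC.
Qed.

Lemma derive_split f x v : differentiable f x ->
  'D_v f x = v.1 * 'D_(basis_dir R false) f x + v.2 * 'D_(basis_dir R true) f x.
Proof.
move=> df; rewrite !deriveE//.
rewrite {1}(_ : v = v.1 *: basis_dir R false + v.2 *: basis_dir R true); last first.
  by case: v => a b; rewrite /basis_dir/=; congr pair; rewrite /= /GRing.scale/= ?mulr0 ?mulr1 ?addr0 ?add0r.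
by rewrite linearD !linearZ.
Qed.

Lemma mvt2 f (x v : R * R) : (forall y, differentiable f y) ->
  exists2 t : R, 0 <= t <= 1 & f (x + v) - f x = 'D_v f (x + t *: v).
Proof.
move=> df; pose g (t : R) := f (x + t *: v).
have dg (t : R) : is_derive t (1 : R) g ('D_v f (x + t *: v)).
  have e : (fun h : R => h^-1 *: ((g \o shift t) (h *: (1 : R)) - g t)) =
      (fun h => h^-1 *: ((f \o shift (x + t *: v)) (h *: v) - f (x + t *: v))).
    apply/funext => h; rewrite /g /=; congr (_ *: (f _ - _)).
    by rewrite [h *: 1]mulr1 scalerDl addrCA.
  apply: DeriveDef.
    rewrite /derivable e; exact: (diff_derivable (df _)).
  by rewrite /derive e.
have [|c c01 e] := @MVT R g (fun t => 'D_v f (x + t *: v)) 0 1 ltr01 (fun t _ => dg t).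
  apply: continuous_subspaceT => t.
  by apply: differentiable_continuous; apply/derivable1_diffP; case: (dg t).
exists c; first by move: c01; rewrite in_itv/= => /andP[/ltW -> /ltW ->].
by move: e; rewrite /g scale1r scale0r addr0 subr0 mulr1.
Qed.

Lemma weight_scale n (t : R) v : 0 <= t <= 1 -> w n (t *: v) <= w n v.
Proof.
move=> /andP[t0 t1]; rewrite /schwartz_weight lerXn2r ?nnegrE ?addr_ge0//.
rewrite !normrM (ger0_norm t0) lerD ?lerD//; by rewrite ler_piMl.
Qed.

Lemma derive_weight_le n s phi M x v : schwartz phi -> sbound n.+1 phi M ->
  (size s <= n)%N -> w n x * `|'D_v (pderiv s phi) x| <= norm1 v * M.
Proof.
move=> sf h sn; have df : differentiable (pderiv s phi) x by case: (sf s).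
rewrite derive_split//.
have h1 b : w n x * `|'D_(basis_dir R b) (pderiv s phi) x| <= M.
  apply: le_trans (h (b :: s) sn x); rewrite ler_wpM2r// weight_le//.
apply: (@le_trans _ _ (`|v.1| * (w n x * `|'D_(basis_dir R false) (pderiv s phi) x|)
   + `|v.2| * (w n x * `|'D_(basis_dir R true) (pderiv s phi) x|))).
  rewrite [leRHS](_ : _ = w n x * (`|v.1| * `|'D_(basis_dir R false) (pderiv s phi) x| + `|v.2| * `|'D_(basis_dir R true) (pderiv s phi) x|)); last by ring.
  rewrite ler_wpM2l ?weight_ge0//.
  by rewrite -!normrM ler_normD.
by rewrite /norm1 mulrDl lerD// ler_wpM2l.
Qed.

Lemma norm1_ge0 v : 0 <= norm1 v.
Proof. exact: addr_ge0. Qed.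

(** Mean value theorem for each derivative, at the price of one order of differentiation; the weight
    at [x] is compared with that at the intermediate point by submultiplicativity. *)
Lemma sbound_incr n phi M v : schwartz phi -> sbound n.+1 phi M ->
  sbound n (fun x => phi (x + v) - phi x) (norm1 v * w n v * M).
Proof.
move=> sf h s sn x.
rewrite (_ : (fun x => phi (x + v) - phi x) = (fun x => -1 * phi x + phi (x + v))); last first.
  by apply/funext => y; rewrite mulN1r addrC.
rewrite pderiv_comb//; last exact: schwartz_shift.
rewrite pderiv_shift mulN1r addrC.
have [|t t01 ->] := @mvt2 (pderiv s phi) x v; first by case: (sf s).
have := derive_weight_le (x + t *: v) v sf h sn.
move=> h'; have M0 := sbound_ge0 h.
apply: (@le_trans _ _ ((w n (x + t *: v) * w n v) * `|'D_v (pderiv s phi) (x + t *: v)|)).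
  rewrite ler_wpM2r//.
  rewrite -[X in w n X](addrK (t *: v) x) (le_trans (weight_add _ _ _))//.
  by rewrite weight_opp ler_wpM2l ?weight_ge0// weight_scale.
by rewrite mulrAC [leRHS]mulrAC ler_wpM2r ?weight_ge0.
Qed.

(** The mean value theorem is applied twice, to [phi] along [h] and then to its two partial
    derivatives. *)
Lemma taylor2 phi M x h : schwartz phi -> sbound 2 phi M ->
  `|phi (x + h) - phi x - 'D_h phi x| <= norm1 h * norm1 h * M.
Proof.
move=> sf hM.
have [|t t01 ->] := @mvt2 phi x h; first by move=> y; exact: schwartz_differentiable.
have d1 y := schwartz_differentiable y sf.
rewrite (derive_split h (d1 (x + t *: h))) (derive_split h (d1 x)).
have hb b : `|'D_(basis_dir R b) phi (x + t *: h) - 'D_(basis_dir R b) phi x| <= norm1 h * M.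
  have sb := schwartz_pderiv [:: b] sf.
  have [|r r01 e] := @mvt2 (pderiv [:: b] phi) x (t *: h).
    by move=> y; exact: schwartz_differentiable.
  rewrite -[X in `|X| <= _]/(pderiv [:: b] phi (x + t *: h) - pderiv [:: b] phi x) e.
  have := @derive_weight_le 1 [:: b] phi M (x + r *: (t *: h)) (t *: h) sf hM isT.
  move=> k; have M0 := sbound_ge0 hM.
  apply: (@le_trans _ _ (norm1 (t *: h) * M)).
    by apply: le_trans k; rewrite ler_peMl// weight_ge1.
  rewrite ler_wpM2r// /norm1 !normrM; move: t01 => /andP[t0 t1].
  by rewrite (ger0_norm t0) lerD// ler_piMl.
rewrite opprD addrACA -!mulrBr (le_trans (ler_normD _ _))// !normrM.
by rewrite -[in leRHS]mulrA [X in _ <= X * _]/norm1 mulrDl lerD// ler_wpM2l.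
Qed.

End Schwartz.

(** * Convolution *)

Section LinearForm.
Context (R : realType).

(** Candidate differentials in coordinates, declared linear below so that uniqueness of the
    differential applies to them. *)
Definition lin2 (A B : R) (h : R * R) : R := A * h.1 + B * h.2.

Lemma lin2_linear A B : linear (lin2 A B).
Proof.
move=> a x y; rewrite /lin2.
have -> : (a *: x + y).1 = a * x.1 + y.1 by [].
have -> : (a *: x + y).2 = a * x.2 + y.2 by [].
transitivity (a * (A * x.1 + B * x.2) + (A * y.1 + B * y.2)); last by [].
by ring.
Qed.

HB.instance Definition _ A B :=
  GRing.isLinear.Build R (R * R)%type R *:%R (lin2 A B) (lin2_linear A B).

Lemma norm1_le_norm (h : R * R) : norm1 h <= 2 * `|h|.
Proof.
rewrite /norm1 mulr_natl mulr2n lerD//.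
  by rewrite prod_normE le_max lexx.
by rewrite prod_normE le_max lexx orbT.
Qed.

(** A quadratic remainder is negligible against the norm, so the differential is identified by
    uniqueness. Differentiation under the integral sign is reduced to this criterion. *)
Lemma differentiable_remainder (F : R * R -> R) (z : R * R) A B K :
  (forall h, `|F (z + h) - F z - lin2 A B h| <= norm1 h * norm1 h * K) ->
  differentiable F z /\ forall v, 'D_v F z = lin2 A B v.
Proof.
move=> hK.
have K0 : 0 <= K.
  have := le_trans (normr_ge0 _) (hK (1, 0)).
  by rewrite /norm1/= normr1 normr0 addr0 !mul1r.
have cL : continuous (lin2 A B).
  move=> x; apply: cvgD; apply: cvgM; try exact: cvg_cst.
    exact: continuous_fst2.
  exact: continuous_snd2.
have o : F \o shift z = cst (F z) + lin2 A B +o_ (0 : R * R) id.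
  apply/eqaddoP => e e0.
  have d0 : 0 < 4 * K + 1 by rewrite ltr_wpDl// mulr_ge0.
  have nr : \forall h \near (0 : R * R), `|h| < e / (4 * K + 1).
    by apply: nbhs0_lt; rewrite divr_gt0.
  apply: filterS nr => h h1.
  rewrite -[_ h]/(F (h + z) - (F z + lin2 A B h)) opprD addrA [h + z]addrC.
  apply: (le_trans (hK h)).
  have hh : 4 * K * `|h| <= e.
    move: h1; rewrite ltr_pdivlMr// => h1.
    by rewrite (le_trans _ (ltW h1))// mulrC ler_wpM2l// lerDl.
  have n1 := norm1_le_norm h; have n0 := norm1_ge0 h.
  rewrite /=; apply: (@le_trans _ _ ((2 * `|h|) * (2 * `|h|) * K)).
    by rewrite ler_wpM2r// ler_pM.
  rewrite (_ : _ * _ * K = (4 * K * `|h|) * `|h|); last by ring.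
  by rewrite ler_wpM2r.
have dE := diff_unique cL o.
have dF : differentiable F z by apply/diff_locallyP; rewrite dE.
by split => // v; rewrite deriveE// dE.
Qed.

End LinearForm.

Section Convolution.
Context (R : realType).
Local Notation w := (@schwartz_weight R).
Implicit Types (f g phi chi eta : R * R -> R).

Definition conv eta phi (z : R * R) : R := int2 (fun y => eta y * phi (z - y)).

Lemma meas2_reflect f b : meas2 f -> meas2 (fun x => f (b - x)).
Proof.
move=> mf; have := meas2_affine (-1, -1) b mf; congr meas2.
apply/funext => x; congr f.
by case: x b => ? ? [? ?]; rewrite /affine2 /affine1/= !mulN1r; congr pair; rewrite addrC.
Qed.

Lemma conv_L1 eta phi c z : L1 eta -> meas2 phi -> (forall x, `|phi x| <= c) ->
  L1 (fun y => eta y * phi (z - y)).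
Proof.
by move=> ei mp pc; apply: (L1_bounded_mul (c := c)) => //; exact: meas2_reflect.
Qed.

Lemma schwartz_bounded phi : schwartz phi -> exists c, forall x, `|phi x| <= c.
Proof. by move=> /schwartz_rapid/rapid_bounded. Qed.

Lemma schwartz_conv_L1 eta phi z : L1 eta -> schwartz phi ->
  L1 (fun y => eta y * phi (z - y)).
Proof.
move=> ei sp; have [c hc] := schwartz_bounded sp.
by apply: conv_L1 hc => //; exact: (schwartz_rapid sp).1.
Qed.

Lemma convC eta phi z : L1 eta -> schwartz phi ->
  conv eta phi z = int2 (fun y => phi y * eta (z - y)).
Proof.
move=> ei sp; rewrite /conv -(int2_reflect z (schwartz_conv_L1 z ei sp)).
by congr int2; apply/funext => y; rewrite subKr mulrC.
Qed.

(** The remainder in [taylor2] at [z - y], integrated against [|eta|], is still quadratic;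
    integrability of [eta] is enough for that. *)
Lemma conv_diff eta phi z : L1 eta -> schwartz phi ->
  differentiable (conv eta phi) z /\
  forall v, 'D_v (conv eta phi) z = conv eta ('D_v phi) z.
Proof.
move=> ei sp; have [M [M0 hM]] := schwartz_sbound 2 sp.
have s1 := schwartz_pderiv [:: false] sp; have s2 := schwartz_pderiv [:: true] sp.
pose D1 := pderiv [:: false] phi; pose D2 := pderiv [:: true] phi.
have dE v x : 'D_v phi x = v.1 * D1 x + v.2 * D2 x.
  by rewrite derive_split//; exact: schwartz_differentiable.
have convE v : conv eta ('D_v phi) z = lin2 (conv eta D1 z) (conv eta D2 z) v.
  pose i1 := schwartz_conv_L1 z ei s1; pose i2 := schwartz_conv_L1 z ei s2.
  transitivity (v.1 * conv eta D1 z + v.2 * conv eta D2 z); last by rewrite /lin2 (mulrC v.1) (mulrC v.2).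
  rewrite /conv -(int2Z v.1 i1) -(int2Z v.2 i2) -(int2D (L1Z v.1 i1) (L1Z v.2 i2)).
  by congr int2; apply/funext => y; rewrite dE mulrDr; congr (_ + _); rewrite mulrCA.
suff [dF DF] : differentiable (conv eta phi) z /\
    forall v, 'D_v (conv eta phi) z = lin2 (conv eta D1 z) (conv eta D2 z) v.
  by split => // v; rewrite DF convE.
apply: (@differentiable_remainder _ _ _ _ _ (int2 (fun y => `|eta y|) * M)) => h.
rewrite -convE /conv.
have L1D : L1 (fun y => eta y * 'D_h phi (z - y)).
  have := L1D (L1Z h.1 (schwartz_conv_L1 z ei s1)) (L1Z h.2 (schwartz_conv_L1 z ei s2)).
  by congr L1; apply/funext => y; rewrite dE mulrDr; congr (_ + _); rewrite mulrCA.
have L1a := schwartz_conv_L1 z ei sp; have L1b := schwartz_conv_L1 (z + h) ei sp.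
have L1c := L1B (L1B L1b L1a) L1D.
rewrite -(int2B L1b L1a) -(int2B (L1B L1b L1a) L1D).
rewrite [leRHS](_ : _ = int2 (fun y => (norm1 h * norm1 h * M) * `|eta y|)); last first.
  rewrite (int2Z _ (L1_norm ei)); move: (int2 _) => I; ring.
apply: int2_norm_le => //; first exact/L1Z/L1_norm.
move=> y; rewrite -!mulrBr normrM mulrC ler_wpM2r//.
rewrite (_ : z + h - y = (z - y) + h); last by rewrite addrAC.
exact: taylor2.
Qed.

Lemma pderiv_conv s eta phi : L1 eta -> schwartz phi ->
  pderiv s (conv eta phi) = conv eta (pderiv s phi).
Proof.
move=> ei sp; elim: s => [//|c s IH]; apply/funext => x.
rewrite -[LHS]/('D_(basis_dir R c) (pderiv s (conv eta phi)) x) IH.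
by have [_ ->] := conv_diff x ei (schwartz_pderiv s sp).
Qed.

Lemma conv_weight n eta phi z M : rapid eta -> schwartz phi ->
  (forall x, w n x * `|phi x| <= M) ->
  w n z * `|conv eta phi z| <= M * int2 (fun y => w n y * `|eta y|).
Proof.
move=> er sp hM; have ei := rapid_L1 er.
have M0 : 0 <= M by rewrite (le_trans _ (hM 0))// mulr_ge0 ?weight_ge0.
rewrite -[X in X * `|_|](ger0_norm (weight_ge0 n z)) -normrM -int2Z; last exact: schwartz_conv_L1.
rewrite -int2Z; last exact: rapid_weight_L1.
apply: int2_norm_le.
- exact/L1Z/schwartz_conv_L1.
- exact/L1Z/rapid_weight_L1.
move=> y; rewrite !normrM (ger0_norm (weight_ge0 n z)).
apply: (@le_trans _ _ ((w n (z - y) * w n y) * (`|eta y| * `|phi (z - y)|))).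
  rewrite ler_wpM2r ?mulr_ge0//.
  by have := weight_add n (z - y) y; rewrite subrK.
rewrite [leLHS](_ : _ = (w n (z - y) * `|phi (z - y)|) * (w n y * `|eta y|)); last by ring.
by rewrite ler_wpM2r// mulr_ge0 ?weight_ge0.
Qed.

Lemma schwartz_conv eta phi : rapid eta -> schwartz phi -> schwartz (conv eta phi).
Proof.
move=> er sp s; have ei := rapid_L1 er; rewrite pderiv_conv//; split.
  by move=> x; have [] := conv_diff x ei (schwartz_pderiv s sp).
move=> n; have [_ /(_ n)[C hC]] := sp s.
exists (C * int2 (fun y => w n y * `|eta y|)) => x.
by apply: conv_weight => //; exact: schwartz_pderiv.
Qed.

Lemma sbound_conv n eta phi M : rapid eta -> schwartz phi -> sbound n phi M ->
  sbound n (conv eta phi) (M * int2 (fun y => w n y * `|eta y|)).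
Proof.
move=> er sp hM s sn x; rewrite pderiv_conv//; last exact: rapid_L1.
by apply: conv_weight => //; [exact: schwartz_pderiv|move=> y; exact: hM].
Qed.

End Convolution.

(** * The kernel family *)

Section Kernel.
Context (R : realType).
Local Notation w := (@schwartz_weight R).
Variable psi : R -> R * R -> R.
Hypothesis psiP : is_kernel_family psi.

Lemma psi_schwartz t : 0 < t -> schwartz (psi t).
Proof. by move=> /psiP[]. Qed.

Let symb (k : R * R) : R := k.1 ^+ 4 + k.2 ^+ 2.

Lemma psi_cos t k : 0 < t -> int2 (fun x => psi t x * cos (dot k x)) = expR (- (t * symb k)).
Proof. by move=> /psiP[_ /(_ k)[]]. Qed.

Lemma psi_sin t k : 0 < t -> int2 (fun x => psi t x * sin (dot k x)) = 0.
Proof. by move=> /psiP[_ /(_ k)[]]. Qed.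

Lemma psi_rapid t : 0 < t -> rapid (psi t).
Proof. by move=> /psi_schwartz/schwartz_rapid. Qed.

Lemma psi_L1 t : 0 < t -> L1 (psi t).
Proof. by move=> /psi_rapid/rapid_L1. Qed.

Lemma L1_mul_cos f k : L1 f -> L1 (fun x : R * R => f x * cos (dot k x)).
Proof.
by move=> fi; apply: (L1_bounded_mul (c := 1)) => // [|x]; [exact: meas2_cos|exact: cos_max].
Qed.

Lemma L1_mul_sin f k : L1 f -> L1 (fun x : R * R => f x * sin (dot k x)).
Proof.
by move=> fi; apply: (L1_bounded_mul (c := 1)) => // [|x]; [exact: meas2_sin|exact: sin_max].
Qed.

Lemma dotD k x y : dot k (x + y) = dot k x + dot k y :> R.
Proof. by rewrite /dot/=; ring. Qed.

(** A translation becomes a phase; the sine transform of [psi t] vanishes, so no mixed term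
    survives. *)
Lemma psi_cos_shift t k x : 0 < t ->
  int2 (fun u => psi t (u - x) * cos (dot k u)) = expR (- (t * symb k)) * cos (dot k x).
Proof.
move=> t0; have pi := psi_L1 t0.
have ci := L1_mul_cos k pi; have si := L1_mul_sin k pi.
pose g u := cos (dot k x) * (psi t u * cos (dot k u)) - sin (dot k x) * (psi t u * sin (dot k u)).
have gi : L1 g by apply: L1B; exact: L1Z.
have -> : (fun u => psi t (u - x) * cos (dot k u)) = (fun u => g (u + - x)).
  apply/funext => u; rewrite /g -{2}(subrK x u) dotD cosD.
  by move: (psi t _) (cos _) (cos _) (sin _) (sin _) => a b c d e; ring.
rewrite (int2_shift _ gi) /g (int2B (L1Z _ ci) (L1Z _ si)) (int2Z _ ci) (int2Z _ si).
by rewrite psi_cos// psi_sin// mulr0 subr0 mulrC.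
Qed.

Lemma psi_sin_shift t k x : 0 < t ->
  int2 (fun u => psi t (u - x) * sin (dot k u)) = expR (- (t * symb k)) * sin (dot k x).
Proof.
move=> t0; have pi := psi_L1 t0.
have ci := L1_mul_cos k pi; have si := L1_mul_sin k pi.
pose g u := sin (dot k x) * (psi t u * cos (dot k u)) + cos (dot k x) * (psi t u * sin (dot k u)).
have gi : L1 g by apply: L1D; exact: L1Z.
have -> : (fun u => psi t (u - x) * sin (dot k u)) = (fun u => g (u + - x)).
  apply/funext => u; rewrite /g -{2}(subrK x u) dotD sinD.
  by move: (psi t _) (cos _) (cos _) (sin _) (sin _) => a b c d e; ring.
rewrite (int2_shift _ gi) /g (int2D (L1Z _ ci) (L1Z _ si)) (int2Z _ ci) (int2Z _ si).
by rewrite psi_cos// psi_sin// mulr0 addr0 mulrC.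
Qed.

(** Turns the pairing of a convolution with a sine or cosine into an iterated integral whose inner
    one is a shifted transform. *)
Lemma conv_fubini eta phi F c : rapid eta -> schwartz phi -> meas2 F ->
  (forall x, `|F x| <= c) ->
  int2 (fun u => conv eta phi u * F u) = int2 (fun x : R * R => int2 (fun u => phi (u - x) * F u) * eta x).
Proof.
move=> er sp mF Fc; have ei := rapid_L1 er; have [c' ec] := rapid_bounded er.
have ni := rapid_L1 (schwartz_rapid (schwartz_opp sp)).
have [_ _ e] := fubini_conv ni mF Fc ei ec.
transitivity (int2 (fun y => F y * int2 (fun x => phi (- (x - y)) * eta x))).
  congr int2; apply/funext => u; rewrite mulrC; congr (_ * _).
  by rewrite /conv; congr int2; apply/funext => y; rewrite opprB mulrC.
rewrite -e; congr int2; apply/funext => x; congr (_ * _).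
by congr int2; apply/funext => y; rewrite opprB.
Qed.

(** The transform turns the convolution into a product, and the exponentials of [- s] and [- t]
    times the symbol multiply. *)
Lemma psi_semigroup s t : 0 < s -> 0 < t -> forall x, conv (psi s) (psi t) x = psi (s + t) x.
Proof.
move=> s0 t0 x; have st0 : 0 < s + t by exact: addr_gt0.
apply/eqP; rewrite -subr_eq0; apply/eqP; move: x.
have sc := schwartz_conv (psi_rapid s0) (psi_schwartz t0).
have sd := schwartzB sc (psi_schwartz st0).
have [C hC] := schwartz_bounded sd.
have ci := rapid_L1 (schwartz_rapid sc); have pi := psi_L1 st0.
apply: (@fourier_inj _ (fun x => conv (psi s) (psi t) x - psi (s + t) x) C).
- exact: schwartz_continuous.
- exact: (rapid_L1 (schwartz_rapid sd)).
- exact: hC.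
- move=> k.
  rewrite (_ : (fun x => _) = (fun x => conv (psi s) (psi t) x * cos (dot k x) - psi (s + t) x * cos (dot k x))); last first.
    by apply/funext => x; rewrite mulrBl.
  rewrite (int2B (L1_mul_cos k ci) (L1_mul_cos k pi)) psi_cos//.
  rewrite (conv_fubini (psi_rapid s0) (psi_schwartz t0) (meas2_cos k) (fun x => cos_max _)).
  under [X in int2 X]eq_fun do rewrite psi_cos_shift// -mulrA [cos _ * _]mulrC.
  rewrite (int2Z _ (L1_mul_cos k (psi_L1 s0))) psi_cos// -expRD.
  by apply/eqP; rewrite subr_eq0; apply/eqP; congr expR; ring.
- move=> k.
  rewrite (_ : (fun x => _) = (fun x => conv (psi s) (psi t) x * sin (dot k x) - psi (s + t) x * sin (dot k x))); last first.
    by apply/funext => x; rewrite mulrBl.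
  rewrite (int2B (L1_mul_sin k ci) (L1_mul_sin k pi)) psi_sin//.
  rewrite (conv_fubini (psi_rapid s0) (psi_schwartz t0) (meas2_sin k) (fun x => sin_max _)).
  under [X in int2 X]eq_fun do rewrite psi_sin_shift// -mulrA [sin _ * _]mulrC.
  by rewrite (int2Z _ (L1_mul_sin k (psi_L1 s0))) psi_sin// mulr0 subr0.
Qed.

(* The symbol [k_1^4 + k_2^2] is homogeneous of degree 4 under this dilation, so
   that every [psi t] is a rescaled [psi 1]. *)
Definition dil (l : R) (u : R * R) : R * R := (l * u.1, l ^+ 2 * u.2).

Lemma dilE l u : dil l u = affine2 (l, l ^+ 2) 0 u.
Proof. by rewrite /dil /affine2 /affine1/= !addr0. Qed.

Lemma int2_dil l f : 0 < l -> L1 f -> l ^+ 3 * int2 (fun x => f (dil l x)) = int2 f.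
Proof.
move=> l0 fi; have l1 : l != 0 by rewrite gt_eqF.
have l2 : l ^+ 2 != 0 by rewrite expf_neq0.
rewrite -[RHS](@int2_affine _ (l, l ^+ 2) 0 _ l1 l2 fi)/=.
rewrite normrX (gtr0_norm l0) -exprS; congr (_ * int2 _).
by apply/funext => x; rewrite dilE.
Qed.

Lemma L1_dil l f : 0 < l -> L1 f -> L1 (fun x => f (dil l x)).
Proof.
move=> l0 fi; have l1 : l != 0 by rewrite gt_eqF.
have l2 : l ^+ 2 != 0 by rewrite expf_neq0.
have := @L1_affine _ (l, l ^+ 2) 0 _ l1 l2 fi.
by congr L1; apply/funext => x; rewrite dilE.
Qed.

(** Equality of transforms: substituting [dil l] absorbs [l^3], the frequency [k] becomes the dual
    one [k'], and [l^4] times the symbol at [k'] is the symbol at [k]. *)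
Lemma psi_dil l : 0 < l -> forall u, l ^+ 3 * psi (l ^+ 4) (dil l u) = psi 1 u.
Proof.
move=> l0 u; have l40 : 0 < l ^+ 4 by rewrite exprn_gt0.
have l1 : l != 0 by rewrite gt_eqF.
apply/eqP; rewrite -subr_eq0; apply/eqP; move: u.
have p1 := psi_schwartz (ltr01 : 0 < 1 :> R); have pl := psi_schwartz l40.
have [C1 h1] := schwartz_bounded p1; have [C2 h2] := schwartz_bounded pl.
have i1 := psi_L1 (ltr01 : 0 < 1 :> R); have il := psi_L1 l40.
have ild := L1_dil l0 il.
pose k' (k : R * R) : R * R := (k.1 / l, k.2 / l ^+ 2).
have dk k u : dot (k' k) (dil l u) = dot k u.
  by rewrite /dot /k' /dil/=; field.
apply: (@fourier_inj _ (fun x => l ^+ 3 * psi (l ^+ 4) (dil l x) - psi 1 x) (`|l ^+ 3| * C2 + C1)).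
- move=> x; apply: cvgB; last exact: schwartz_continuous.
  apply: cvgM; first exact: cvg_cst.
  apply: (cvg_comp (dil l) (psi (l ^+ 4))); last exact: schwartz_continuous.
  apply: (@cvg_pair _ _ _ _ (nbhs (l * x.1)) (nbhs (l ^+ 2 * x.2))).
    by apply: cvgM; [exact: cvg_cst|exact: continuous_fst2].
  by apply: cvgM; [exact: cvg_cst|exact: continuous_snd2].
- by apply: L1B => //; exact: L1Z.
- by move=> x; rewrite (le_trans (ler_normB _ _))// normrM lerD// ler_wpM2l.
- move=> k.
  rewrite (_ : (fun x => _) = (fun x => l ^+ 3 * (psi (l ^+ 4) (dil l x) * cos (dot (k' k) (dil l x))) - psi 1 x * cos (dot k x))); last first.
    by apply/funext => x; rewrite mulrBl dk mulrA.
  have ik := L1_mul_cos (k' k) il.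
  rewrite (int2B (L1Z _ (L1_dil l0 ik)) (L1_mul_cos k i1)) (int2Z _ (L1_dil l0 ik)).
  rewrite (int2_dil l0 ik) psi_cos// psi_cos//.
  by apply/eqP; rewrite subr_eq0; apply/eqP; congr expR; rewrite /symb /k'/=; field.
- move=> k.
  rewrite (_ : (fun x => _) = (fun x => l ^+ 3 * (psi (l ^+ 4) (dil l x) * sin (dot (k' k) (dil l x))) - psi 1 x * sin (dot k x))); last first.
    by apply/funext => x; rewrite mulrBl dk mulrA.
  have ik := L1_mul_sin (k' k) il.
  rewrite (int2B (L1Z _ (L1_dil l0 ik)) (L1_mul_sin k i1)) (int2Z _ (L1_dil l0 ik)).
  by rewrite (int2_dil l0 ik) psi_sin// psi_sin// subr0.
Qed.

Lemma root4 (t : R) : 0 < t -> (t `^ 4^-1) ^+ 4 = t.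
Proof.
by move=> t0; rewrite -powR_mulrn ?powR_ge0// -powRrM mulVf// powRr1// ltW.
Qed.

Lemma root4_gt0 (t : R) : 0 < t -> 0 < t `^ 4^-1.
Proof. exact: powR_gt0. Qed.

Lemma root4_le1 (t : R) : 0 < t <= 1 -> t `^ 4^-1 <= 1.
Proof.
move=> /andP[t0 t1]; apply: (@le_trans _ _ (1 `^ 4^-1)); last by rewrite powR1.
by apply: ge0_ler_powR; rewrite ?nnegrE ?ler01// ltW.
Qed.

Lemma int2_psi_dil t (g : R * R -> R) : 0 < t -> L1 (fun y => `|psi t y| * g y) ->
  int2 (fun y => `|psi t y| * g y) = int2 (fun u => `|psi 1 u| * g (dil (t `^ 4^-1) u)).
Proof.
move=> t0 gi; have l0 := root4_gt0 t0; rewrite -(int2_dil l0 gi).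
rewrite -int2Z; last exact: (L1_dil l0 gi).
congr int2; apply/funext => u; rewrite -(psi_dil l0 u) root4// normrM.
by rewrite mulrA gtr0_norm// exprn_gt0.
Qed.

Lemma weight_dil n (l : R) u : 0 < l <= 1 -> w n (dil l u) <= w n u.
Proof.
move=> /andP[l0 l1]; rewrite /schwartz_weight lerXn2r ?nnegrE ?addr_ge0//.
rewrite /dil/= (normrM l u.1) (normrM (l ^+ 2) u.2) normrX (gtr0_norm l0) lerD ?lerD// ler_piMl//.
by rewrite exprn_ile1// ltW.
Qed.

Definition psi_mass (n : nat) : R := int2 (fun y => `|psi 1 y| * w n y).

Lemma psi_weight_L1 n t : 0 < t -> L1 (fun y => `|psi t y| * w n y).
Proof.
move=> t0; have := rapid_weight_L1 n (psi_rapid t0).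
by congr L1; apply/funext => y; rewrite mulrC.
Qed.

Lemma meas2_weight n : meas2 (w n).
Proof. by apply: continuous_meas2; exact: continuous_weight. Qed.

Lemma meas2_norm f : meas2 f -> meas2 (fun x : R * R => `|f x|).
Proof. by move=> mf; exact: measurableT_comp. Qed.

Lemma psi_moment_L1 n t g c : 0 < t -> meas2 g -> (forall y, `|g y| <= c * w n y) ->
  L1 (fun y => `|psi t y| * g y).
Proof.
move=> t0 mg gw; apply: (L1_le _ (L1Z c (psi_weight_L1 n t0))).
  by apply: meas2M => //; apply: meas2_norm; exact: (psi_rapid t0).1.
by move=> y; rewrite normrM normr_id mulrCA ler_wpM2l.
Qed.

(** After rescaling to [psi 1], a dilation by a factor at most 1 only decreases the weight. *)
Lemma psi_mass_le n t : 0 < t <= 1 -> int2 (fun y => `|psi t y| * w n y) <= psi_mass n.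
Proof.
move=> t01; have /andP[t0 t1] := t01; rewrite int2_psi_dil//; last exact: psi_weight_L1.
have l01 : 0 < t `^ 4^-1 <= 1 by rewrite root4_gt0// root4_le1.
apply: int2_le.
- apply: (psi_moment_L1 (n := n) (g := fun u => w n (dil (t `^ 4^-1) u)) (c := 1) ltr01) => [|y].
    have := meas2_affine (t `^ 4^-1, (t `^ 4^-1) ^+ 2) 0 (meas2_weight n).
    by congr meas2; apply/funext => y; rewrite dilE.
  by rewrite mul1r ger0_norm ?weight_ge0// weight_dil.
- exact: psi_weight_L1.
- by move=> y; rewrite ler_wpM2l// weight_dil.
Qed.

Lemma continuous_norm1 : continuous (@norm1 R).
Proof.
by move=> x; apply: cvgD; apply: cvg_norm; [exact: continuous_fst2|exact: continuous_snd2].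
Qed.

Lemma norm1_dil (l : R) u : 0 < l <= 1 -> norm1 (dil l u) <= l * norm1 u.
Proof.
move=> /andP[l0 l1]; rewrite /norm1 /= (normrM l u.1) (normrM (l ^+ 2) u.2) normrX (gtr0_norm l0) mulrDr lerD//.
by rewrite expr2 -mulrA ler_piMl// mulr_ge0// ltW.
Qed.

Lemma norm1_weight n (y : R * R) : norm1 y * w n y <= w n.+1 y.
Proof.
rewrite -[n.+1]add1n -weight_exp ler_wpM2r ?weight_ge0//.
exact: (@norm1_le_weight _ 0).
Qed.

(** Under the dilation [norm1] contracts at least by the factor [t^(1/4)]; this gain pays for the
    derivative lost in [sbound_incr]. *)
Lemma psi_incr_mass n t : 0 < t <= 1 ->
  int2 (fun y => `|psi t y| * (norm1 y * w n y)) <= t `^ 4^-1 * psi_mass n.+1.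
Proof.
move=> t01; have /andP[t0 t1] := t01.
have l01 : 0 < t `^ 4^-1 <= 1 by rewrite root4_gt0// root4_le1.
have m : meas2 (fun y => norm1 y * w n y).
  by apply: meas2M; [apply: continuous_meas2; exact: continuous_norm1|exact: meas2_weight].
have i s : 0 < s -> L1 (fun y => `|psi s y| * (norm1 y * w n y)).
  move=> s0; apply: (psi_moment_L1 (n := n.+1) (c := 1) s0 m) => y.
  by rewrite mul1r ger0_norm ?mulr_ge0 ?weight_ge0 ?norm1_ge0 ?norm1_weight.
rewrite int2_psi_dil//; last exact: i.
rewrite /psi_mass -int2Z; last exact: psi_weight_L1.
apply: int2_le.
- apply: (psi_moment_L1 (n := n.+1) (g := fun u => norm1 (dil (t `^ 4^-1) u) * w n (dil (t `^ 4^-1) u)) (c := 1) ltr01) => [|y].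
    have := meas2_affine (t `^ 4^-1, (t `^ 4^-1) ^+ 2) 0 m.
    by congr meas2; apply/funext => y; rewrite dilE.
  rewrite mul1r ger0_norm ?mulr_ge0 ?weight_ge0 ?norm1_ge0//.
  by rewrite (le_trans (norm1_weight _ _))// weight_dil.
- exact/L1Z/psi_weight_L1.
- move=> y; rewrite [leRHS]mulrCA ler_wpM2l//.
  apply: (@le_trans _ _ ((t `^ 4^-1 * norm1 y) * w n y)).
    by rewrite ler_pM ?norm1_ge0 ?weight_ge0 ?norm1_dil ?weight_dil.
  by rewrite -mulrA ler_wpM2l ?norm1_weight// ltW//; case/andP: l01.
Qed.

Definition d0 (u : R * R) : R := `|u.1| + Num.sqrt `|u.2|.

Lemma pdist_d0 x y : pdist x y = d0 (x - y). Proof. by []. Qed.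

Lemma d0_ge0 u : 0 <= d0 u. Proof. by rewrite addr_ge0// sqrtr_ge0. Qed.

Lemma d0_dil (l : R) u : 0 < l -> d0 (dil l u) = l * d0 u.
Proof.
move=> l0; rewrite /d0 /= (normrM l u.1) (normrM (l ^+ 2) u.2) normrX (gtr0_norm l0) mulrDr; congr (_ + _).
by rewrite (sqrtrM _ (sqr_ge0 l)) sqrtr_sqr (gtr0_norm l0).
Qed.

Lemma d0_weight u : d0 u <= w 1 u.
Proof.
rewrite /d0 /schwartz_weight expr1.
have : Num.sqrt `|u.2| <= 1 + `|u.2|.
  rewrite -[X in _ <= 1 + X](sqr_sqrtr (normr_ge0 u.2)).
  move: (Num.sqrt _) => q; have := sqr_ge0 (q - 1); have := sqr_ge0 q; nra.
lra.
Qed.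

Lemma continuous_d0 : continuous d0.
Proof.
move=> x; apply: cvgD; first by apply: cvg_norm; exact: continuous_fst2.
apply: (cvg_comp (fun y : R * R => `|y.2|) Num.sqrt); last exact: sqrt_continuous.
by apply: cvg_norm; exact: continuous_snd2.
Qed.

(** [d0] is homogeneous of degree 1 under the dilations, so the moment of [psi t] is exactly
    [(t^(1/4))^a] times that of [psi 1]. *)
Lemma psi_d0_moment a : 0 <= a -> exists C, 0 <= C /\ forall t, 0 < t <= 1 ->
  L1 (fun y => `|psi t y| * d0 y `^ a) /\
  int2 (fun y => `|psi t y| * d0 y `^ a) <= C * (t `^ 4^-1) `^ a.
Proof.
move=> a0; pose n := Num.bound a.
have an : a <= n%:R by rewrite ltW// archi_boundP.
have m : meas2 (fun y => d0 y `^ a).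
  apply: (measurableT_comp (@measurable_powR R a)).
  by apply: continuous_meas2; exact: continuous_d0.
have dw y : d0 y `^ a <= w n y.
  apply: (@le_trans _ _ (w 1 y `^ a)).
    by apply: ge0_ler_powR; rewrite ?nnegrE ?d0_ge0 ?weight_ge0 ?d0_weight.
  apply: (@le_trans _ _ (w 1 y `^ n%:R)); first by rewrite ler_powR ?weight_ge1.
  by rewrite powR_mulrn ?weight_ge0// /schwartz_weight expr1.
have i t : 0 < t -> L1 (fun y => `|psi t y| * d0 y `^ a).
  move=> t0; apply: (psi_moment_L1 (n := n) (c := 1) t0 m) => y.
  by rewrite mul1r ger0_norm ?powR_ge0.
exists (int2 (fun y => `|psi 1 y| * d0 y `^ a)); split.
  by apply: int2_ge0 => y; rewrite mulr_ge0// powR_ge0.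
move=> t t01; have /andP[t0 t1] := t01; split; first exact: i.
rewrite int2_psi_dil//; last exact: i.
rewrite mulrC -int2Z; last exact: i.
have l0 := root4_gt0 t0.
under [X in int2 X <= _]eq_fun do rewrite d0_dil// powRM ?d0_ge0 ?(ltW l0)// mulrCA.
exact: lexx.
Qed.

End Kernel.

(** * Exchanging a tempered distribution with an integral *)

Section Exchange.
Context (R : realType).
Local Notation w := (@schwartz_weight R).
Local Notation mR := (measurableTypeR R).
Implicit Types (f phi chi eta : R * R -> R).

Lemma rapidD f1 f2 : rapid f1 -> rapid f2 -> rapid (fun x => f1 x + f2 x).
Proof.
move=> [m1 r1] [m2 r2]; split; first exact: measurable_funD.
move=> n; have [C1 h1] := r1 n; have [C2 h2] := r2 n; exists (C1 + C2) => x.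
apply: (@le_trans _ _ (w n x * `|f1 x| + w n x * `|f2 x|)); last by rewrite lerD.
by rewrite -mulrDr ler_wpM2l ?weight_ge0// ler_normD.
Qed.

Lemma rapid0 : rapid (fun _ : R * R => 0 : R).
Proof.
split; first exact: measurable_cst.
by move=> n; exists 0 => x; rewrite normr0 mulr0.
Qed.

Lemma rapid_sum (I : Type) (r : seq I) (f_ : I -> R * R -> R) :
  (forall i, rapid (f_ i)) -> rapid (fun x => \sum_(i <- r) f_ i x).
Proof.
move=> fr; elim: r => [|i r IH].
  by under eq_fun do rewrite big_nil; exact: rapid0.
by under eq_fun do rewrite big_cons; exact: rapidD.
Qed.

Lemma additive_sum (T : (R * R -> R) -> R) (I : Type) (r : seq I) (f_ : I -> R * R -> R) :
  (forall f1 f2, rapid f1 -> rapid f2 -> T (fun x => f1 x + f2 x) = T f1 + T f2) ->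
  (forall i, rapid (f_ i)) -> T (fun x => \sum_(i <- r) f_ i x) = \sum_(i <- r) T (f_ i).
Proof.
move=> TD fr; have T0 : T (fun=> 0) = 0.
  have := TD _ _ rapid0 rapid0; under [X in T X = _]eq_fun do rewrite addr0.
  by move/eqP; rewrite -subr_eq0 opprD addrA subrr sub0r oppr_eq0 => /eqP.
elim: r => [|i r IH].
  by under eq_fun do rewrite big_nil; rewrite big_nil.
under eq_fun do rewrite big_cons.
by rewrite TD ?IH ?big_cons//; exact: rapid_sum.
Qed.

Lemma int2_additive f1 f2 : rapid f1 -> rapid f2 ->
  int2 (fun x => f1 x + f2 x) = int2 f1 + int2 f2.
Proof. by move=> /rapid_L1 i1 /rapid_L1 i2; rewrite int2D. Qed.

(* The points [cell_pt m i] for [i <= 2 m^2] form a grid of step [1 / m] on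
   [[-m, m]]; [cell m i] is the indicator of the set of reals quantized to
   [cell_pt m i], the extreme cells being unbounded. *)
Definition cell_pt (m i : nat) : R := i%:R / m%:R - m%:R.

Definition cell_step (m i : nat) (u : R) : bool :=
  (i == 0)%N || ((i <= 2 * m ^ 2)%N && (cell_pt m i <= u)).

Definition cell (m i : nat) (u : R) : R :=
  (cell_step m i u)%:R - (cell_step m i.+1 u)%:R.

Lemma cell_sum m u : \sum_(i < (2 * m ^ 2).+1) cell m i u = 1.
Proof.
have h n : \sum_(i < n) cell m i u = 1 - (cell_step m n u)%:R.
  elim: n => [|n IH]; first by rewrite big_ord0 /cell_step eqxx subrr.
  by rewrite big_ord_recr/= IH /cell addrA subrK.
by rewrite h /cell_step/= ltnn subr0.
Qed.

Lemma cell_stepS m i u : (0 < m)%N -> cell_step m i.+1 u -> cell_step m i u.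
Proof.
move=> m0; rewrite /cell_step /= => /andP[/ltnW iK h].
apply/orP; right; rewrite iK; apply: le_trans h.
by rewrite lerD2r ler_wpM2r ?invr_ge0// ler_nat.
Qed.

Lemma cell_01 m i u : (0 < m)%N ->
  cell m i u = (cell_step m i u && ~~ cell_step m i.+1 u)%:R.
Proof.
move=> m0; rewrite /cell; have := @cell_stepS m i u m0.
case: (cell_step m i u); case: (cell_step m i.+1 u) => h; rewrite ?subrr ?subr0//.
by have := h isT.
Qed.

(** Within the grid the error is at most the step [1 / m]; beyond it [|u| >= m], so that the error
    is at most [|u| <= u^2 / m]. *)
Lemma cell_close m i u : (0 < m)%N -> (i <= 2 * m ^ 2)%N -> cell m i u != 0 ->
  `|u - cell_pt m i| <= (1 + u ^+ 2) / m%:R.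
Proof.
move=> m0 iK; rewrite cell_01// pnatr_eq0 eqb0 negbK => /andP[s1 s2].
have M0 : 0 < m%:R :> R by rewrite ltr0n.
have M1 : 1 <= m%:R :> R by rewrite ler1n.
rewrite ler_pdivlMr//.
have stepE : cell_pt m i.+1 = cell_pt m i + 1 / m%:R.
  by rewrite /cell_pt -natr1 mulrDl addrAC.
have ptm : cell_pt m 0 = - m%:R by rewrite /cell_pt mul0r sub0r.
have ptK : cell_pt m (2 * m ^ 2) = m%:R.
  by rewrite /cell_pt natrM natrX; move: M0; move: (m%:R : R) => M M0; field; rewrite gt_eqF.
have [iE|iE] := eqVneq i (2 * m ^ 2)%N.
  have K0 : (2 * m ^ 2 == 0)%N = false by rewrite muln_eq0 expn_eq0 (gtn_eqF m0).
  move: s1; rewrite /cell_step iE K0 leqnn/= ptK => h.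
  by rewrite ger0_norm ?subr_ge0//; nra.
have iK' : (i < 2 * m ^ 2)%N by rewrite ltn_neqAle iE iK.
have up : u < cell_pt m i.+1 by move: s2; rewrite /cell_step/= iK'/= ltNge.
have [h1|h1] := lerP (cell_pt m i) u.
  move: up; rewrite stepE -ltrBlDl ltr_pdivlMr// => h2.
  by rewrite (le_trans (ltW h2))// lerDl sqr_ge0.
have i0 : i = 0%N.
  by move: s1; rewrite /cell_step leNgt h1 andbF orbF => /eqP.
rewrite i0 ptm in h1 *; nra.
Qed.

Lemma measurable_cell m i : measurable_fun [set: mR] (cell m i : mR -> R).
Proof.
have ms j : measurable_fun [set: mR] ((fun u => (cell_step m j u)%:R) : mR -> R).
  rewrite /cell_step; case: (j == 0)%N => /=; first exact: measurable_cst.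
  case: (j <= 2 * m ^ 2)%N => /=; last exact: measurable_cst.
  rewrite (_ : (fun u => _) = (\1_(`[cell_pt m j, +oo[%classic) : mR -> R)).
    exact: measurable_indic.
  by apply/funext => u; rewrite indicE mem_setE/= in_itv/= andbT.
exact: measurable_funB.
Qed.

Lemma meas2_cell m i j : meas2 (fun y => cell m i y.1 * cell m j y.2).
Proof.
apply: measurable_funM.
  exact: (measurableT_comp (measurable_cell m i) measurable_fst).
exact: (measurableT_comp (measurable_cell m j) measurable_snd).
Qed.

Section TestFunction.
Variables (g : (R * R -> R) -> R^o) (phi : R * R -> R).
Hypotheses (gt : tempered g) (sp : schwartz phi).

Lemma tempered_lin a f1 f2 : schwartz f1 -> schwartz f2 ->
  g (fun x => a * f1 x + f2 x) = a * g f1 + g f2.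
Proof. by move=> s1 s2; case: gt => h _; exact: h. Qed.

Lemma temperedB f1 f2 : schwartz f1 -> schwartz f2 ->
  g (fun x => f1 x - f2 x) = g f1 - g f2.
Proof.
move=> s1 s2; have := tempered_lin (-1) s2 s1.
rewrite mulN1r addrC => <-; congr g.
by apply/funext => x; rewrite mulN1r addrC.
Qed.

Let tr y : R * R -> R := fun z => phi (z - y).

Let tr_schwartz y : schwartz (tr y).
Proof. exact: schwartz_shift. Qed.

Lemma exchange_cst : exists n C M : _, [/\ 0 <= C * M, 0 <= C & 0 <= M] /\
  (forall f L, schwartz f -> sbound n f L -> `|g f| <= C * L) /\ sbound n.+1 phi M.
Proof.
have [_ [n [C hC]]] := gt; have [M [M0 hM]] := schwartz_sbound n.+1 sp.
exists n, `|C|, M; rewrite mulr_ge0//; split => //; split => // f L sf hL.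
apply: (le_trans (hC f L sf hL)).
by rewrite ler_wpM2r ?ler_norm// (sbound_ge0 hL).
Qed.

Lemma sbound_tr_incr n M y y' : sbound n.+1 phi M ->
  sbound n (fun z => tr y' z - tr y z) (norm1 (y - y') * w n (y - y') * M * w n y).
Proof.
move=> hM; have := sbound_shift (- y) (sbound_incr (y - y') sp hM).
rewrite weight_opp; congr sbound; apply/funext => z.
by rewrite /tr addrA subrK.
Qed.

Lemma translate_incr n C M y y' : 0 <= C -> sbound n.+1 phi M ->
  (forall f L, schwartz f -> sbound n f L -> `|g f| <= C * L) ->
  `|g (tr y') - g (tr y)| <= C * (norm1 (y - y') * w n (y - y') * M * w n y).
Proof.
move=> C0 hM hC; rewrite -temperedB//; apply: hC; first exact: schwartzB.
exact: sbound_tr_incr.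
Qed.

(** Supplies the measurability of the integrand in [exchange]. *)
Lemma translate_continuous : continuous (fun y => g (tr y) : R).
Proof.
have [n [C [M [[CM C0 M0] [hC hM]]]]] := exchange_cst.
move=> y; apply/cvgrPdist_le => e e0.
pose K := C * (w n (1, 1) * M * w n y) * 2 + 1.
have K0 : 0 < K by rewrite ltr_wpDl// !mulr_ge0// weight_ge0.
have nr' : \forall y' \near y, `|y - y'| < Num.min 1 (e / K).
  have e1 : 0 < Num.min 1 (e / K) by rewrite lt_min ltr01 divr_gt0.
  exact: (@cvgr_dist_lt _ _ _ (nbhs y) _ id y cvg_id _ e1).
apply: filterS nr' => y'; rewrite lt_min => /andP[h1 h2].
rewrite distrC; apply: (le_trans (translate_incr y y' C0 hM hC)).
have n1 := norm1_le_norm (y - y').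
have w1 : w n (y - y') <= w n (1, 1).
  rewrite /schwartz_weight lerXn2r ?nnegrE ?addr_ge0//= normr1.
  move: h1; rewrite prod_normE gt_max => /andP[/ltW a /ltW b].
  by rewrite lerD// lerD.
have {}h2 : `|y - y'| * K <= e by rewrite -ler_pdivlMr// ltW.
apply: le_trans h2.
apply: (@le_trans _ _ (C * ((2 * `|y - y'|) * w n (1, 1) * M * w n y))).
  rewrite ler_wpM2l// ler_wpM2r ?weight_ge0// ler_wpM2r//.
  by rewrite ler_pM ?norm1_ge0 ?weight_ge0.
rewrite /K mulrDr mulr1 (_ : C * _ = `|y - y'| * (C * (w n (1, 1) * M * w n y) * 2)); last first.
  by ring.
by rewrite lerDl.
Qed.

Lemma translate_bound : exists n K, 0 <= K /\ forall y, `|g (tr y)| <= K * w n y.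
Proof.
have [n [C [M [[CM C0 M0] [hC hM]]]]] := exchange_cst.
exists n, (C * M); split => // y.
rewrite -mulrA -(weight_opp n y); apply: hC => //.
by apply: sbound_shift; exact: sbound_le hM.
Qed.

Lemma exchange_L1 eta : rapid eta -> L1 (fun y => eta y * g (tr y)).
Proof.
move=> er; have [n [K [K0 hK]]] := translate_bound.
apply: (L1_le _ (L1Z K (rapid_weight_L1 n er))).
  by apply: meas2M; [case: er|apply: continuous_meas2; exact: translate_continuous].
move=> y; rewrite normrM mulrC (le_trans (ler_wpM2r (normr_ge0 _) (hK y)))//.
by rewrite mulrA.
Qed.

(** The quantity shown to vanish in [exchange]. It is additive in [eta], which allows cutting [eta]
    into pieces concentrated near grid points. *)
Let defect eta : R := g (conv eta phi) - int2 (fun y => eta y * g (tr y)).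

Let defectD f1 f2 : rapid f1 -> rapid f2 ->
  defect (fun x => f1 x + f2 x) = defect f1 + defect f2.
Proof.
move=> r1 r2; rewrite /defect.
have i1 := exchange_L1 r1; have i2 := exchange_L1 r2.
have -> : int2 (fun y => (f1 y + f2 y) * g (tr y)) =
    int2 (fun y => f1 y * g (tr y)) + int2 (fun y => f2 y * g (tr y)).
  rewrite -(int2D i1 i2); congr int2; apply/funext => y; exact: mulrDl.
have -> : conv (fun x => f1 x + f2 x) phi = fun z => 1 * conv f1 phi z + conv f2 phi z.
  apply/funext => z; rewrite mul1r /conv.
  rewrite -(int2D (schwartz_conv_L1 z (rapid_L1 r1) sp) (schwartz_conv_L1 z (rapid_L1 r2) sp)).
  by congr int2; apply/funext => y; exact: mulrDl.
rewrite tempered_lin; try exact: schwartz_conv.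
rewrite mul1r; move: (int2 _) (int2 _) (g _) (g _) => a b c d; ring.
Qed.

(** Both terms of the defect are compared with [g (tr p)] times the integral of [eta], as if [eta]
    were a point mass at [p]; this accounts for the factor 2. *)
Let defect_cell eta n C M p : 0 <= C -> rapid eta -> sbound n.+1 phi M ->
  (forall f L, schwartz f -> sbound n f L -> `|g f| <= C * L) ->
  L1 (fun y => `|eta y| * (norm1 (y - p) * w n (y - p) * M * w n y)) ->
  `|defect eta| <= 2 * C * int2 (fun y => `|eta y| * (norm1 (y - p) * w n (y - p) * M * w n y)).
Proof.
move=> C0 er hM hC Bi; set B := int2 _; have ei := rapid_L1 er.
pose c := int2 eta.
have h1 : `|g (conv eta phi) - c * g (tr p)| <= C * B.
  have -> : g (conv eta phi) - c * g (tr p) = g (fun z => (- c) * tr p z + conv eta phi z).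
    by rewrite tempered_lin//; [rewrite addrC mulNr|exact: schwartz_conv].
  have sc := schwartz_conv er sp.
  apply: hC; first exact: schwartz_comb.
  move=> s sn z; rewrite pderiv_comb// pderiv_conv// pderiv_shift.
  have ss := schwartz_pderiv s sp; have sL := schwartz_conv_L1 z ei ss.
  have cL := L1Z (pderiv s phi (z - p)) ei.
  rewrite addrC mulNr /conv mulrC.
  have -> : int2 (fun y => eta y * pderiv s phi (z - y)) - c * pderiv s phi (z - p) =
      int2 (fun y => eta y * pderiv s phi (z - y) - pderiv s phi (z - p) * eta y).
    by rewrite (int2B sL cL) (int2Z _ ei) [c * _]mulrC.
  rewrite -[X in _ * X](ger0_norm (weight_ge0 n z)) -normrM mulrC -(int2Z _ (L1B sL cL)).
  apply: int2_norm_le => //; first exact/L1Z/(L1B sL cL).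
  move=> y; rewrite normrM (ger0_norm (weight_ge0 n z)).
  rewrite [pderiv s phi (z - p) * _]mulrC -mulrBr normrM mulrCA ler_wpM2l//.
  have := sbound_tr_incr y p hM sn z.
  have -> : (fun z => tr p z - tr y z) = (fun z => (-1) * tr y z + tr p z).
    by apply/funext => u; rewrite mulN1r addrC.
  by rewrite pderiv_comb// !pderiv_shift mulN1r addrC -normrN opprB.
have h2 : `|int2 (fun y => eta y * g (tr y)) - c * g (tr p)| <= C * B.
  have i1 := exchange_L1 er; have i2 := L1Z (g (tr p)) ei.
  rewrite [c * _]mulrC -(int2Z _ ei) -(int2B i1 i2) -(int2Z _ Bi).
  apply: int2_norm_le; [exact: L1B|exact: L1Z|move=> y].
  rewrite [g (tr p) * _]mulrC -mulrBr normrM mulrCA ler_wpM2l//.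
  by rewrite distrC; exact: translate_incr.
rewrite /defect -(subrKA (c * g (tr p))) (le_trans (ler_normD _ _))//.
rewrite -mulrA mulr_natl mulr2n lerD//.
by rewrite distrC.
Qed.

Let cell2 m (p : 'I_(2 * m ^ 2).+1 * 'I_(2 * m ^ 2).+1) (y : R * R) : R :=
  cell m p.1 y.1 * cell m p.2 y.2.

Let cell2_pt m (p : 'I_(2 * m ^ 2).+1 * 'I_(2 * m ^ 2).+1) : R * R :=
  (cell_pt m p.1, cell_pt m p.2).

Let cell2_01 m p y : (0 < m)%N -> 0 <= @cell2 m p y <= 1.
Proof.
move=> m0; rewrite /cell2 !cell_01//.
by case: (cell_step m p.1 _ && _); case: (cell_step m p.2 _ && _);
  rewrite ?mulr0 ?mul0r ?mulr1 ?lexx ?ler01.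
Qed.

Let cell2_sum m y : \sum_p @cell2 m p y = 1.
Proof.
rewrite -(pair_bigA _ (fun i j : 'I_(2 * m ^ 2).+1 => cell m i y.1 * cell m j y.2))/=.
by under eq_bigr do rewrite -mulr_sumr cell_sum mulr1; rewrite cell_sum.
Qed.

Let cell2_close m p y : (0 < m)%N -> @cell2 m p y != 0 ->
  norm1 (y - cell2_pt p) <= 2 * w 2 y / m%:R.
Proof.
move=> m0; rewrite /cell2 mulf_eq0 negb_or => /andP[h1 h2].
have i1 : (p.1 <= 2 * m ^ 2)%N by rewrite -ltnS.
have i2 : (p.2 <= 2 * m ^ 2)%N by rewrite -ltnS.
have := cell_close m0 i1 h1; have := cell_close m0 i2 h2.
rewrite /norm1 /cell2_pt /= => a b; apply: (le_trans (lerD b a)).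
rewrite -mulrDl ler_wpM2r ?invr_ge0// /schwartz_weight.
rewrite -(real_normK (num_real y.1)) -(real_normK (num_real y.2)).
have := normr_ge0 y.1; have := normr_ge0 y.2.
by move: `|y.1| `|y.2| => u v u0 v0; nra.
Qed.

(** The quantisation error [2 w_2 / m] also controls the weight at the difference:
    [1 + 2 w_2 <= 3 w_2], whence [3^n] and the [2 n] in the exponent. *)
Let cell2_bound m n M p y : (0 < m)%N -> 0 <= M -> @cell2 m p y != 0 ->
  norm1 (y - cell2_pt p) * w n (y - cell2_pt p) * M * w n y
  <= 2 * 3 ^+ n * M / m%:R * w (2 + 2 * n + n) y.
Proof.
move=> m0 M0 h; have hc := cell2_close m0 h.
have M1 : 1 <= m%:R :> R by rewrite ler1n.
have W2 := weight_ge1 2 y.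
have hw : w n (y - cell2_pt p) <= 3 ^+ n * w (2 * n) y.
  have -> : w n (y - cell2_pt p) = (1 + norm1 (y - cell2_pt p)) ^+ n.
    by rewrite /norm1 addrA.
  have -> : w (2 * n) y = (w 2 y) ^+ n by rewrite /schwartz_weight exprM.
  rewrite -exprMn lerXn2r ?nnegrE ?addr_ge0 ?norm1_ge0 ?mulr_ge0 ?weight_ge0//.
  apply: (@le_trans _ _ (1 + 2 * w 2 y)); last by lra.
  rewrite lerD2l (le_trans hc)// ler_pdivrMr ?(lt_le_trans ltr01)//.
  by rewrite ler_peMr// mulr_ge0// weight_ge0.
rewrite -(weight_exp (2 + 2 * n) n) -(weight_exp 2 (2 * n)).
apply: (@le_trans _ _ ((2 * w 2 y / m%:R) * (3 ^+ n * w (2 * n) y) * M * w n y)).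
  rewrite ler_wpM2r ?weight_ge0// ler_wpM2r// ler_pM ?weight_ge0//.
  exact: norm1_ge0.
rewrite le_eqVlt; apply/orP; left; apply/eqP.
by move: (w 2 y) (w (2 * n) y) (w n y) (m%:R^-1) (3 ^+ n) => a b c d e; ring.
Qed.

(** In place of a vector-valued integral, [eta] is cut along the cells of step [1 / m] and each
    piece is treated as a point mass. Since the cells sum to 1, the errors recombine into one
    weighted integral of [|eta|] divided by [m]. *)
Theorem exchange eta : rapid eta ->
  g (conv eta phi) = int2 (fun y => eta y * g (fun z => phi (z - y))).
Proof.
move=> er; apply/eqP; rewrite -subr_eq0 -[X in X == 0]/(defect eta).
have [n [C [M [[CM C0 M0] [hC hM]]]]] := exchange_cst.
pose N := (2 + 2 * n + n)%N.
have iN := rapid_weight_L1 N er.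
pose I := int2 (fun y => w N y * `|eta y|).
suff hm m : (0 < m)%N -> `|defect eta| <= (2 * C * (2 * 3 ^+ n * M) * I) / m%:R.
  rewrite -normr_le0; apply/ler_addgt0Pr => e e0; rewrite add0r.
  pose A := 2 * C * (2 * 3 ^+ n * M) * I.
  have A0 : 0 <= A.
    by rewrite !mulr_ge0// ?exprn_ge0// int2_ge0// => y; rewrite mulr_ge0 ?weight_ge0.
  pose m := (Num.bound (A / e)).+1.
  apply: (le_trans (hm m isT)); rewrite ler_pdivrMr ?ltr0n// [e * _]mulrC -ler_pdivrMr//.
  have := @archi_boundP _ (A / e) (divr_ge0 A0 (ltW e0)).
  by move=> /ltW h; apply: (le_trans h); rewrite ler_nat.
move=> m0.
have r2 p : rapid (fun y => @cell2 m p y * eta y).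
  apply: (rapid_mul (c := 1)) => //; first exact: meas2_cell.
  by move=> y; have /andP[c0 c1] := cell2_01 p y m0; rewrite ger0_norm.
have -> : eta = (fun y => \sum_p @cell2 m p y * eta y).
  by apply/funext => y; rewrite -mulr_suml cell2_sum mul1r.
rewrite (additive_sum _ defectD r2).
have cN p : L1 (fun y => @cell2 m p y * (w N y * `|eta y|)).
  have h1 y : `|@cell2 m p y| <= 1.
    by have /andP[c0 c1] := cell2_01 p y m0; rewrite ger0_norm.
  have := L1_bounded_mul iN (meas2_cell m p.1 p.2) h1.
  by congr L1; apply/funext => y; rewrite mulrC.
pose c := 2 * 3 ^+ n * M / m%:R.
have pt p y : `|@cell2 m p y * eta y| * (norm1 (y - cell2_pt p) * w n (y - cell2_pt p) * M * w n y)
    <= c * (@cell2 m p y * (w N y * `|eta y|)).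
  have /andP[c0 c1] := cell2_01 p y m0.
  have [h|h] := eqVneq (@cell2 m p y) 0; first by rewrite h mul0r normr0 !mul0r mulr0.
  have := cell2_bound n m0 M0 h; rewrite -/N -/c => hb.
  rewrite normrM (ger0_norm c0).
  apply: (le_trans (ler_wpM2l (mulr_ge0 c0 (normr_ge0 _)) hb)).
  rewrite le_eqVlt; apply/orP; left; apply/eqP.
  by move: (w _ _) (@cell2 _ _ _) `|_| => a b d; ring.
have Bi p : L1 (fun y => `|@cell2 m p y * eta y| *
     (norm1 (y - cell2_pt p) * w n (y - cell2_pt p) * M * w n y)).
  apply: (L1_le _ (L1Z c (cN p))).
    have mw k q : meas2 (fun y => w k (y - q)).
      apply: continuous_meas2 => y; apply: (cvg_comp (fun y => y - q) (w k)); last exact: continuous_weight.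
      by apply: cvgB; [exact: cvg_id|exact: cvg_cst].
    apply: meas2M; first exact: (measurableT_comp _ (r2 p).1).
    apply: meas2M; last by apply: continuous_meas2; exact: continuous_weight.
    apply: meas2M; last exact: measurable_cst.
    apply: meas2M; last exact: mw.
    apply: continuous_meas2 => y; apply: cvgD; apply: cvg_norm.
      by apply: cvgB; [exact: continuous_fst2|exact: cvg_cst].
    by apply: cvgB; [exact: continuous_snd2|exact: cvg_cst].
  move=> y; rewrite ger0_norm//.
  by rewrite mulr_ge0// mulr_ge0 ?weight_ge0// mulr_ge0// mulr_ge0 ?norm1_ge0 ?weight_ge0.
rewrite (le_trans (ler_norm_sum _ _ _))//.
apply: (@le_trans _ _ (\sum_p 2 * C * (c * int2 (fun y => @cell2 m p y * (w N y * `|eta y|))))).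
  apply: ler_sum => p _.
  apply: (le_trans (defect_cell C0 (r2 p) hM hC (Bi p))).
  rewrite ler_wpM2l ?mulr_ge0// -(int2Z _ (cN p)).
  by apply: int2_le => //; exact: L1Z.
rewrite -mulr_sumr -mulr_sumr.
have rr p : rapid (fun y => @cell2 m p y * (w N y * `|eta y|)).
  have [me re] := er; split.
    by apply: meas2M; [exact: meas2_cell|exact: (L1_meas iN)].
  move=> k; have [D hD] := re (k + N)%N; exists D => y.
  have /andP[c0 c1] := cell2_01 p y m0.
  have wn := mulr_ge0 (weight_ge0 N y) (normr_ge0 (eta y)).
  rewrite (ger0_norm (mulr_ge0 c0 wn)); apply: le_trans (hD y).
  by rewrite -weight_exp -mulrA ler_wpM2l ?weight_ge0// ler_piMl.
rewrite -(additive_sum _ int2_additive rr).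
have -> : (fun y => \sum_p @cell2 m p y * (w N y * `|eta y|)) = (fun y => w N y * `|eta y|).
  by apply/funext => y; rewrite -mulr_suml cell2_sum mul1r.
rewrite -/I /c le_eqVlt; apply/orP; left; apply/eqP.
by move: I (m%:R^-1) (3 ^+ n) => a b e; ring.
Qed.

End TestFunction.
End Exchange.

(** * Mollification and uniqueness *)

Section Smear.
Context (R : realType).
Local Notation w := (@schwartz_weight R).
Variable psi : R -> R * R -> R.
Hypothesis psiP : is_kernel_family psi.
Local Notation lam t := (t `^ 4^-1).
Implicit Types (phi : R * R -> R).

(** The transpose of mollification: [g (smear t phi)] is the integral of [phi] against the mollified
    [g], whence the reflected kernel. *)
Definition smear (s : R) phi : R * R -> R := conv (fun z => psi s (- z)) phi.

Lemma psi_opp_rapid s : 0 < s -> rapid (fun z => psi s (- z)).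
Proof. by move=> s0; apply: schwartz_rapid; apply: schwartz_opp; exact: psi_schwartz. Qed.

Lemma int2_opp (f : R * R -> R) : L1 f -> int2 (fun z => f (- z)) = int2 f.
Proof.
move=> fi; rewrite -(int2_reflect 0 fi); congr int2; apply/funext => z.
by rewrite sub0r.
Qed.

Lemma psi_integral s : 0 < s -> int2 (psi s) = 1.
Proof.
move=> s0; have := psi_cos psiP 0 s0; rewrite expr0n/= !expr0n/= addr0 mulr0 oppr0 expR0 => <-.
by congr int2; apply/funext => x; rewrite /dot !mul0r addr0 cos0 mulr1.
Qed.

Lemma schwartz_smear s phi : 0 < s -> schwartz phi -> schwartz (smear s phi).
Proof. by move=> s0 sp; apply: schwartz_conv => //; exact: psi_opp_rapid. Qed.

Lemma smearE s phi y : 0 < s -> schwartz phi ->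
  smear s phi y = int2 (fun x => psi s (x - y) * phi x).
Proof.
move=> s0 sp; rewrite /smear convC//; last exact: (rapid_L1 (psi_opp_rapid s0)).
by congr int2; apply/funext => x; rewrite opprB mulrC.
Qed.

Lemma psi_mass_ge0 n : 0 <= psi_mass psi n.
Proof. by apply: int2_ge0 => y; rewrite mulr_ge0// weight_ge0. Qed.

Lemma sbound_smear n s phi M : 0 < s <= 1 -> schwartz phi -> sbound n phi M ->
  sbound n (smear s phi) (M * psi_mass psi n).
Proof.
move=> /[dup] s01 /andP[s0 s1] sp hM; have M0 := sbound_ge0 hM.
have := sbound_conv (psi_opp_rapid s0) sp hM; apply: sbound_leM.
rewrite ler_wpM2l//; apply: le_trans (psi_mass_le psiP n s01).
rewrite -(int2_opp (psi_weight_L1 psiP n s0)) le_eqVlt; apply/orP; left; apply/eqP.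
by congr int2; apply/funext => y; rewrite weight_opp mulrC.
Qed.

(** Since [psi s] has integral 1, the difference is an average of increments of [phi]; one
    derivative is exchanged for the factor [s^(1/4)]. *)
Lemma sbound_smear_sub n s phi M : 0 < s <= 1 -> schwartz phi -> sbound n.+1 phi M ->
  sbound n (fun y => smear s phi y - phi y) (M * (lam s * psi_mass psi n.+1)).
Proof.
move=> /[dup] s01 /andP[s0 s1] sp hM t tn y; have M0 := sbound_ge0 hM.
have ss := schwartz_smear s0 sp; have st := schwartz_pderiv t sp.
have -> : (fun y => smear s phi y - phi y) = (fun y => (-1) * phi y + smear s phi y).
  by apply/funext => z; rewrite mulN1r addrC.
have pr := psi_opp_rapid s0; have pi := rapid_L1 pr.
rewrite pderiv_comb// pderiv_conv// mulN1r addrC.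
have ic := schwartz_conv_L1 y pi st.
have cL := L1Z (pderiv t phi y) pi.
have -> : conv (fun z => psi s (- z)) (pderiv t phi) y - pderiv t phi y =
    int2 (fun z => psi s (- z) * pderiv t phi (y - z) - pderiv t phi y * psi s (- z)).
  rewrite (int2B ic cL) (int2Z _ pi) (int2_opp (psi_L1 psiP s0)) psi_integral//.
  by rewrite mulr1.
pose B z := `|psi s (- z)| * (norm1 z * w n z).
have Bs : L1 (fun z => `|psi s z| * (norm1 z * w n z)).
  apply: (psi_moment_L1 psiP (n := n.+1) (c := 1) s0) => [|z].
    by apply: meas2M; apply: continuous_meas2; [exact: continuous_norm1|exact: continuous_weight].
  by rewrite mul1r ger0_norm ?mulr_ge0 ?weight_ge0 ?norm1_ge0 ?norm1_weight.
have BE : B = fun z => `|psi s (0 - z)| * (norm1 (0 - z) * w n (0 - z)).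
  by apply/funext => z; rewrite /B sub0r weight_opp /norm1/= !normrN.
have Bi : L1 B by rewrite BE; exact: (L1_reflect 0 Bs).
have hB : int2 B <= lam s * psi_mass psi n.+1.
  by rewrite BE (int2_reflect 0 Bs); exact: psi_incr_mass.
apply: le_trans (ler_wpM2l M0 hB).
rewrite -[X in X * _](ger0_norm (weight_ge0 n y)) -normrM -(int2Z _ (L1B ic cL)) -(int2Z _ Bi).
apply: int2_norm_le; [exact: L1Z (L1B ic cL)|exact: L1Z|move=> z].
rewrite normrM (ger0_norm (weight_ge0 n y)).
rewrite [pderiv t phi y * _]mulrC -mulrBr normrM mulrCA /B [M * _]mulrCA ler_wpM2l//.
have := sbound_incr (- z) sp hM tn y.
have -> : (fun x => phi (x - z) - phi x) = (fun x => (-1) * phi x + phi (x - z)).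
  by apply/funext => u; rewrite mulN1r addrC.
rewrite pderiv_comb//; last exact: schwartz_shift.
by rewrite pderiv_shift mulN1r addrC weight_opp /norm1/= !normrN [_ * M]mulrC.
Qed.

Lemma smear_psi s t x : 0 < s -> 0 < t ->
  smear s (fun y => psi t (x - y)) = (fun y => psi (s + t) (x - y)).
Proof.
move=> s0 t0; apply/funext => y; rewrite -(psi_semigroup psiP s0 t0) /smear /conv.
rewrite -(int2_opp (schwartz_conv_L1 (x - y) (psi_L1 psiP s0) (psi_schwartz psiP t0))).
congr int2; apply/funext => z; congr (_ * psi t _).
by rewrite opprB opprK addrA [RHS]addrAC.
Qed.

(** [exchange] for the reflected kernel, followed by the semigroup law. *)
Lemma mollify_add (g : (R * R -> R) -> R^o) s t x : tempered g -> 0 < s -> 0 < t ->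
  L1 (fun y => psi s (x - y) * (mollify (psi t) g y : R)) /\
  mollify (psi (s + t)) g x = int2 (fun y => psi s (x - y) * mollify (psi t) g y).
Proof.
move=> gt s0 t0; have ss := psi_schwartz psiP s0; have st := psi_schwartz psiP t0.
have so := schwartz_opp st; have er := schwartz_rapid (schwartz_reflect x ss).
have e y : (fun z => psi t (- (z - y))) = (fun z => psi t (y - z)).
  by apply/funext => z; rewrite opprB.
have i := exchange_L1 gt so er; have := exchange gt so er.
have -> : (fun y => psi s (x - y) * g (fun z => psi t (- (z - y)))) =
    (fun y => psi s (x - y) * mollify (psi t) g y).
  by apply/funext => y; rewrite e.
move=> <-; split.
  by move: i; congr L1; apply/funext => y; rewrite e.
rewrite /mollify; congr g; apply/funext => z.
rewrite -(psi_semigroup psiP s0 t0) /conv.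
rewrite -(int2_reflect x (schwartz_conv_L1 (x - z) (psi_L1 psiP s0) st)).
congr int2; apply/funext => y; congr (_ * psi t _).
by rewrite !opprB addrC addrA subrK.
Qed.

Lemma smear_exchange (g : (R * R -> R) -> R^o) t phi : tempered g -> 0 < t -> schwartz phi ->
  L1 (fun y => phi y * (mollify (psi t) g y : R)) /\
  g (smear t phi) = int2 (fun y => phi y * mollify (psi t) g y).
Proof.
move=> gt t0 sp; have st := psi_schwartz psiP t0; have so := schwartz_opp st.
have er := schwartz_rapid sp.
have e y : (fun z => psi t (- (z - y))) = (fun z => psi t (y - z)).
  by apply/funext => z; rewrite opprB.
have i := exchange_L1 gt so er; have := exchange gt so er.
have -> : (fun y => phi y * g (fun z => psi t (- (z - y)))) =
    (fun y => phi y * mollify (psi t) g y).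
  by apply/funext => y; rewrite e.
move=> <-; split.
  by move: i; congr L1; apply/funext => y; rewrite e.
congr g; apply/funext => z; rewrite smearE// /conv.
by congr int2; apply/funext => y; rewrite opprB mulrC.
Qed.

Lemma mollify_continuous (g : (R * R -> R) -> R^o) t : tempered g -> 0 < t ->
  continuous (fun x => mollify (psi t) g x : R).
Proof.
move=> gt t0; have so := schwartz_opp (psi_schwartz psiP t0).
have := translate_continuous gt so; rewrite /= => h.
rewrite (_ : (fun x => _) = (fun y => g (fun z => psi t (- (z - y))) : R)) //.
by apply/funext => x; rewrite /mollify; congr g; apply/funext => z; rewrite opprB.
Qed.

Lemma powR_exprn (a x : R) k : 0 <= a -> (a `^ x) ^+ k = (a ^+ k) `^ x.
Proof.
move=> a0; rewrite -(powR_mulrn k (powR_ge0 a x)) -(powR_mulrn k a0).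
by rewrite -(powRrM a x) -(powRrM a k%:R) mulrC.
Qed.

Lemma dyadic_root k : lam ((2^-1 : R) ^+ k) = (lam 2^-1) ^+ k.
Proof. by rewrite powR_exprn// invr_ge0. Qed.

Lemma lam_half_lt1 : lam (2^-1 : R) < 1.
Proof.
rewrite -[ltRHS](_ : 1 `^ 4^-1 = 1); last by rewrite powR1.
by apply: gt0_ltr_powR; rewrite ?nnegrE ?invr_gt0// invf_lt1// ltr1n.
Qed.

(** [g phi] differs from [g (smear t phi)] by [O(t^(1/4))], and the latter is the integral of [phi]
    against the mollified [g]; then [t = 2^-k] is sent to 0. *)
Lemma mollify_small_eq0 (g : (R * R -> R) -> R^o) c kappa phi :
  tempered g -> 0 < kappa ->
  (forall t x, 0 < t <= 1 -> `|mollify (psi t) g x| <= c * (lam t) `^ kappa) ->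
  schwartz phi -> g phi = 0.
Proof.
move=> gt kap gs sp; have pi := rapid_L1 (schwartz_rapid sp).
have [_ [n [C hC]]] := gt; have [M [M0 hM]] := schwartz_sbound n.+1 sp.
pose r := lam (2^-1 : R); have r0 : 0 < r by rewrite powR_gt0// invr_gt0.
pose A := `|C| * (M * psi_mass psi n.+1); pose D := `|c| * int2 (fun y => `|phi y|).
have bnd k : `|g phi : R| <= A * r ^+ k + D * (r `^ kappa) ^+ k.
  pose t := (2^-1 : R) ^+ k.
  have t0 : 0 < t by rewrite exprn_gt0// invr_gt0.
  have t01 : 0 < t <= 1 by rewrite t0 exprn_ile1// ?invr_ge0// invf_le1// ler1n.
  have lt : lam t = r ^+ k by exact: dyadic_root.
  have [i e] := smear_exchange gt t0 sp.
  have h2 : `|g (smear t phi) : R| <= D * (r `^ kappa) ^+ k.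
    have -> : (r `^ kappa) ^+ k = (lam t) `^ kappa.
      by rewrite lt powR_exprn// ltW.
    rewrite e /D -mulrA [int2 _ * _]mulrC mulrA -(int2Z _ (L1_norm pi)).
    apply: int2_norm_le => //; first exact/L1Z/L1_norm.
    move=> y; rewrite normrM mulrC ler_wpM2r// (le_trans (gs t y t01))//.
    by rewrite ler_wpM2r ?powR_ge0// ler_norm.
  have h1 : `|g (smear t phi) - g phi : R| <= A * r ^+ k.
    have ss := schwartz_smear t0 sp.
    rewrite -(temperedB gt ss sp).
    have := hC _ _ (schwartzB ss sp) (sbound_smear_sub t01 sp hM).
    move=> /le_trans; apply; rewrite lt /A.
    rewrite (_ : `|C| * _ * _ = `|C| * (M * (r ^+ k * psi_mass psi n.+1))); last first.
      by move: (psi_mass _ _) (r ^+ k) `|C| => a b d; ring.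
    rewrite ler_wpM2r ?ler_norm// !mulr_ge0// ?psi_mass_ge0// exprn_ge0// ltW//.
  rewrite -(subrK (g (smear t phi)) (g phi)) (le_trans (ler_normD _ _))// lerD//.
  by rewrite distrC.
have cv q a : 0 <= q < 1 -> a * q ^+ k @[k --> \oo] --> (0 : R).
  move=> /andP[q0 q1]; rewrite -[X in _ --> X](mulr0 a); apply: cvgM; first exact: cvg_cst.
  by apply: cvg_expr; rewrite ger0_norm.
have rk1 : r `^ kappa < 1.
  rewrite -[ltRHS](_ : 1 `^ kappa = 1); last by rewrite powR1.
  by apply: gt0_ltr_powR; rewrite ?nnegrE ?(ltW r0)// lam_half_lt1.
have lim0 : A * r ^+ k + D * (r `^ kappa) ^+ k @[k --> \oo] --> (0 : R).
  rewrite -[X in _ --> X]addr0; apply: cvgD; apply: cv.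
    by rewrite (ltW r0) lam_half_lt1.
  by rewrite powR_ge0.
apply/eqP; rewrite -normr_le0.
rewrite -lerN2; apply: (cvg_seq_le (cvgN lim0)) => k.
by rewrite lerN2.
Qed.

End Smear.

(** * Reconstruction *)

Section Sequences.
Context (R : realType).
Implicit Types (u : nat -> R) (q A B : R).

Lemma geometric_incr_bound u q B : 0 <= q < 1 ->
  (forall k, `|u k.+1 - u k| <= B * q ^+ k) -> forall k, `|u k - u 0%N| <= B / (1 - q).
Proof.
move=> /andP[q0 q1] hu k.
have B0 : 0 <= B by have := hu 0%N; rewrite expr0 mulr1; exact: le_trans.
have q1' : 0 < 1 - q by rewrite subr_gt0.
suff : `|u k - u 0%N| <= B * (1 - q ^+ k) / (1 - q).
  move=> /le_trans; apply; rewrite ler_wpM2r ?invr_ge0 ?(ltW q1')//.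
  by rewrite ler_piMr// gerBl exprn_ge0.
elim: k => [|k IH]; first by rewrite subrr normr0 expr0 subrr mulr0 mul0r.
rewrite -(subrK (u k) (u k.+1)) -addrA (le_trans (ler_normD _ _))//.
apply: (le_trans (lerD (hu k) IH)); rewrite le_eqVlt; apply/orP; left; apply/eqP.
by rewrite exprS; move: (q ^+ k) => p; field; rewrite gt_eqF.
Qed.

Lemma geometric_incr_cvg u q B : 0 <= q < 1 ->
  (forall k, `|u k.+1 - u k| <= B * q ^+ k) -> cvgn u.
Proof.
move=> /andP[q0 q1] hu; pose v j := u j.+1 - u j.
have sv : series v = fun k => u k - u 0%N.
  by apply/funext => k; rewrite /series/= telescope_sumr.
have cg : cvgn (series (geometric B q)) by apply: is_cvg_geometric_series; rewrite ger0_norm.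
have cn : cvgn [normed series v].
  apply: (series_le_cvg _ _ _ cg) => n; [exact: normr_ge0| |exact: hu].
  exact: le_trans (normr_ge0 _) (hu n).
have cs : cvgn (series v) by exact: normed_cvg.
have -> : u = (fun k => series v k + u 0%N).
  by apply/funext => k; rewrite sv subrK.
by apply: is_cvgD => //; exact: is_cvg_cst.
Qed.

(** The increments up to step [k] add up to at most [q / (q - 1)] times the last bound [B q^k]. *)
Lemma geometric_growth u q A B : 1 < q -> 0 <= B -> `|u 0%N| <= A ->
  (forall k, `|u k.+1 - u k| <= B * q ^+ k.+1) ->
  forall k, `|u k| <= (A + B * (q / (q - 1))) * q ^+ k.
Proof.
move=> q1 B0 u0 hu; have q0 : 0 < q - 1 by rewrite subr_gt0.
have A0 : 0 <= A by rewrite (le_trans _ u0).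
have c0 : 0 <= B * (q / (q - 1)).
  by rewrite mulr_ge0// divr_ge0 ?(ltW q0)// (le_trans ler01 (ltW q1)).
elim=> [|k IH]; first by rewrite expr0 mulr1 (le_trans u0)// lerDl.
rewrite -(subrK (u k) (u k.+1)) (le_trans (ler_normD _ _))//.
apply: (le_trans (lerD (hu k) IH)).
have qk : 0 <= q ^+ k by rewrite exprn_ge0// (le_trans ler01 (ltW q1)).
rewrite exprS !mulrA -mulrDl ler_wpM2r//.
rewrite -subr_ge0 (_ : _ - _ = A * (q - 1)); first by rewrite mulr_ge0// ltW.
by field; rewrite gt_eqF.
Qed.

End Sequences.

Lemma cvg_sumr (R : realType) (T : Type) (F : set_system T) (FF : Filter F)
    (I : Type) (r : seq I) (f : I -> T -> R) (l : I -> R) :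
  (forall i, f i x @[x --> F] --> l i) ->
  \sum_(i <- r) f i x @[x --> F] --> \sum_(i <- r) l i.
Proof.
move=> fl; elim: r => [|i r IH].
  by rewrite big_nil; under eq_fun do rewrite big_nil; exact: cvg_cst.
by rewrite big_cons; under eq_fun do rewrite big_cons; exact: cvgD.
Qed.

Lemma L1_sum (R : realType) (I : Type) (r : seq I) (T : I -> R * R -> R) :
  (forall i, L1 (T i)) -> L1 (fun y => \sum_(i <- r) T i y) /\
  int2 (fun y => \sum_(i <- r) T i y) = \sum_(i <- r) int2 (T i).
Proof.
move=> iT; elim: r => [|i r [IH1 IH2]].
  under eq_fun do rewrite big_nil; rewrite big_nil; split.
    exact: (rapid_L1 (@rapid0 R)).
  by have := int2Z 0 (rapid_L1 (@rapid0 R)); rewrite !mul0r.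
under eq_fun do rewrite big_cons; rewrite big_cons; split; first exact: L1D.
by rewrite int2D// IH2.
Qed.

Section Reconstruction.
Context (R : realType).
Local Notation w := (@schwartz_weight R).
Variable psi : R -> R * R -> R.
Hypothesis psiP : is_kernel_family psi.
Local Notation lam t := (t `^ 4^-1).
Implicit Types (phi : R * R -> R).
Variables (I : finType) (b : I -> R) (kappa Q : R).
Hypotheses (kappa0 : 0 < kappa) (bk : forall i, b i < kappa)
  (Q0 : 0 < Q) (bQ : forall i, kappa <= b i + Q).

(* [Q] only serves to control the growth for distances larger than 1. *)
Definition coherent (G : R * R -> (R * R -> R) -> R^o) (M : R) : Prop :=
  forall x y t, 0 < t <= 1 ->
    `|mollify (psi t) (G y) y - mollify (psi t) (G x) y : R|
    <= M * \sum_i (lam t) `^ (b i) * (d0 (y - x) `^ (kappa - b i) + d0 (y - x) `^ Q).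

Definition diag (G : R * R -> (R * R -> R) -> R^o) (t : R) (x : R * R) : R :=
  mollify (psi t) (G x) x.

Lemma d0_opp (u : R * R) : d0 (- u) = d0 u.
Proof. by rewrite /d0 /= !normrN. Qed.

Lemma d0_cvg0 (x : R * R) (a : R) : 0 < a -> d0 (y - x) `^ a @[y --> x] --> (0 : R).
Proof.
move=> a0; apply/cvgrPdist_le => e e0.
have c : d0 (y - x) @[y --> x] --> (0 : R).
  have -> : (0 : R) = d0 (x - x) by rewrite subrr /d0 /= normr0 sqrtr0 addr0.
  apply: (cvg_comp (fun y => y - x) (@d0 R)); last exact: continuous_d0.
  by apply: cvgB; [exact: cvg_id|exact: cvg_cst].
have e1 : 0 < e `^ a^-1 by exact: powR_gt0.
have n1 : \forall y \near x, `|0 - d0 (y - x)| <= e `^ a^-1.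
  exact: (@cvgr_dist_le _ _ _ _ _ _ _ c _ e1).
apply: filterS n1 => y; rewrite !sub0r !normrN !ger0_norm ?powR_ge0 ?d0_ge0// => h.
apply: (@le_trans _ _ ((e `^ a^-1) `^ a)).
  by apply: ge0_ler_powR; rewrite ?nnegrE ?d0_ge0 ?powR_ge0// ltW.
by rewrite -powRrM mulVf ?gt_eqF// powRr1// ltW.
Qed.

Lemma lam_gt0 (t : R) : 0 < t -> 0 < lam t. Proof. exact: powR_gt0. Qed.

(** Continuity in the base point of [G] is available only through coherence; it yields the
    measurability of [diag]. *)
Lemma diag_continuous G M t : (forall x, tempered (G x)) -> coherent G M ->
  0 < t <= 1 -> continuous (diag G t).
Proof.
move=> Gt GM t01 x; have /andP[t0 t1] := t01.
apply/cvgrPdist_le => e e0.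
have c1 := mollify_continuous psiP (Gt x) t0.
have c2 : M * (\sum_i (lam t) `^ (b i) * (d0 (y - x) `^ (kappa - b i) + d0 (y - x) `^ Q))
    @[y --> x] --> (0 : R).
  rewrite -[X in _ --> X](mulr0 M); apply: cvgM; first exact: cvg_cst.
  rewrite -[X in _ --> X](_ : \sum_(i : I) (lam t) `^ (b i) * (0 + 0) = 0); last first.
    by rewrite big1// => i _; rewrite addr0 mulr0.
  apply: (@cvg_sumr _ _ (nbhs x) _ _ _ (fun i y => (lam t) `^ (b i) *
    (d0 (y - x) `^ (kappa - b i) + d0 (y - x) `^ Q)) (fun i => (lam t) `^ (b i) * (0 + 0))) => i.
  apply: cvgM; first exact: cvg_cst.
  apply: cvgD; apply: d0_cvg0 => //.
  by rewrite subr_gt0.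
have e2 : 0 < e / 2 by exact: divr_gt0.
have n1 := @cvgr_dist_le _ _ _ _ _ _ _ (c1 x) _ e2.
have n2 := @cvgr_dist_le _ _ _ _ _ _ _ c2 _ e2.
near=> y.
have h1 : `|mollify (psi t) (G x) x - mollify (psi t) (G x) y : R| <= e / 2.
  by near: y; exact: n1.
have h2 := GM x y t t01.
have h3 : `|0 - (M * (\sum_i (lam t) `^ (b i) * (d0 (y - x) `^ (kappa - b i) + d0 (y - x) `^ Q)))| <= e / 2.
  by near: y; exact: n2.
rewrite sub0r normrN in h3.
rewrite /diag -(subrKA (mollify (psi t) (G x) y)) (le_trans (ler_normD _ _))//.
rewrite [leRHS]splitr lerD// distrC (le_trans h2)// (le_trans (ler_norm _))//.
Unshelve. all: by end_near. Qed.

(** The implication inside the existential lets a constant be chosen for every real [a]; for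
    negative [a] any value will do. *)
Lemma mom_exists (a : R) : exists C : R, 0 <= a -> 0 <= C /\ forall t, 0 < t <= 1 ->
  L1 (fun y => `|psi t y| * d0 y `^ a) /\
  int2 (fun y => `|psi t y| * d0 y `^ a) <= C * (lam t) `^ a.
Proof.
have [a0|a0] := leP 0 a; last by exists 0.
by have [C hC] := psi_d0_moment psiP a0; exists C.
Qed.

Let mom a : R := projT1 (cid (mom_exists a)).

Let momP a : 0 <= a -> 0 <= mom a /\ forall t, 0 < t <= 1 ->
  L1 (fun y => `|psi t y| * d0 y `^ a) /\
  int2 (fun y => `|psi t y| * d0 y `^ a) <= mom a * (lam t) `^ a.
Proof. exact: (projT2 (cid (mom_exists a))). Qed.

Definition step_cst : R := \sum_i (mom (kappa - b i) * 3 `^ (kappa - b i) + mom Q * 3 `^ Q).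

Lemma step_cst_ge0 : 0 <= step_cst.
Proof.
apply: sumr_ge0 => i _; have [m1 _] := momP (ltW Q0).
have kb : 0 <= kappa - b i by rewrite subr_ge0 ltW.
have [m2 _] := momP kb.
by rewrite addr_ge0// mulr_ge0// powR_ge0.
Qed.

Lemma lam_le3 (s t : R) : 0 < s -> 0 < t -> s <= 3 * t -> lam s <= 3 * lam t.
Proof.
move=> s0 t0 st; apply: (@le_trans _ _ (lam (3 * t))).
  have t30 : 0 <= 3 * t by rewrite mulr_ge0// ltW.
  by apply: ge0_ler_powR => //; rewrite ?nnegrE ?invr_ge0// ltW.
rewrite powRM ?(ltW t0)// ler_wpM2r ?powR_ge0//.
rewrite -[leRHS]powRr1//; apply: ler_powR; first by rewrite ler1n.
by rewrite invf_le1// ler1n.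
Qed.

(** [diag (s + t) x] averages the mollified [G x] with fixed base point, whereas in the convolution
    the base point moves with [y]. Coherence bounds the difference pointwise, and the moments of
    [psi s] turn powers of the distance into powers of [t^(1/4)]; the terms in [Q] use [t <= 1] and
    [kappa <= b i + Q]. *)
Lemma step_bound G M s t x : (forall z, tempered (G z)) -> coherent G M -> 0 <= M ->
  (exists K, forall y, `|diag G t y| <= K) ->
  0 < s <= 1 -> 0 < t <= 1 -> s <= 3 * t ->
  `|int2 (fun y => psi s (x - y) * diag G t y) - diag G (s + t) x|
   <= step_cst * M * (lam t) `^ kappa.
Proof.
move=> Gt GM M0 [K hK] s01 t01 st; have /andP[s0 s1] := s01; have /andP[t0 t1] := t01.
have mF : meas2 (diag G t) by apply: continuous_meas2; exact: diag_continuous GM _.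
have ps : L1 (fun y => psi s (x - y)) by apply: L1_reflect; exact: psi_L1.
have iF : L1 (fun y => psi s (x - y) * diag G t y) by exact: L1_bounded_mul hK.
have [iG e] := mollify_add psiP x (Gt x) s0 t0.
rewrite /diag in iF *; rewrite e -(int2B iF iG).
pose T i y := (lam t) `^ (b i) * (`|psi s (x - y)| * d0 (x - y) `^ (kappa - b i)
   + `|psi s (x - y)| * d0 (x - y) `^ Q).
have kb i : 0 <= kappa - b i by rewrite subr_ge0 ltW.
have ia a : 0 <= a -> L1 (fun y => `|psi s (x - y)| * d0 (x - y) `^ a).
  by move=> a0; have [_ /(_ _ s01)[i _]] := momP a0; exact: (L1_reflect x i).
have iT i : L1 (T i) by apply: L1Z; apply: L1D; apply: ia => //; exact: ltW.
have ma a : 0 <= a -> int2 (fun y => `|psi s (x - y)| * d0 (x - y) `^ a) <= mom a * (3 * lam t) `^ a.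
  move=> a0; have [m0 /(_ _ s01)[i h]] := momP a0.
  rewrite (int2_reflect x i) (le_trans h)// ler_wpM2l//.
  apply: ge0_ler_powR => //; rewrite ?nnegrE ?powR_ge0// ?mulr_ge0 ?powR_ge0//.
  exact: lam_le3.
have l0 := lam_gt0 t0; have l1 := root4_le1 t01.
have hT i : int2 (T i) <= (mom (kappa - b i) * 3 `^ (kappa - b i) + mom Q * 3 `^ Q) * (lam t) `^ kappa.
  have i1 := ia _ (kb i); have i2 := ia _ (ltW Q0).
  rewrite /T (int2Z _ (L1D i1 i2)) (int2D i1 i2).
  apply: (le_trans (ler_wpM2l (powR_ge0 _ _) (lerD (ma _ (kb i)) (ma _ (ltW Q0))))).
  rewrite !powRM ?powR_ge0// mulrDr mulrDl.
  have [m1 _] := momP (kb i); have [m2 _] := momP (ltW Q0).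
  apply: lerD.
    rewrite mulrCA mulrA -[leRHS]mulrA -mulrA ler_wpM2l//.
    rewrite mulrCA ler_wpM2l ?powR_ge0// -powRD.
      by rewrite [b i + _]addrC subrK.
    by apply/implyP => _; rewrite (gt_eqF l0).
  rewrite mulrCA mulrA -[leRHS]mulrA -mulrA ler_wpM2l//.
  rewrite mulrCA ler_wpM2l ?powR_ge0// -powRD.
    by rewrite ger_powR// l0.
  by apply/implyP => _; rewrite (gt_eqF l0).
apply: (@le_trans _ _ (M * \sum_i int2 (T i))); last first.
  rewrite mulrAC [leRHS]mulrC ler_wpM2l// /step_cst mulr_suml.
  by apply: ler_sum => i _; exact: hT.
have [iS sE] := L1_sum (index_enum I) iT.
rewrite -sE -(int2Z _ iS); apply: int2_norm_le; [exact: L1B|exact: L1Z|move=> y].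
rewrite -mulrBr normrM.
apply: (le_trans (ler_wpM2l (normr_ge0 _) (GM x y t t01))).
rewrite mulrCA ler_wpM2l// mulr_sumr; apply: ler_sum => i _.
by rewrite /T -d0_opp opprB mulrCA mulrDr.
Qed.

End Reconstruction.

(** Source of the factor 3 in [step_bound]: a dyadic [z] with [z <= T / 2 < 2 z] leaves a remaining
    time [T - z] of at most [3 z]. *)
Lemma sub_le3 (R : realType) (T z : R) : T / 2 < 2 * z -> T - z <= 3 * z.
Proof. by move=> h; lra. Qed.

Lemma lt_half_of_double (R : realType) (T u v z : R) :
  0 < u -> u + u = v -> v <= T / 2 -> z <= u -> z < T / 2.
Proof. by move=> *; lra. Qed.

Lemma half_le (R : realType) (T : R) : 0 < T -> T / 2 <= T.
Proof. by move=> *; lra. Qed.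

(** * Existence of the limit and its distance to the approximations *)

Section Bootstrap.
Context (R : realType).
Local Notation w := (@schwartz_weight R).
Variable psi : R -> R * R -> R.
Hypothesis psiP : is_kernel_family psi.
Local Notation lam t := (t `^ 4^-1).
Implicit Types (phi : R * R -> R).
Variables (F : R -> R * R -> R) (kappa D K0 : R) (m0 : nat).
Hypotheses (kappa0 : 0 < kappa) (D0 : 0 <= D)
  (Fm : forall t, 0 < t <= 1 -> meas2 (F t))
  (Fb : forall t x, 0 < t <= 1 -> `|F t x| <= K0 * (lam t) `^ (- (m0%:R + 2^-1)))
  (Fstep : forall s t x, 0 < s <= 1 -> 0 < t <= 1 -> s <= 3 * t ->
    `|int2 (fun y => psi s (x - y) * F t y) - F (s + t) x| <= D * (lam t) `^ kappa).

Let r : R := lam (2^-1).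
Let h k : R := (2^-1) ^+ k.
Let f k phi : R := int2 (fun y => F (h k) y * phi y).

Let r0 : 0 < r. Proof. by rewrite powR_gt0// invr_gt0. Qed.
Let r1 : r < 1. Proof. exact: lam_half_lt1. Qed.
Let h0 k : 0 < h k. Proof. by rewrite exprn_gt0// invr_gt0. Qed.
Let h1 k : h k <= 1. Proof. by rewrite exprn_ile1// ?invr_ge0// invf_le1// ler1n. Qed.
Let h01 k : 0 < h k <= 1. Proof. by rewrite h0 h1. Qed.
Let hS k : h k.+1 + h k.+1 = h k.
Proof. by rewrite /h exprS -mulrDl -mulr2n -[2^-1 *+ 2]mulr_natr mulVf ?mul1r// pnatr_eq0. Qed.
Let lamh k a : (lam (h k)) `^ a = (r `^ a) ^+ k.
Proof. by rewrite powR_exprn ?(ltW r0)// /h dyadic_root. Qed.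

Let F_bounded t : 0 < t <= 1 -> exists c, forall y, `|F t y| <= c.
Proof.
by move=> t01; exists (K0 * (lam t) `^ (- (m0%:R + 2^-1))) => y; exact: Fb.
Qed.

Let F_L1 t phi : 0 < t <= 1 -> L1 phi -> L1 (fun y => F t y * phi y).
Proof.
move=> t01 pi; have [c hc] := F_bounded t01.
have := L1_bounded_mul pi (Fm t01) hc.
by congr L1; apply/funext => y; rewrite mulrC.
Qed.

Let smear_fubini s t phi : 0 < s -> 0 < t <= 1 -> schwartz phi ->
  L1 (fun x => int2 (fun y => psi s (x - y) * F t y) * phi x) /\
  int2 (fun y => F t y * smear psi s phi y) =
  int2 (fun x => int2 (fun y => psi s (x - y) * F t y) * phi x).
Proof.
move=> s0 t01 sp; have [c hc] := F_bounded t01.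
have pr := schwartz_rapid sp; have [c' hc'] := rapid_bounded pr.
have [i1 i2 e] := fubini_conv (psi_L1 psiP s0) (Fm t01) hc (rapid_L1 pr) hc'.
split => //; rewrite e; congr int2; apply/funext => y; congr (_ * _).
exact: smearE.
Qed.

Let consecutive k phi : schwartz phi ->
  `|int2 (fun x => (int2 (fun y => psi (h k.+1) (x - y) * F (h k.+1) y) - F (h k) x) * phi x)|
  <= D * (r `^ kappa) ^+ k.+1 * int2 (fun y => `|phi y|).
Proof.
move=> sp; have pi := rapid_L1 (schwartz_rapid sp).
have [i _] := smear_fubini (h0 k.+1) (h01 k.+1) sp.
have i2 := F_L1 (h01 k) pi.
rewrite -(int2Z _ (L1_norm pi)); apply: int2_norm_le.
- by have := L1B i i2; congr L1; apply/funext => x; rewrite mulrBl.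
- exact/L1Z/L1_norm.
move=> x; rewrite normrM ler_wpM2r// -lamh -(hS k); apply: Fstep => //.
by rewrite -[leLHS]mul1r ler_pM2r// ler1n.
Qed.

(** Fubini moves the smearing from the test function to [F]; the identity separates the error of
    smearing [phi] from the error in the approximate semigroup property of [F]. *)
Let incrE k phi : schwartz phi -> f k.+1 phi - f k phi =
  - f k.+1 (fun y => smear psi (h k.+1) phi y - phi y) +
  int2 (fun x => (int2 (fun y => psi (h k.+1) (x - y) * F (h k.+1) y) - F (h k) x) * phi x).
Proof.
move=> sp; have pi := rapid_L1 (schwartz_rapid sp).
have ss := schwartz_smear psiP (h0 k.+1) sp; have si := rapid_L1 (schwartz_rapid ss).
have [i e] := smear_fubini (h0 k.+1) (h01 k.+1) sp.
have i2 := F_L1 (h01 k) pi.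
have -> : f k.+1 (fun y => smear psi (h k.+1) phi y - phi y) =
    int2 (fun y => F (h k.+1) y * smear psi (h k.+1) phi y) - f k.+1 phi.
  rewrite /f -(int2B (F_L1 (h01 k.+1) si) (F_L1 (h01 k.+1) pi)).
  by congr int2; apply/funext => y; rewrite mulrBr.
rewrite e.
have -> : (fun x => (int2 (fun y => psi (h k.+1) (x - y) * F (h k.+1) y) - F (h k) x) * phi x) =
    (fun x => int2 (fun y => psi (h k.+1) (x - y) * F (h k.+1) y) * phi x - F (h k) x * phi x).
  by apply/funext => x; rewrite mulrBl.
rewrite (int2B i i2) -/(f k phi); move: (int2 _) (f _ _) (f _ _) => a b c; ring.
Qed.

Let jm : R := int2 (@jap R).

Let jm0 : 0 <= jm. Proof. by apply: int2_ge0 => y; exact: jap_ge0. Qed.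

Let L1norm_sbound n phi L : schwartz phi -> (4 <= n)%N -> sbound n phi L ->
  int2 (fun y => `|phi y|) <= L * jm.
Proof.
move=> sp n4 hL; have pi := rapid_L1 (schwartz_rapid sp).
rewrite -(int2Z _ (@L1_jap R)); apply: int2_le; [exact: L1_norm|exact/L1Z/L1_jap|move=> y].
have := sbound_pt y (sbound_le n4 hL) => hy.
apply: le_trans (ler_wpM2r (jap_ge0 y) hy).
by rewrite mulrAC ler_peMl// weight4_jap.
Qed.

(* The hypothesis only bounds [F t] by a negative power of [t]; since
   [smear psi s phi - phi] is small of order [s^(1/4)] at the cost of one
   derivative, the exponent [a] can be lowered step by step until the increments
   of [f k phi] are summable. *)
Definition tame (a : R) (n : nat) (K : R) : Prop := 0 <= K /\
  forall phi L k, schwartz phi -> sbound n phi L ->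
    `|f k phi| <= K * L * (r `^ (- a)) ^+ k.

Let tame_init : exists n K, (4 <= n)%N /\ tame (m0%:R + 2^-1) n K.
Proof.
exists 4%N, (`|K0| * jm); split => //; split; first exact: mulr_ge0.
move=> phi L k sp hL; have pi := rapid_L1 (schwartz_rapid sp).
have := L1norm_sbound sp (leqnn 4) hL => hj.
apply: (@le_trans _ _ ((`|K0| * (r `^ (- (m0%:R + 2^-1))) ^+ k) * int2 (fun y => `|phi y|))).
  rewrite -(int2Z _ (L1_norm pi)); apply: int2_norm_le; first exact: F_L1.
    exact/L1Z/L1_norm.
  move=> y; rewrite normrM ler_wpM2r//; apply: (le_trans (Fb y (h01 k))).
  by rewrite lamh ler_wpM2r ?ler_norm// exprn_ge0// powR_ge0.
rewrite [leRHS](_ : _ = (`|K0| * (r `^ (- (m0%:R + 2^-1))) ^+ k) * (L * jm)).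
  by rewrite ler_wpM2l// mulr_ge0// exprn_ge0// powR_ge0.
move: jm (_ ^+ k) `|K0| => x y z; ring.
Qed.

Let pm n := psi_mass psi n.

(** In [incrE] the first term is tameness applied to [smear phi - phi], which is small of order
    [r^(k+1)]; the second is the step hypothesis. *)
Let incr_tame a n K phi L k : (4 <= n)%N -> tame a n K -> schwartz phi -> sbound n.+1 phi L ->
  `|f k.+1 phi - f k phi| <= K * L * pm n.+1 * (r `^ (1 - a)) ^+ k.+1
     + D * L * jm * (r `^ kappa) ^+ k.+1.
Proof.
move=> n4 [Kn hK] sp hL; rewrite incrE// (le_trans (ler_normD _ _))// lerD//.
  have ss := schwartz_smear psiP (h0 k.+1) sp.
  have := hK _ _ k.+1 (schwartzB ss sp) (sbound_smear_sub psiP (h01 k.+1) sp hL).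
  rewrite normrN => /le_trans; apply; rewrite /h dyadic_root -/r -/(pm n.+1).
  have -> : (r `^ (1 - a)) ^+ k.+1 = r ^+ k.+1 * (r `^ (- a)) ^+ k.+1.
    rewrite -exprMn -[X in (X * _) ^+ _](powRr1 (ltW r0)) -powRD//.
    by apply/implyP => _; rewrite gt_eqF.
  rewrite le_eqVlt; apply/orP; left; apply/eqP.
  by move: (_ ^+ k.+1) (_ ^+ k.+1) (pm _) => x y z; ring.
have hj := L1norm_sbound sp n4 (sbound_le (leqnSn n) hL).
apply: (le_trans (consecutive k sp)).
rewrite [leRHS](_ : _ = D * (r `^ kappa) ^+ k.+1 * (L * jm)).
  by rewrite ler_wpM2l// mulr_ge0// exprn_ge0// powR_ge0.
by move: jm (_ ^+ k.+1) => x y; ring.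
Qed.

Let rgt1 a : a < 0 -> 1 < r `^ a.
Proof.
move=> a0; rewrite -(opprK a) powRN invf_gt1 ?powR_gt0//.
rewrite -[ltRHS](_ : 1 `^ (- a) = 1); last by rewrite powR1.
by apply: gt0_ltr_powR; rewrite ?oppr_gt0 ?nnegrE ?(ltW r0).
Qed.

Let rlt1 a : 0 < a -> 0 <= r `^ a < 1.
Proof.
move=> a0; rewrite powR_ge0/=.
rewrite -[ltRHS](_ : 1 `^ a = 1); last by rewrite powR1.
by apply: gt0_ltr_powR; rewrite ?nnegrE ?(ltW r0).
Qed.

(** The increments grow like [r^(- a k)], a geometric sequence of ratio above 1 because [a > 0];
    hence so does [f k phi]. *)
Let tame_step a n K : 0 < a -> (4 <= n)%N -> tame (a + 1) n K ->
  exists n' K', (4 <= n')%N /\ tame a n' K'.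
Proof.
move=> a0 n4 tK; have [Kn hK] := tK.
pose q := r `^ (- a); have q1 : 1 < q by apply: rgt1; rewrite oppr_lt0.
pose B := K * pm n.+1 + D * jm.
have pm0 : 0 <= pm n.+1 by exact: psi_mass_ge0.
have B0 : 0 <= B by rewrite addr_ge0// mulr_ge0.
have q10 : 0 <= q / (q - 1).
  by rewrite divr_ge0 ?subr_ge0 ?(ltW q1)// (le_trans ler01 (ltW q1)).
exists n.+1, (K + B * (q / (q - 1))); split; first exact: leqW.
split; first by rewrite addr_ge0// mulr_ge0.
move=> phi L k sp hL; have L0 := sbound_ge0 hL.
have u0 : `|f 0 phi| <= K * L.
  by have := hK _ _ 0%N sp (sbound_le (leqnSn n) hL); rewrite expr0 mulr1.
have BL0 : 0 <= B * L by rewrite mulr_ge0.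
have hi j : `|f j.+1 phi - f j phi| <= B * L * q ^+ j.+1.
  apply: (le_trans (incr_tame j n4 tK sp hL)).
  rewrite (_ : 1 - (a + 1) = - a); last by rewrite opprD addrCA subrr addr0.
  rewrite -/q [leRHS](_ : _ = K * L * pm n.+1 * q ^+ j.+1 + D * L * jm * q ^+ j.+1).
    rewrite lerD2l ler_wpM2l ?mulr_ge0//.
    have /andP[k0 k1] := rlt1 kappa0.
    rewrite (@le_trans _ _ 1)// ?exprn_ile1 ?(ltW k1)// exprn_ege1// ltW//.
  by rewrite /B; move: (pm _) jm (q ^+ _) => x y z; ring.
have := geometric_growth q1 BL0 u0 hi k.
by rewrite -[B * L * _]mulrAC -mulrDl.
Qed.

(** The exponents run through [m + 1/2]: every step ends at a positive exponent, where the geometric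
    ratio exceeds 1, and the last one, [1/2], is below 1, so that the next increments decay. *)
Lemma tame_half : exists n K, (4 <= n)%N /\ tame 2^-1 n K.
Proof.
suff H m : (exists n K, (4 <= n)%N /\ tame (m%:R + 2^-1) n K) ->
    exists n K, (4 <= n)%N /\ tame 2^-1 n K by exact: (H m0 tame_init).
elim: m => [|m IH]; first by rewrite add0r.
move=> [n [K [n4 tK]]]; apply: IH; apply: (tame_step (n := n) (K := K)) => //.
by rewrite addrAC natr1.
Qed.

Let half_lt1 : (2^-1 : R) < 1. Proof. by rewrite invf_lt1// ltr1n. Qed.

Let rate : R := Num.max (r `^ (1 - 2^-1)) (r `^ kappa).

Let rate01 : 0 <= rate < 1.
Proof.
have /andP[a0 a1] := @rlt1 (1 - 2^-1) (etrans (subr_gt0 _ _) half_lt1).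
have /andP[b0 b1] := rlt1 kappa0.
by rewrite /rate le_max a0/= gt_max a1 b1.
Qed.

Let incr_rate : exists n B, 0 <= B /\ forall phi L, schwartz phi -> sbound n phi L ->
  `|f 0 phi| <= B * L /\ forall k, `|f k.+1 phi - f k phi| <= (B * L) * rate ^+ k.
Proof.
have [n [K [n4 tK]]] := tame_half; have [Kn hK] := tK.
have pm0 : 0 <= pm n.+1 by exact: psi_mass_ge0.
exists n.+1, (K + (K * pm n.+1 + D * jm)); split.
  by rewrite !addr_ge0 ?mulr_ge0.
move=> phi L sp hL; have L0 := sbound_ge0 hL; split.
  have := hK _ _ 0%N sp (sbound_le (leqnSn n) hL); rewrite expr0 mulr1.
  move=> /le_trans; apply; rewrite ler_wpM2r// lerDl.
  by rewrite addr_ge0 ?mulr_ge0.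
move=> k; apply: (le_trans (incr_tame k n4 tK sp hL)).
have /andP[q0 q1] := rate01.
have hq a : 0 < a -> r `^ a <= rate -> (r `^ a) ^+ k.+1 <= rate ^+ k.
  move=> a0 ha; apply: (@le_trans _ _ (rate ^+ k.+1)).
    by rewrite lerXn2r ?nnegrE ?powR_ge0.
  by rewrite exprS ler_piMl ?exprn_ge0// ltW.
apply: (@le_trans _ _ ((K * L * pm n.+1 + D * L * jm) * rate ^+ k)).
  rewrite [leRHS]mulrDl; apply: lerD; rewrite ler_wpM2l ?mulr_ge0// hq//.
  - by rewrite subr_gt0.
  - by rewrite le_max lexx.
  - by rewrite le_max lexx orbT.
rewrite ler_wpM2r ?exprn_ge0// mulrDl -[leLHS]add0r lerD ?mulr_ge0//.
rewrite le_eqVlt; apply/orP; left; apply/eqP.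
by move: (pm _) jm => y z; ring.
Qed.

(** A pointwise limit taken for every function; it is claimed to exist for Schwartz functions only,
    and these are all that [tempered] looks at. *)
Definition recon_limit phi : R^o := limn (fun k => f k phi).

Let f_cvg phi : schwartz phi -> f k phi @[k --> \oo] --> (recon_limit phi : R).
Proof.
move=> sp; have [n [B [B0 hB]]] := incr_rate; have [L [L0 hL]] := schwartz_sbound n sp.
have [_ h3] := hB phi L sp hL.
exact: (geometric_incr_cvg rate01 h3).
Qed.

Lemma recon_limit_tempered : tempered recon_limit.
Proof.
split.
  move=> a phi chi sp sc; apply: cvg_lim => //.
  have e k : f k (fun x => a * phi x + chi x) = a * f k phi + f k chi.
    have i1 := F_L1 (h01 k) (rapid_L1 (schwartz_rapid sp)).
    have i2 := F_L1 (h01 k) (rapid_L1 (schwartz_rapid sc)).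
    rewrite /f -(int2Z _ i1) -(int2D (L1Z a i1) i2).
    by congr int2; apply/funext => y; rewrite mulrDr mulrCA.
  under eq_fun do rewrite e.
  by apply: cvgD; [apply: cvgM; [exact: cvg_cst|exact: f_cvg]|exact: f_cvg].
have [n [B [B0 hB]]] := incr_rate.
exists n, (B + B / (1 - rate)) => phi M sp hM.
have [h2 h3] := hB phi M sp hM.
have hk k : `|f k phi| <= (B + B / (1 - rate)) * M.
  rewrite -(subrK (f 0 phi) (f k phi)) (le_trans (ler_normD _ _))//.
  rewrite mulrDl [leRHS]addrC lerD// [leRHS]mulrAC.
  exact: (geometric_incr_bound rate01 h3 k).
have fc := f_cvg sp.
rewrite ler_norml; apply/andP; split; last first.
  by apply: (cvg_seq_le fc) => k; rewrite (le_trans (ler_norm _)).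
rewrite lerNl; apply: (cvg_seq_le (cvgN fc)) => k.
by rewrite (le_trans (ler_norm _))// normrN.
Qed.

Let dyadic_scale T : 0 < T <= 1 -> exists m, h m <= T / 2 < 2 * h m.
Proof.
move=> /andP[T0 T1].
have ex : exists k, h k <= T / 2.
  have c : h k @[k --> \oo] --> (0 : R) by apply: cvg_expr; rewrite ger0_norm ?invr_ge0.
  have T2 : 0 < T / 2 by exact: divr_gt0.
  have [k _ hk] := @cvgr_dist_le _ _ _ _ _ _ _ c _ T2.
  exists k; have := hk k (leqnn k); rewrite /= sub0r normrN ger0_norm// ltW//.
case: (ex_minnP ex) => m hm mmin; exists m; rewrite hm/=.
case: m hm mmin => [|m] hm mmin.
  by move: hm; rewrite /h expr0 => hm; lra.
rewrite (_ : 2 * h m.+1 = h m); last by rewrite -(hS m) -[RHS]mulr2n mulr_natl.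
rewrite ltNge; apply/negP => hm'.
by have := mmin m hm'; rewrite ltnn.
Qed.

Definition recon_cst : R := psi_mass psi 0 / (1 - r `^ kappa) + 1.

(** Pairing [F (h k)] with [psi T] itself would leave smearing errors whose constants depend on [T].
    Paired with [psi (T - h k)] instead, the semigroup law makes consecutive terms differ by the
    step error only, so they telescope with a constant independent of [T]. At [k = m] the pairing is
    [F T] up to one more step, and as [k] grows it merges with [f k] at [psi T]. *)
Lemma recon_limit_bound T x : 0 < T <= 1 ->
  `|mollify (psi T) recon_limit x - F T x : R| <= recon_cst * D * (lam T) `^ kappa.
Proof.
move=> /[dup] T01 /andP[T0 T1]; have [m /andP[m1 m2]] := dyadic_scale T01.
have hle i j : (i <= j)%N -> h j <= h i.
  by move=> ij; apply: ler_wiXn2l => //; rewrite ?invr_ge0// ltW.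
have hT : h m < T.
  by rewrite (le_lt_trans m1)// ltr_pdivrMr// ltr_pMr// ltr1n.
have Th k : (m <= k)%N -> 0 < T - h k.
  by move=> /hle mk; rewrite subr_gt0 (le_lt_trans mk).
have Th1 k : T - h k <= 1 by rewrite (le_trans _ T1)// gerBl ltW.
pose chi k y := psi (T - h k) (x - y).
have sch k : (m <= k)%N -> schwartz (chi k).
  by move=> mk; apply: schwartz_reflect; apply: (psi_schwartz psiP); exact: Th.
have sph : schwartz (fun y => psi T (x - y)).
  by apply: schwartz_reflect; exact: (psi_schwartz psiP).
pose A k := int2 (fun y => F (h k) y * chi k y).
have smch k : (m <= k)%N -> smear psi (h k.+1) (chi k) = chi k.+1.
  move=> mk; rewrite /chi (smear_psi psiP x (h0 k.+1) (Th k mk)).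
  apply/funext => y; congr (psi _ _); rewrite -(hS k); ring.
have massle k : (m <= k)%N -> int2 (fun y => `|chi k y|) <= pm 0.
  move=> mk; have Tk := Th k mk.
  have Tk1 : 0 < T - h k <= 1 by rewrite Tk Th1.
  apply: le_trans (psi_mass_le psiP 0 Tk1).
  rewrite /chi (int2_reflect x (L1_norm (psi_L1 psiP Tk))).
  rewrite le_eqVlt; apply/orP; left; apply/eqP; congr int2; apply/funext => y.
  by rewrite /schwartz_weight expr0 mulr1.
have /andP[q0 q1] := rlt1 kappa0.
have Aincr k : (m <= k)%N -> `|A k.+1 - A k| <= D * pm 0 * (r `^ kappa) ^+ k.
  move=> mk; have sk := sch k mk; have pi := rapid_L1 (schwartz_rapid sk).
  have [i e] := smear_fubini (h0 k.+1) (h01 k.+1) sk.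
  have i2 := F_L1 (h01 k) pi.
  rewrite /A -(smch k mk) e -(int2B i i2).
  have := consecutive k sk.
  have -> : (fun x => (int2 (fun y => psi (h k.+1) (x - y) * F (h k.+1) y) - F (h k) x) * chi k x) =
      (fun x => int2 (fun y => psi (h k.+1) (x - y) * F (h k.+1) y) * chi k x - F (h k) x * chi k x).
    by apply/funext => z; rewrite mulrBl.
  move=> /le_trans; apply.
  apply: (@le_trans _ _ (D * (r `^ kappa) ^+ k.+1 * pm 0)).
    by rewrite ler_wpM2l ?mulr_ge0 ?exprn_ge0 ?massle.
  rewrite mulrAC ler_wpM2l ?mulr_ge0 ?psi_mass_ge0//.
  by rewrite exprS ler_piMl ?exprn_ge0// ltW.
have lamT : (r `^ kappa) ^+ m <= (lam T) `^ kappa.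
  rewrite -lamh; apply: ge0_ler_powR; rewrite ?nnegrE ?powR_ge0 ?(ltW kappa0)//.
  by apply: ge0_ler_powR; rewrite ?nnegrE ?invr_ge0 ?(ltW (h0 m)) ?(ltW T0) ?(ltW hT).
have Am : `|A m - F T x| <= D * (lam T) `^ kappa.
  have s01 : 0 < T - h m <= 1 by rewrite Th1 Th.
  have s3 : T - h m <= 3 * h m.
    exact: sub_le3.
  have := Fstep x s01 (h01 m) s3; rewrite subrK.
  have -> : (fun y => psi (T - h m) (x - y) * F (h m) y) = (fun y => F (h m) y * chi m y).
    by apply/funext => y; rewrite mulrC.
  by rewrite (lamh m kappa) => h4; exact: (le_trans h4 (ler_wpM2l D0 lamT)).
have Abound j : `|A (m + j)%N - F T x| <= recon_cst * D * (lam T) `^ kappa.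
  have := @geometric_incr_bound _ (fun j => A (m + j)%N) (r `^ kappa) (D * pm 0 * (r `^ kappa) ^+ m).
  move=> /(_ (rlt1 kappa0)) => hb.
  have {}hb : `|A (m + j)%N - A (m + 0)%N| <= D * pm 0 * (r `^ kappa) ^+ m / (1 - r `^ kappa).
    apply: hb => i; rewrite addnS; apply: (le_trans (Aincr _ (leq_addr _ _))).
    by rewrite exprD mulrA.
  rewrite addn0 in hb.
  rewrite -(subrKA (A m)) (le_trans (ler_normD _ _))// /recon_cst mulrDl mulrDl mul1r lerD//.
  apply: (le_trans hb).
  rewrite -/(pm 0) [leRHS](_ : _ = D * pm 0 * (lam T) `^ kappa / (1 - r `^ kappa)).
    rewrite ler_wpM2r ?invr_ge0 ?subr_ge0 ?(ltW q1)//.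
    by rewrite ler_wpM2l// mulr_ge0 ?psi_mass_ge0.
  by move: (pm 0) ((1 - _)^-1) ((lam T) `^ _) => u v z; ring.
have [n [K [n4 [Kn hK]]]] := tame_half.
have T20 : 0 < T / 2 by exact: divr_gt0.
have [L0 [L00 hL0]] := schwartz_sbound n.+1 (schwartz_reflect x (psi_schwartz psiP T20)).
have pn0 : 0 <= pm n.+1 by exact: psi_mass_ge0.
pose B := K * (L0 * pm n.+1 * pm n.+1).
(* Replacing [chi k] by [psi T] costs an error that vanishes as [k] grows; its constant [B] may
   depend on [T] and [x], since only the limit is used. *)
have fA j : `|f (m + j).+1 (fun y => psi T (x - y)) - A (m + j).+1| <= B * (r `^ (1 - 2^-1)) ^+ j.
  set k := (m + j).+1; have mk : (m <= k)%N by rewrite /k leqW// leq_addr.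
  have hk4 : h k < T / 2.
    have /hle : (m.+1 <= k)%N by rewrite ltnS leq_addr.
    exact: lt_half_of_double (h0 m.+1) (hS m) m1.
  have e1 : smear psi (h k) (chi k) = (fun y => psi T (x - y)).
    rewrite /chi (smear_psi psiP x (h0 k) (Th k mk)).
    by apply/funext => y; rewrite addrC subrK.
  have d0 : 0 < T / 2 - h k by rewrite subr_gt0.
  (* Being a smearing of the fixed function [psi (T / 2)], [chi k] has seminorms bounded uniformly
     in [k]. *)
  have e2 : smear psi (T / 2 - h k) (fun y => psi (T / 2) (x - y)) = chi k.
    rewrite (smear_psi psiP x d0 T20); apply/funext => y; congr (psi _ _).
    by field.
  have d01 : 0 < T / 2 - h k <= 1 by rewrite d0/= (le_trans _ (Th1 k))// lerD2r half_le.
  have bchi : sbound n.+1 (chi k) (L0 * pm n.+1).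
    rewrite -e2; apply: sbound_smear => //.
    by apply: schwartz_reflect; exact: (psi_schwartz psiP).
  have sk := sch k mk; have ss := schwartz_smear psiP (h0 k) sk.
  have := hK _ _ k (schwartzB ss sk) (sbound_smear_sub psiP (h01 k) sk bchi).
  rewrite {1}/f.
  have -> : (fun y => F (h k) y * (smear psi (h k) (chi k) y - chi k y)) =
     (fun y => F (h k) y * smear psi (h k) (chi k) y - F (h k) y * chi k y).
    by apply/funext => y; rewrite mulrBr.
  rewrite (int2B (F_L1 (h01 k) (rapid_L1 (schwartz_rapid ss))) (F_L1 (h01 k) (rapid_L1 (schwartz_rapid sk)))).
  rewrite e1 -/(A k) -/(f k _) => /le_trans; apply.
  rewrite /h dyadic_root -/r -/(pm n.+1).
  rewrite [leLHS](_ : _ = B * (r ^+ k * (r `^ (- 2^-1)) ^+ k)); last first.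
    by rewrite /B; move: (_ ^+ k) (_ ^+ k) (pm _) => u v z; ring.
  have BB : 0 <= B by rewrite !mulr_ge0.
  rewrite ler_wpM2l// -exprMn -[X in (X * _) ^+ _](powRr1 (ltW r0)) -powRD; last first.
    by apply/implyP => _; rewrite gt_eqF.
  have /andP[a0 a1] := @rlt1 (1 - 2^-1) (etrans (subr_gt0 _ _) half_lt1).
  by apply: ler_wiXn2l => //; [exact: ltW|rewrite /k leqW// leq_addl].
have fc : f (m + j).+1 (fun y => psi T (x - y)) @[j --> \oo] --> (mollify (psi T) recon_limit x : R).
  have c := f_cvg sph.
  have := @cvg_comp _ _ _ (fun j => (m + j).+1) (fun k => f k (fun y => psi T (x - y))) _ _ _ _ c.
  apply; apply: cvg_trans (_ : (fun j => (j + m.+1)%N) @ \oo --> \oo); last exact: cvg_addnr.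
  by rewrite (_ : (fun j => (m + j).+1) = (fun j => (j + m.+1)%N))//; apply/funext => j; rewrite addnS addnC.
have vc : `|f (m + j).+1 (fun y => psi T (x - y)) - F T x| - B * (r `^ (1 - 2^-1)) ^+ j @[j --> \oo]
   --> (`|mollify (psi T) recon_limit x - F T x : R| - B * 0).
  apply: cvgB; first by apply: cvg_norm; apply: cvgB; [exact: fc|exact: cvg_cst].
  apply: cvgM; first exact: cvg_cst.
  have /andP[a0 a1] := @rlt1 (1 - 2^-1) (etrans (subr_gt0 _ _) half_lt1).
  by apply: cvg_expr; rewrite ger0_norm.
rewrite -[leLHS]subr0 -[X in _ - X](mulr0 B); apply: (cvg_seq_le vc) => j.
rewrite lerBlDr -(subrKA (A (m + j).+1)) (le_trans (ler_normD _ _))// addrC lerD//.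
by rewrite -addnS.
Qed.

End Bootstrap.

Section Reconstruct.
Context (R : realType).
Variable psi : R -> R * R -> R.
Hypothesis psiP : is_kernel_family psi.
Local Notation lam t := (t `^ 4^-1).
Variables (I : finType) (b : I -> R) (kappa Q : R).
Hypotheses (kappa0 : 0 < kappa) (bk : forall i, b i < kappa)
  (Q0 : 0 < Q) (bQ : forall i, kappa <= b i + Q).

(** The constant is chosen before [G]. The crude power [a] is dominated by a negative half-integer
    one, as [t^(1/4) <= 1], and only affects the number of bootstrap steps. *)
Theorem reconstruction : exists2 C : R, 0 <= C &
  forall (G : R * R -> (R * R -> R) -> R^o) (M : R),
  (forall x, tempered (G x)) -> 0 <= M -> coherent psi b kappa Q G M ->
  (exists K a : R, forall t x, 0 < t <= 1 -> `|diag psi G t x| <= K * (lam t) `^ a) ->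
  exists2 u : (R * R -> R) -> R^o, tempered u &
    forall T x, 0 < T <= 1 ->
      `|mollify (psi T) u x - diag psi G T x : R| <= C * M * (lam T) `^ kappa.
Proof.
have c0 := step_cst_ge0 psiP bk Q0.
have r0 : 0 <= recon_cst psi kappa.
  have r01 : (2^-1 : R) `^ 4^-1 `^ kappa <= 1.
    rewrite -[leRHS](_ : 1 `^ kappa = 1); last by rewrite powR1.
    apply: ge0_ler_powR; rewrite ?nnegrE ?powR_ge0 ?(ltW kappa0) ?ler01//.
    exact/ltW/lam_half_lt1.
  rewrite /recon_cst addr_ge0// divr_ge0 ?subr_ge0//.
  by apply: int2_ge0 => y; rewrite mulr_ge0// weight_ge0.
exists (recon_cst psi kappa * step_cst psiP b kappa Q); first exact: mulr_ge0.
move=> G M Gt M0 GM [K [a hK]].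
pose m0 := Num.bound (`|a|).
have Fb t x : 0 < t <= 1 -> `|diag psi G t x| <= `|K| * (lam t) `^ (- (m0%:R + 2^-1)).
  move=> t01; have /andP[t0 t1] := t01; apply: (le_trans (hK t x t01)).
  apply: (@le_trans _ _ (`|K| * (lam t) `^ a)).
    by rewrite ler_wpM2r ?powR_ge0 ?ler_norm.
  rewrite ler_wpM2l//; apply: ger_powR; first by rewrite root4_gt0 ?root4_le1.
  have := archi_boundP (normr_ge0 a); rewrite -/m0 => ha.
  have := ler_norm (- a); rewrite normrN => ha'.
  rewrite lerNl (le_trans ha')// (le_trans (ltW ha))// lerDl invr_ge0//.
have Fm t : 0 < t <= 1 -> meas2 (diag psi G t).
  by move=> t01; apply: continuous_meas2; exact: (diag_continuous psiP bk Q0 Gt GM t01).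
have D0 : 0 <= step_cst psiP b kappa Q * M by exact: mulr_ge0.
have Fstep s t x : 0 < s <= 1 -> 0 < t <= 1 -> s <= 3 * t ->
    `|int2 (fun y => psi s (x - y) * diag psi G t y) - diag psi G (s + t) x|
    <= step_cst psiP b kappa Q * M * (lam t) `^ kappa.
  move=> s01 t01 st; apply: (step_bound psiP bk Q0 bQ x Gt GM M0) => //.
  by exists (K * (lam t) `^ a) => y; exact: hK.
exists (recon_limit (diag psi G)).
  exact: (recon_limit_tempered psiP kappa0 D0 Fm Fb Fstep).
move=> T x T01; rewrite -(mulrA (recon_cst _ _)).
exact: (recon_limit_bound psiP kappa0 D0 Fm Fb Fstep).
Qed.

End Reconstruct.

(** * Operators on direct sums and tensor products *)

Section TheSpec.
Lemma the_spec (T : Type) (t0 : T) (P : T -> Prop) : (exists t, P t) -> P (the t0 P).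
Proof.
by rewrite /the; case: pselect => // h _; exact: (projT2 (cid h)).
Qed.
End TheSpec.

Section DirectSum.
Context (R : realType) (K : finType) (E : K -> completeNormedModType R).
Implicit Types (v w : forall k, E k).

Lemma snorm_ge0 v : 0 <= snorm v.
Proof. exact: sumr_ge0. Qed.

Lemma norm_le_snorm v k : `|v k| <= snorm v.
Proof. by rewrite /snorm (bigD1 k)//= lerDl sumr_ge0. Qed.

Lemma snormD v w : snorm (fun k => v k + w k) <= snorm v + snorm w.
Proof. by rewrite /snorm -big_split/=; apply: ler_sum => k _; exact: ler_normD. Qed.

Lemma snormZ a v : snorm (fun k => a *: v k) = `|a| * snorm v.
Proof. by rewrite /snorm mulr_sumr; apply: eq_bigr => k _; rewrite normrZ. Qed.

Lemma snorm0 : snorm (fun k => 0 : E k) = 0.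
Proof. by rewrite /snorm big1// => k _; rewrite normr0. Qed.

Definition single k (z : E k) : forall k', E k' :=
  fun k' => match @eqP _ k k' with
            | ReflectT e => ecast k' (E k') e z
            | ReflectF _ => 0
            end.

Lemma single_eq k (z : E k) : single z k = z.
Proof. by rewrite /single; case: eqP => // e; rewrite (eq_irrelevance e erefl). Qed.

Lemma single_neq k (z : E k) k' : k != k' -> single z k' = 0.
Proof. by rewrite /single; case: eqP. Qed.

Lemma sum_single v : v = fun k' => \sum_k single (v k) k'.
Proof.
apply: functional_extensionality_dep => k'.
rewrite (bigD1 k')//= single_eq big1 ?addr0// => k kk'.
by rewrite single_neq.
Qed.

Lemma snorm_single k (z : E k) : snorm (single z) = `|z|.
Proof.
rewrite /snorm (bigD1 k)//= single_eq big1 ?addr0// => k' kk'.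
by rewrite single_neq ?normr0// eq_sym.
Qed.

Section Linear.
Context (Y : lmodType R) (T : (forall k, E k) -> Y).
Hypothesis TL : forall (a : R) v w, T (fun k => a *: v k + w k) = a *: T v + T w.

Lemma vlin0 : T (fun k => 0) = 0.
Proof.
have := TL (-1) (fun k => 0) (fun k => 0).
rewrite scaleN1r addNr => <-; congr T.
by apply: functional_extensionality_dep => k; rewrite scaler0 addr0.
Qed.

Lemma vlinD v w : T (fun k => v k + w k) = T v + T w.
Proof.
rewrite -[T v]scale1r -TL; congr T.
by apply: functional_extensionality_dep => k; rewrite scale1r.
Qed.

Lemma vlinZ a v : T (fun k => a *: v k) = a *: T v.
Proof.
rewrite -[RHS]addr0 -vlin0 -TL; congr T.
by apply: functional_extensionality_dep => k; rewrite addr0.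
Qed.

Lemma vlinB v w : T (fun k => v k - w k) = T v - T w.
Proof.
rewrite addrC -[- T w]scaleN1r -TL; congr T.
by apply: functional_extensionality_dep => k; rewrite scaleN1r addrC.
Qed.

Lemma vlin_sum (I : Type) (r : seq I) (f : I -> forall k, E k) :
  T (fun k => \sum_(i <- r) f i k) = \sum_(i <- r) T (f i).
Proof.
elim: r => [|i r IH].
  rewrite big_nil -[RHS]vlin0; congr T.
  by apply: functional_extensionality_dep => k; rewrite big_nil.
rewrite big_cons -IH -vlinD; congr T.
by apply: functional_extensionality_dep => k; rewrite big_cons.
Qed.

Lemma vlin_single v : T v = \sum_k T (single (v k)).
Proof. by rewrite {1}(sum_single v) vlin_sum. Qed.

End Linear.
End DirectSum.

Section Operators.
Context (R : realType).
Implicit Types (K L N : finType).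

Lemma bounded_by_le K L (E : K -> completeNormedModType R) (F : L -> completeNormedModType R)
    (A : (forall k, E k) -> forall l, F l) a a' : a <= a' -> bounded_by A a -> bounded_by A a'.
Proof.
by move=> aa h v; apply: (le_trans (h v)); rewrite ler_wpM2r// snorm_ge0.
Qed.

Lemma is_op_ge0 K L (E : K -> completeNormedModType R) (F : L -> completeNormedModType R)
    (A : (forall k, E k) -> forall l, F l) : is_op A -> exists2 a, 0 <= a & bounded_by A a.
Proof.
by move=> [_ [a ha]]; exists `|a| => //; exact: bounded_by_le (ler_norm a) ha.
Qed.

Lemma is_form_ge0 K (E : K -> completeNormedModType R) (f : (forall k, E k) -> R) :
  is_form f -> exists2 a, 0 <= a & forall v, `|f v| <= a * snorm v.
Proof.
move=> [_ [a ha]]; exists `|a| => // v; apply: (le_trans (ha v)).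
by rewrite ler_wpM2r ?ler_norm// snorm_ge0.
Qed.

Lemma is_op_id K (E : K -> completeNormedModType R) : is_op (fun v : forall k, E k => v).
Proof. by split => //; exists 1 => v; rewrite mul1r. Qed.

Lemma is_op_comp K L N (E : K -> completeNormedModType R) (F : L -> completeNormedModType R)
    (H : N -> completeNormedModType R)
    (A : (forall k, E k) -> forall l, F l) (B : (forall l, F l) -> forall n, H n) :
  is_op A -> is_op B -> is_op (fun v => B (A v)).
Proof.
move=> Ao Bo; have [a a0 ha] := is_op_ge0 Ao; have [b b0 hb] := is_op_ge0 Bo.
have [Al _] := Ao; have [Bl _] := Bo; split.
  move=> c v w n; rewrite -Bl; congr (B _ n).
  by apply: functional_extensionality_dep => l; rewrite Al.
exists (b * a) => v; apply: (le_trans (hb _)); rewrite -mulrA ler_wpM2l//.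
Qed.

Lemma is_op_lin K L (E : K -> completeNormedModType R) (F : L -> completeNormedModType R)
    (A B : (forall k, E k) -> forall l, F l) (c : R) :
  is_op A -> is_op B -> is_op (fun v l => c *: A v l + B v l).
Proof.
move=> Ao Bo; have [a a0 ha] := is_op_ge0 Ao; have [b b0 hb] := is_op_ge0 Bo.
have [Al _] := Ao; have [Bl _] := Bo; split.
  move=> d v w n; rewrite Al Bl !scalerDr !scalerA [c * d]mulrC.
  by rewrite addrACA.
exists (`|c| * a + b) => v; apply: (le_trans (snormD _ _)).
by rewrite snormZ mulrDl lerD// -mulrA ler_wpM2l.
Qed.

Lemma is_op_scale K L (E : K -> completeNormedModType R) (F : L -> completeNormedModType R)
    (A : (forall k, E k) -> forall l, F l) (c : L -> R) :
  is_op A -> is_op (fun v l => c l *: A v l).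
Proof.
move=> Ao; have [a a0 ha] := is_op_ge0 Ao; have [Al _] := Ao; split.
  by move=> d v w n; rewrite Al scalerDr !scalerA [c n * d]mulrC.
exists ((\sum_l `|c l|) * a) => v; rewrite -mulrA.
apply: (@le_trans _ _ ((\sum_l `|c l|) * snorm (A v))).
  rewrite /snorm [leRHS]mulr_sumr; apply: ler_sum => l _.
  by rewrite normrZ ler_wpM2r// (bigD1 l)//= lerDl sumr_ge0.
by rewrite ler_wpM2l// sumr_ge0.
Qed.

Lemma is_form_comp K L (E : K -> completeNormedModType R) (F : L -> completeNormedModType R)
    (A : (forall k, E k) -> forall l, F l) (f : (forall l, F l) -> R) :
  is_op A -> is_form f -> is_form (fun v => f (A v)).
Proof.
move=> Ao fo; have [a a0 ha] := is_op_ge0 Ao; have [b b0 hb] := is_form_ge0 fo.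
have [Al _] := Ao; have [fl _] := fo; split.
  move=> c v w; rewrite -fl; congr (f _).
  by apply: functional_extensionality_dep => l; rewrite Al.
exists (b * a) => v; apply: (le_trans (hb _)); rewrite -mulrA ler_wpM2l//.
Qed.

Lemma is_form_lin K (E : K -> completeNormedModType R) (f g : (forall k, E k) -> R) (c : R) :
  is_form f -> is_form g -> is_form (fun v => c * f v + g v).
Proof.
move=> fo go; have [a a0 ha] := is_form_ge0 fo; have [b b0 hb] := is_form_ge0 go.
have [fl _] := fo; have [gl _] := go; split.
  by move=> d v w; rewrite fl gl; ring.
exists (`|c| * a + b) => v; apply: (le_trans (ler_normD _ _)).
by rewrite normrM mulrDl lerD// -mulrA ler_wpM2l.
Qed.

End Operators.

Section Tensors.
Context (R : realType) (I J : finType).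
Context (E : I -> completeNormedModType R) (F : J -> completeNormedModType R).
Variable X : tensor_data E F.
Hypothesis U : uniform_crossnorm X.

Lemma tens0l i j (w : F j) : tens X (0 : E i) w = 0.
Proof.
have := ucn_linl U (-1) (0 : E i) 0 w.
by rewrite scaler0 addr0 scaleN1r addNr.
Qed.

Lemma tens0r i j (v : E i) : tens X v (0 : F j) = 0.
Proof.
have := ucn_linr U (-1) v (0 : F j) 0.
by rewrite scaler0 addr0 scaleN1r addNr.
Qed.

Lemma single_tens i j (v : E i) (w : F j) :
  @single R (I * J)%type (fun p => tspace X p.1 p.2) (i, j) (tens X v w) =
  fun q => tens X (single v q.1) (single w q.2).
Proof.
apply: functional_extensionality_dep => -[i' j'] /=.
have [e|ne] := eqVneq (i, j) (i', j').
  by case: e => <- <-; rewrite !single_eq.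
rewrite single_neq//; move: ne; rewrite xpair_eqE negb_and => /orP[h|h].
  by rewrite (single_neq v h) tens0l.
by rewrite (single_neq w h) tens0r.
Qed.

(** By linearity one summand suffices. There finite sums of pure tensors are dense, and a pure
    tensor placed in one summand is the pure tensor of two one-summand vectors. *)
Lemma tensor_dense (Y : normedModType R) (T : (forall p : I * J, tspace X p.1 p.2) -> Y) (a : R) :
  (forall (c : R) v w, T (fun k => c *: v k + w k) = c *: T v + T w) ->
  (forall v, `|T v| <= a * snorm v) ->
  (forall (v : forall i, E i) (w : forall j, F j),
    T (fun p => tens X (v p.1) (w p.2)) = 0) -> forall z, T z = 0.
Proof.
move=> TL Ta T0 z; rewrite (vlin_single TL) big1// => -[i j] _.
move: (z (i, j)) => /= {z} z; apply/eqP; rewrite -normr_le0.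
apply/ler_addgt0Pr => e e0; rewrite add0r.
have d0 : 0 < e / (`|a| + 1) by rewrite divr_gt0// ltr_wpDl.
have [s hs] := ucn_dense U z d0.
pose zs := \sum_(q <- s) tens X q.1 q.2.
have Tzs : T (@single R (I * J)%type (fun p => tspace X p.1 p.2) (i, j) zs) = 0.
  have -> : @single R (I * J)%type (fun p => tspace X p.1 p.2) (i, j) zs =
      fun k => \sum_(q <- s) @single R (I * J)%type (fun p => tspace X p.1 p.2) (i, j) (tens X q.1 q.2) k.
    apply: functional_extensionality_dep => k.
    have [e1|ne] := eqVneq (i, j) k.
      by case: _ / e1; rewrite single_eq; apply: eq_bigr => q _; rewrite single_eq.
    by rewrite single_neq// big1// => q _; rewrite single_neq.
  by rewrite (vlin_sum TL) big1// => q _; rewrite single_tens T0.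
rewrite -[T _]subr0 -Tzs -(vlinB TL) (le_trans (Ta _))//.
have -> : snorm (fun k => @single R (I * J)%type (fun p => tspace X p.1 p.2) (i, j) z k - 
    @single R (I * J)%type (fun p => tspace X p.1 p.2) (i, j) zs k) = `|z - zs|.
  rewrite -(@snorm_single R (I * J)%type (fun p => tspace X p.1 p.2) (i, j)); congr snorm.
  apply: functional_extensionality_dep => k.
  have [e1|ne] := eqVneq (i, j) k.
    by case: _ / e1; rewrite !single_eq.
  by rewrite !single_neq// subr0.
have a1 : 0 < `|a| + 1 by rewrite ltr_wpDl.
apply: (@le_trans _ _ ((`|a| + 1) * (e / (`|a| + 1)))); last first.
  by rewrite mulrC divfK ?gt_eqF.
apply: (@le_trans _ _ ((`|a| + 1) * `|z - zs|)).
  by rewrite ler_wpM2r// (le_trans (ler_norm a))// lerDl.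
by rewrite ler_wpM2l ?(ltW a1)// ltW.
Qed.

End Tensors.

Section TensorSpec.
Context (R : realType) (I J : finType).
Context (E : I -> completeNormedModType R) (F : J -> completeNormedModType R).
Variable X : tensor_data E F.
Hypothesis U : uniform_crossnorm X.
Local Notation TS := (forall p : I * J, tspace X p.1 p.2).
Local Notation pure v w := (fun p : I * J => tens X (v p.1) (w p.2)).

Lemma tensor_op_exists (A : (forall i, E i) -> forall i, E i)
    (B : (forall j, F j) -> forall j, F j) : is_op A -> is_op B ->
  exists O : TS -> TS, @is_tensor_op R I J E F X I J I J id id Some Some A B O.
Proof.
move=> Ao Bo; have [a a0 ha] := is_op_ge0 Ao; have [b b0 hb] := is_op_ge0 Bo.
have [c hc] := @ucn_op R I J E F X U I J I J id id Some Some (or_introl (fun _ => isT))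
  (or_introl (fun _ => isT)).
have [T0 [h _]] := hc A B a b Ao Bo a0 b0 ha hb.
by exists T0.
Qed.

Lemma tensor_op_spec (A : (forall i, E i) -> forall i, E i)
    (B : (forall j, F j) -> forall j, F j) : is_op A -> is_op B ->
  @is_tensor_op R I J E F X I J I J id id Some Some A B (tensor_op X A B).
Proof. by move=> Ao Bo; apply: the_spec; exact: tensor_op_exists. Qed.

(** A form viewed as an operator into a single copy of the real line, the shape in which the
    crossnorm axioms handle functionals. *)
Definition unit_op (K : finType) (H : K -> completeNormedModType R) (f : (forall k, H k) -> R) :
  (forall k, H k) -> forall _ : unit, (R^o : completeNormedModType R) := fun v _ => f v.

Lemma snorm_unit (v : forall _ : unit, (R^o : completeNormedModType R)) : snorm v = `|v tt|.
Proof. by rewrite /snorm (bigD1 tt)//= big1 ?addr0// => -[]. Qed.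

Lemma unit_op_is_op (K : finType) (H : K -> completeNormedModType R) (f : (forall k, H k) -> R) :
  is_form f -> is_op (unit_op f).
Proof.
move=> fo; have [a a0 ha] := is_form_ge0 fo; have [fl _] := fo; split.
  by move=> c v w []; rewrite /unit_op fl.
by exists a => v; rewrite snorm_unit; exact: ha.
Qed.

Let none (u : unit) : option I := None.
Let none' (u : unit) : option J := None.

Lemma tensor_form_exists (f : (forall i, E i) -> R) (g : (forall j, F j) -> R) :
  is_form f -> is_form g ->
  exists h : TS -> R, is_form h /\ forall v w, h (pure v w) = f v * g w.
Proof.
move=> fo go; have Ao := unit_op_is_op fo; have Bo := unit_op_is_op go.
have [a a0 ha] := is_op_ge0 Ao; have [b b0 hb] := is_op_ge0 Bo.
have [c hc] := @ucn_op R I J E F X U I J unit unit id id none none' (or_intror (fun _ => isT))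
  (or_intror (fun _ => isT)).
have [T0 [[[Ol [c0 ho]] Op] _]] := hc (unit_op f) (unit_op g) a b Ao Bo a0 b0 ha hb.
exists (fun z => T0 z (tt, tt)); split; last by move=> v w; exact: (Op v w (tt, tt)).
split; first by move=> d v w; exact: (Ol d v w (tt, tt)).
exists c0 => v; apply: le_trans (ho v).
exact: (@norm_le_snorm R (unit * unit)%type (fun p => tgtt X (none p.1) (none' p.2)) (T0 v) (tt, tt)).
Qed.

Lemma tensor_form_spec (f : (forall i, E i) -> R) (g : (forall j, F j) -> R) :
  is_form f -> is_form g ->
  is_form (tensor_form X f g) /\ forall v w, tensor_form X f g (pure v w) = f v * g w.
Proof. by move=> fo go; apply: (the_spec _ (tensor_form_exists fo go)). Qed.

Lemma form_ext (h1 h2 : TS -> R) : is_form h1 -> is_form h2 ->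
  (forall (v : forall i, E i) (w : forall j, F j), h1 (pure v w) = h2 (pure v w)) -> forall z, h1 z = h2 z.
Proof.
move=> f1 f2 e z; have [hl [a ha]] := is_form_lin (-1) f1 f2.
apply/eqP; rewrite eq_sym -subr_eq0; apply/eqP.
have := @tensor_dense R I J E F X U (R^o : normedModType R) (fun v => -1 * h1 v + h2 v) a hl ha _ z.
rewrite mulN1r addrC => -> // v w.
by rewrite mulN1r addrC e subrr.
Qed.

Lemma op_ext (K : finType) (H : K -> completeNormedModType R) (O1 O2 : TS -> forall k, H k) :
  is_op O1 -> is_op O2 ->
  (forall (v : forall i, E i) (w : forall j, F j) k, O1 (pure v w) k = O2 (pure v w) k) -> forall z k, O1 z k = O2 z k.
Proof.
move=> f1 f2 e z k; have [hl [a ha]] := is_op_lin (-1) f1 f2.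
apply/eqP; rewrite eq_sym -subr_eq0; apply/eqP.
have := @tensor_dense R I J E F X U (H k) (fun v => -1 *: O1 v k + O2 v k) a.
move=> /(_ _ _ _ z); rewrite scaleN1r addrC; apply.
- by move=> c v w; exact: (hl c v w k).
- by move=> v; apply: le_trans (ha v); exact: (norm_le_snorm (fun l => -1 *: O1 v l + O2 v l)).
- by move=> v w; rewrite scaleN1r addrC e subrr.
Qed.

(** Comparison with the weighted operators with components [a i P_i] and [b j S_j]: their tensor
    product is that of [P] and [S] with component [(i, j)] multiplied by [a i] and [b j], and
    uniformity of the crossnorm carries the two separate bounds over. *)
Lemma tensor_mono (K1 L1 : finType) (s1 : K1 -> option I) (r1 : L1 -> option J)
    (Al : (forall i, E i) -> forall k, tgtl E (s1 k))
    (Ar : (forall j, F j) -> forall l, tgtr F (r1 l))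
    (P : (forall i, E i) -> forall i, E i) (S : (forall j, F j) -> forall j, F j)
    OA (a : I -> R) (b : J -> R) :
  pure_target s1 -> pure_target r1 -> is_op Al -> is_op Ar -> is_op P -> is_op S ->
  @is_tensor_op R I J E F X I J K1 L1 id id s1 r1 Al Ar OA ->
  (forall i, 0 <= a i) -> (forall j, 0 <= b j) ->
  (forall v, snorm (Al v) <= \sum_i a i * `|P v i|) ->
  (forall w, snorm (Ar w) <= \sum_j b j * `|S w j|) ->
  forall z, snorm (OA z) <= \sum_p a p.1 * b p.2 * `|tensor_op X P S z p|.
Proof.
move=> ps pr Alo Aro Po So OAt a0 b0 hl hr z.
have [TO Tp] := tensor_op_spec Po So.
pose Bl v i : tgtl E (Some i) := a i *: P v i.
pose Br w j : tgtr F (Some j) := b j *: S w j.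
have Blo : is_op (Bl : (forall i, E (id i)) -> forall i, tgtl E (Some i)) by exact: is_op_scale.
have Bro : is_op (Br : (forall j, F (id j)) -> forall j, tgtr F (Some j)) by exact: is_op_scale.
pose OB (z : TS) (p : I * J) : tgtt X (Some p.1) (Some p.2) := (a p.1 * b p.2) *: tensor_op X P S z p.
have OBt : @is_tensor_op R I J E F X I J I J id id Some Some Bl Br OB.
  split.
    exact: (@is_op_scale _ _ _ (fun p : I * J => tspace X p.1 p.2) (fun p : I * J => tspace X p.1 p.2)).
  move=> v w p; rewrite /OB (Tp v w p) /Bl /Br /=.
  have tZl : tens X (a p.1 *: P v p.1) (b p.2 *: S w p.2) = a p.1 *: tens X (P v p.1) (b p.2 *: S w p.2).
    by have := ucn_linl U (a p.1) (P v p.1) 0 (b p.2 *: S w p.2); rewrite addr0 (tens0l U) addr0.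
  have tZr : tens X (P v p.1) (b p.2 *: S w p.2) = b p.2 *: tens X (P v p.1) (S w p.2).
    by have := ucn_linr U (b p.2) (P v p.1) (S w p.2) 0; rewrite addr0 (tens0r U) addr0.
  by rewrite tZl tZr scalerA.
have h1 v : snorm (Al v) <= snorm (Bl v).
  apply: (le_trans (hl v)); apply: ler_sum => i _.
  by rewrite normrZ ger0_norm.
have h2 w : snorm (Ar w) <= snorm (Br w).
  apply: (le_trans (hr w)); apply: ler_sum => j _.
  by rewrite normrZ ger0_norm.
have p1 : @pure_target I I Some by left.
have p2 : @pure_target J J Some by left.
have := ucn_mono U ps pr p1 p2 Alo Aro Blo Bro OAt OBt h1 h2 z.
move=> /le_trans; apply; apply: ler_sum => p _.
by rewrite /OB normrZ ger0_norm ?mulr_ge0.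
Qed.

Lemma tensor_form_bound (f : (forall i, E i) -> R) (g : (forall j, F j) -> R)
    (P : (forall i, E i) -> forall i, E i) (S : (forall j, F j) -> forall j, F j)
    (a : I -> R) (b : J -> R) :
  is_form f -> is_form g -> is_op P -> is_op S ->
  (forall i, 0 <= a i) -> (forall j, 0 <= b j) ->
  (forall v, `|f v| <= \sum_i a i * `|P v i|) ->
  (forall w, `|g w| <= \sum_j b j * `|S w j|) ->
  forall z, `|tensor_form X f g z| <= \sum_p a p.1 * b p.2 * `|tensor_op X P S z p|.
Proof.
move=> fo go Po So a0 b0 hf hg z.
have [To Tp] := tensor_form_spec fo go; have [Tl [c hc]] := To.
pose OA (z : TS) (p : unit * unit) : tgtt X (none p.1) (none' p.2) := tensor_form X f g z.
have sE y : snorm (OA y) = `|tensor_form X f g y|.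
  by rewrite /snorm (bigD1 (tt, tt))//= big1 ?addr0// => -[[] []].
rewrite -sE; apply: (@tensor_mono unit unit none none' (unit_op f) (unit_op g)) => //.
- by right.
- by right.
- exact: unit_op_is_op.
- exact: unit_op_is_op.
- split; last by move=> v w p; exact: Tp.
  by split; [move=> d v w p; exact: Tl|exists c => v; rewrite sE].
- by move=> v; rewrite snorm_unit; exact: hf.
- by move=> w; rewrite snorm_unit; exact: hg.
Qed.

End TensorSpec.

(** * Skeletons and reductions *)

Section LeastConst.
Context (R : realType).
Implicit Types (P : R -> Prop) (C : R).

Lemma least_const_ge0 P : 0 <= least_const P.
Proof.
rewrite /least_const; set E := [set C | _].
have [-> | /set0P E0] := eqVneq E set0; first by rewrite inf0.
by apply: lb_le_inf => // C [].
Qed.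

Lemma least_const_approx P : (exists2 C, 0 <= C & P C) -> forall e, 0 < e ->
  exists2 C, P C & C < least_const P + e.
Proof.
move=> [C C0 PC] e e0.
have h : has_inf [set C : R | 0 <= C /\ P C].
  by split; [exists C|exists 0 => ? []].
by have [D [_ PD] De] := inf_adherent e0 h; exists D.
Qed.

(** [least_const] is an infimum not known to be attained, but an estimate linear in the constant
    passes to it. The case [r = 0] is separate because the approximation divides by [r]. *)
Lemma least_const_le P (l r : R) : 0 <= r -> (exists2 C, 0 <= C & P C) ->
  (forall C, P C -> l <= C * r) -> l <= least_const P * r.
Proof.
move=> r0 PE h; move: r0; rewrite le_eqVlt => /orP[/eqP r0|r0].
  by have [C _ PC] := PE; have := h _ PC; rewrite -r0 !mulr0.
apply/ler_addgt0Pr => e e0.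
have [C PC Ce] := least_const_approx PE (divr_gt0 e0 r0).
apply: (le_trans (h _ PC)).
have := ltW Ce; rewrite -(ler_pM2r r0) => /le_trans; apply.
by rewrite mulrDl divfK ?gt_eqF.
Qed.

End LeastConst.

Section Graded.
Context (R : realType) (S : gspace R).
Local Notation I := (gidx S).
Implicit Types (v w : gvec S) (i j : I).

Lemma ghom_homs i : ghom i \in homs S.
Proof. by apply/imfsetP; exists i. Qed.

Lemma sum_homs (P : pred R) (f : R -> R) v :
  \sum_(b <- homs S | P b) f b * graded_norm b v = \sum_(i | P (ghom i)) f (ghom i) * `|v i|.
Proof.
under eq_bigr do rewrite /graded_norm mulr_sumr.
rewrite (exchange_big_dep (fun i => P (ghom i))) /=; last first.
  by move=> b i Pb /eqP ->.
apply: eq_bigr => i Pi.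
rewrite (eq_bigl (fun b => b == ghom i)).
  by rewrite -big_filter filter_pred1_uniq ?fset_uniq ?ghom_homs// big_seq1.
by move=> b; rewrite [b == _]eq_sym; case: eqVneq => [<-|_]; rewrite ?Pi ?andbF.
Qed.

Lemma graded_norm_ge0 b v : 0 <= graded_norm b v.
Proof. exact: sumr_ge0. Qed.

Lemma norm_le_graded v i : `|v i| <= graded_norm (ghom i) v.
Proof. by rewrite /graded_norm (bigD1 i)//= lerDl sumr_ge0. Qed.

(** Identity plus a strictly lower part, expressed on one-summand vectors so as to pass to tensor
    products. *)
Definition lower_triangular (G : gvec S -> gvec S) : Prop :=
  forall i j (z : gpiece i), ~~ (ghom i < ghom j) -> G (single z) j = single z j.

Section Triangular.
Variable G : gvec S -> gvec S.
Hypotheses (Go : is_op G) (Gt : lower_triangular G).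

Lemma tri_local v w j : (forall i, ghom i < ghom j -> v i = w i) ->
  G v j - v j = G w j - w j.
Proof.
move=> h; have [Gl _] := Go.
have Gl' a v' w' : (fun u => G u j - u j) (fun k => a *: v' k + w' k)
    = a *: (fun u => G u j - u j) v' + (fun u => G u j - u j) w'.
  by rewrite /= Gl scalerBr opprD addrACA.
have e u : G u j - u j = \sum_i (G (single (u i)) j - single (u i) j) by exact: (vlin_single Gl').
rewrite !e; apply: eq_bigr => i _.
have [ij|ij] := boolP (ghom i < ghom j); first by rewrite h.
by rewrite !Gt// !subrr.
Qed.

Lemma tri_eq v w j : (forall i, ghom i <= ghom j -> v i = w i) -> G v j = G w j.
Proof.
move=> h; have := @tri_local v w j (fun i ij => h i (ltW ij)).
by rewrite h// => /(addIr (- w j)).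
Qed.

(** Induction measure for triangular systems, the homogeneities themselves being real numbers. *)
Definition rank j := #|[pred i : I | ghom i < ghom j]|.

Lemma rank_lt i j : ghom i < ghom j -> (rank i < rank j)%N.
Proof.
move=> ij; apply: proper_card; apply/properP; split.
  by apply/fintype.subsetP => k; rewrite !inE => /lt_trans; apply.
by exists i; rewrite !inE ?ltxx.
Qed.

Lemma rank_ltI j : (rank j < #|I|)%N.
Proof.
rewrite -(cardC [pred i : I | ghom i < ghom j]) -addn1 leq_add2l.
by apply/card_gt0P; exists j; rewrite !inE ltxx.
Qed.

Lemma tri_inj v w j : (forall i, ghom i <= ghom j -> G v i = G w i) -> v j = w j.
Proof.
have [n] := ubnP (rank j); elim: n j => // n IH j; rewrite ltnS => jn h.
have := @tri_local v w j; rewrite h// => /(_ _)/addrI/oppr_inj; apply => i ij.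
by apply: IH => [|k ki]; [exact: leq_trans (rank_lt ij) jn|apply: h; exact: le_trans ki (ltW ij)].
Qed.

(* [v - (G v - v)] iterated: after [n] steps the components of rank below [n]
   are stationary. *)
Let solve_step (w v : gvec S) : gvec S := fun i => -1 *: (-1 *: v i + G v i) + w i.

Let solve n w := iter n (solve_step w) (fun=> 0).

Let solve_stable n w j : (rank j < n)%N -> solve n.+1 w j = solve n w j.
Proof.
have sE m : solve m.+1 w j = -1 *: (-1 *: solve m w j + G (solve m w) j) + w j by [].
elim: n j sE => // n IH j sE jn; rewrite (sE n.+1) (sE n).
have e : G (solve n.+1 w) j - solve n.+1 w j = G (solve n w) j - solve n w j.
  by apply: tri_local => i ij; apply: IH => //; exact: leq_trans (rank_lt ij) jn.
have aux (a b c d : gpiece j) : b - a = d - c -> -1 *: a + b = -1 *: c + d.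
  by rewrite !scaleN1r => h; rewrite addrC h addrC.
by rewrite (aux _ _ _ _ e).
Qed.

(** After as many steps as there are summands the iteration is stationary in every component, and a
    stationary [v] satisfies [G v = w]; each iterate is a bounded operator of [w] by composition. *)
Lemma tri_inverse : exists2 H : gvec S -> gvec S, is_op H & forall w, G (H w) = w.
Proof.
exists (solve #|I|); last first.
  move=> w; apply: functional_extensionality_dep => j.
  have := solve_stable w (rank_ltI j); rewrite -[LHS]/(-1 *: (-1 *: solve #|I| w j + G (solve #|I| w) j) + w j).
  move: (solve _ w) => v; rewrite scaleN1r scaleN1r opprD opprK -addrA -{2}[v j]addr0.
  by move/addrI/eqP; rewrite addrC subr_eq0 => /eqP.
elim: #|I| => [|n IH].
  split; first by move=> a v w l; rewrite /solve /= scaler0 addr0.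
  by exists 0 => v; rewrite /solve /= snorm0 mul0r.
have h : is_op (fun w => solve n w) by [].
have hG := is_op_comp h Go.
exact: is_op_lin (-1) (is_op_lin (-1) h hG) (@is_op_id R I (@gpiece R S)).
Qed.

End Triangular.
End Graded.

Section Coefficients.
Context (R : realType) (S : gspace R) (G : gop S) (V : gform S) (x : R * R).
Hypotheses (Go : is_op (G x)) (Gt : lower_triangular (G x)).

Lemma tri_surj w : exists v, G x v = w.
Proof. by have [H _ h] := tri_inverse Go Gt; exists (H w). Qed.

Lemma coef_spec : is_form (V x) ->
  is_form (coefficients G V x) /\ forall v, V x v = coefficients G V x (G x v).
Proof.
move=> Vf; apply: (@the_spec _ _ (fun W => is_form W /\ forall v, V x v = W (G x v))).
have [H Ho h] := tri_inverse Go Gt; exists (fun w => V x (H w)).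
split; first exact: is_form_comp Ho Vf.
move=> v; congr (V x _); apply: functional_extensionality_dep => i.
by symmetry; apply: (tri_inj Go Gt) => j _; rewrite h.
Qed.

(** Every [w] is of the form [G x v], so a bound on the form in terms of [G x v] is one on the
    coefficients. *)
Lemma coef_bound (c : gidx S -> R) : is_form (V x) ->
  (forall v, `|V x v| <= \sum_i c i * `|G x v i|) ->
  forall w, `|coefficients G V x w| <= \sum_i c i * `|w i|.
Proof.
move=> Vf h w; have [v <-] := tri_surj w; have [_ e] := coef_spec Vf.
by rewrite -e.
Qed.

Lemma trunc_is_op eta : is_op (@trunc R S eta).
Proof.
have := is_op_scale (fun i : gidx S => if ghom i < eta then 1 else 0) (@is_op_id R _ (@gpiece R S)).
congr is_op; apply: funext => v; apply: functional_extensionality_dep => i.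
by rewrite /trunc; case: ifP => _; rewrite ?scale1r ?scale0r.
Qed.

Lemma reduce_is_form eta : is_form (V x) -> is_form (reduce G eta V x).
Proof.
move=> Vf; have [Wf _] := coef_spec Vf.
exact: is_form_comp (is_op_comp Go (trunc_is_op eta)) Wf.
Qed.

End Coefficients.

Lemma skeleton_tri (R : realType) (S : gspace R) (G : gop S) x :
  is_skeleton G -> lower_triangular (G x).
Proof.
move=> [_ _ [c [cl cE]] _] i j z ij; rewrite cE big1 ?addr0// => k kj.
rewrite single_neq; last by apply: contra ij => /eqP ->.
by have := cl x k j (-1) 0 0; rewrite scaler0 addr0 scaleN1r addNr.
Qed.

Section Constants.
Context (R : realType) (S : gspace R).
Implicit Types (G : gop S) (V : gform S) (v : gvec S).
Local Notation I := (gidx S).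

Lemma ex_const_ge0 (P : R -> Prop) : (forall C D, C <= D -> P C -> P D) ->
  (exists C, P C) -> exists2 C, 0 <= C & P C.
Proof. by move=> h [C PC]; exists `|C| => //; exact: h (ler_norm C) PC. Qed.

Lemma sum_skeleton_ge0 G x y v b :
  0 <= \sum_(c <- homs S | c < b) (pdist y x) `^ (b - c) * graded_norm c (G x v).
Proof. by apply: sumr_ge0 => c _; rewrite mulr_ge0 ?powR_ge0 ?graded_norm_ge0. Qed.

Lemma sk_normP G : (exists C, skeleton_bound G C) -> skeleton_bound G (sk_norm G).
Proof.
move=> h b bS v x y d; apply: least_const_le; first exact: sum_skeleton_ge0.
  apply: ex_const_ge0 h => C D CD h b' b'S v' x' y' d'.
  by apply: (le_trans (h b' b'S v' x' y' d')); rewrite ler_wpM2r ?sum_skeleton_ge0.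
by move=> C /(_ b bS v x y d).
Qed.

Lemma sum_mod_ge0 G a x y v :
  0 <= \sum_(b <- homs S) (pdist y x) `^ (Num.max (a - b) 0) * graded_norm b (G x v).
Proof. by apply: sumr_ge0 => c _; rewrite mulr_ge0 ?powR_ge0 ?graded_norm_ge0. Qed.

Lemma mod_normP G a V : (exists C, mod_bound G a V C) -> mod_bound G a V (mod_norm G a V).
Proof.
move=> h v x y d; apply: least_const_le; first exact: sum_mod_ge0.
  apply: ex_const_ge0 h => C D CD h v' x' y' d'.
  by apply: (le_trans (h v' x' y' d')); rewrite ler_wpM2r ?sum_mod_ge0.
by move=> C /(_ v x y d).
Qed.

Lemma sum_size_ge0 G (N : R) (ang : R -> R) x v :
  0 <= \sum_(b <- homs S) N `^ (ang b) * graded_norm b (G x v).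
Proof. by apply: sumr_ge0 => c _; rewrite mulr_ge0 ?powR_ge0 ?graded_norm_ge0. Qed.

Lemma size_normP G N ang V : (exists C, size_bound G N ang V C) ->
  size_bound G N ang V (size_norm G N ang V).
Proof.
move=> h v x; apply: least_const_le; first exact: sum_size_ge0.
  apply: ex_const_ge0 h => C D CD h v' x'.
  by apply: (le_trans (h v' x')); rewrite ler_wpM2r ?sum_size_ge0.
by move=> C /(_ v x).
Qed.

Lemma skeleton_idx G C : skeleton_bound G C -> forall v x y (j : I), pdist y x <= 1 ->
  `|G y v j - G x v j| <=
    \sum_(i | ghom i < ghom j) C * (pdist y x) `^ (ghom j - ghom i) * `|G x v i|.
Proof.
move=> h v x y j d; have := h _ (ghom_homs j) v x y d.
rewrite (@sum_homs _ _ (fun c => c < ghom j) (fun c => (pdist y x) `^ (ghom j - c))) mulr_sumr.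
under eq_bigr do rewrite mulrA.
by apply: le_trans; exact: (norm_le_graded (fun i => G y v i - G x v i)).
Qed.

Lemma mod_idx G a V C : mod_bound G a V C -> forall v x y, pdist y x <= 1 ->
  `|V y v - V x v| <=
    \sum_(i : I) C * (pdist y x) `^ (Num.max (a - ghom i) 0) * `|G x v i|.
Proof.
move=> h v x y d; have := h v x y d.
rewrite (@sum_homs _ _ predT (fun c => (pdist y x) `^ (Num.max (a - c) 0))) mulr_sumr.
by under eq_bigr do rewrite mulrA.
Qed.

Lemma size_idx G N ang V C : size_bound G N ang V C -> forall v x,
  `|V x v| <= \sum_(i : I) C * N `^ (ang (ghom i)) * `|G x v i|.
Proof.
move=> h v x; have := h v x.
rewrite (@sum_homs _ _ predT (fun c => N `^ (ang c))) mulr_sumr.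
by under eq_bigr do rewrite mulrA.
Qed.

(** The cardinality is lost in passing from single summands to graded norms; this is harmless where
    only the existence of a constant is wanted. *)
Lemma idx_skeleton G C : 0 <= C ->
  (forall v x y (j : I), pdist y x <= 1 -> `|G y v j - G x v j| <=
    \sum_(i | ghom i < ghom j) C * (pdist y x) `^ (ghom j - ghom i) * `|G x v i|) ->
  skeleton_bound G (#|I|%:R * C).
Proof.
move=> C0 h b bS v x y d.
rewrite (@sum_homs _ _ (fun c => c < b) (fun c => (pdist y x) `^ (b - c))).
rewrite /graded_norm.
apply: (@le_trans _ _ (\sum_(j : I)
   C * \sum_(i | ghom i < b) pdist y x `^ (b - ghom i) * `|G x v i|)); last first.
  by rewrite sumr_const mulr_natl mulrnAl.
rewrite [leRHS](bigID (fun j => ghom j == b))/= ler_wpDr//.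
  by apply: sumr_ge0 => j _; rewrite mulr_ge0// sumr_ge0// => i _; rewrite mulr_ge0 ?powR_ge0.
apply: ler_sum => j /eqP <-; apply: (le_trans (h v x y j d)).
by rewrite mulr_sumr ler_sum// => i _; rewrite mulrA.
Qed.

End Constants.

Section TensorOperators.
Context (R : realType) (Sp Sm : gspace R).
Variable X : tensor_data (@gpiece R Sp) (@gpiece R Sm).
Hypothesis U : uniform_crossnorm X.
Implicit Types (A : gvec Sp -> gvec Sp) (B : gvec Sm -> gvec Sm).
Implicit Types (v : gvec Sp) (w : gvec Sm) (z : gvec (gtensor X)).

Definition pure v w : gvec (gtensor X) := fun p => tens X (v p.1) (w p.2).

Lemma tensor_op_is_op A B : is_op A -> is_op B ->
  is_op (tensor_op X A B : gvec (gtensor X) -> gvec (gtensor X)).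
Proof. by move=> Ao Bo; have [] := tensor_op_spec U Ao Bo. Qed.

Lemma tensor_op_pure A B v w p : is_op A -> is_op B ->
  tensor_op X A B (pure v w) p = tens X (A v p.1) (B w p.2).
Proof. by move=> Ao Bo; have [_] := tensor_op_spec U Ao Bo => ->. Qed.

(** Checked on pure tensors after projecting onto the source and target summands. Both homogeneities
    cannot increase; so either both factors act as the identity, or one does while its indices
    differ, and then both sides vanish. *)
Lemma tensor_op_tri A B : is_op A -> is_op B -> lower_triangular A -> lower_triangular B ->
  lower_triangular (tensor_op X A B : gvec (gtensor X) -> gvec (gtensor X)).
Proof.
move=> Ao Bo At Bt [i j] [i' j'] z hij.
have [Ol [a1 ho]] := tensor_op_is_op Ao Bo.
pose K := (gidx Sp * gidx Sm)%type.
pose pr (u : gvec (gtensor X)) : gvec (gtensor X) := @single R K (@gpiece R (gtensor X)) (i, j) (u (i, j)).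
have prl (c : R) u u' q : pr (fun k => c *: u k + u' k) q = c *: pr u q + pr u' q.
  rewrite /pr; have [e|ne] := eqVneq (i, j) q.
    by case: _ / e; rewrite !single_eq.
  by rewrite !single_neq// scaler0 addr0.
have pro : is_op pr.
  split=> //; exists 1 => u; rewrite mul1r snorm_single.
  exact: (norm_le_snorm u (i, j)).
pose m (u : gvec (gtensor X)) : gvec (gtensor X) := fun q => if q == (i', j') then u q else 0.
have mo : is_op m.
  split; first by move=> c u u' q; rewrite /m; case: ifP => // _; rewrite scaler0 addr0.
  exists 1 => u; rewrite mul1r; apply: ler_sum => q _; rewrite /m.
  by case: ifP => // _; rewrite normr0.
have h1 := is_op_comp (is_op_comp pro (tensor_op_is_op Ao Bo)) mo.
have h2 := is_op_comp pro mo.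
have e : forall (v : gvec Sp) (w : gvec Sm) q,
    m (tensor_op X A B (pr (pure v w))) q = m (pr (pure v w)) q.
  move=> v w q; rewrite /m; case: eqP => // ->.
  rewrite /pr /pure /= (single_tens U) tensor_op_pure//=.
  have [ii|ii] := boolP (ghom i < ghom i'); last first.
    have [jj|jj] := boolP (ghom j < ghom j'); last by rewrite At// Bt.
    have ii' : i != i'.
      by apply: contra hij => /eqP ->; rewrite /= ltrD2l.
    by rewrite At// single_neq// !(tens0l U).
  have [jj|jj] := boolP (ghom j < ghom j').
    by move: hij; rewrite /= ltrD.
  have jj' : j != j'.
    by apply: contra hij => /eqP ->; rewrite /= ltrD2r.
  by rewrite Bt// single_neq// !(tens0r U).
have := op_ext U h1 h2 e (@single R K (@gpiece R (gtensor X)) (i, j) z) (i', j').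
by rewrite /m eqxx /pr single_eq.
Qed.

Lemma tensor_op_comp_bound A B (P : gvec Sp -> gvec Sp) (Q : gvec Sm -> gvec Sm) i j
    (a : gidx Sp -> R) (b : gidx Sm -> R) :
  is_op A -> is_op B -> is_op P -> is_op Q ->
  (forall i', 0 <= a i') -> (forall j', 0 <= b j') ->
  (forall v, `|A v i| <= \sum_i' a i' * `|P v i'|) ->
  (forall w, `|B w j| <= \sum_j' b j' * `|Q w j'|) ->
  forall z, `|tensor_op X A B z (i, j)| <= \sum_p a p.1 * b p.2 * `|tensor_op X P Q z p|.
Proof.
move=> Ao Bo Po Qo a0 b0 hA hB z.
have [[Ol [a1 ho]] Op] := tensor_op_spec U Ao Bo.
have [Al [c hc]] := Ao; have [Bl [d hd]] := Bo.
have sE (Y : completeNormedModType R) (y : Y) : snorm (fun _ : unit => y) = `|y|.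
  by rewrite /snorm (bigD1 tt)//= big1 ?addr0// => -[].
have sE2 (Y : completeNormedModType R) (y : Y) : snorm (fun _ : unit * unit => y) = `|y|.
  by rewrite /snorm (bigD1 (tt, tt))//= big1 ?addr0// => -[[] []].
pose s1 (_ : unit) := Some i; pose r1 (_ : unit) := Some j.
pose A1 v (k : unit) : tgtl (@gpiece R Sp) (s1 k) := A v i.
pose B1 w (k : unit) : tgtr (@gpiece R Sm) (r1 k) := B w j.
pose O1 (u : forall p : gidx Sp * gidx Sm, tspace X p.1 p.2) (k : unit * unit) :
  tgtt X (s1 k.1) (r1 k.2) := tensor_op X A B u (i, j).
rewrite -[leLHS](sE2 (tspace X i j)).
apply: (@tensor_mono _ _ _ _ _ X U unit unit s1 r1 A1 B1 P Q O1) => //.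
- by left.
- by left.
- split; first by move=> e v w k; rewrite /A1 Al.
  by exists c => v; rewrite sE; apply: le_trans (hc v); exact: (norm_le_snorm (A v)).
- split; first by move=> e v w k; rewrite /B1 Bl.
  by exists d => v; rewrite sE; apply: le_trans (hd v); exact: (norm_le_snorm (B v)).
- split; last by move=> v w k; rewrite /O1 (Op v w (i, j)).
  split; first by move=> e v w k; rewrite /O1 (Ol e v w (i, j)).
  exists a1 => v; rewrite sE2; apply: le_trans (ho v).
  exact: (@norm_le_snorm R (gidx Sp * gidx Sm)%type (@gpiece R (gtensor X)) (tensor_op X A B v) (i, j)).
- by move=> v; rewrite sE.
- by move=> w; rewrite sE.
Qed.

Lemma tensor_op_sub A A' B B' : is_op A -> is_op A' -> is_op B -> is_op B' ->
  forall z p, tensor_op X A' B' z p - tensor_op X A B z p =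
    tensor_op X (fun v i => -1 *: A v i + A' v i) B' z p
    + tensor_op X A (fun w j => -1 *: B w j + B' w j) z p.
Proof.
move=> Ao Ao' Bo Bo' z p.
have dA := is_op_lin (-1) Ao Ao'; have dB := is_op_lin (-1) Bo Bo'.
have h1 := is_op_lin (-1) (tensor_op_is_op Ao Bo) (tensor_op_is_op Ao' Bo').
have h2 := is_op_lin 1 (tensor_op_is_op dA Bo') (tensor_op_is_op Ao dB).
have e : forall (v : gvec Sp) (w : gvec Sm) q,
    -1 *: tensor_op X A B (pure v w) q + tensor_op X A' B' (pure v w) q =
    1 *: tensor_op X (fun v i => -1 *: A v i + A' v i) B' (pure v w) q
    + tensor_op X A (fun w j => -1 *: B w j + B' w j) (pure v w) q.
  move=> v w q; rewrite !tensor_op_pure// (ucn_linl U) (ucn_linr U).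
  by rewrite !scaleN1r scale1r [RHS]addrC addrA addrK.
have := op_ext U h1 h2 e z p.
by rewrite scaleN1r scale1r addrC.
Qed.

End TensorOperators.

Arguments pure {R Sp Sm} X v w.

(** * The extended skeleton *)

Lemma sum_row_le (R : realType) (I J : finType) (f : I * J -> R) (i : I) :
  (forall p, 0 <= f p) -> \sum_j f (i, j) <= \sum_p f p.
Proof.
move=> f0; have -> : \sum_p f p = \sum_i \sum_j f (i, j).
  by rewrite (pair_bigA _ (fun i j => f (i, j))); apply: eq_bigr => -[].
by rewrite [leRHS](bigD1 i)//= lerDl sumr_ge0// => k _; rewrite sumr_ge0.
Qed.

Section MinusPart.
Context (R : realType) (Sp' Sm : gspace R).
Local Notation Sp := (with_unit Sp').
Variable X : tensor_data (@gpiece R Sp) (@gpiece R Sm).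
Hypothesis U : uniform_crossnorm X.
Implicit Types (v : gvec Sp) (w : gvec Sm) (z : gvec (gtensor X)).

Lemma tens_unit_norm j (w : @gpiece R Sm j) : `|tens X (i := None) (1 : R^o) w| = `|w|.
Proof. by rewrite (ucn_cross U) normr1 mul1r. Qed.

Lemma tens_unit_scale j (a : R^o) (w : @gpiece R Sm j) :
  tens X (i := None) a w = tens X (i := None) (1 : R^o) (a *: w).
Proof.
have := @ucn_linl _ _ _ _ _ _ U None j a (1 : R^o) 0 w.
rewrite (tens0l U) !addr0 => e1.
have := @ucn_linr _ _ _ _ _ _ U None j a (1 : R^o) w 0.
rewrite (tens0r U) !addr0 => e2.
by rewrite e2 -e1; congr (tens X _ _); rewrite /GRing.scale /= mulr1.
Qed.

Lemma tens_unit_inj j (w w' : @gpiece R Sm j) :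
  tens X (i := None) (1 : R^o) w = tens X (i := None) (1 : R^o) w' -> w = w'.
Proof.
move=> e; apply/eqP; rewrite -subr_eq0 -normr_eq0 -tens_unit_norm.
have := @ucn_linr _ _ _ _ _ _ U None j (-1) (1 : R^o) w' w.
by rewrite scaleN1r [- w' + w]addrC => ->; rewrite scaleN1r e addNr normr0.
Qed.

(** Evaluation at the unit summand tensored with the identity, available from [ucn_op] with the real
    line as left target. *)
Lemma minus_op_exists : exists2 M : gvec (gtensor X) -> gvec Sm, is_op M &
  (forall v w j, M (pure X v w) j = (v None : R^o) *: w j).
Proof.
pose s1 (_ : unit) : option (gidx Sp) := None.
pose A (v : gvec Sp) (k : unit) : tgtl (@gpiece R Sp) (s1 k) := v None.
pose B (w : gvec Sm) (j : gidx Sm) : tgtr (@gpiece R Sm) (Some j) := w j.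
have p1 : pure_target s1 by right.
have p2 : @pure_target (gidx Sm) (gidx Sm) Some by left.
have [c hc] := @ucn_op _ _ _ _ _ _ U (gidx Sp) (gidx Sm) unit (gidx Sm) id id s1 Some p1 p2.
have Ab : @bounded_by R (gidx Sp) unit (@gpiece R Sp) (fun k => tgtl (@gpiece R Sp) (s1 k)) A 1.
  move=> v; rewrite mul1r {1}/snorm (bigD1 tt)//= big1 ?addr0; last by case.
  exact: (norm_le_snorm v None).
have Bb : @bounded_by R (gidx Sm) (gidx Sm) (@gpiece R Sm) (fun j => tgtr (@gpiece R Sm) (Some j)) B 1.
  by move=> w; rewrite mul1r.
have Ao : @is_op R (gidx Sp) unit (@gpiece R Sp) (fun k => tgtl (@gpiece R Sp) (s1 k)) A.
  by split=> //; exists 1.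
have Bo : @is_op R (gidx Sm) (gidx Sm) (@gpiece R Sm) (fun j => tgtr (@gpiece R Sm) (Some j)) B.
  by split=> //; exists 1.
have [T [[[Tl [a Ta]] Tp] _]] := hc A B 1 1 Ao Bo ler01 ler01 Ab Bb.
exists (fun z j => T z (tt, j)); last by move=> v w j; exact: (Tp v w (tt, j)).
split; first by move=> d v w j; exact: (Tl d v w (tt, j)).
exists a => v; apply: le_trans (Ta v).
exact: (sum_row_le tt (fun p => normr_ge0 (T v p))).
Qed.

(** The description in [minus_part] picks out the operator of [minus_op_exists], because tensoring
    with 1 is isometric, hence injective. *)
Lemma minus_part_char : is_op (minus_part X) /\
  (forall v w j, minus_part X (pure X v w) j = (v None : R^o) *: w j) /\
  forall z j, tens X (i := None) (1 : R^o) (minus_part X z j) = z (None, j).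
Proof.
have [M Mo Mp] := minus_op_exists.
have [Ml [a Ma]] := Mo.
pose O1 z j := tens X (i := None) (1 : R^o) (M z j).
pose O2 z (j : gidx Sm) := z (None, j).
have o1 : is_op O1.
  split.
    by move=> d z z' j; rewrite /O1 Ml (ucn_linr U).
  by exists a => z; apply: le_trans (Ma z); apply: ler_sum => j _; rewrite tens_unit_norm.
have o2 : is_op O2.
  split => //; exists 1 => z; rewrite mul1r.
  exact: (sum_row_le None (fun p => normr_ge0 (z p))).
have e z j : tens X (i := None) (1 : R^o) (M z j) = z (None, j).
  apply: (op_ext U o1 o2) => v w {}j; rewrite /O1 /O2 Mp.
  by rewrite -tens_unit_scale.
have mE : minus_part X = M.
  apply: funext => z; apply: functional_extensionality_dep => j; apply: tens_unit_inj.
  have h : exists w : @gpiece R Sm j, z (None, j) = tens X (i := None) (1 : R^o) w.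
    by exists (M z j); rewrite e.
  have h' : z (None, j) = tens X (i := None) (1 : R^o) (minus_part X z j).
    exact: (the_spec 0 h).
  by rewrite -h' e.
by rewrite mE.
Qed.

Lemma minus_part_op : is_op (minus_part X). Proof. by have [] := minus_part_char. Qed.

Lemma minus_part_pure v w j : minus_part X (pure X v w) j = (v None : R^o) *: w j.
Proof. by have [_ [h _]] := minus_part_char. Qed.

Lemma minus_partE z j : tens X (i := None) (1 : R^o) (minus_part X z j) = z (None, j).
Proof. by have [_ [_ h]] := minus_part_char. Qed.

Lemma minus_part_norm z j : `|minus_part X z j| = `|z (None, j)|.
Proof. by rewrite -minus_partE tens_unit_norm. Qed.

Lemma minus_part_local z z' j : z (None, j) = z' (None, j) -> minus_part X z j = minus_part X z' j.
Proof. by move=> h; apply: tens_unit_inj; rewrite !minus_partE. Qed.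

(** Nothing lies below homogeneity 0, so a triangular operator does not alter the unit component. *)
Lemma unit_component (A : gvec Sp -> gvec Sp) v : (forall i : gidx Sp', 0 < ghom i) ->
  is_op A -> lower_triangular A -> A v None = v None.
Proof.
move=> pos Ao At; have := @tri_local _ _ _ Ao At v (fun=> 0) None.
have [Al _] := Ao.
have A0 : A (fun=> 0) None = (0 : @gpiece R Sp None).
  exact: (@vlin0 R (gidx Sp) (@gpiece R Sp) (@gpiece R Sp None) (fun u => A u None)
    (fun a x1 x2 => Al a x1 x2 None)).
rewrite A0 subrr => h; apply/eqP; rewrite -subr_eq0; apply/eqP; apply: h => -[i|] /=.
  by rewrite ltNge ltW.
by rewrite ltxx.
Qed.

Lemma minus_part_tensor (A : gvec Sp -> gvec Sp) (B : gvec Sm -> gvec Sm) z :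
  (forall i : gidx Sp', 0 < ghom i) -> is_op A -> is_op B -> lower_triangular A ->
  minus_part X (tensor_op X A B z) = B (minus_part X z).
Proof.
move=> pos Ao Bo At; apply: functional_extensionality_dep => j.
have h1 := is_op_comp (tensor_op_is_op U Ao Bo) minus_part_op.
have h2 := is_op_comp minus_part_op Bo.
apply: (op_ext U h1 h2) => v w {}j.
have -> : tensor_op X A B (fun p => tens X (v p.1) (w p.2)) = pure X (A v) (B w).
  by apply: functional_extensionality_dep => p; exact: tensor_op_pure.
rewrite minus_part_pure (unit_component v pos Ao At).
have [Bl _] := Bo.
rewrite -(@vlinZ R (gidx Sm) (@gpiece R Sm) (@gpiece R Sm j) (fun u => B u j) (fun a x1 x2 => Bl a x1 x2 j)); congr (B _ j).
by apply: functional_extensionality_dep => k; rewrite -minus_part_pure.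
Qed.

End MinusPart.

Section Low.
Context (R : realType).
Implicit Types C D d a b : R.

(** The coefficient of a strictly lower term in the skeleton bound, extended by 0 so that sums over
    all indices, as in [tensor_mono], can be used. *)
Definition low C d a a' : R := if a' < a then C * d `^ (a - a') else 0.

Lemma low_ge0 C d a a' : 0 <= C -> 0 <= low C d a a'.
Proof. by move=> C0; rewrite /low; case: ifP => // _; rewrite mulr_ge0 ?powR_ge0. Qed.

Lemma low_mul C D d a a' b b' : 0 <= C -> 0 <= D ->
  low C d a a' * low D d b b' <= low (C * D) d (a + b) (a' + b').
Proof.
move=> C0 D0; rewrite {1 2}/low; case: ifP => hi; last by rewrite mul0r low_ge0 ?mulr_ge0.
case: ifP => hj; last by rewrite mulr0 low_ge0 ?mulr_ge0.
rewrite /low ltrD// opprD addrACA [in leRHS]powRD; last first.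
  by rewrite gt_eqF// addr_gt0 ?subr_gt0.
by rewrite [leLHS]mulrACA.
Qed.

Lemma low_l C d a a' b : low C d (a + b) (a' + b) = low C d a a'.
Proof. by rewrite /low ltrD2r opprD addrACA subrr addr0. Qed.

Lemma low_r C d a b b' : low C d (a + b) (a + b') = low C d b b'.
Proof. by rewrite /low ltrD2l opprD addrACA subrr add0r. Qed.

Lemma lowD C D d a a' : low C d a a' + low D d a a' = low (C + D) d a a'.
Proof. by rewrite /low; case: ifP; rewrite ?addr0 // mulrDl. Qed.

End Low.

Section Extension.
Context (R : realType) (Sp' Sm : gspace R).
Local Notation Sp := (with_unit Sp').
Variable X : tensor_data (@gpiece R Sp) (@gpiece R Sm).
Hypothesis U : uniform_crossnorm X.
Hypothesis pos : forall i : gidx Sp', 0 < ghom i.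
Variables (Gp : gop Sp) (Gm : gop Sm).
Hypotheses (Gp_sk : is_skeleton Gp) (Gm_sk : is_skeleton Gm).
Local Notation G := (tensor_skeleton X Gp Gm).
Local Notation S := (gtensor X).
Variables (level : R) (Nst : {posnum R}) (Vm : gform Sm) (am : R).
Hypothesis Vm_form : forall x, is_form (Vm x).
Hypothesis Vm_mod : exists C, mod_bound Gm am Vm C.
Hypothesis level_gt : forall j : gidx Sm, ghom j < level.
Hypothesis level_le : level <= am.
Local Notation EXT := (extension X level Nst).
Local Notation Gext := (ext_skeleton X level Nst G Vm).

Lemma tensor_skeleton_op x : is_op (G x).
Proof. exact: (tensor_op_is_op U (sk_op Gp_sk x) (sk_op Gm_sk x)). Qed.

Lemma tensor_skeleton_tri x : lower_triangular (G x).
Proof.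
by apply: (tensor_op_tri U (sk_op Gp_sk x) (sk_op Gm_sk x)); exact: skeleton_tri.
Qed.

Lemma minus_part_skeleton x z : minus_part X (G x z) = Gm x (minus_part X z).
Proof.
by apply: (minus_part_tensor U z pos (sk_op Gp_sk x) (sk_op Gm_sk x)); exact: skeleton_tri.
Qed.

Lemma snorm_ext (w : gvec EXT) : snorm w = `|w None| + snorm (ext_snd w).
Proof.
rewrite /snorm (bigD1 None)//=; congr (_ + _).
rewrite (reindex_omap Some id)//=; last by case.
by apply: eq_bigl => i; rewrite eqxx.
Qed.

Lemma ext_normE (w : gvec EXT) : `|w None| = `|ext_fst w| / Nst%:num.
Proof. by []. Qed.

Lemma snorm_ext_snd (w : gvec EXT) : snorm (ext_snd w) <= snorm w.
Proof. by rewrite snorm_ext lerDr. Qed.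

Lemma ext_op x : is_op (Gext x).
Proof.
have [Gl _] := tensor_skeleton_op x.
have [a a0 Ga] := is_op_ge0 (tensor_skeleton_op x).
have [Vl _] := is_form_comp (minus_part_op U) (Vm_form x).
have [b b0 Vb] := is_form_ge0 (is_form_comp (minus_part_op U) (Vm_form x)).
split.
  move=> c v w [i|]; first exact: (Gl c (ext_snd v) (ext_snd w) i).
  have := Vl c (ext_snd v) (ext_snd w).
  rewrite /ext_skeleton /= => h.
  transitivity (c * ext_fst v + ext_fst w - (c * Vm x (minus_part X (ext_snd v))
    + Vm x (minus_part X (ext_snd w)))).
    by rewrite -h.
  rewrite /GRing.scale /=.
  by move: (Vm x _) (Vm x _) (ext_fst v) (ext_fst w) => p q r s; ring.
exists (1 + b / Nst%:num + a) => w; rewrite snorm_ext ext_normE /=.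
have h1 : snorm (ext_snd (Gext x w)) <= a * snorm w.
  apply: (@le_trans _ _ (a * snorm (ext_snd w))); last first.
    by rewrite ler_wpM2l ?snorm_ext_snd.
  exact: Ga.
have h2 : `|ext_fst (Gext x w)| / Nst%:num <= (1 + b / Nst%:num) * snorm w.
  apply: (@le_trans _ _ ((`|ext_fst w| + b * snorm w) / Nst%:num)).
    rewrite ler_wpM2r ?invr_ge0//.
    apply: (le_trans (ler_normB _ _)); rewrite lerD2l.
    apply: (le_trans (Vb (ext_snd w))).
    by rewrite ler_wpM2l ?snorm_ext_snd.
  rewrite !mulrDl mul1r [_ * _ / _]mulrAC lerD2r -ext_normE.
  exact: norm_le_snorm.
by rewrite mulrDl lerD.
Qed.

Lemma ext_snd_single_none (z : @gpiece R EXT None) : ext_snd (single z) = (fun=> 0).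
Proof. by apply: functional_extensionality_dep => i; rewrite /ext_snd single_neq. Qed.

Lemma ext_snd_single (i : gidx S) (z : @gpiece R EXT (Some i)) :
  ext_snd (@single R (gidx EXT) (@gpiece R EXT) (Some i) z) = @single R (gidx S) (@gpiece R S) i z.
Proof.
apply: functional_extensionality_dep => k; rewrite /ext_snd.
have [e|ne] := eqVneq i k.
  by case: _ / e; rewrite !single_eq.
by rewrite !single_neq.
Qed.

Lemma form_zero (K : finType) (E : K -> completeNormedModType R) (f : (forall k, E k) -> R) :
  is_form f -> f (fun=> 0) = 0.
Proof. by move=> [fl _]; exact: (@vlin0 R K E (R^o : lmodType R) f fl). Qed.

Lemma op_zero (K L : finType) (E : K -> completeNormedModType R) (F : L -> completeNormedModType R)
  (A : (forall k, E k) -> forall l, F l) l : is_op A -> A (fun=> 0) l = 0.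
Proof.
by move=> [Al _]; exact: (@vlin0 R K E (F l) (fun u => A u l) (fun a x1 x2 => Al a x1 x2 l)).
Qed.

(** The new row only sees the components [(None, j)], whose homogeneities lie below [level] by
    [level_gt]. *)
Lemma ext_tri x : lower_triangular (Gext x).
Proof.
have Mf := is_form_comp (minus_part_op U) (Vm_form x).
move=> [i|] [j|] z ij.
- transitivity (G x (ext_snd (@single R (gidx EXT) (@gpiece R EXT) (Some i) z)) j) => //.
  rewrite ext_snd_single tensor_skeleton_tri//.
  by rewrite -ext_snd_single.
- transitivity (0 : @gpiece R EXT None); last by rewrite single_neq.
  transitivity (ext_fst (@single R (gidx EXT) (@gpiece R EXT) (Some i) z)
    - Vm x (minus_part X (ext_snd (@single R (gidx EXT) (@gpiece R EXT) (Some i) z)))) => //.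
  rewrite /ext_fst [X in X - _]single_neq// ext_snd_single sub0r.
  suff -> : minus_part X (@single R (gidx S) (@gpiece R S) i z) = (fun=> 0).
    by rewrite form_zero// oppr0.
  apply: functional_extensionality_dep => j.
  transitivity (minus_part X (fun=> 0) j); last exact: op_zero (minus_part_op U).
  apply: (minus_part_local U); rewrite single_neq//.
  by apply: contra ij => /eqP -> /=; rewrite add0r.
- transitivity (0 : @gpiece R EXT (Some j)); last by rewrite single_neq.
  transitivity (G x (ext_snd (@single R (gidx EXT) (@gpiece R EXT) None z)) j) => //.
  by rewrite ext_snd_single_none op_zero//; exact: tensor_skeleton_op.
- transitivity (ext_fst (@single R (gidx EXT) (@gpiece R EXT) None z)
    - Vm x (minus_part X (ext_snd (@single R (gidx EXT) (@gpiece R EXT) None z)))) => //.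
  rewrite ext_snd_single_none.
  suff -> : minus_part X (fun=> 0) = (fun=> 0) by rewrite form_zero// subr0.
  by apply: functional_extensionality_dep => j; exact: op_zero (minus_part_op U).
Qed.

Lemma pdist_ge0 (x y : R * R) : 0 <= pdist x y.
Proof. by rewrite /pdist addr_ge0. Qed.

Lemma powR_le1_ge (d a b : R) : 0 <= d <= 1 -> b <= a -> 0 <= b -> d `^ a <= d `^ b.
Proof.
move=> /andP[]; rewrite le_eqVlt => /orP[/eqP <- _ ba b0|d0 d1 ba _].
  have [a0|a0] := eqVneq a 0.
    by have -> : b = a by apply/eqP; rewrite eq_le ba a0 b0.
  by rewrite powR0// powR_ge0.
by apply: ger_powR; rewrite // d0.
Qed.

Let skeleton_low (T : gspace R) (GT : gop T) C v x y i : skeleton_bound GT C -> pdist y x <= 1 ->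
  `|-1 *: GT x v i + GT y v i| <= \sum_i' low C (pdist y x) (ghom i) (ghom i') * `|GT x v i'|.
Proof.
move=> h d; rewrite scaleN1r addrC; apply: (le_trans (skeleton_idx h v i d)).
rewrite big_mkcond; apply: ler_sum => k _; rewrite /low.
by case: ifP; rewrite ?mul0r.
Qed.

(** Leibniz rule with [Gm y] in the first term; [Gm y] is bounded through [Gm x] by a Kronecker
    delta plus a strictly lower part. The three summands of the constant come from the three
    resulting products. *)
Lemma tensor_skeleton_bound : exists2 C, 0 <= C &
  forall z x y (p : gidx S), pdist y x <= 1 -> `|G y z p - G x z p| <=
    \sum_(q | ghom q < ghom p) C * (pdist y x) `^ (ghom p - ghom q) * `|G x z q|.
Proof.
have mono (T : gspace R) (GT : gop T) C D : C <= D -> skeleton_bound GT C -> skeleton_bound GT D.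
  move=> CD h b' b'S v' x' y' d'.
  by apply: (le_trans (h b' b'S v' x' y' d')); rewrite ler_wpM2r ?sum_skeleton_ge0.
have [Cp Cp0 hp] := ex_const_ge0 (@mono _ Gp) (sk_bound Gp_sk).
have [Cm Cm0 hm] := ex_const_ge0 (@mono _ Gm) (sk_bound Gm_sk).
exists (Cp + Cp * Cm + Cm); first by rewrite !addr_ge0 ?mulr_ge0.
move=> z x y [i j] d1; set d := pdist y x.
have d0 : 0 <= d := pdist_ge0 y x.
have := tensor_op_sub U (sk_op Gp_sk x) (sk_op Gp_sk y) (sk_op Gm_sk x) (sk_op Gm_sk y) z (i, j).
rewrite /tensor_skeleton => ->; apply: (le_trans (ler_normD _ _)).
have dp := is_op_lin (-1) (sk_op Gp_sk x) (sk_op Gp_sk y).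
have dm := is_op_lin (-1) (sk_op Gm_sk x) (sk_op Gm_sk y).
have dl (T : finType) (k : T) (f : T -> R) : \sum_k' (k' == k)%:R * f k' = f k.
  by rewrite (bigD1 k)//= eqxx mul1r big1 ?addr0// => k' /negbTE ->; rewrite mul0r.
have h1 := tensor_op_comp_bound U (i := i) (j := j) dp (sk_op Gm_sk y) (sk_op Gp_sk x) (sk_op Gm_sk x)
  (a := fun i' => low Cp d (ghom i) (ghom i')) (b := fun j' => (j' == j)%:R + low Cm d (ghom j) (ghom j')) _ _ _ _ z.
have h2 := tensor_op_comp_bound U (i := i) (j := j) (sk_op Gp_sk x) dm (sk_op Gp_sk x) (sk_op Gm_sk x)
  (a := fun i' => (i' == i)%:R) (b := fun j' => low Cm d (ghom j) (ghom j')) _ _ _ _ z.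
apply: (le_trans (lerD (h1 _ _ _ _) (h2 _ _ _ _))) => {h1 h2}.
- by move=> i'; exact: low_ge0.
- by move=> j'; rewrite addr_ge0 ?low_ge0.
- by move=> v; exact: skeleton_low.
- move=> w; under eq_bigr do rewrite mulrDl.
  rewrite big_split/= dl -lerBlDl; apply: le_trans (skeleton_low w j hm d1).
  by rewrite scaleN1r [X in _ <= `|X|]addrC; exact: lerB_dist.
- by [].
- by move=> j'; exact: low_ge0.
- by move=> v; rewrite dl.
- by move=> w; exact: skeleton_low.
rewrite -big_split/= [leRHS]big_mkcond/=; apply: ler_sum => -[i' j'] _ /=.
rewrite -mulrDl; set t := `|_|; have t0 : 0 <= t by exact: normr_ge0.
suff : low Cp d (@ghom R Sp i) (@ghom R Sp i') * ((j' == j)%:R + low Cm d (ghom j) (ghom j'))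
    + (i' == i)%:R * low Cm d (ghom j) (ghom j') <=
    low (Cp + Cp * Cm + Cm) d (@ghom R Sp i + ghom j) (@ghom R Sp i' + ghom j').
  move=> h; apply: (le_trans (ler_wpM2r t0 h)); rewrite /low.
  by case: ifP; rewrite ?mul0r.
rewrite -!lowD mulrDr; apply: lerD; first apply: lerD.
- have [->|_] := eqVneq j' j; first by rewrite mulr1 low_l.
  by rewrite mulr0 low_ge0.
- exact: low_mul.
- have [->|_] := eqVneq i' i; first by rewrite mul1r low_r.
  by rewrite mul0r low_ge0.
Qed.

Lemma sum_ext (f : gidx EXT -> R) (P : pred (gidx EXT)) :
  \sum_(o | P o) f o = (if P None then f None else 0) + \sum_(p : gidx S | P (Some p)) f (Some p).
Proof.
rewrite [LHS]big_mkcond (bigD1 None)//=; congr (_ + _).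
rewrite (reindex_omap Some id)//=; last by case.
rewrite [RHS]big_mkcond; apply: eq_bigl => i; by rewrite eqxx.
Qed.

(** The new row is the increment bound of [Vm], its exponents weakened by [level <= am] and
    [d <= 1], and its norm divided by [Nst]. Existence of some constant makes [sk_norm] of the
    extension a valid bound. *)
Lemma ext_skeleton_bound : exists C, skeleton_bound Gext C.
Proof.
have [C C0 hC] := tensor_skeleton_bound.
have mono C1 C2 : C1 <= C2 -> mod_bound Gm am Vm C1 -> mod_bound Gm am Vm C2.
  move=> CD h v x y d.
  by apply: (le_trans (h v x y d)); rewrite ler_wpM2r ?sum_mod_ge0.
have [D D0 hD] := ex_const_ge0 mono Vm_mod.
have N0 : 0 < Nst%:num by [].
pose K := C + D / Nst%:num.
have K0 : 0 <= K by rewrite addr_ge0 ?divr_ge0.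
exists (#|gidx EXT|%:R * K); apply: idx_skeleton => // v x y o d1.
have d0 := pdist_ge0 y x.
have nn (P : pred (gidx EXT)) : 0 <= \sum_(p : gidx S | P (Some p)) 
   K * pdist y x `^ (@ghom _ EXT o - @ghom _ EXT (Some p)) * `|Gext x v (Some p)|.
  by apply: sumr_ge0 => p _; rewrite !mulr_ge0 ?powR_ge0.
rewrite sum_ext; case: o nn => [p|] nn.
  apply: (@le_trans _ _ (\sum_(q : gidx S | ghom q < ghom p)
     K * (pdist y x) `^ (ghom p - ghom q) * `|Gext x v (Some q)|)); last first.
    by rewrite lerDr; case: ifP => // _; rewrite !mulr_ge0 ?powR_ge0.
  apply: (le_trans (hC (ext_snd v) x y p d1)); apply: ler_sum => q _.
  by rewrite !ler_wpM2r ?powR_ge0// lerDl divr_ge0.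
rewrite ltxx add0r.
have -> : `|Gext y v None - Gext x v None|
    = `|Vm y (minus_part X (ext_snd v)) - Vm x (minus_part X (ext_snd v))| / Nst%:num.
  rewrite rescaled_normE distrC; congr (`|_| / _); rewrite /ext_skeleton /=.
  have e (f a b : R) : (f - a) - (f - b) = b - a by ring.
  exact: e.
rewrite ler_pdivrMr//.
apply: (le_trans (mod_idx hD (minus_part X (ext_snd v)) d1)).
apply: (@le_trans _ _ (\sum_(j : gidx Sm)
   D * pdist y x `^ (level - ghom j) * `|G x (ext_snd v) (None, j)|)).
  apply: ler_sum => j _.
  rewrite -minus_part_skeleton (minus_part_norm U) ler_wpM2r// ler_wpM2l//.
  by apply: powR_le1_ge; rewrite ?d0 ?d1 ?subr_ge0 ?(ltW (level_gt _))// le_max lerD2r level_le.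
rewrite mulr_suml.
pose f p := if @ghom _ S p < level then K * pdist y x `^ (level - ghom p) * `|G x (ext_snd v) p| * Nst%:num else 0.
apply: (@le_trans _ _ (\sum_p f p)); last by rewrite [leRHS]big_mkcond.
apply: le_trans (sum_row_le None _); last first.
  by move=> p; rewrite /f; case: ifP => // _; rewrite !mulr_ge0 ?powR_ge0.
apply: ler_sum => j _; rewrite /f /= add0r level_gt.
have KN : D <= K * Nst%:num.
  by rewrite /K mulrDl divfK ?gt_eqF// lerDr mulr_ge0.
have e (p n m : R) : K * p * n * m = K * m * (p * n) by ring.
by rewrite e -mulrA ler_wpM2r// mulr_ge0 ?powR_ge0.
Qed.
End Extension.

(** * The positive factor *)

Lemma pdist_eq0 (R : realType) (x y : R * R) : 0 = pdist y x -> x = y.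
Proof.
move/esym/eqP; rewrite /pdist paddr_eq0// normr_eq0 subr_eq0 => /andP[/eqP e1].
rewrite sqrtr_eq0 normr_le0 subr_eq0 => /eqP e2.
by move: x y e1 e2 => [? ?] [? ?] /= -> ->.
Qed.

Section PositivePart.
Context (R : realType) (Sp' : gspace R).
Local Notation Sp := (with_unit Sp').
Variables (alpha ap N : R) (angp : R -> R) (Gp : gop Sp) (Vp : gform Sp).
Hypothesis alpha0 : 0 < alpha.
Hypothesis alpha_le : forall i : gidx Sp', alpha <= ghom i.
Hypothesis alpha_ap : alpha < ap.
Hypothesis Gp_sk : is_skeleton Gp.
Hypothesis N01 : 0 < N <= 1.
Hypothesis Vp_md : is_modelled Gp N angp ap Vp.
Local Notation up := (scalar_part Gp alpha Vp).
Local Notation Vbar := (higher_part Gp alpha Vp).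

Let pos (i : gidx Sp') : 0 < ghom i. Proof. exact: lt_le_trans (alpha_le i). Qed.
Let Go x := sk_op Gp_sk x.
Let Gt x := skeleton_tri x Gp_sk.
Let Vf x := md_form Vp_md x.

Lemma unit_comp x v : Gp x v None = v None.
Proof. exact: unit_component. Qed.

Lemma trunc_alpha (v : gvec Sp) : trunc alpha v = fun o => (v None : R) *: @unit0 R Sp' o.
Proof.
apply: functional_extensionality_dep => -[i|]; rewrite /trunc /=.
  by rewrite scaler0 ltNge alpha_le.
by rewrite alpha0 /GRing.scale /= mulr1.
Qed.

Lemma reduce_alpha x v : reduce Gp alpha Vp x v = up x * (v None : R).
Proof.
rewrite /scalar_part /reduce !trunc_alpha !unit_comp.
have [[Wl _] _] := coef_spec (Go x) (@Gt x) (Vf x).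
have e c : coefficients Gp Vp x (fun o => c *: @unit0 R Sp' o) = c * coefficients Gp Vp x (@unit0 R Sp').
  exact: (@vlinZ R (gidx Sp) (@gpiece R Sp) (R^o : lmodType R) (coefficients Gp Vp x) Wl).
by rewrite !e mulrC mul1r.
Qed.

Lemma Vp_split x v : Vp x v = Vbar x v + up x * (v None : R).
Proof. by rewrite /higher_part reduce_alpha subrK. Qed.

Lemma eval_none_form : is_form (fun v : gvec Sp => (v None : R)).
Proof. by split => //; exists 1 => v; rewrite mul1r; exact: (norm_le_snorm v None). Qed.

Lemma Vbar_form x : is_form (Vbar x).
Proof.
have := is_form_lin (- up x) eval_none_form (Vf x).
congr is_form; apply: funext => v; rewrite Vp_split; ring.
Qed.

(** Vectors whose expansion at [x] is the unit let bounds on [Vp] be read as bounds on [up]. *)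
Lemma up_fiber x : exists2 v, Gp x v = @unit0 R Sp' & Vp x v = up x.
Proof.
have [v vE] := tri_surj (Go x) (@Gt x) (@unit0 R Sp').
exists v => //; rewrite /scalar_part /reduce trunc_alpha unit_comp.
have [_ ->] := coef_spec (Go x) (@Gt x) (Vf x); rewrite vE; congr (coefficients _ _ _ _).
by apply: functional_extensionality_dep => o; rewrite scale1r.
Qed.

Let N0 : 0 < N. Proof. by case/andP: N01. Qed.

Let sizeP := size_idx (size_normP (md_size Vp_md)).
Let modP := mod_idx (mod_normP (md_mod Vp_md)).

Lemma sum_unit (f : gidx Sp -> R) : \sum_o f o * `|@unit0 R Sp' o| = f None.
Proof.
rewrite (bigD1 None)//= normr1 mulr1 big1 ?addr0// => -[i|]//= _.
by rewrite normr0 mulr0.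
Qed.

Lemma up_bound x : `|up x| <= size_norm Gp N angp Vp * N `^ (angp 0).
Proof.
have [v vE <-] := up_fiber x; apply: (le_trans (sizeP v x)).
by rewrite vE sum_unit.
Qed.

Lemma Vbar_coef x v : Vbar x v =
  coefficients Gp Vp x (fun o => if o is Some i then Gp x v (Some i) else 0).
Proof.
rewrite /higher_part; have [[Wl _] ->] := coef_spec (Go x) (@Gt x) (Vf x).
rewrite /reduce -(@vlinB R (gidx Sp) (@gpiece R Sp) (R^o : lmodType R) (coefficients Gp Vp x) Wl).
congr (coefficients _ _ _ _); apply: functional_extensionality_dep => -[i|] /=.
  by rewrite trunc_alpha scaler0 subr0.
by rewrite trunc_alpha /= /GRing.scale /= mulr1 subrr.
Qed.

(** For [v] with the unit as expansion at [x], [up y - up x] is the increment of [Vp] minus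
    [Vbar y v], and the latter only sees the components that the skeleton creates in passing from
    [x] to [y]. The constant serves only to show that the Hoelder supremum is finite. *)
Lemma up_holder_local : exists2 K, 0 <= K & forall x y, pdist y x <= 1 ->
  `|up y - up x| <= K * pdist y x `^ alpha.
Proof.
have [C C0 hC] : exists2 C, 0 <= C & skeleton_bound Gp C.
  apply: (ex_const_ge0 _ (sk_bound Gp_sk)) => C D CD h b' b'S v' x' y' d'.
  by apply: (le_trans (h b' b'S v' x' y' d')); rewrite ler_wpM2r ?sum_skeleton_ge0.
pose A := mod_norm Gp ap Vp.
pose B := size_norm Gp N angp Vp.
have A0 : 0 <= A by exact: least_const_ge0.
have B0 : 0 <= B by exact: least_const_ge0.
exists (A + \sum_(i : gidx Sp') B * N `^ (angp (ghom i)) * C).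
  by rewrite addr_ge0// sumr_ge0// => i _; rewrite !mulr_ge0 ?powR_ge0.
move=> x y d1; have d0 := pdist_ge0 y x.
have [v vE Vv] := up_fiber x.
have vN : v None = 1 :> R by rewrite -(unit_comp x) vE.
have e : up y = Vp y v - Vbar y v by rewrite Vp_split vN mulr1; ring.
have -> : up y - up x = (Vp y v - Vp x v) + - Vbar y v by rewrite e Vv; ring.
apply: (le_trans (ler_normD _ _)); rewrite mulrDl normrN; apply: lerD.
  apply: (le_trans (modP v d1)); rewrite vE sum_unit /= subr0 -/A ler_wpM2l//.
  apply: powR_le1_ge; rewrite ?d0 ?d1 ?(ltW alpha0)// le_max (ltW alpha_ap)//.
rewrite Vbar_coef.
apply: (le_trans (coef_bound (Go y) (@Gt y) (Vf y) (fun v => sizeP v y) _)).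
rewrite (bigD1 None)//= normr0 mulr0 add0r (reindex_omap Some id)//=; last by case.
rewrite (eq_bigl xpredT); last by move=> i; rewrite eqxx.
rewrite mulr_suml; apply: ler_sum => i _.
rewrite -[leRHS]mulrA ler_wpM2l ?mulr_ge0 ?powR_ge0//.
have := skeleton_idx hC v (Some i) d1; rewrite vE /= subr0 => /le_trans; apply.
rewrite (bigD1 None)//= ?pos// normr1 mulr1 subr0 big1 ?addr0; last first.
  by move=> -[k _|/andP[]//]; rewrite /= normr0 mulr0.
rewrite ler_wpM2l//; apply: powR_le1_ge; rewrite ?d0 ?d1 ?(ltW alpha0)//.
Qed.

(** For distances above 1 boundedness of [up] suffices, as [alpha > 0]. Without this the supremum in
    [holder_seminorm] might be its default value 0. *)
Lemma holder_set_bounded : exists B, forall x y, x <> y ->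
  pdist y x `^ (- alpha) * `|up y - up x| <= B.
Proof.
have [K K0 hK] := up_holder_local.
pose B := size_norm Gp N angp Vp * N `^ (angp 0).
have B0 : 0 <= B by rewrite mulr_ge0 ?powR_ge0// least_const_ge0.
exists (Num.max K (B + B)) => x y xy.
have d0 : 0 < pdist y x.
  rewrite lt_neqAle pdist_ge0 andbT; apply/eqP => h; apply: xy; exact: pdist_eq0.
rewrite powRN mulrC ler_pdivrMr ?powR_gt0//.
have [d1|d1] := leP (pdist y x) 1.
  by apply: (le_trans (hK x y d1)); rewrite ler_wpM2r ?powR_ge0// le_max lexx.
apply: (@le_trans _ _ (B + B)).
  by apply: (le_trans (ler_normB _ _)); apply: lerD; exact: up_bound.
apply: (@le_trans _ _ ((B + B) * pdist y x `^ alpha)).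
  rewrite ler_peMr ?addr_ge0// -(powRr0 (pdist y x)) ler_powR ?(ltW alpha0)// ltW//.
by rewrite ler_wpM2r ?powR_ge0// le_max lexx orbT.
Qed.

Lemma has_sup_holder : has_sup [set c | exists x y : R * R,
  x <> y /\ c = pdist y x `^ (- alpha) * `|up y - up x|].
Proof.
have [B hB] := holder_set_bounded; split.
  exists (pdist (1, 0) (0, 0) `^ (- alpha) * `|up (1, 0) - up (0, 0)|).
  exists (0, 0), (1, 0); split => // -[/eqP].
  by rewrite eq_sym oner_eq0.
by exists B => _ [x [y [xy ->]]]; exact: hB.
Qed.

Lemma holder_ge0 : 0 <= holder_seminorm alpha up.
Proof.
have [[c hc] _] := has_sup_holder; have := sup_upper_bound has_sup_holder hc.
apply: le_trans; have [x [y [_ ->]]] := hc.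
by rewrite mulr_ge0 ?powR_ge0.
Qed.

Lemma up_holder x y : `|up y - up x| <= holder_seminorm alpha up * pdist y x `^ alpha.
Proof.
have [<-|/eqP xy] := eqVneq x y.
  by rewrite subrr normr0 mulr_ge0 ?powR_ge0// holder_ge0.
have d0 : 0 < pdist y x.
  rewrite lt_neqAle pdist_ge0 andbT; apply/eqP => h; apply: xy; exact: pdist_eq0.
rewrite -ler_pdivrMr ?powR_gt0// mulrC -powRN.
by apply: (sup_upper_bound has_sup_holder); exists x, y.
Qed.

(** Makes [size_norm] of [Vbar] a valid bound rather than a default value. *)
Lemma Vbar_size : exists C, size_bound Gp N angp Vbar C.
Proof.
exists (size_norm Gp N angp Vp + size_norm Gp N angp Vp * N `^ (angp 0) * N `^ (- angp 0)) => v x.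
rewrite (@sum_homs _ _ predT (fun c => N `^ (angp c))) mulrDl.
have -> : Vbar x v = Vp x v - up x * (v None : R) by rewrite Vp_split; ring.
apply: (le_trans (ler_normB _ _)); apply: lerD.
  by have := sizeP v x; under eq_bigr do rewrite -mulrA; rewrite -mulr_sumr.
rewrite normrM -mulrA; apply: ler_pM => //; first exact: up_bound.
rewrite powRN [leRHS]mulrC ler_pdivlMr ?powR_gt0//.
rewrite (bigD1 None)//= unit_comp mulrC lerDl.
by rewrite sumr_ge0// => o _; rewrite mulr_ge0 ?powR_ge0.
Qed.

(** The coefficient of [Vbar] at homogeneity 0 vanishes, so [v] may be replaced by a vector whose
    expansion at [x] has no unit component; the constant stays the same. *)
Lemma Vbar_pos x v : `|Vbar x v| <=
  \sum_(i : gidx Sp') size_norm Gp N angp Vbar * N `^ (angp (ghom i)) * `|Gp x v (Some i)|.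
Proof.
pose w : gvec Sp := fun o => if o is Some i then Gp x v (Some i) else 0.
have [u uE] := tri_surj (Go x) (@Gt x) w.
have e : Vbar x v = Vbar x u.
  rewrite (Vbar_coef x v) (Vbar_coef x u); congr (coefficients Gp Vp x _).
  by apply: functional_extensionality_dep => -[i|//]; rewrite uE.
rewrite e; apply: (le_trans (size_idx (size_normP Vbar_size) u x)).
rewrite (bigD1 None)//= uE normr0 mulr0 add0r (reindex_omap Some id)//=; last by case.
by rewrite (eq_bigl xpredT)// => i; rewrite eqxx.
Qed.

(** [Vbar] is expanded at [x] only; its change from [x] to [y] is that of [Vp] minus that of [up].
    Thus no constant of the skeleton [Gp] enters, as the form of [M^c] requires. *)
Lemma Vbar_shift x y v : pdist y x <= 1 -> `|Vbar y v| <=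
  \sum_o ((if o is Some i then size_norm Gp N angp Vbar * N `^ (angp (ghom i))
           else holder_seminorm alpha up * pdist y x `^ alpha)
    + mod_norm Gp ap Vp * pdist y x `^ (Num.max (ap - @ghom _ Sp o) 0)) * `|Gp x v o|.
Proof.
move=> d1; have -> : Vbar y v = Vbar x v + (- (up y - up x) * (v None : R)) + (Vp y v - Vp x v).
  by rewrite !Vp_split; ring.
under eq_bigr do rewrite mulrDl.
rewrite big_split/=; apply: (le_trans (ler_normD _ _)); apply: lerD; last exact: modP.
rewrite (bigD1 None)//= [leRHS]addrC; apply: (le_trans (ler_normD _ _)); apply: lerD; last first.
  by rewrite normrM normrN unit_comp ler_wpM2r// up_holder.
rewrite (reindex_omap Some id)//=; last by case.
by rewrite (eq_bigl xpredT)// ?Vbar_pos// => i; rewrite eqxx.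
Qed.

End PositivePart.

(** * Chaining points at distance larger than one *)

Section Subdivision.
Context (R : realType).
Implicit Types (x y : R * R) (d : R).

Definition subdiv x y (n k : nat) : R * R :=
  (y.1 + k%:R / n%:R * (x.1 - y.1), y.2 + k%:R / n%:R * (x.2 - y.2)).

Lemma subdiv0 x y n : subdiv x y n 0 = y.
Proof. by case: y => a b; rewrite /subdiv /= !mul0r !addr0. Qed.

Lemma subdivn x y n : (0 < n)%N -> subdiv x y n n = x.
Proof.
move=> n0; have e : n%:R / n%:R = 1 :> R by rewrite divff// pnatr_eq0 -lt0n.
by rewrite /subdiv e !mul1r !subrKC; case: x.
Qed.

(* The parabolic distance scales like a square root in the second variable,
   whence [pdist x y ^+ 2] steps. *)
Lemma pdist_subdiv x y n k : (0 < n)%N -> pdist x y ^+ 2 <= n%:R ->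
  pdist (subdiv x y n k.+1) (subdiv x y n k) <= 1.
Proof.
move=> n0 dn; have N0 : 0 < n%:R :> R by rewrite ltr0n.
have d0 := pdist_ge0 x y.
have s0 : 0 < Num.sqrt n%:R :> R by rewrite sqrtr_gt0.
have ds : pdist x y <= Num.sqrt n%:R by rewrite -(ler_pXn2r (n := 2)) ?nnegrE ?(ltW s0)// sqr_sqrtr// ltW.
have s1 : Num.sqrt n%:R <= n%:R :> R.
  rewrite -{2}(@sqr_sqrtr _ n%:R) ?(ltW N0)// expr2 ler_peMr ?(ltW s0)//.
  by rewrite -[leLHS]sqrtr1 ler_wsqrtr// ler1n.
have e (a b : R) : b + k.+1%:R / n%:R * (a - b) - (b + k%:R / n%:R * (a - b)) = (a - b) / n%:R.
  have n1 : n%:R != 0 :> R by rewrite gt_eqF.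
  by rewrite -natr1; field.
apply: (@le_trans _ _ (pdist x y / Num.sqrt n%:R)); last by rewrite ler_pdivrMr// mul1r.
rewrite /pdist /subdiv /= !e !normrM !normfV (ger0_norm (ltW N0)) mulrDl.
apply: lerD; first by rewrite ler_wpM2l// lef_pV2.
by rewrite sqrtrM// sqrtrV// ltW.
Qed.

Lemma subdiv_size d : 1 <= d -> exists2 n, (0 < n)%N & d ^+ 2 <= n%:R <= 2 * d ^+ 2.
Proof.
move=> d1; have dd : 1 <= d ^+ 2 by rewrite expr_ge1// (le_trans ler01).
have /andP[h1 h2] := truncn_itv (le_trans ler01 dd).
exists (Num.truncn (d ^+ 2)).+1 => //; rewrite (ltW h2)/= -natr1.
by apply: (le_trans (lerD h1 dd)); rewrite mulr_natl mulr2n.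
Qed.

(** The first two terms of the binomial expansion; in this form an induction along a chain closes
    with a power of the number of its points. *)
Lemma exp_step (m : R) l : 0 <= m -> m ^+ l.+1 + l.+1%:R * m ^+ l <= (m + 1) ^+ l.+1.
Proof.
move=> m0; elim: l => [|l IH]; first by rewrite !expr1 expr0 mulr1.
rewrite [leRHS]exprS; apply: (@le_trans _ _ ((m + 1) * (m ^+ l.+1 + l.+1%:R * m ^+ l))); last first.
  by rewrite ler_wpM2l// addr_ge0.
rewrite -subr_ge0 -(@natr1 _ l.+1).
have -> : (m + 1) * (m ^+ l.+1 + l.+1%:R * m ^+ l) - (m ^+ l.+2 + (l.+1%:R + 1) * m ^+ l.+1) = l.+1%:R * m ^+ l.
  by rewrite !exprS; move: (m ^+ l) (l.+1%:R : R) => a b; ring.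
by rewrite mulr_ge0// exprn_ge0.
Qed.

End Subdivision.

Section Chain.
Context (R : realType) (V : Type) (H : {fset R}) (kappa K s : R).
Variables (F : R * R -> V -> R) (g : R * R -> R -> V -> R).
Hypotheses (K0 : 0 <= K) (s0 : 0 <= s).
Hypothesis g0 : forall x b v, 0 <= g x b v.
Hypothesis F_incr : forall x y v, pdist y x <= 1 -> `|F y v - F x v| <=
  K * \sum_(c <- H | c < kappa) pdist y x `^ (kappa - c) * g x c v.
Hypothesis g_incr : forall b x y v, b \in H -> pdist y x <= 1 ->
  g y b v <= g x b v + s * \sum_(c <- H | c < b) pdist y x `^ (b - c) * g x c v.

(** Each step of a chain feeds a component from strictly lower ones only, so this count is the
    degree of growth of the component [b]. *)
Let lev (b : R) : nat := count (fun c => c < b) H.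

Lemma count_lt_lt b c : b \in H -> b < c -> (lev b < lev c)%N.
Proof.
move=> bH bc; rewrite /lev -!size_filter.
apply: (@uniq_leq_size _ (b :: [seq x <- H | x < b])).
  by rewrite /= mem_filter ltxx filter_uniq ?fset_uniq.
move=> x; rewrite inE => /orP[/eqP ->|]; first by rewrite mem_filter bc.
by rewrite !mem_filter => /andP[xb ->]; rewrite (lt_trans xb bc).
Qed.

Let P (y : R * R) (v : V) := \sum_(c <- H | c < kappa) g y c v.

Lemma powR_unit_le1 (d a : R) : 0 <= d <= 1 -> 0 <= a -> d `^ a <= 1.
Proof. by move=> d01 a0; rewrite -(powRr0 d); apply: powR_le1_ge. Qed.

Lemma chain_growth x y n v : (0 < n)%N -> pdist x y ^+ 2 <= n%:R -> forall k b, b \in H -> b < kappa ->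
  g (subdiv x y n k) b v <= ((1 + s) * k.+1%:R) ^+ lev b * P y v.
Proof.
move=> n0 dn; have P0 : 0 <= P y v by apply: sumr_ge0.
have A1 (k : nat) : 1 <= (1 + s) * k.+1%:R.
  by rewrite -[leLHS]mulr1 ler_pM ?lerDl// ler1n.
elim=> [|k IH] b bH bk.
  rewrite subdiv0; apply: (@le_trans _ _ (P y v)); last first.
    by rewrite -[leLHS]mul1r ler_wpM2r// exprn_ege1.
  rewrite /P (big_rem b)//= bk lerDl.
  by apply: sumr_ge0.
have d1 := pdist_subdiv k n0 dn.
apply: (le_trans (g_incr v bH d1)).
case E : (lev b) => [|l].
  rewrite big1_seq ?mulr0 ?addr0.
    by rewrite expr0; have := IH b bH bk; rewrite E expr0.
  move=> c /andP[cb cH]; have := count_lt_lt cH cb; by rewrite E.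
pose B : R := (1 + s) * k.+1%:R.
(* There are [l + 1] lower homogeneities, each growing with degree at most [l], which is exactly
   what [exp_step] absorbs. *)
have Bl : B ^+ l.+1 + s * (l.+1%:R * B ^+ l) <= ((1 + s) * k.+2%:R) ^+ l.+1.
  rewrite /B !exprMn -(natr1 k.+1).
  apply: (@le_trans _ _ ((1 + s) ^+ l.+1 * (k.+1%:R ^+ l.+1 + l.+1%:R * k.+1%:R ^+ l))).
    rewrite mulrDr lerD2l [leLHS]mulrA [s * _]mulrC -[leLHS]mulrA [leRHS]mulrCA ler_wpM2l//.
    rewrite mulrA ler_wpM2r ?exprn_ge0// exprS ler_wpM2r ?exprn_ge0 ?addr_ge0//.
    by rewrite lerDr.
  by rewrite ler_wpM2l ?exprn_ge0 ?addr_ge0//; apply: exp_step.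
apply: (@le_trans _ _ ((B ^+ l.+1 + s * (l.+1%:R * B ^+ l)) * P y v)); last by rewrite ler_wpM2r.
rewrite mulrDl; apply: lerD; first by rewrite -E; exact: IH.
rewrite -mulrA ler_wpM2l//.
apply: (@le_trans _ _ (\sum_(c <- H | c < b) B ^+ l * P y v)).
  rewrite big_seq_cond [leRHS]big_seq_cond; apply: ler_sum => c /andP[cH cb].
  apply: (@le_trans _ _ (g (subdiv x y n k) c v)).
    by rewrite ler_piMl// powR_unit_le1 ?subr_ge0 ?(ltW cb)// pdist_ge0.
  apply: (le_trans (IH c cH (lt_trans cb bk))); rewrite ler_wpM2r// ler_weXn2l ?A1//.
  by rewrite -ltnS -E; exact: count_lt_lt.
rewrite big_const_seq iter_addr_0 -/(lev b) E -mulrA mulr_natl.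
exact: lexx.
Qed.

Variable L : nat.
Hypothesis levL : forall b, b \in H -> b < kappa -> (lev b <= L)%N.
Hypothesis cntL : (lev kappa <= L.+1)%N.
Variable Q : R.
Hypothesis QL : (2 * L.+1)%:R <= Q.

(** For distances [d] above 1 each of the [n <= 2 d^2] steps contributes a multiple of [n^L], hence
    a multiple of [n^(L+1)] in total: this gives [d^(2 (L+1)) <= d^Q] and the factor [2^(L+1)]. The
    other factor [L + 1] bounds the number of homogeneities below [kappa]. *)
Lemma chain_bound x y v : `|F x v - F y v| <=
  K * (1 + s) ^+ L * (L.+1%:R * 2 ^+ L.+1) *
  \sum_(c <- H | c < kappa) g y c v * (pdist x y `^ (kappa - c) + pdist x y `^ Q).
Proof.
have d0 := pdist_ge0 x y.
have A1 : 1 <= (1 + s) ^+ L by rewrite exprn_ege1// lerDl.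
have L1 : 1 <= L.+1%:R * 2 ^+ L.+1 :> R.
  by rewrite -[leLHS]mulr1 ler_pM ?ler1n// exprn_ege1// ler1n.
have [d1|d1] := leP (pdist x y) 1.
  apply: (le_trans (F_incr v d1)).
  rewrite -mulrA -mulrA ler_wpM2l// mulrA.
  apply: (@le_trans _ _ (\sum_(c <- H | c < kappa) g y c v * (pdist x y `^ (kappa - c) + pdist x y `^ Q))).
    by apply: ler_sum => c _; rewrite mulrC ler_wpM2l// lerDl powR_ge0.
  rewrite ler_peMl//; first by apply: sumr_ge0 => c _; rewrite mulr_ge0// addr_ge0 ?powR_ge0.
  by rewrite -[leLHS]mulr1 ler_pM.
have [n n0 /andP[dn nd]] := subdiv_size (ltW d1).
pose z := subdiv x y n.
have P0 : 0 <= P y v by apply: sumr_ge0.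
have nn (k : nat) : 1 <= (1 + s) * k.+1%:R.
  by rewrite -[leLHS]mulr1 ler_pM ?lerDl// ler1n.
pose D : R := K * (L.+1%:R * (((1 + s) * n%:R) ^+ L * P y v)).
have step k : (k < n)%N -> `|F (z k.+1) v - F (z k) v| <= D.
  move=> kn; apply: (le_trans (F_incr v (pdist_subdiv k n0 dn))); rewrite ler_wpM2l//.
  apply: (@le_trans _ _ (\sum_(c <- H | c < kappa) ((1 + s) * n%:R) ^+ L * P y v)).
    rewrite big_seq_cond [leRHS]big_seq_cond; apply: ler_sum => c /andP[cH ck].
    apply: (@le_trans _ _ (g (z k) c v)).
      by rewrite ler_piMl// powR_unit_le1 ?subr_ge0 ?(ltW ck)// pdist_ge0 pdist_subdiv.
    apply: (le_trans (chain_growth v n0 dn k cH ck)); rewrite ler_wpM2r//.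
    apply: (@le_trans _ _ (((1 + s) * k.+1%:R) ^+ L)); first by rewrite ler_weXn2l// levL.
    rewrite lerXn2r ?nnegrE ?mulr_ge0 ?addr_ge0// ler_wpM2l ?addr_ge0// ler_nat//.
  rewrite big_const_seq iter_addr_0 -/(lev kappa) mulr_natl ler_wpMn2l//.
  by rewrite mulr_ge0// exprn_ge0// mulr_ge0 ?addr_ge0.
have tel m : (m <= n)%N -> `|F (z m) v - F (z 0%N) v| <= m%:R * D.
  elim: m => [|m IH] mn; first by rewrite subrr normr0 mul0r.
  have -> : F (z m.+1) v - F (z 0%N) v = (F (z m.+1) v - F (z m) v) + (F (z m) v - F (z 0%N) v) by ring.
  apply: (le_trans (ler_normD _ _)); rewrite -natr1 mulrDl mul1r addrC lerD ?step//.
  by apply: IH; exact: ltnW.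
have := tel n (leqnn n); rewrite /z subdiv0 subdivn// => /le_trans; apply.
have nL : (n%:R : R) ^+ L.+1 <= 2 ^+ L.+1 * pdist x y `^ Q.
  apply: (@le_trans _ _ ((2 * pdist x y ^+ 2) ^+ L.+1)).
    by rewrite lerXn2r// nnegrE// mulr_ge0// exprn_ge0.
  rewrite exprMn ler_wpM2l ?exprn_ge0// -exprM -powR_mulrn// ler_powR// ltW//.
apply: (@le_trans _ _ (K * (1 + s) ^+ L * (L.+1%:R * 2 ^+ L.+1) * (P y v * pdist x y `^ Q))).
  have -> : n%:R * D = K * (1 + s) ^+ L * L.+1%:R * P y v * n%:R ^+ L.+1.
    rewrite /D exprMn exprS; move: ((1 + s) ^+ L) ((n%:R : R) ^+ L) (P y v) (n%:R : R) (L.+1%:R : R) => a b c d e.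
    by ring.
  apply: (@le_trans _ _ (K * (1 + s) ^+ L * L.+1%:R * P y v * (2 ^+ L.+1 * pdist x y `^ Q))).
    by rewrite ler_wpM2l ?mulr_ge0// (le_trans ler01).
  move: ((1 + s) ^+ L) ((2 : R) ^+ L.+1) (P y v) (pdist x y `^ Q) (L.+1%:R : R) => a b c d e.
  by have -> : K * a * e * c * (b * d) = K * a * (e * b) * (c * d) by ring.
rewrite ler_wpM2l ?mulr_ge0 ?exprn_ge0 ?addr_ge0//.
rewrite /P mulr_suml; apply: ler_sum => c _.
by rewrite ler_wpM2l// lerDr powR_ge0.
Qed.

End Chain.

(** * The product form *)

Section RealBounds.
Context (R : realType).
Implicit Types (d a b : R).

(** For [d = 0] the sum rule fails when nonzero exponents cancel, which nonnegativity excludes. *)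
Lemma powRD_ge0 d a b : 0 <= a -> 0 <= b -> d `^ (a + b) = d `^ a * d `^ b.
Proof.
move=> a0 b0; have [ab|ab] := eqVneq (a + b) 0; last by rewrite powRD// (negbTE ab).
move/eqP: ab; rewrite paddr_eq0// => /andP[/eqP -> /eqP ->].
by rewrite addr0 powRr0 mulr1.
Qed.

(** Exponent count at the unit of the first factor. The Hoelder part of [up] consumes
    [kappa <= alpha + am], the increment of [Vp] consumes [kappa <= ap + hj]: the two entries of the
    minimum that defines [kappa]. *)
Lemma shift_bound_unit d (H A C alpha ap am kappa hj : R) : 0 <= d <= 1 -> 0 <= H -> 0 <= A -> 0 <= C ->
  0 < alpha -> 0 < ap -> kappa <= ap + hj -> kappa <= alpha + am ->
  (H * d `^ alpha + A * d `^ (Num.max (ap - 0) 0)) * (C * d `^ (Num.max (am - hj) 0)) <=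
  (H + A) * C * d `^ (Num.max (kappa - (0 + hj)) 0).
Proof.
move=> d01 H0 A0 C0 al0 ap0 k1 k2; rewrite subr0 add0r (max_idPl (ltW ap0)).
set m := Num.max (am - hj) 0; set e := Num.max (kappa - hj) 0.
have m0 : 0 <= m by rewrite /m le_max lexx orbT.
have e0 : 0 <= e by rewrite /e le_max lexx orbT.
have h1 : d `^ alpha * d `^ m <= d `^ e.
  rewrite -powRD_ge0 ?(ltW al0)//; apply: powR_le1_ge => //.
  rewrite /e ge_max addr_ge0 ?(ltW al0)// andbT.
  have : am - hj <= m by rewrite /m le_max lexx.
  lra.
have h2 : d `^ ap * d `^ m <= d `^ e.
  rewrite -powRD_ge0 ?(ltW ap0)//; apply: powR_le1_ge => //.
  rewrite /e ge_max addr_ge0 ?(ltW ap0)// andbT; lra.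
have -> : (H * d `^ alpha + A * d `^ ap) * (C * d `^ m) =
    C * (H * (d `^ alpha * d `^ m) + A * (d `^ ap * d `^ m)) by ring.
have -> : (H + A) * C * d `^ e = C * (H * d `^ e + A * d `^ e) by ring.
by rewrite ler_wpM2l// lerD// ler_wpM2l.
Qed.

Lemma shift_bound_pos d (B A C a am kappa hi hj : R) : 0 <= d <= 1 -> 0 <= B -> 0 <= A -> 0 <= C ->
  0 <= a -> kappa <= hi + am ->
  (B + A * d `^ a) * (C * d `^ (Num.max (am - hj) 0)) <=
  (B + A) * C * d `^ (Num.max (kappa - (hi + hj)) 0).
Proof.
move=> d01 B0 A0 C0 a0 k1.
set m := Num.max (am - hj) 0; set e := Num.max (kappa - (hi + hj)) 0.
have e0 : 0 <= e by rewrite /e le_max lexx orbT.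
have h1 : d `^ m <= d `^ e.
  apply: powR_le1_ge => //.
  rewrite /e ge_max [0 <= m]le_max lexx orbT andbT.
  have : am - hj <= m by rewrite /m le_max lexx.
  lra.
have h2 : d `^ a <= 1 by rewrite -(powRr0 d); apply: powR_le1_ge.
rewrite mulrA; apply: ler_pM; rewrite ?mulr_ge0 ?addr_ge0 ?mulr_ge0 ?powR_ge0//.
by rewrite ler_wpM2r// lerD2l ler_piMr.
Qed.

Lemma shift_bound_snd d (A D ap kappa hi hj : R) : 0 <= d <= 1 -> 0 <= A -> 0 <= D ->
  kappa <= ap + hj -> 
  A * d `^ (Num.max (ap - hi) 0) * D <=  A * D * d `^ (Num.max (kappa - (hi + hj)) 0).
Proof.
move=> d01 A0 D0 k1; rewrite mulrAC ler_wpM2l ?mulr_ge0//.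
set m := Num.max (ap - hi) 0; set e := Num.max (kappa - (hi + hj)) 0.
have e0 : 0 <= e by rewrite /e le_max lexx orbT.
apply: powR_le1_ge => //.
rewrite /e ge_max [0 <= m]le_max lexx orbT andbT.
have : ap - hi <= m by rewrite /m le_max lexx.
lra.
Qed.

Lemma sum_fset_le (A : {fset R}) (P : pred R) (K : R) : 0 <= K ->
  \sum_(b <- A | P b) K <= #|` A|%:R * K.
Proof.
move=> K0; rewrite big_const_seq iter_addr_0 mulr_natl.
by apply: ler_wpMn2l => //; exact: count_size.
Qed.

Lemma powN_ge (N a b : R) : 0 < N <= 1 -> a <= b -> N `^ b <= N `^ a.
Proof. by move=> N01 ab; exact: ger_powR. Qed.

End RealBounds.

Section Diamond.
Context (R : realType) (Sp' Sm : gspace R).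
Local Notation Sp := (with_unit Sp').
Variable X : tensor_data (@gpiece R Sp) (@gpiece R Sm).
Hypothesis U : uniform_crossnorm X.
Variables (alpha ap am kappa N : R) (Nst : {posnum R}) (angp angm ang : R -> R).
Variables (Gp : gop Sp) (Gm : gop Sm) (Vp : gform Sp) (Vm : gform Sm).
Hypothesis alpha0 : 0 < alpha.
Hypothesis alpha_le : forall i : gidx Sp', alpha <= ghom i.
Hypothesis alpha_ap : alpha < ap.
Hypothesis Gp_sk : is_skeleton Gp.
Hypothesis Gm_sk : is_skeleton Gm.
Hypothesis N01 : 0 < N <= 1.
Hypothesis Vp_md : is_modelled Gp N angp ap Vp.
Hypothesis Vm_md : is_modelled Gm N angm am Vm.
Hypothesis kappa_ap : forall j : gidx Sm, kappa <= ap + ghom j.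
Hypothesis kappa_am : kappa <= alpha + am.
Hypothesis level_gt : forall j : gidx Sm, ghom j < kappa - alpha.
Variables (mp mm : R).
Hypothesis mpP : forall i : gidx Sp', mp <= angp (ghom i).
Hypothesis mmP : forall j : gidx Sm, mm <= angm (ghom j).
Hypothesis ang_le : forall (i : gidx Sp) (j : gidx Sm),
  ang (ghom i + ghom j) <= angp (ghom i) + angm (ghom j).
Local Notation G := (tensor_skeleton X Gp Gm).
Local Notation S := (gtensor X).
Local Notation level := (kappa - alpha).
Local Notation EXT := (extension X level Nst).
Local Notation Gext := (ext_skeleton X level Nst G Vm).
Local Notation up := (scalar_part Gp alpha Vp).
Local Notation Vbar := (higher_part Gp alpha Vp).
Local Notation VV := (product_form X Vbar Vm).
Local Notation Vdiam := (diamond_form X level Nst up Vbar Vm).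
Local Notation Hld := (holder_seminorm alpha up).
Local Notation Ap := (mod_norm Gp ap Vp).
Local Notation Bp := (size_norm Gp N angp Vp).
Local Notation Bb := (size_norm Gp N angp Vbar).
Local Notation Am := (mod_norm Gm am Vm).
Local Notation Bm := (size_norm Gm N angm Vm).
Local Notation Mc := ((N `^ mp * Bb + Hld + Ap) * Am + N `^ mm * Ap * Bm).

Let pos (i : gidx Sp') : 0 < ghom i. Proof. exact: lt_le_trans (alpha_le i). Qed.
Let ap0 : 0 < ap. Proof. exact: lt_trans alpha_ap. Qed.
Let Gpo x := sk_op Gp_sk x.
Let Gmo x := sk_op Gm_sk x.
Let Gmt x := skeleton_tri x Gm_sk.
Let Vpf x := md_form Vp_md x.
Let Vmf x := md_form Vm_md x.
Let Vbf x := Vbar_form alpha0 alpha_le Gp_sk Vp_md x.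
Let split x v := Vp_split alpha0 alpha_le Gp_sk Vp_md x v.

Let nn1 : 0 <= Hld. Proof. exact: (holder_ge0 alpha0 alpha_le alpha_ap Gp_sk Vp_md). Qed.
Let nn2 : 0 <= Ap. Proof. exact: least_const_ge0. Qed.
Let nn3 : 0 <= Bp. Proof. exact: least_const_ge0. Qed.
Let nn4 : 0 <= Bb. Proof. exact: least_const_ge0. Qed.
Let nn5 : 0 <= Am. Proof. exact: least_const_ge0. Qed.
Let nn6 : 0 <= Bm. Proof. exact: least_const_ge0. Qed.

Lemma Mc_ge0 : 0 <= Mc.
Proof. by rewrite !(addr_ge0, mulr_ge0, powR_ge0). Qed.

Lemma product_form_pure (f : gvec Sp -> R) (g : gvec Sm -> R) v w : is_form f -> is_form g ->
  tensor_form X f g (pure X v w) = f v * g w.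
Proof. by move=> ff gf; have [_] := tensor_form_spec U ff gf; exact. Qed.

Lemma product_form_form (f : gvec Sp -> R) (g : gvec Sm -> R) : is_form f -> is_form g ->
  is_form (tensor_form X f g : gvec S -> R).
Proof. by move=> ff gf; have [] := tensor_form_spec U ff gf. Qed.

Lemma diamond_is_form x : is_form (Vdiam x).
Proof.
have f1 : is_form (fun w : gvec EXT => ext_fst w).
  split => //; exists Nst%:num => w.
  rewrite snorm_ext ext_normE mulrDr [_ * (_ / _)]mulrC divfK ?gt_eqF// lerDl.
  by rewrite mulr_ge0 ?snorm_ge0.
have f2 : is_form (fun w : gvec EXT => VV x (ext_snd w)).
  have [Tl _] := product_form_form (Vbf x) (Vmf x).
  have [a a0 Ta] := is_form_ge0 (product_form_form (Vbf x) (Vmf x)).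
  split; first by move=> c v w; exact: (Tl c (ext_snd v) (ext_snd w)).
  exists a => w; apply: (le_trans (Ta _)).
  by rewrite ler_wpM2l ?snorm_ext_snd.
exact: (is_form_lin (up x) f1 f2).
Qed.

Variable mk : R.
Hypothesis mkP : forall p : gidx S, kappa <= ghom p -> mk <= ang (ghom p).

(* The increment of [up] acts through [ext_fst (Gext x v)] once
   [Vm x (minus_part _)] is subtracted; what is left over completes [Vbar] to [Vp]
   in the second tensor factor. *)
Lemma diamond_diff x y (v : gvec EXT) :
  Vdiam y v - Vdiam x v =
  (up y - up x) * (ext_fst (Gext x v)) +
  (tensor_form X (Vbar y) (fun w => -1 * Vm x w + Vm y w) (ext_snd v)
   + tensor_form X (fun w => -1 * Vp x w + Vp y w) (Vm x) (ext_snd v)).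
Proof.
have dm := is_form_lin (-1) (Vmf x) (Vmf y).
have dp := is_form_lin (-1) (Vpf x) (Vpf y).
have Mf := is_form_comp (minus_part_op U) (Vmf x).
have f1 := is_form_lin (up y - up x) Mf (is_form_lin (-1) (product_form_form (Vbf x) (Vmf x))
  (product_form_form (Vbf y) (Vmf y))).
have f2 := is_form_lin 1 (product_form_form (Vbf y) dm) (product_form_form dp (Vmf x)).
have e : forall (p : gvec Sp) (w : gvec Sm),
  (up y - up x) * Vm x (minus_part X (pure X p w)) + (-1 * tensor_form X (Vbar x) (Vm x) (pure X p w)
   + tensor_form X (Vbar y) (Vm y) (pure X p w)) =
  1 * tensor_form X (Vbar y) (fun w => -1 * Vm x w + Vm y w) (pure X p w)
   + tensor_form X (fun w => -1 * Vp x w + Vp y w) (Vm x) (pure X p w).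
  move=> p w; rewrite !product_form_pure// !split.
  have -> : minus_part X (pure X p w) = fun j => (p None : R) *: w j.
    by apply: functional_extensionality_dep => j; exact: minus_part_pure.
  have [Vl _] := Vmf x.
  rewrite (@vlinZ R (gidx Sm) (@gpiece R Sm) (R^o : lmodType R) _ Vl).
  rewrite /GRing.scale /=; move: (Vm x w) (Vm y w) (Vbar x p) (Vbar y p) (up x) (up y) (p None : R).
  by move=> a b c d f g h; ring.
have := form_ext U f1 f2 e (ext_snd v).
rewrite mul1r => <-; rewrite /diamond_form /product_form /ext_skeleton /ext_fst /=.
move: (Vm x _) (tensor_form X (Vbar x) _ _) (tensor_form X (Vbar y) _ _) (up x) (up y) (v None : R).
by move=> a b c d f g; ring.
Qed.

(** Both tensor terms of [diamond_diff] are bounded by [tensor_form_bound] with expansions at [x];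
    [Vbar y] is brought back to [x] by [Vbar_shift]. The factor [Nst] undoes the normalisation of
    the new component. *)
Lemma diamond_incr x y (v : gvec EXT) : pdist y x <= 1 ->
  `|Vdiam y v - Vdiam x v| <= Nst%:num * Hld * pdist y x `^ alpha * `|Gext x v None|
   + \sum_(p : gidx S) Mc * pdist y x `^ (Num.max (kappa - ghom p) 0) * `|Gext x v (Some p)|.
Proof.
move=> d1; have d0 := pdist_ge0 y x.
have d01 : 0 <= pdist y x <= 1 by rewrite d0.
rewrite diamond_diff; apply: (le_trans (ler_normD _ _)); apply: lerD.
  rewrite normrM ext_normE.
  have -> : Nst%:num * Hld * pdist y x `^ alpha * (`|ext_fst (Gext x v)| / Nst%:num) =
    Hld * pdist y x `^ alpha * `|ext_fst (Gext x v)|.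
    have : Nst%:num != 0 by rewrite gt_eqF.
    move: (Nst%:num) (Hld) (pdist y x `^ alpha) (`|ext_fst (Gext x v)|) => a b c d a0; field.
    exact: a0.
  rewrite ler_wpM2r//.
  exact: (up_holder alpha0 alpha_le alpha_ap Gp_sk Vp_md).
apply: (le_trans (ler_normD _ _)).
have dm := is_form_lin (-1) (Vmf x) (Vmf y).
have dp := is_form_lin (-1) (Vpf x) (Vpf y).
have h1 := tensor_form_bound U (Vbf y) dm (Gpo x) (Gmo x)
  (a := fun o => (if o is Some i then Bb * N `^ (angp (ghom i)) else Hld * pdist y x `^ alpha)
    + Ap * pdist y x `^ (Num.max (ap - @ghom _ Sp o) 0))
  (b := fun j => Am * pdist y x `^ (Num.max (am - ghom j) 0)) _ _ _ _ (ext_snd v).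
have h2 := tensor_form_bound U dp (Vmf x) (Gpo x) (Gmo x)
  (a := fun o => Ap * pdist y x `^ (Num.max (ap - @ghom _ Sp o) 0))
  (b := fun j => Bm * N `^ (angm (ghom j))) _ _ _ _ (ext_snd v).
apply: (le_trans (lerD (h1 _ _ _ _) (h2 _ _ _ _))) => {h1 h2}.
- by case=> [i|]; rewrite !(addr_ge0, mulr_ge0, powR_ge0).
- by move=> j; rewrite mulr_ge0 ?powR_ge0.
- move=> w; exact: (Vbar_shift alpha0 alpha_le alpha_ap Gp_sk N01 Vp_md).
- by move=> w; rewrite mulN1r addrC; exact: (mod_idx (mod_normP (md_mod Vm_md)) w d1).
- by move=> o; rewrite mulr_ge0 ?powR_ge0.
- by move=> j; rewrite mulr_ge0 ?powR_ge0.
- by move=> w; rewrite mulN1r addrC; exact: (mod_idx (mod_normP (md_mod Vp_md)) w d1).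
- by move=> w; exact: (size_idx (size_normP (md_size Vm_md)) w x).
rewrite -big_split/=; apply: ler_sum => -[k j] _ /=.
rewrite -mulrDl ler_wpM2r// [leRHS]mulrDl; apply: lerD; last first.
  have h := @shift_bound_snd R (pdist y x) Ap Bm ap kappa (@ghom _ Sp k) (ghom j) d01 nn2 nn6 (kappa_ap j).
  have hN := powN_ge N01 (mmP j).
  have -> : Ap * pdist y x `^ Num.max (ap - @ghom _ Sp k) 0 * (Bm * N `^ angm (ghom j)) =
    N `^ angm (ghom j) * (Ap * pdist y x `^ Num.max (ap - @ghom _ Sp k) 0 * Bm) by rewrite mulrA mulrC.
  have e (a b c d : R) : a * b * c * d = a * (b * c * d) by rewrite !mulrA.
  by rewrite e; apply: ler_pM; rewrite ?mulr_ge0 ?powR_ge0.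
case: k => [i|].
  have h := @shift_bound_pos R (pdist y x) (Bb * N `^ (angp (ghom i))) Ap Am (Num.max (ap - ghom i) 0)
    am kappa (ghom i) (ghom j) d01 _ nn2 nn5 _ _.
  apply: (le_trans (h _ _ _)); rewrite ?le_max ?lexx ?orbT ?mulr_ge0 ?powR_ge0//.
    by apply: (le_trans kappa_am); rewrite lerD2r.
  rewrite ler_wpM2r ?powR_ge0// ler_wpM2r// lerD2r mulrC.
  apply: (@le_trans _ _ (N `^ mp * Bb)); last by rewrite lerDl.
  by rewrite ler_wpM2r// powN_ge.
have h := @shift_bound_unit R (pdist y x) Hld Ap Am alpha ap am kappa (ghom j) d01 nn1 nn2 nn5
  alpha0 ap0 (kappa_ap j) kappa_am.
apply: (le_trans h); rewrite ler_wpM2r ?powR_ge0// ler_wpM2r// lerD2r lerDr.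
by rewrite mulr_ge0 ?powR_ge0.
Qed.

Local Notation sk := (sk_norm Gext).
Local Notation Mb := (Bp * Bm).
Local Notation F := (reduce Gext kappa Vdiam).

Let Geo x := ext_op U Gp_sk Gm_sk level Nst Vmf x.
Let Get x : lower_triangular (Gext x).
Proof. exact: (ext_tri U Gp_sk Gm_sk Vmf level_gt). Qed.
Let level_am : level <= am. Proof. by rewrite lerBlDl. Qed.
Let skP : skeleton_bound Gext sk.
Proof.
apply: sk_normP.
exact: (ext_skeleton_bound U pos Gp_sk Gm_sk Nst (md_mod Vm_md) level_gt level_am).
Qed.
Let sk0 : 0 <= sk. Proof. exact: least_const_ge0. Qed.
Let Mb0 : 0 <= Mb. Proof. exact: mulr_ge0. Qed.

(* Adding [up y (x) Vm y] to the form restores [Vp y] in place of [Vbar y]: the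
   coefficients of the product form with respect to the extended skeleton are
   [up y] and those of [Vp y (x) Vm y]. *)
Lemma diamond_expand y (v : gvec EXT) :
  Vdiam y v = up y * ext_fst (Gext y v) + tensor_form X (Vp y) (Vm y) (ext_snd v).
Proof.
have Mf := is_form_comp (minus_part_op U) (Vmf y).
have f1 := is_form_lin (up y) Mf (product_form_form (Vbf y) (Vmf y)).
have f2 := product_form_form (Vpf y) (Vmf y).
have e : forall (p : gvec Sp) (w : gvec Sm),
  up y * Vm y (minus_part X (pure X p w)) + tensor_form X (Vbar y) (Vm y) (pure X p w) =
  tensor_form X (Vp y) (Vm y) (pure X p w).
  move=> p w; rewrite !product_form_pure// !split.
  have -> : minus_part X (pure X p w) = fun j => (p None : R) *: w j.
    by apply: functional_extensionality_dep => j; exact: minus_part_pure.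
  have [Vl _] := Vmf y.
  rewrite (@vlinZ R (gidx Sm) (@gpiece R Sm) (R^o : lmodType R) _ Vl).
  rewrite /GRing.scale /=; move: (Vm y w) (Vbar y p) (up y) (p None : R).
  by move=> a b c d; ring.
have := form_ext U f1 f2 e (ext_snd v) => <-.
rewrite /diamond_form /product_form /ext_skeleton /ext_fst /=.
move: (Vm y _) (tensor_form X (Vbar y) _ _) (up y) (v None : R).
by move=> a b c d; ring.
Qed.

(** Weights for the coefficients of the product form: [Nst] because the new piece carries the norm
    divided by [Nst], and [Mb] because [diamond_expand] involves [Vp] rather than [Vbar]. *)
Definition diamond_coef y (o : gidx EXT) : R :=
  if o is Some p then Mb * N `^ (ang (@ghom _ S p)) else Nst%:num * `|up y|.

(** Since [N <= 1], [ang_le] merges the two powers of [N] into the one at the summed homogeneity. *)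
Lemma tensor_size (f : gvec Sp -> R) (a : R) y z : is_form f -> 0 <= a ->
  (forall v, `|f v| <= \sum_(i : gidx Sp) a * N `^ (angp (ghom i)) * `|Gp y v i|) ->
  `|tensor_form X f (Vm y) z| <= \sum_(p : gidx S) a * Bm * N `^ (ang (ghom p)) * `|G y z p|.
Proof.
move=> ff a0 hf.
have h := tensor_form_bound U ff (Vmf y) (Gpo y) (Gmo y)
  (a := fun i => a * N `^ (angp (@ghom _ Sp i))) (b := fun j => Bm * N `^ (angm (ghom j)))
  _ _ hf (size_idx (size_normP (md_size Vm_md)) ^~ y) z.
apply: (le_trans (h _ _)).
- by move=> o; rewrite mulr_ge0 ?powR_ge0.
- by move=> o; rewrite mulr_ge0 ?powR_ge0.
apply: ler_sum => -[i j] _ /=; rewrite ler_wpM2r// mulrACA ler_wpM2l ?mulr_ge0//.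
rewrite -powRD; last by rewrite (gt_eqF (proj1 (andP N01))) implybT.
by apply: powN_ge => //; exact: ang_le.
Qed.

Lemma diamond_coef_bound y w :
  `|coefficients Gext Vdiam y w| <= \sum_o diamond_coef y o * `|w o|.
Proof.
apply: (coef_bound (Geo y) (Get y) (diamond_is_form y)) => v.
have sE (f : gidx EXT -> R) : \sum_o f o = f None + \sum_p f (Some p) := sum_ext f predT.
rewrite diamond_expand sE; apply: (le_trans (ler_normD _ _)); apply: lerD.
  rewrite normrM ext_normE.
  have : Nst%:num != 0 by rewrite gt_eqF.
  rewrite -[diamond_coef y None]/(Nst%:num * `|up y|).
  move: (Nst%:num) (`|up y|) (`|ext_fst _|) => a b c a0.
  by have -> : a * b * (c / a) = b * c by field.
exact: (tensor_size (ext_snd v) (Vpf y) nn3 (size_idx (size_normP (md_size Vp_md)) ^~ y)).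
Qed.

(* Replacing [v] by the [v'] whose expansion at [x] is the truncated one turns
   the reduction at [x] into [Vdiam x v'] and leaves the reduction at [y] unchanged. *)
Lemma reduced_incr x y (v : gvec EXT) : pdist y x <= 1 ->
  `|F y v - F x v| <= (Nst%:num * Hld + Mc + #|` homs EXT|%:R * (N `^ mk * sk * Mb)) *
    \sum_(c <- homs EXT | c < kappa) pdist y x `^ (kappa - c) * graded_norm c (Gext x v).
Proof.
move=> d1; have d0 := pdist_ge0 y x.
have d01 : 0 <= pdist y x <= 1 by rewrite d0.
have [v' vE] := tri_surj (Geo x) (@Get x) (trunc kappa (Gext x v)).
have vv' i : ghom i < kappa -> v' i = v i.
  move=> ik; apply: (tri_inj (Geo x) (@Get x)) => j ji.
  by rewrite vE /trunc (le_lt_trans ji ik).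
have Fy : F y v = F y v'.
  rewrite /reduce; congr (coefficients _ _ _ _).
  apply: functional_extensionality_dep => i; rewrite /trunc; case: ifP => // ik.
  by apply: (tri_eq (Geo y) (@Get y)) => j ji; rewrite vv'// (le_lt_trans ji ik).
have Fx : F x v = Vdiam x v'.
  have [_ ->] := coef_spec (Geo x) (@Get x) (diamond_is_form x).
  by rewrite vE.
have [[Wl _] WE] := coef_spec (Geo y) (@Get y) (diamond_is_form y).
pose hi (w : gvec EXT) : gvec EXT := fun i => w i - trunc kappa w i.
have Fy' : F y v' = Vdiam y v' - coefficients Gext Vdiam y (hi (Gext y v')).
  rewrite WE (@vlinB R (gidx EXT) (@gpiece R EXT) (R^o : lmodType R) _ Wl).
  by rewrite opprB addrCA subrr addr0.
have -> : F y v - F x v = (Vdiam y v' - Vdiam x v') - coefficients Gext Vdiam y (hi (Gext y v')).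
  by rewrite Fy Fy' Fx; ring.
pose r : R := \sum_(i : gidx EXT | ghom i < kappa) pdist y x `^ (kappa - ghom i) * `|Gext x v i|.
rewrite (@sum_homs _ _ (fun c => c < kappa) (fun c => pdist y x `^ (kappa - c))) -/r.
have nk : level < kappa by rewrite ltrBlDr ltrDl.
have r0 : 0 <= r by apply: sumr_ge0 => i _; rewrite mulr_ge0 ?powR_ge0.
apply: (le_trans (ler_normB _ _)); rewrite mulrDl; apply: lerD.
  apply: (le_trans (diamond_incr v' d1)).
  rewrite vE /r; move: (Gext x v) => t.
  rewrite sum_ext /= nk mulrDr; apply: lerD.
    rewrite /trunc /= nk subKr -mulrA ler_wpM2r ?mulr_ge0 ?powR_ge0//.
    by rewrite lerDl Mc_ge0.
  rewrite mulr_sumr [leRHS]big_mkcond; apply: ler_sum => p _.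
  rewrite /trunc /=; have [pk|pk] := ltP (@ghom _ Sp p.1 + ghom p.2) kappa; last by rewrite normr0 mulr0.
  rewrite (max_idPl _) ?subr_ge0 ?(ltW pk)// -mulrA ler_wpM2r ?mulr_ge0 ?powR_ge0//.
  by rewrite lerDr !mulr_ge0 ?nn1.
apply: (le_trans (diamond_coef_bound _ _)).
(* [hi] keeps the homogeneities from [kappa] on, where the expansion of [v'] at [x] vanishes; what
   it sees at [y] is therefore an increment of the skeleton. *)
apply: (@le_trans _ _ (\sum_(i | kappa <= ghom i) (N `^ mk * Mb) * `|Gext y v' i - Gext x v' i|)).
  rewrite [leRHS]big_mkcond; apply: ler_sum => i _.
  rewrite /hi /trunc; have [ik|ik] := ltP (ghom i) kappa.
    by rewrite subrr normr0 mulr0.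
  rewrite vE /trunc ltNge ik /= !subr0 ler_wpM2r//.
  case: i ik => [p|]; last by rewrite leNgt nk.
  by move=> pk /=; rewrite mulrC ler_wpM2r// powN_ge// mkP.
rewrite -(@sum_homs _ _ (fun c => kappa <= c) (fun c => N `^ mk * Mb)).
apply: (@le_trans _ _ (\sum_(b <- homs EXT | kappa <= b) N `^ mk * sk * Mb * r)); last first.
  by rewrite -[leRHS]mulrA; apply: sum_fset_le; rewrite !mulr_ge0 ?powR_ge0.
rewrite big_seq_cond [leRHS]big_seq_cond; apply: ler_sum => b /andP[bE kb].
have e (a1 a2 a3 a4 : R) : a1 * a2 * a3 * a4 = a1 * a3 * (a2 * a4) by ring.
rewrite (e (N `^ mk) sk Mb r) ler_wpM2l ?mulr_ge0 ?powR_ge0//.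
apply: (le_trans (skP bE v' d1)); rewrite ler_wpM2l//.
rewrite (@sum_homs _ _ (fun c => c < b) (fun c => pdist y x `^ (b - c))).
rewrite /r [leLHS]big_mkcond [leRHS]big_mkcond; apply: ler_sum => i _.
rewrite vE /trunc; have [ik|ik] := ltP (ghom i) kappa; last first.
  by rewrite normr0 mulr0 if_same.
rewrite (lt_le_trans ik kb) ler_wpM2r//.
by apply: powR_le1_ge => //; rewrite ?lerD2r// subr_ge0 ltW.
Qed.

Lemma ext_growth b x y (v : gvec EXT) : b \in homs EXT -> pdist y x <= 1 ->
  graded_norm b (Gext y v) <= graded_norm b (Gext x v) +
    sk * \sum_(c <- homs EXT | c < b) pdist y x `^ (b - c) * graded_norm c (Gext x v).
Proof.
move=> bH d1; rewrite -lerBlDl; apply: le_trans (skP bH v d1).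
rewrite lerBlDl /graded_norm -big_split/=; apply: ler_sum => i _.
by rewrite -lerBlDl; exact: lerB_dist.
Qed.

Local Notation K0 := (Nst%:num * Hld + Mc + #|` homs EXT|%:R * (N `^ mk * sk * Mb)).

Lemma diamond_chain (L : nat) (Q : R) x y (v : gvec EXT) :
  (forall b, b \in homs EXT -> b < kappa -> (count (fun c => (c < b)%R) (homs EXT) <= L)%N) ->
  (count (fun c => (c < kappa)%R) (homs EXT) <= L.+1)%N -> (2 * L.+1)%:R <= Q ->
  `|F x v - F y v| <= K0 * (1 + sk) ^+ L * (L.+1%:R * 2 ^+ L.+1) *
  \sum_(c <- homs EXT | c < kappa) graded_norm c (Gext y v)
    * (pdist x y `^ (kappa - c) + pdist x y `^ Q).
Proof.
move=> h1 h2 h3.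
have h4 : 0 <= K0.
  apply: addr_ge0; first by apply: addr_ge0; [exact: mulr_ge0|exact: Mc_ge0].
  by apply: mulr_ge0 => //; apply: mulr_ge0 => //; apply: mulr_ge0; rewrite ?powR_ge0.
exact: (@chain_bound R (gvec EXT) (homs EXT) kappa K0 sk F (fun x b v => graded_norm b (Gext x v))
  h4 sk0 (fun x b v => graded_norm_ge0 b _) (fun x y v d => reduced_incr v d)
  (fun b x y v bH d => ext_growth v bH d) L h1 h2 Q h3).
Qed.

(** A qualitative bound: [D] depends on the data and only serves to show that [diag] grows at most
    like a power of [t]. *)
Lemma diamond_reduce_size : exists2 D, 0 <= D & forall x (v : gvec EXT),
  `|F x v| <= D * \sum_(c <- homs EXT | c < kappa) graded_norm c (Gext x v).
Proof.
pose D : R := Nst%:num * (Bp * N `^ (angp 0)) + \sum_(p : gidx S) Mb * N `^ (ang (ghom p)).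
have D0 : 0 <= D.
  by rewrite addr_ge0 ?mulr_ge0 ?powR_ge0// sumr_ge0// => p _; rewrite !mulr_ge0 ?powR_ge0.
exists D => // x v; rewrite /reduce; apply: (le_trans (diamond_coef_bound _ _)).
have := @sum_homs _ EXT (fun c => c < kappa) (fun=> D) (Gext x v).
rewrite -mulr_sumr => ->; rewrite [leRHS]big_mkcond/=; apply: ler_sum => o _.
rewrite /trunc; case: ifP => // _; last by rewrite normr0 mulr0.
rewrite ler_wpM2r// /D; case: o => [p|]; rewrite /diamond_coef.
  rewrite [X in _ <= _ + X](bigD1 p)//= addrCA lerDl addr_ge0 ?mulr_ge0 ?powR_ge0//.
  by rewrite sumr_ge0// => q _; rewrite !mulr_ge0 ?powR_ge0.
apply: (@le_trans _ _ (Nst%:num * (Bp * N `^ (angp 0)))).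
  by rewrite ler_wpM2l// (up_bound alpha0 alpha_le Gp_sk Vp_md).
by rewrite lerDl sumr_ge0// => q _; rewrite !mulr_ge0 ?powR_ge0.
Qed.

Let Go x := tensor_skeleton_op U Gp_sk Gm_sk x.
Let Gt x : lower_triangular (G x). Proof. exact: tensor_skeleton_tri. Qed.
Let VVf x : is_form (VV x). Proof. exact: (product_form_form (Vbf x) (Vmf x)). Qed.

(** The two reductions refer to different skeletons. They are compared through [v], whose extended
    expansion at [x] is the truncated one; truncation leaves [minus_part] alone because its
    homogeneities lie below [kappa], so the first entry of [v] is still [u]. *)
Lemma diamond_reduce_split x u (z : gvec S) :
  F x (ext_vec X level Nst u z) = up x * u + reduce G kappa VV x z.
Proof.
have nk : level < kappa by rewrite ltrBlDr ltrDl.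
have [v vE] := tri_surj (Geo x) (@Get x) (trunc kappa (Gext x (ext_vec X level Nst u z))).
have [_ e] := coef_spec (Geo x) (@Get x) (diamond_is_form x).
have [_ e'] := coef_spec (Go x) (@Gt x) (VVf x).
have vS : G x (ext_snd v) = trunc kappa (G x z).
  by apply: functional_extensionality_dep => p; have := congr1 (fun w : gvec EXT => w (Some p)) vE.
have vM : minus_part X (ext_snd v) = minus_part X z.
  apply: functional_extensionality_dep => j.
  apply: (tri_inj (Gmo x) (@Gmt x)) => i _.
  rewrite -!(minus_part_skeleton U pos Gp_sk Gm_sk) vS.
  apply: (minus_part_local U); rewrite /trunc /= add0r.
  by rewrite (lt_trans (level_gt _) nk).
have vN : ext_fst v = u.
  have := congr1 (fun w : gvec EXT => w None : R) vE.
  rewrite /trunc /= nk /ext_skeleton /= vM => /addIr; exact.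
by rewrite /reduce -vE -e /diamond_form vN -vS -e'.
Qed.

Lemma product_reduce_diff (me eta : R) x (z : gvec S) : eta <= kappa ->
  (forall p : gidx S, eta <= ghom p -> me <= ang (ghom p)) ->
  `|reduce G kappa VV x z - reduce G eta VV x z| <=
  Bb * Bm * N `^ me * \sum_(c <- homs S | eta <= c < kappa) graded_norm c (G x z).
Proof.
move=> ek hme; have [[Wl _] e] := coef_spec (Go x) (@Gt x) (VVf x).
rewrite /reduce -(@vlinB R (gidx S) (@gpiece R S) (R^o : lmodType R) _ Wl).
have hs := size_idx (size_normP (Vbar_size alpha0 alpha_le Gp_sk N01 Vp_md)).
apply: (le_trans (coef_bound (Go x) (@Gt x) (VVf x)
  (fun z => tensor_size z (Vbf x) nn4 (hs ^~ x)) _)).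
have := @sum_homs _ S (fun c => eta <= c < kappa) (fun=> Bb * Bm * N `^ me) (G x z).
rewrite -mulr_sumr => ->; rewrite [leRHS]big_mkcond/=; apply: ler_sum => p _.
rewrite /trunc; have [pe|pe] := ltP (@ghom _ S p) eta.
  by rewrite (lt_le_trans pe ek) subrr normr0 mulr0.
rewrite subr0 /=; case: ifP => pk; last by rewrite normr0 mulr0.
by rewrite ler_wpM2r// ler_wpM2l ?mulr_ge0// powN_ge// hme.
Qed.
End Diamond.

(** * From the estimates on forms to the theorem *)

Section FormTempered.
Context (R : realType) (K : finType) (E : K -> completeNormedModType R).

Lemma form_tempered (f : (forall k, E k) -> R^o) (g : forall k, (R * R -> R) -> E k) :
  is_form f -> (forall k, tempered (g k)) -> tempered (fun phi => f (fun k => g k phi)).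
Proof.
move=> ff gt; have [fl _] := ff; have [a a0 fa] := is_form_ge0 ff; split.
  move=> c phi chi sp sc; rewrite -[c *: _]/(c * _) -fl; congr (f _).
  by apply: functional_extensionality_dep => k; have [-> //] := gt k.
have /choice[n hn] := fun k => proj2 (gt k).
have /choice[C hC] := hn.
exists (\max_k n k)%N, (a * \sum_k `|C k|) => phi M sp hM.
have M0 : 0 <= M.
  apply: le_trans (hM [::] isT (0, 0)).
  by rewrite mulr_ge0// exprn_ge0// !addr_ge0.
apply: (le_trans (fa _)); rewrite -mulrA ler_wpM2l// mulr_suml; apply: ler_sum => k _.
apply: (@le_trans _ _ (C k * M)); last by rewrite ler_wpM2r// ler_norm.
apply: hC => // w wk x.
have nk : (n k <= \max_k n k)%N by exact: leq_bigmax.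
apply: le_trans (hM w (leq_trans wk nk) x).
by rewrite ler_wpM2r// weight_le.
Qed.

End FormTempered.

Lemma tempered_sub (R : realType) (u w : (R * R -> R) -> R^o) :
  tempered u -> tempered w -> tempered (fun phi => u phi - w phi : R^o).
Proof.
move=> ut wt.
pose g (b : bool) : (R * R -> R) -> (R^o : completeNormedModType R) := if b then u else w.
apply: (@form_tempered R bool (fun=> R^o : completeNormedModType R)
  (fun v => (v true : R) - (v false : R)) g); last by case.
split; first by move=> a v v'; rewrite /GRing.scale /=; ring.
exists 1 => v; rewrite mul1r /snorm big_bool; exact: ler_normB.
Qed.

Section MinList.
Context (R : realType).
Implicit Types s : seq R.

Lemma minl_le s x : x \in s -> minl s <= x.
Proof.
rewrite /minl; move: (head 0 s) => x0.
elim: s => // y s IH; rewrite inE big_cons ge_min => /orP[/eqP ->|/IH ->].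
  by rewrite lexx.
by rewrite orbT.
Qed.

Lemma minl_in s : s != [::] -> minl s \in s.
Proof.
have h x0 : \big[Num.min/x0]_(b <- s) b \in x0 :: s.
  elim: s => [|y s IH]; first by rewrite big_nil mem_head.
  rewrite big_cons; case: leP => _; first by rewrite !inE eqxx orbT.
  by move: IH; rewrite !inE => /orP[->//|->]; rewrite !orbT.
case: s h => // y s h _; have := h y; rewrite /minl /= !inE.
by rewrite orbA orbb.
Qed.

End MinList.

Section Homogeneities.
Context (R : realType) (Sp' Sm : gspace R).
Local Notation Sp := (with_unit Sp').
Variable X : tensor_data (@gpiece R Sp) (@gpiece R Sm).
Variables (level : R) (Nst : {posnum R}).
Local Notation S := (gtensor X).
Local Notation EXT := (extension X level Nst).

Lemma homs_ext : homs EXT = (level |` homs S)%fset.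
Proof.
apply/fsetP => b; rewrite in_fset1U; apply/imfsetP/orP.
  by move=> [[p|] _ ->]; [right; exact: ghom_homs|left].
move=> [/eqP ->|/imfsetP[p _ ->]]; first by exists None.
by exists (Some p).
Qed.

Lemma graded_ext (w : gvec EXT) c : level \notin homs S ->
  graded_norm c w = if c == level then `|w None| else graded_norm c (ext_snd w).
Proof.
move=> nl; rewrite /graded_norm sum_ext /= eq_sym; case: eqP => [->|_]; last by rewrite add0r.
rewrite big1 ?addr0// => p /eqP pE; case/negP: nl.
by rewrite -pE; exact: (@ghom_homs R S p).
Qed.

End Homogeneities.

Lemma tempered_rescaled (R : realType) (c : {posnum R}) (u : (R * R -> R) -> R^o) :
  tempered u ->
  @tempered R (rescaled c : completeNormedModType R) (fun phi => u phi : rescaled c).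
Proof.
move=> [ul [n [C hC]]]; split; first exact: ul.
exists n, (C / c%:num) => phi M sp hM.
by rewrite rescaled_normE mulrAC ler_wpM2r ?invr_ge0//; exact: hC.
Qed.

Section FinalBounds.
Context (R : realType).

Lemma mult_bound (W1 W2 n a l : R) : 1 <= n -> 0 <= W1 -> 0 <= a -> 0 <= l ->
  (W1 + n * W2) * a * l <= n * l * (a * (W1 + W2)).
Proof.
move=> n1 W10 a0 l0.
have -> : (W1 + n * W2) * a * l = W1 * a * l + n * l * (a * W2) by ring.
have -> : n * l * (a * (W1 + W2)) = n * (W1 * a * l) + n * l * (a * W2) by ring.
by rewrite lerD2r ler_peMl// !mulr_ge0.
Qed.

Lemma sub_bound (C a M W s p q : R) : 0 <= C -> 0 <= a -> 0 <= M -> 0 <= W -> 0 <= q ->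
  p <= q -> s <= a * q -> C * M * p + W * s <= (C + a) * (M + W) * q.
Proof.
move=> C0 a0 M0 W0 q0 pq sq.
have h1 : C * M * p <= C * M * q by rewrite ler_wpM2l// mulr_ge0.
have h2 : W * s <= W * (a * q) by rewrite ler_wpM2l.
have h3 : 0 <= C * W * q by rewrite !mulr_ge0.
have h4 : 0 <= a * M * q by rewrite !mulr_ge0.
have -> : (C + a) * (M + W) * q = C * M * q + W * (a * q) + (C * W * q + a * M * q) by ring.
lra.
Qed.

End FinalBounds.

Local Close Scope classical_set_scope.

Theorem corollary1 (R : realType) (psi : R -> R * R -> R)
  (psiP : is_kernel_family psi)
  (Ap' Am : {fset R}) (angp angm ang : R -> R) (ap am : R) :
  let Ap := (0 |` Ap')%fset in
  let A := sumset Ap Am in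
  let alpha := minl Ap' in
  let kappa := Num.min (ap + minl Am) (alpha + am) in
  Ap' != fset0 -> Am != fset0 ->
  0 < alpha -> (forall b, b \in Am -> b < 0) ->
  0 < ap -> am < 0 ->
  kappa - alpha \notin A ->
  (forall b, b \in Am -> b < kappa - alpha) ->
  0 < kappa -> (exists2 b, b \in A & kappa <= b) ->
  (forall b, b \in Ap -> 0 <= angp b) ->
  (forall b, b \in Am -> 0 <= angm b) ->
  (forall b, b \in A -> 0 <= ang b) ->
  (forall b c, b \in Ap -> c \in Am -> ang (b + c) <= angp b + angm c) ->
  exists (C : R) (Ceta : R -> R),
  forall (Tp' : Ap' -> completeNormedModType R)
         (Tm : Am -> completeNormedModType R),
  let Sp := with_unit (gspace_of Tp') in
  let Sm := gspace_of Tm in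
  forall X : tensor_data (@gpiece R Sp) (@gpiece R Sm),
  uniform_crossnorm X ->
  let S := gtensor X in
  forall (Gp : gop Sp) (Gm : gop Sm),
  is_skeleton Gp -> is_skeleton Gm ->
  let G : gop S := tensor_skeleton X Gp Gm in
  forall (N : R) (Nst : {posnum R}), 0 < N <= 1 ->
  forall (Vp : gform Sp) (Vm : gform Sm),
  is_modelled Gp N angp ap Vp -> is_modelled Gm N angm am Vm ->
  let up := scalar_part Gp alpha Vp in
  let Vbar := higher_part Gp alpha Vp in
  let VV := product_form X Vbar Vm in
  let Gext := ext_skeleton X (kappa - alpha) Nst G Vm in
  let Vdiam := diamond_form X (kappa - alpha) Nst up Vbar Vm in
  let Mb := size_norm Gp N angp Vp * size_norm Gm N angm Vm in
  let Mc :=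
    (N `^ (minl [seq angp b | b <- Ap']) * size_norm Gp N angp Vbar
     + holder_seminorm alpha up + mod_norm Gp ap Vp) * mod_norm Gm am Vm
    + N `^ (minl [seq angm b | b <- Am])
      * mod_norm Gp ap Vp * size_norm Gm N angm Vm in
  let Mkappa :=
    (1 + sk_norm Gext) ^+ (#|` A| - 1)
    * (Nst%:num * holder_seminorm alpha up + Mc
       + N `^ (minl [seq ang b | b <- A & kappa <= b]) * sk_norm Gext * Mb) in
  let Meta eta :=
    Mkappa + N `^ (minl [seq ang b | b <- A & eta <= b])
             * size_norm Gp N angp Vbar * size_norm Gm N angm Vm in
  forall vv : forall i : gidx S, (R * R -> R) -> gpiece i,
  tempered_below kappa vv ->
  let vvT T x : gvec S := fun i => mollify (psi T) (vv i) x in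
  (forall b, b \in A -> b < kappa -> forall x T, 0 < T <= 1 ->
     graded_norm b (G x (vvT T x)) <= (T `^ 4^-1) `^ b) ->
  forall um : (R * R -> R) -> R^o,
  tempered um ->
  let umT T x : R := mollify (psi T) um x in
  (forall x T, 0 < T <= 1 ->
     Nst%:num^-1 * `|umT T x - Vm x (minus_part X (vvT T x))|
     <= (T `^ 4^-1) `^ (kappa - alpha)) ->
  let reconstructs (c : R) (w : (R * R -> R) -> R^o) :=
    forall T, 0 < T <= 1 -> forall x,
      `|mollify (psi T) w x
        - reduce Gext kappa Vdiam x
            (ext_vec X (kappa - alpha) Nst (umT T x) (vvT T x))|
      <= c * Mkappa * (T `^ 4^-1) `^ kappa in
  exists upum : (R * R -> R) -> R^o,
  [/\ tempered upum,
      reconstructs C upum,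
      (forall w c, tempered w -> reconstructs c w ->
         forall phi, schwartz phi -> w phi = upum phi) &
      forall eta, (exists2 b, b \in A & b < eta) -> eta < kappa ->
      forall T, 0 < T <= 1 -> forall x,
        `|mollify (psi T) upum x - up x * umT T x
          - reduce G eta VV x (vvT T x)|
        <= Ceta eta * Meta eta * (T `^ 4^-1) `^ eta].
Proof.
move=> Ap A alpha kappa Ap'0 Am0 alpha0 Amneg ap0 am0 lvlA lvl kap0 [b0 b0A b0k] angp0 angm0
  ang0 angle.
pose E := ((kappa - alpha) |` A)%fset.
pose Ik := [fset b in E | b < kappa]%fset.
pose L := (#|` A| - 1)%N.
(* The first summand is the growth exponent of chains in [chain_bound]; the second ensures
   [kappa <= c + Q] for every [c] in [E]. *)
pose Q : R := (2 * L.+1)%:R + \sum_(c <- E) `|kappa - c|.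
have A0 : (0 < #|` A|)%N by rewrite cardfs_gt0; apply/fset0Pn; exists b0.
have LA : L.+1 = #|` A| by rewrite /L subn1 prednK.
have Q0 : 0 < Q by rewrite ltr_pwDl ?ltr0n// sumr_ge0.
have bQ (b : R) : b \in E -> kappa <= b + Q.
  move=> bE; rewrite -lerBlDl /Q (big_fsetD1 b)//=.
  apply: (le_trans (ler_norm _)); rewrite addrCA lerDl addr_ge0// sumr_ge0//.
have IkE (b : Ik) : val b \in E /\ val b < kappa.
  by have := fsvalP b; rewrite !inE => /andP[].
(* [reconstruction] is instantiated with the homogeneities alone, so that [C0] does not depend on
   the spaces and the data introduced below. *)
have [C0 C00 recon] := @reconstruction R psi psiP Ik val kappa Q kap0 (fun b => (IkE b).2) Q0
  (fun b => bQ _ (IkE b).1).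
(* The cardinality of [E] comes from the pieces removed in [reduced_incr], the rest from
   [chain_bound]. *)
pose C1 : R := #|` E|%:R * (L.+1%:R * 2 ^+ L.+1).
exists (C0 * C1), (fun=> C0 * C1 + #|` A|%:R).
move=> Tp' Tm Sp Sm X U S Gp Gm Gp_sk Gm_sk G N Nst N01 Vp Vm Vp_md Vm_md up Vbar VV Gext Vdiam
  Mb Mc Mkappa Meta vv vv_t vvT vv_le um um_t umT um_le reconstructs.
have alpha_le (i : gidx (gspace_of Tp')) : alpha <= ghom i by apply: minl_le; exact: fsvalP.
have Am_nil : (Am : seq R) != [::] by move: Am0; rewrite -size_eq0 -cardfs_eq0 cardfE.
(* From [minl Am < kappa - alpha] and [kappa <= ap + minl Am]. *)
have alpha_ap : alpha < ap.
  have h := lvl _ (minl_in Am_nil).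
  have h2 : kappa <= ap + minl Am by rewrite /kappa ge_min lexx.
  lra.
have kappa_ap (j : gidx Sm) : kappa <= ap + ghom j.
  rewrite /kappa ge_min; apply/orP; left; rewrite lerD2l; apply: minl_le; exact: fsvalP.
have kappa_am : kappa <= alpha + am by rewrite /kappa ge_min lexx orbT.
have level_gt (j : gidx Sm) : ghom j < kappa - alpha by apply: lvl; exact: fsvalP.
have ApE (i : gidx Sp) : ghom i \in Ap.
  by case: i => [i|]; rewrite !inE ?eqxx//; apply/orP; right; exact: fsvalP.
have AmE (j : gidx Sm) : ghom j \in Am by exact: fsvalP.
have mpP (i : gidx (gspace_of Tp')) : minl [seq angp b | b <- Ap'] <= angp (ghom i).
  by apply: minl_le; apply: map_f; exact: fsvalP.
have mmP (j : gidx Sm) : minl [seq angm b | b <- Am] <= angm (ghom j).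
  by apply: minl_le; apply: map_f; exact: fsvalP.
have ang_le (i : gidx Sp) (j : gidx Sm) : ang (ghom i + ghom j) <= angp (ghom i) + angm (ghom j).
  exact: angle.
have SA (p : gidx S) : ghom p \in A.
  by apply/imfset2P; exists (@ghom R Sp p.1); rewrite ?ApE//; exists (ghom p.2).
have homsS : homs S = A.
  apply/fsetP => b; apply/imfsetP/imfset2P.
    by move=> [p _ ->]; exists (@ghom R Sp p.1); rewrite ?ApE//; exists (ghom p.2).
  move=> [a aA [c cA ->]].
  have [k kE] : exists k : gidx Sp, ghom k = a.
    move: aA; rewrite !inE => /orP[/eqP ->|aA]; first by exists None.
    by exists (Some [` aA]%fset).
  by exists (k, [` cA]%fset) => //; rewrite -kE.
have mkP eta (p : gidx S) : eta <= ghom p -> minl [seq ang b | b <- A & eta <= b] <= ang (ghom p).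
  by move=> pe; apply: minl_le; apply: map_f; rewrite mem_filter pe; exact: SA.
pose EXT := extension X (kappa - alpha) Nst.
have homsE : homs EXT = E by rewrite homs_ext homsS.
(* [b0] is not below [kappa], which compensates for the one element that [E] has beyond [A]. *)
have cK : (count (fun c => (c < kappa)%R) E <= L.+1)%N.
  have h1 : (0 < count (predC (fun c => (c < kappa)%R)) E)%N.
    by rewrite -has_count; apply/hasP; exists b0; rewrite /= ?in_fset1U ?b0A ?orbT// -leNgt.
  have h2 := count_predC (fun c => (c < kappa)%R) E.
  have h3 : (size E <= #|` A|.+1)%N by rewrite -/(#|` E|) cardfsU1 lvlA add1n.
  rewrite -ltnS LA; apply: leq_trans h3; rewrite -h2 -addn1 leq_add2l.
  exact: h1.
have cE b : b \in E -> b < kappa -> (count (fun c => (c < b)%R) E <= L)%N.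
  by move=> bE bk; rewrite -ltnS; apply: leq_trans cK; exact: count_lt_lt.
pose F := reduce Gext kappa Vdiam.
pose vE T x := ext_vec X (kappa - alpha) Nst (umT T x) (vvT T x).
(* At homogeneity [kappa - alpha] this is the hypothesis on [um], elsewhere the one on [vv]. *)
have gnE T x c : 0 < T <= 1 -> c \in E -> c < kappa ->
    graded_norm c (Gext x (vE T x)) <= (T `^ 4^-1) `^ c.
  move=> T01 cE' ck; rewrite graded_ext ?homsS//.
  have [->|cl] := eqVneq c (kappa - alpha).
    by have := um_le x T T01; rewrite mulrC.
  apply: vv_le => //; move: cE'; rewrite in_fset1U (negbTE cl); exact.
pose H := fun x phi => F x (ext_vec X (kappa - alpha) Nst (um phi) (fun i => vv i phi)) : R^o.
have Ht x : tempered (H x).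
  pose g (k : gidx EXT) : (R * R -> R) -> gpiece k := fun phi =>
    ext_vec X (kappa - alpha) Nst (um phi) (fun i => vv i phi) k.
  apply: (@form_tempered R (gidx EXT) (@gpiece R EXT) (F x) g).
    apply: reduce_is_form.
    - exact: (ext_op U Gp_sk Gm_sk _ _ (md_form Vm_md)).
    - exact: (ext_tri U Gp_sk Gm_sk (md_form Vm_md) level_gt).
    - exact: (diamond_is_form U kappa Nst alpha0 alpha_le Gp_sk Vp_md Vm_md).
  by move=> -[p|]; [exact: (vv_t p).1|exact: tempered_rescaled].
pose sk := sk_norm Gext.
have sk0 : 0 <= sk by exact: least_const_ge0.
have hld0 : 0 <= holder_seminorm alpha up by exact: (holder_ge0 alpha0 alpha_le alpha_ap Gp_sk Vp_md).
have sz0 (T : gspace R) (GT : gop T) a V : 0 <= size_norm GT N a V by exact: least_const_ge0.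
have md0 (T : gspace R) (GT : gop T) a V : 0 <= mod_norm GT a V by exact: least_const_ge0.
have Mc0 : 0 <= Mc by rewrite /Mc !(addr_ge0, mulr_ge0, powR_ge0).
have Mb0 : 0 <= Mb by rewrite mulr_ge0.
pose Z := Nst%:num * holder_seminorm alpha up + Mc
  + N `^ (minl [seq ang b | b <- A & kappa <= b]) * sk * Mb.
have Z0 : 0 <= Z.
  apply: addr_ge0; first by apply: addr_ge0 => //; exact: mulr_ge0.
  by apply: mulr_ge0 => //; apply: mulr_ge0 => //; exact: powR_ge0.
have Mk0 : 0 <= Mkappa by apply: mulr_ge0; [rewrite exprn_ge0 ?addr_ge0|exact: Z0].
have C10 : 0 <= C1 by rewrite !mulr_ge0 ?exprn_ge0.
have E1 : (1 : R) <= #|` E|%:R.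
  by rewrite ler1n cardfs_gt0; apply/fset0Pn; exists b0; rewrite in_fset1U b0A orbT.
have Hcoh : coherent psi (val : Ik -> R) kappa Q H (C1 * Mkappa).
  move=> x y t t01; have sumE (f : R -> R) : \sum_(i : Ik) f (val i) = \sum_(c <- E | c < kappa) f c.
    by rewrite big_fset_condE big_seq_fsetE.
  rewrite (sumE (fun c => (t `^ 4^-1) `^ c * (d0 (y - x) `^ (kappa - c) + d0 (y - x) `^ Q))).
  rewrite distrC -[mollify _ _ _]/(F x (vE t y)) -[mollify _ (H y) _]/(F y (vE t y)).
  have := @diamond_chain R _ _ X U alpha ap am kappa N Nst angp angm ang Gp Gm Vp Vm alpha0 alpha_le
    alpha_ap Gp_sk Gm_sk N01 Vp_md Vm_md kappa_ap kappa_am level_gt _ _ mpP mmP ang_le _ (mkP kappa)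
    L Q x y (vE t y).
  rewrite homsE => /(_ cE cK) h.
  have QL : (2 * L.+1)%:R <= Q by rewrite lerDl sumr_ge0.
  apply: (le_trans (h QL)).
  apply: ler_pM.
  - apply: mulr_ge0; last by rewrite mulr_ge0 ?exprn_ge0.
    apply: mulr_ge0; last by rewrite exprn_ge0 ?addr_ge0.
    apply: addr_ge0; first by apply: addr_ge0 => //; exact: mulr_ge0.
    by apply: mulr_ge0 => //; apply: mulr_ge0 => //; apply: mulr_ge0 => //; exact: powR_ge0.
  - by apply: sumr_ge0 => c _; rewrite mulr_ge0 ?graded_norm_ge0 ?addr_ge0 ?powR_ge0.
  - apply: (mult_bound _ E1).
    + by apply: addr_ge0 => //; exact: mulr_ge0.
    + by rewrite exprn_ge0 ?addr_ge0.
    + by rewrite mulr_ge0 ?exprn_ge0.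
  rewrite big_seq_cond [leRHS]big_seq_cond; apply: ler_sum => c /andP[cE' ck].
  rewrite pdist_d0 -d0_opp opprB ler_wpM2r ?addr_ge0 ?powR_ge0//.
  exact: gnE.
have [D D0 hD] := diamond_reduce_size U Nst alpha0 alpha_le Gp_sk Gm_sk N01 Vp_md Vm_md level_gt ang_le.
have Hdiag : exists K a : R, forall t x, 0 < t <= 1 -> `|diag psi H t x| <= K * (t `^ 4^-1) `^ a.
  (* The exponent does not exceed any homogeneity, so one power of [t^(1/4) <= 1] dominates them
     all. *)
  exists (D * #|` E|%:R), (- \sum_(c <- E) `|c|) => t x t01.
  rewrite -[diag _ _ _ _]/(F x (vE t x)); apply: (le_trans (hD x (vE t x))).
  rewrite -mulrA ler_wpM2l// homsE.
  apply: (@le_trans _ _ (\sum_(c <- E | c < kappa) (t `^ 4^-1) `^ (- \sum_(c <- E) `|c|))).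
    rewrite big_seq_cond [leRHS]big_seq_cond; apply: ler_sum => c /andP[cE' ck].
    apply: (le_trans (gnE t x c t01 cE' ck)); apply: powN_ge.
      by rewrite root4_gt0 ?root4_le1//; case/andP: t01.
    rewrite lerNl (big_fsetD1 c)//=; apply: (@le_trans _ _ `|c|).
      by rewrite -normrN ler_norm.
    by rewrite lerDl sumr_ge0.
  by apply: sum_fset_le; exact: powR_ge0.
have [u ut hu] := recon H (C1 * Mkappa) Ht (mulr_ge0 C10 Mk0) Hcoh Hdiag.
have hu' : reconstructs (C0 * C1) u.
  by move=> T T01 x; rewrite -(mulrA C0); exact: hu.
exists u; split => //.
- move=> w c wt hw phi sp.
  have := @mollify_small_eq0 R psi psiP (fun phi => w phi - u phi : R^o) ((c + C0 * C1) * Mkappa) kappa phi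
    (tempered_sub wt ut) kap0 _ sp.
  move=> h; apply/eqP; rewrite -subr_eq0; apply/eqP; apply: h => t x t01.
  have := hw t t01 x; have := hu' t t01 x.
  rewrite /mollify -/(F x (vE t x)); set f := F x _ => h1 h2.
  have -> : w (fun y => psi t (x - y)) - u (fun y => psi t (x - y)) =
    (w (fun y => psi t (x - y)) - f) - (u (fun y => psi t (x - y)) - f) by rewrite opprB addrA subrK.
  apply: (le_trans (ler_normB _ _)); rewrite mulrDl mulrDl.
  by apply: lerD; [exact: h2|exact: h1].
move=> eta _ ek T T01 x.
have e := diamond_reduce_split U Nst alpha0 alpha_le Gp_sk Gm_sk Vp_md Vm_md level_gt x (umT T x) (vvT T x).
have h1 := hu' T T01 x.
have h2 := @product_reduce_diff R _ _ X U alpha ap am kappa N angp angm ang Gp Gm Vp Vm alpha0 alpha_le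
  Gp_sk Gm_sk N01 Vp_md Vm_md ang_le _ eta x (vvT T x) (ltW ek) (mkP eta).
have l01 : 0 < T `^ 4^-1 <= 1 by rewrite root4_gt0 ?root4_le1//; case/andP: T01.
have h3 : \sum_(c <- homs S | eta <= c < kappa) graded_norm c (G x (vvT T x)) <=
    #|` A|%:R * (T `^ 4^-1) `^ eta.
  rewrite homsS; apply: (@le_trans _ _ (\sum_(c <- A | eta <= c < kappa) (T `^ 4^-1) `^ eta)).
    rewrite big_seq_cond [leRHS]big_seq_cond; apply: ler_sum => c /andP[cA /andP[ec ck]].
    by apply: (le_trans (vv_le c cA ck x T T01)); exact: powN_ge.
  by apply: sum_fset_le; exact: powR_ge0.
have h4 : (T `^ 4^-1) `^ kappa <= (T `^ 4^-1) `^ eta by apply: powN_ge => //; exact: ltW.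
rewrite /Meta; move: h1 h2; rewrite -[reduce Gext kappa Vdiam x _]/(F x (vE T x)) /F e => h1 h2.
set m := mollify _ _ _ in h1 *; set r := reduce G kappa VV x _ in h1 h2.
set r' := reduce G eta VV x _ in h2 *; set v := up x * umT T x in h1 *.
have e0 (a b c d : R) : a - b - d = (a - (b + c)) + (c - d) by ring.
rewrite (e0 m v r r').
apply: (le_trans (ler_normD _ _)); apply: (le_trans (lerD h1 h2)).
rewrite -[N `^ _ * _ * _]mulrA [N `^ _ * (_ * _)]mulrC.
apply: (@sub_bound _ (C0 * C1) _ Mkappa) => //; rewrite ?mulr_ge0 ?powR_ge0//.
Qed.
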